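(* Let $f$ be a transcendental meromorphic function on $\mathbb{C}$ with hyper order $\rho_2(f)<1$, let $c\in\mathbb{C}\setminus\{0\}$, and let $L(f)(z)=af(z+c)-bf(z)$, where $a,b$ are nonzero constants. Suppose that $E(0,f(z))\subseteq E(0,L(f))$, $E(\infty,L(f))\subseteq E(\infty,f(z))$ and $\overline{E}(1,f(z))\subseteq\overline{E}(1,L(f))$. Then $L(f)\equiv f$ or $f(z+c)\equiv f(z)$.
   Context: For a meromorphic function $g$ and $a\in\mathbb{C}\cup\{\infty\}$, $E(a,g)$ denotes the set of zeros of $g-a$ (poles of $g$ if $a=\infty$) counted with multiplicity (a zero of multiplicity $m$ counted $m$ times), and $\overline{E}(a,g)$ denotes the set of such points each counted once. An inclusion $E(a,g)\subseteq E(b,h)$ means every $a$-point of $g$ of multiplicity $m$ is a $b$-point of $h$ of multiplicity at least $m$; $\overline{E}(a,g)\subseteq\overline{E}(b,h)$ means every $a$-point of $g$ is a $b$-point of $h$. The hyper order is $\rho_2(f)=\limsup_{r\to\infty}\frac{\log\log T(r,f)}{\log r}$, where $T(r,f)$ is the Nevanlinna characteristic. *)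

(* Defs.v *)
From Stdlib Require Import Reals ClassicalEpsilon List.
From mathcomp Require all_boot all_algebra all_classical all_reals all_analysis.
From mathcomp Require Rstruct Rstruct_topology.

Module LInt.
From mathcomp Require Import all_boot all_algebra.
From mathcomp Require Import all_classical all_reals all_analysis.
From mathcomp Require Import Rstruct Rstruct_topology.
Definition lint (F : R -> R) (a b : R) : \bar R :=
  (\int[@lebesgue_measure R]_(x in `[a, b]%classic) (F x)%:E)%E.
(* its real value (all integrals used below are finite) *)
Definition rlint (F : R -> R) (a b : R) : R := fine (lint F a b).
End LInt.

From Coquelicot Require Import Coquelicot.
Open Scope R_scope.

Definition cdiff (g : C -> C) (w : C) : Prop :=
  ex_derive (K := C_AbsRing) (V := C_NormedModule) g w.

Definition holo_on_disc (g : C -> C) (z : C) (r : R) : Prop :=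
  forall w : C, Cmod (w - z) < r -> cdiff g w.

Definition holo_at (f : C -> C) (z : C) : Prop :=
  exists r, 0 < r /\ holo_on_disc f z r.

(* z is a pole of f of order exactly m (m >= 1):
   f(w) = g(w) / (w - z)^m near z (w <> z), with g holomorphic, g(z) <> 0.
   The value f z itself is irrelevant. *)
Definition pole_order (f : C -> C) (z : C) (m : nat) : Prop :=
  (0 < m)%nat /\
  exists r g, 0 < r /\ holo_on_disc g z r /\ g z <> RtoC 0 /\
    forall w : C, 0 < Cmod (w - z) < r -> f w = (g w / (w - z) ^ m)%C.

Definition is_pole (f : C -> C) (z : C) : Prop := exists m, pole_order f z m.

(* meromorphic on the whole plane: at every point, f is holomorphic near it
   or has a pole there (so poles are isolated, and at non-poles f takes its
   genuine value) *)
Definition meromorphic (f : C -> C) : Prop :=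
  forall z : C, holo_at f z \/ is_pole f z.

Fixpoint peval (p : list C) (z : C) : C :=
  match p with
  | nil => RtoC 0
  | a :: q => (a + z * peval q z)%C
  end.

Definition rational_fun (f : C -> C) : Prop :=
  exists P Q : list C, (exists a, In a Q /\ a <> RtoC 0) /\
    forall z : C, peval Q z <> RtoC 0 -> f z = (peval P z / peval Q z)%C.

Definition transcendental_meromorphic (f : C -> C) : Prop :=
  meromorphic f /\ ~ rational_fun f.

Definition apoint_order (h : C -> C) (b : C) (z : C) (m : nat) : Prop :=
  (0 < m)%nat /\
  exists r G, 0 < r /\ holo_on_disc G z r /\ G z <> RtoC 0 /\
    forall w : C, 0 < Cmod (w - z) < r -> (h w - b)%C = ((w - z) ^ m * G w)%C.

(* z is a b-point of h of multiplicity at least m (h = b identically near z allowed) *)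
Definition apoint_mult_ge (h : C -> C) (b : C) (z : C) (m : nat) : Prop :=
  exists r G, 0 < r /\ holo_on_disc G z r /\
    forall w : C, 0 < Cmod (w - z) < r -> (h w - b)%C = ((w - z) ^ m * G w)%C.

Definition E_sub (g : C -> C) (a : C) (h : C -> C) (b : C) : Prop :=
  forall z m, apoint_order g a z m -> apoint_mult_ge h b z m.

Definition Ebar_sub (g : C -> C) (a : C) (h : C -> C) (b : C) : Prop :=
  forall z m, apoint_order g a z m -> apoint_mult_ge h b z 1.

Definition E_sub_infty (g h : C -> C) : Prop :=
  forall z m, pole_order g z m -> exists k, (m <= k)%nat /\ pole_order h z k.

Definition logplus (x : R) : R := Rmax 0 (ln x).

Definition circ (r theta : R) : C := (r * cos theta, r * sin theta).

Definition prox (f : C -> C) (r : R) : R :=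
  / (2 * PI) * LInt.rlint (fun t => logplus (Cmod (f (circ r t)))) 0 (2 * PI).

Definition pole_count (f : C -> C) (t : R) (N : nat) : Prop :=
  exists l : list (C * nat),
    NoDup (map fst l) /\
    (forall z, Cmod z <= t -> is_pole f z -> In z (map fst l)) /\
    (forall z m, In (z, m) l -> Cmod z <= t /\ pole_order f z m) /\
    N = fold_right (fun p acc => (snd p + acc)%nat) 0%nat l.

Definition npoles (f : C -> C) (t : R) : nat :=
  epsilon (inhabits 0%nat) (pole_count f t).

Definition count_fun (f : C -> C) (r : R) : R :=
  LInt.rlint (fun t => (INR (npoles f t) - INR (npoles f 0)) / t) 0 r
  + INR (npoles f 0) * ln r.

Definition char_T (f : C -> C) (r : R) : R := prox f r + count_fun f r.

Definition limsup_pinfty (g : R -> R) : Rbar :=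
  Rbar_glb (fun y => exists R0 : R,
    y = Rbar_lub (fun x => exists r, R0 < r /\ x = Finite (g r))).

Definition hyper_order (f : C -> C) : Rbar :=
  limsup_pinfty (fun r => ln (ln (char_T f r)) / ln r).

(* Main.v *)
(** Write f(z + c) = K(z) f(z). The first two inclusions make K entire, and the third gives
    K = d := (1 + b) / a at the 1-points of f; the two conclusions are K = d and K = 1. Suppose that
    neither holds. With K2(z) = K(z) K(z + c), the functions p1 = (K - K2)(f - 1), p2 = (K2 - 1)(K f - 1)
    and p3 = (1 - K)(K2 f - 1) have sum zero, and their zeros are zeros of functions built from K, because
    the zeros of K f - 1 and K2 f - 1 are the translates of 1-points of f. Comparing the p_i with the
    Wronskian of p1 and p2 (Cartan's argument, with the logarithmic derivatives bounded pointwise on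
    circles away from all zeros) bounds T(r, f) by the means of |ln |K|| at z, z + c, z + 2c, up to
    logarithmic terms. By the Poisson-Jensen formula these means are o(T), since hyper-order less than 1
    leaves infinitely many windows in which T at most doubles. On the other hand T(r, f) >= kappa r,
    because the zeros or poles of f repeat along an arithmetic progression, or f is zero free.
    When K2 = 1, ln |K| is half the difference between ln |K| and its translate, so that it would
    grow exponentially if K were not constant; hence K = -1, f omits 1 and -1, and the same argument for
    (f - 1) / (f + 1) shows that f is constant. *)
Require Import Defs.
From Stdlib Require Import Reals Lra Lia Classical ClassicalEpsilon List FinFun Psatz.
From mathcomp Require all_boot all_order all_algebra all_classical all_reals all_analysis.
From mathcomp Require Rstruct Rstruct_topology.
From Coquelicot Require Import Coquelicot.
Open Scope R_scope.

(** * Complex derivatives and path integrals *)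

(** A meromorphic function is given here only by local data, so no global quotient of entire
    functions is formed: on each large disc f is written as P / Q, with Q the polynomial of its
    poles there. The obstacle is that the additive constants of all estimates must not depend on the
    disc. They are read off on one fixed circle |z| = r0 that avoids the zeros of every function
    involved, with Q scaled so that ln |Q| has mean zero on it. The vanishing sum has the
    coefficients K - K2, K2 - 1 and 1 - K because P - Q, K P - Q and K2 P - Q are combinations of
    only two functions, P and Q. If the Wronskian vanishes identically, p1 is a constant multiple of
    p2, and f is then itself a quotient of functions built from K. In a window of length y at
    distance X from 0 the logarithmic difference costs about (ln X) T / y, and about ln T windows
    are searched. As ln T is of order X^s with s < 1, up to a logarithm, a small power of X serves
    as y. *)

Definition ccont (F : C -> C) (z : C) : Prop :=
  forall eps, 0 < eps -> exists d, 0 < d /\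
    forall w, Cmod (w - z) < d -> Cmod (F w - F z) < eps.

Definition cder (F : C -> C) (z l : C) : Prop :=
  forall eps, 0 < eps -> exists d, 0 < d /\
    forall w, Cmod (w - z) < d -> Cmod (F w - F z - l * (w - z)) <= eps * Cmod (w - z).

Lemma cder_is_derive F z l :
  cder F z l <-> is_derive (K := C_AbsRing) (V := C_NormedModule) F z l.
Proof.
split.
- intros H; split; [apply is_linear_scal_l|].
  intros x Hx eps.
  assert (E : x = z).
  { apply (is_filter_lim_locally_unique (K := C_AbsRing) (V := AbsRing_NormedModule C_AbsRing)) in Hx. now symmetry. }
  subst x.
  destruct (H eps (cond_pos eps)) as [d [Hd HH]].
  exists (mkposreal d Hd). intros y Hy. 
  assert (Hy' : Cmod (y - z) < d) by exact Hy.
  specialize (HH y Hy').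
  change (Cmod (F y - F z - (y - z) * l) <= eps * Cmod (y - z)).
  now rewrite (Cmult_comm (y - z)).
- intros [_ H] eps Heps.
  destruct (H z (fun P HP => HP) (mkposreal eps Heps)) as [d HH].
  exists d; split; [apply cond_pos|]. intros w Hw.
  specialize (HH w Hw).
  change (Cmod (F w - F z - (w - z) * l) <= eps * Cmod (w - z)) in HH.
  now rewrite (Cmult_comm l).
Qed.

Lemma Cmod_minus_sym x y : Cmod (x - y) = Cmod (y - x).
Proof. rewrite <- Cmod_opp. f_equal. ring. Qed.

Lemma Cmod_diff_triangle x y z : Cmod (x - z) <= Cmod (x - y) + Cmod (y - z).
Proof. replace (x - z)%C with ((x - y) + (y - z))%C by ring. apply Cmod_triangle. Qed.

Lemma Cmod_rev_triangle x y : Cmod x - Cmod y <= Cmod (x - y).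
Proof.
generalize (Cmod_triangle (x - y) y). replace (x - y + y)%C with x by ring. lra.
Qed.

Lemma Cmod_pos_neq z : z <> RtoC 0 -> 0 < Cmod z.
Proof. apply Cmod_gt_0. Qed.

Lemma Cmod_minus_self (z : C) : Cmod (z - z) = 0.
Proof. replace (z - z)%C with (RtoC 0) by ring. apply Cmod_0. Qed.

Lemma Cminus_neq (x y : C) : x <> y -> (x - y)%C <> RtoC 0.
Proof. intros H E. apply H. replace x with (x - y + y)%C by ring. rewrite E. ring. Qed.

Lemma Cmod_minus_pos (x y : C) : x <> y -> 0 < Cmod (x - y).
Proof. intros. now apply Cmod_pos_neq, Cminus_neq. Qed.

Lemma ccont_local F G z r : 0 < r -> (forall w, Cmod (w - z) < r -> F w = G w) ->
  ccont F z -> ccont G z.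
Proof.
intros Hr E H eps Heps. destruct (H eps Heps) as [d [Hd HH]].
exists (Rmin d r); split. now apply Rmin_pos.
intros w Hw. rewrite <- !E. apply HH. eapply Rlt_le_trans; [apply Hw|apply Rmin_l].
rewrite Cmod_minus_self; lra.
eapply Rlt_le_trans; [apply Hw|apply Rmin_r].
Qed.

Lemma ccont_const k z : ccont (fun _ => k) z.
Proof. intros eps He. exists 1; split; [lra|]. intros. rewrite Cmod_minus_self. lra. Qed.

Lemma ccont_id z : ccont (fun w => w) z.
Proof. intros eps He. exists eps; split; [lra|]. auto. Qed.

Lemma ccont_plus F G z : ccont F z -> ccont G z -> ccont (fun w => F w + G w)%C z.
Proof.
intros HF HG eps He. destruct (HF (eps/2) ltac:(lra)) as [d1 [H1 K1]].
destruct (HG (eps/2) ltac:(lra)) as [d2 [H2 K2]].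
exists (Rmin d1 d2); split. now apply Rmin_pos. intros w Hw.
specialize (K1 w (Rlt_le_trans _ _ _ Hw (Rmin_l _ _))).
specialize (K2 w (Rlt_le_trans _ _ _ Hw (Rmin_r _ _))).
replace (F w + G w - (F z + G z))%C with ((F w - F z) + (G w - G z))%C by ring.
eapply Rle_lt_trans. apply Cmod_triangle. lra.
Qed.

Lemma ccont_mult F G z : ccont F z -> ccont G z -> ccont (fun w => F w * G w)%C z.
Proof.
intros HF HG eps He.
set (M := Cmod (F z) + Cmod (G z) + 1).
assert (M1 : 1 <= M) by (unfold M; generalize (Cmod_ge_0 (F z)) (Cmod_ge_0 (G z)); lra).
set (e := Rmin 1 (eps / (2 * M))).
assert (Pe : 0 < e). { apply Rmin_pos. lra. apply Rdiv_lt_0_compat; lra. }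
destruct (HF e Pe) as [d1 [H1 K1]]. destruct (HG e Pe) as [d2 [H2 K2]].
exists (Rmin d1 d2); split. now apply Rmin_pos. intros w Hw.
specialize (K1 w (Rlt_le_trans _ _ _ Hw (Rmin_l _ _))).
specialize (K2 w (Rlt_le_trans _ _ _ Hw (Rmin_r _ _))).
replace (F w * G w - F z * G z)%C with ((F w - F z) * (G w - G z) + (F w - F z) * G z + F z * (G w - G z))%C by ring.
eapply Rle_lt_trans. apply Cmod_triangle. 
eapply Rle_lt_trans. apply Rplus_le_compat_r. apply Cmod_triangle. rewrite !Cmod_mult.
assert (e1 : e <= 1) by apply Rmin_l.
assert (e2 : e * (2 * M) <= eps).
{ apply Rle_trans with (eps / (2 * M) * (2 * M)). apply Rmult_le_compat_r. lra. apply Rmin_r. right. field. lra. }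
generalize (Cmod_ge_0 (F w - F z)) (Cmod_ge_0 (G w - G z)) (Cmod_ge_0 (F z)) (Cmod_ge_0 (G z)). intros.
unfold M in *. nra.
Qed.

Lemma ccont_inv F z : F z <> RtoC 0 -> ccont F z -> ccont (fun w => / F w)%C z.
Proof.
intros HN HF eps He.
pose proof (Cmod_pos_neq _ HN) as P. set (m := Cmod (F z)) in *.
set (e := Rmin (m/2) (eps * (m * m / 2))).
assert (Pe : 0 < e). { apply Rmin_pos. lra. apply Rmult_lt_0_compat; nra. }
destruct (HF e Pe) as [d [H1 K1]]. exists d; split; auto. intros w Hw. specialize (K1 w Hw).
assert (B : m / 2 < Cmod (F w)).
{ generalize (Cmod_rev_triangle (F z) (F w)). rewrite Cmod_minus_sym. fold m.
  assert (e <= m/2) by apply Rmin_l. lra. }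
assert (HW : F w <> RtoC 0). { intros E. rewrite E, Cmod_0 in B. lra. }
replace (/ F w - / F z)%C with (- (F w - F z) / (F w * F z))%C by (field; auto).
rewrite Cmod_div by (apply Cmult_neq_0; auto). rewrite Cmod_opp, Cmod_mult. fold m.
apply Rmult_lt_reg_r with (Cmod (F w) * m). nra.
unfold Rdiv. rewrite Rmult_assoc, Rinv_l, Rmult_1_r by nra.
apply Rlt_le_trans with (1 := K1). apply Rle_trans with (1 := Rmin_r _ _).
apply Rmult_le_compat_l. lra. nra.
Qed.

Lemma ccont_comp F G z : ccont G z -> ccont F (G z) -> ccont (fun w => F (G w)) z.
Proof.
intros HG HF eps He. destruct (HF eps He) as [d [H1 K1]]. destruct (HG d H1) as [d2 [H2 K2]].
exists d2; split; auto.
Qed.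

(** Caratheodory's form of the derivative: with a slope that is continuous at [z], the product and
    chain rules become identities between slopes, without estimates. *)
Lemma cder_slope F z l : cder F z l <->
  exists phi, ccont phi z /\ phi z = l /\ forall w, (F w - F z = phi w * (w - z))%C.
Proof.
split.
- intros H.
  exists (fun w => if excluded_middle_informative (w = z) then l else (F w - F z) / (w - z))%C.
  assert (Ez : forall A (x y : A), (if excluded_middle_informative (z = z) then x else y) = x).
  { intros. destruct (excluded_middle_informative (z = z)); congruence. }
  split; [|split].
  + intros eps He. destruct (H (eps/2) ltac:(lra)) as [d [Hd K]]. exists d; split; auto.
    intros w Hw. rewrite Ez.
    destruct (excluded_middle_informative (w = z)) as [E|E]. rewrite Cmod_minus_self; lra.
    pose proof (Cmod_minus_pos _ _ E) as P.
    replace ((F w - F z) / (w - z) - l)%C with ((F w - F z - l * (w - z)) / (w - z))%C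
      by (field; now apply Cminus_neq).
    rewrite Cmod_div by now apply Cminus_neq.
    apply Rle_lt_trans with (eps/2); [|lra].
    apply Rmult_le_reg_r with (Cmod (w - z)); auto. unfold Rdiv at 1. rewrite Rmult_assoc, Rinv_l, Rmult_1_r by lra.
    now apply K.
  + apply Ez.
  + intros w. destruct (excluded_middle_informative (w = z)) as [->|E]. ring.
    field. now apply Cminus_neq.
- intros [phi [Hc [El Hw]]] eps He. destruct (Hc eps He) as [d [Hd K]]. exists d; split; auto.
  intros w Hw'. rewrite Hw, <- El.
  replace (phi w * (w - z) - phi z * (w - z))%C with ((phi w - phi z) * (w - z))%C by ring.
  rewrite Cmod_mult. apply Rmult_le_compat_r. apply Cmod_ge_0. left. now apply K.
Qed.

Lemma cder_local F G z l r : 0 < r -> (forall w, Cmod (w - z) < r -> F w = G w) ->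
  cder F z l -> cder G z l.
Proof.
intros Hr E H eps Heps. destruct (H eps Heps) as [d [Hd HH]].
exists (Rmin d r); split. now apply Rmin_pos.
intros w Hw. rewrite <- !E. apply HH. eapply Rlt_le_trans; [apply Hw|apply Rmin_l].
rewrite Cmod_minus_self; lra.
eapply Rlt_le_trans; [apply Hw|apply Rmin_r].
Qed.

Lemma cder_ccont F z l : cder F z l -> ccont F z.
Proof.
intros H. apply cder_slope in H. destruct H as [phi [Hc [_ Hw]]].
assert (A : ccont (fun w => F z + phi w * (w + (- z)))%C z).
{ apply ccont_plus. apply ccont_const. apply ccont_mult; auto. apply ccont_plus. apply ccont_id. apply ccont_const. }
apply (ccont_local _ F z 1) in A; auto. lra.
intros w _. replace (F w) with (F w - F z + F z)%C by ring. rewrite Hw. ring.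
Qed.

Lemma cder_const k z : cder (fun _ => k) z (RtoC 0).
Proof. apply cder_slope. exists (fun _ => RtoC 0). split; [|split]; auto. apply ccont_const. intros; ring. Qed.

Lemma cder_id z : cder (fun w => w) z (RtoC 1).
Proof. apply cder_slope. exists (fun _ => RtoC 1). split; [|split]; auto. apply ccont_const. intros; ring. Qed.

Lemma cder_plus F G z l m : cder F z l -> cder G z m -> cder (fun w => F w + G w)%C z (l + m)%C.
Proof.
rewrite !cder_slope. intros [p [H1 [H2 H3]]] [q [K1 [K2 K3]]].
exists (fun w => p w + q w)%C. split; [|split]. now apply ccont_plus. now rewrite H2, K2.
intros w. replace (F w + G w - (F z + G z))%C with ((F w - F z) + (G w - G z))%C by ring. rewrite H3, K3. ring.
Qed.

Lemma cder_mult F G z l m : cder F z l -> cder G z m ->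
  cder (fun w => F w * G w)%C z (l * G z + F z * m)%C.
Proof.
intros HF HG. pose proof (cder_ccont _ _ _ HG) as CG. revert HF HG.
rewrite !cder_slope. intros [p [H1 [H2 H3]]] [q [K1 [K2 K3]]].
exists (fun w => p w * G w + F z * q w)%C. split; [|split].
apply ccont_plus; apply ccont_mult; auto. apply ccont_const. now rewrite H2, K2.
intros w. replace (F w * G w - (F z * G z))%C with ((F w - F z) * G w + F z * (G w - G z))%C by ring. rewrite H3, K3. ring.
Qed.

Lemma cder_comp F G z l m : cder G z m -> cder F (G z) l -> cder (fun w => F (G w)) z (l * m)%C.
Proof.
intros HG HF. pose proof (cder_ccont _ _ _ HG) as CG. revert HF HG.
rewrite !cder_slope. intros [p [H1 [H2 H3]]] [q [K1 [K2 K3]]].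
exists (fun w => p (G w) * q w)%C. split; [|split].
apply ccont_mult; auto. now apply ccont_comp. now rewrite H2, K2.
intros w. rewrite H3, K3. ring.
Qed.

Lemma cder_Cinv z : z <> RtoC 0 -> cder Cinv z (- / (z * z))%C.
Proof.
intros Hz. 
assert (A : cder (fun w => if Rlt_dec 0 (Cmod w) then /w else / w)%C z (- / (z * z))%C).
2:{ eapply cder_local; [apply Rlt_0_1| |apply A]. intros w _. simpl. destruct (Rlt_dec 0 (Cmod w)); auto. }
pose proof (Cmod_pos_neq _ Hz) as P.
intros eps He.
assert (CI : ccont (fun w => / w)%C z). { apply (ccont_inv (fun w => w)); auto. apply ccont_id. }
destruct (CI (eps * Cmod z) ltac:(nra)) as [d [Hd K]].
exists (Rmin d (Cmod z)); split. now apply Rmin_pos. intros w Hw.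
specialize (K w (Rlt_le_trans _ _ _ Hw (Rmin_l _ _))).
pose proof (Rlt_le_trans _ _ _ Hw (Rmin_r _ _)) as Hw2.
assert (W : w <> RtoC 0). { intros ->. replace (0 - z)%C with (-z)%C in Hw2 by ring. rewrite Cmod_opp in Hw2. lra. }
replace ((if Rlt_dec 0 (Cmod w) then / w else / w) - (if Rlt_dec 0 (Cmod z) then / z else / z))%C with (/ w - / z)%C
 by (destruct (Rlt_dec 0 (Cmod w)), (Rlt_dec 0 (Cmod z)); auto).
replace (/ w - / z - - / (z * z) * (w - z))%C with (- (/ w - / z) * (w - z) / z)%C by (field; auto).
rewrite Cmod_div, Cmod_mult, Cmod_opp by auto.
apply Rmult_le_reg_r with (Cmod z); auto. unfold Rdiv. rewrite Rmult_assoc, Rinv_l, Rmult_1_r by lra.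
generalize (Cmod_ge_0 (w - z)). nra.
Qed.

Lemma cder_inv F z l : F z <> RtoC 0 -> cder F z l -> cder (fun w => / F w)%C z (- l / (F z * F z))%C.
Proof.
intros HN H. replace (- l / (F z * F z))%C with ((- / (F z * F z)) * l)%C by (field; auto).
apply (cder_comp Cinv F); auto. now apply cder_Cinv.
Qed.

Lemma cder_eq F z l l' : cder F z l -> l = l' -> cder F z l'.
Proof. now intros H <-. Qed.

Lemma cder_ext F G z l : (forall w, F w = G w) -> cder F z l -> cder G z l.
Proof. intros E. apply cder_local with 1. lra. auto. Qed.

Lemma cder_opp F z l : cder F z l -> cder (fun w => - F w)%C z (- l)%C.
Proof.
intros H. eapply cder_ext; [|eapply cder_eq; [apply (cder_mult (fun _ => Copp (RtoC 1)) F z _ _ (cder_const _ _) H)|]].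
intros w. cbv beta. ring. cbv beta; ring.
Qed.

Lemma cder_minus F G z l m : cder F z l -> cder G z m -> cder (fun w => F w - G w)%C z (l - m)%C.
Proof. intros H1 H2. apply cder_plus; auto. now apply cder_opp. Qed.

Lemma cder_div F G z l m : G z <> RtoC 0 -> cder F z l -> cder G z m ->
  cder (fun w => F w / G w)%C z ((l * G z - F z * m) / (G z * G z))%C.
Proof.
intros HN HF HG. eapply cder_eq. apply cder_mult. apply HF. apply cder_inv; eauto. 
cbv beta. field. auto.
Qed.

Lemma cdiff_cder F z : cdiff F z <-> exists l, cder F z l.
Proof. split; intros [l H]; exists l; now apply cder_is_derive. Qed.

Lemma C_derive_cder F z : cdiff F z -> cder F z (C_derive F z).
Proof. intros H. apply cder_is_derive. apply C_derive_correct; auto. Qed.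

Lemma cder_C_derive F z l : cder F z l -> C_derive F z = l.
Proof. intros H. apply is_C_derive_unique. now apply cder_is_derive. Qed.

Lemma cdiff_ccont F z : cdiff F z -> ccont F z.
Proof. rewrite cdiff_cder. intros [l H]. now apply cder_ccont in H. Qed.
Lemma cdiff_const k z : cdiff (fun _ => k) z.
Proof. apply cdiff_cder. eexists. apply cder_const. Qed.
Lemma cdiff_id z : cdiff (fun w => w) z.
Proof. apply cdiff_cder. eexists. apply cder_id. Qed.
Lemma cdiff_plus F G z : cdiff F z -> cdiff G z -> cdiff (fun w => F w + G w)%C z.
Proof. rewrite !cdiff_cder. intros [l H] [m K]. eexists. apply cder_plus; eauto. Qed.
Lemma cdiff_minus F G z : cdiff F z -> cdiff G z -> cdiff (fun w => F w - G w)%C z.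
Proof. rewrite !cdiff_cder. intros [l H] [m K]. eexists. apply cder_minus; eauto. Qed.
Lemma cdiff_mult F G z : cdiff F z -> cdiff G z -> cdiff (fun w => F w * G w)%C z.
Proof. rewrite !cdiff_cder. intros [l H] [m K]. eexists. apply cder_mult; eauto. Qed.
Lemma cdiff_div F G z : G z <> RtoC 0 -> cdiff F z -> cdiff G z -> cdiff (fun w => F w / G w)%C z.
Proof. rewrite !cdiff_cder. intros N [l H] [m K]. eexists. apply cder_div; eauto. Qed.
Lemma cdiff_comp F G z : cdiff G z -> cdiff F (G z) -> cdiff (fun w => F (G w)) z.
Proof. rewrite !cdiff_cder. intros [l H] [m K]. eexists. apply cder_comp; eauto. Qed.
Lemma cdiff_local F G z r : 0 < r -> (forall w, Cmod (w - z) < r -> F w = G w) ->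
  cdiff F z -> cdiff G z.
Proof. rewrite !cdiff_cder. intros Hr E [l H]. exists l. eapply cder_local; eauto. Qed.

(** Some goals are equations in the carrier of an algebraic structure on the reals; retyping them
    over [R] lets [ring] recognise the operations. *)
Ltac rring := match goal with |- ?a = ?b => change (@eq R a b); ring end.

(** * Curves in the complex plane and their integrals *)

Definition rcont (f : R -> C) (t : R) : Prop :=
  continuous (fun s => Re (f s)) t /\ continuous (fun s => Im (f s)) t.

Definition rder (f : R -> C) (t : R) (l : C) : Prop :=
  is_derive (fun s => Re (f s)) t (Re l) /\ is_derive (fun s => Im (f s)) t (Im l).

Lemma continuous_eps (f : R -> R) t : continuous f t <->
  forall eps, 0 < eps -> exists d, 0 < d /\ forall s, Rabs (s - t) < d -> Rabs (f s - f t) < eps.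
Proof.
split.
- intros H eps He. destruct (proj1 (filterlim_locally f (f t)) H (mkposreal _ He)) as [d K].
  exists d; split. apply cond_pos. intros s Hs. apply (K s Hs).
- intros H. apply filterlim_locally. intros eps. destruct (H eps (cond_pos eps)) as [d [Hd K]].
  exists (mkposreal d Hd). intros y Hy. apply (K y Hy).
Qed.

Lemma rcont_eps f t : rcont f t <->
  forall eps, 0 < eps -> exists d, 0 < d /\ forall s, Rabs (s - t) < d -> Cmod (f s - f t) < eps.
Proof.
unfold rcont. rewrite !continuous_eps. split.
- intros [H1 H2] eps He. destruct (H1 (eps/2) ltac:(lra)) as [d1 [P1 K1]].
  destruct (H2 (eps/2) ltac:(lra)) as [d2 [P2 K2]].
  exists (Rmin d1 d2); split. now apply Rmin_pos. intros s Hs.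
  specialize (K1 s (Rlt_le_trans _ _ _ Hs (Rmin_l _ _))).
  specialize (K2 s (Rlt_le_trans _ _ _ Hs (Rmin_r _ _))).
  eapply Rle_lt_trans. apply Cmod_2Rmax.
  change (fst (f s - f t)%C) with (Re (f s) - Re (f t)). change (snd (f s - f t)%C) with (Im (f s) - Im (f t)).
  apply Rle_lt_trans with (2 * Rmax (Rabs (Re (f s) - Re (f t))) (Rabs (Im (f s) - Im (f t)))).
  apply Rmult_le_compat_r. eapply Rle_trans. apply (Rabs_pos (Re (f s) - Re (f t))). apply Rmax_l.
  rewrite <- (sqrt_square 2) at 2 by lra. apply sqrt_le_1; lra.
  apply Rmax_case; lra.
- intros H. split; intros eps He; destruct (H eps He) as [d [Hd K]]; exists d; split; auto; intros s Hs;
  specialize (K s Hs); pose proof (Rmax_Cmod (f s - f t)%C) as M;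
  (eapply Rle_lt_trans; [|apply K]); (eapply Rle_trans; [|apply M]).
  apply (Rmax_l (Rabs (Re (f s) - Re (f t)))). apply (Rmax_r _ (Rabs (Im (f s) - Im (f t)))).
Qed.

Lemma rcont_comp F f t : ccont F (f t) -> rcont f t -> rcont (fun s => F (f s)) t.
Proof.
rewrite !rcont_eps. intros H1 H2 eps He. destruct (H1 eps He) as [d [Hd K]].
destruct (H2 d Hd) as [d' [Hd' K']]. exists d'; auto.
Qed.

Lemma rcont_const k t : rcont (fun _ => k) t.
Proof. split; apply continuous_const. Qed.
Lemma rcont_plus f g t : rcont f t -> rcont g t -> rcont (fun s => f s + g s)%C t.
Proof. intros [H1 H2] [K1 K2]. split; [apply (continuous_plus (fun s => Re (f s)) (fun s => Re (g s)))|
 apply (continuous_plus (fun s => Im (f s)) (fun s => Im (g s)))]; auto. Qed.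
Lemma rcont_mult f g t : rcont f t -> rcont g t -> rcont (fun s => f s * g s)%C t.
Proof. intros [H1 H2] [K1 K2]. split.
 apply (continuous_minus (fun s => Re (f s) * Re (g s)) (fun s => Im (f s) * Im (g s)));
 [apply (continuous_mult (fun s => Re (f s)) (fun s => Re (g s)))|apply (continuous_mult (fun s => Im (f s)) (fun s => Im (g s)))]; auto.
 apply (continuous_plus (fun s => Re (f s) * Im (g s)) (fun s => Im (f s) * Re (g s)));
 [apply (continuous_mult (fun s => Re (f s)) (fun s => Im (g s)))|apply (continuous_mult (fun s => Im (f s)) (fun s => Re (g s)))]; auto.
Qed.
Lemma rcont_opp f t : rcont f t -> rcont (fun s => - f s)%C t.
Proof. intros [H1 H2]. split; [apply (continuous_opp (fun s => Re (f s)))|apply (continuous_opp (fun s => Im (f s)))]; auto. Qed.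
Lemma rcont_minus f g t : rcont f t -> rcont g t -> rcont (fun s => f s - g s)%C t.
Proof. intros. apply rcont_plus; auto. now apply rcont_opp. Qed.
Lemma rcont_inv f t : f t <> RtoC 0 -> rcont f t -> rcont (fun s => / f s)%C t.
Proof. intros N H. apply (rcont_comp Cinv f); auto. apply (ccont_inv (fun w => w)); auto. apply ccont_id. Qed.
Lemma rcont_div f g t : g t <> RtoC 0 -> rcont f t -> rcont g t -> rcont (fun s => f s / g s)%C t.
Proof. intros. apply rcont_mult; auto. now apply rcont_inv. Qed.
Lemma rcont_RtoC f t : continuous f t -> rcont (fun s => RtoC (f s)) t.
Proof. split. exact H. apply continuous_const. Qed.

Lemma is_derive_slope (f : R -> R) (t l : R) : is_derive f t l <->
  exists phi : R -> R, continuous phi t /\ phi t = l /\ forall s, f s - f t = phi s * (s - t).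
Proof.
split.
- intros H. exists (fun s => if Req_EM_T s t then l else (f s - f t) / (s - t)).
  assert (Ez : (if Req_EM_T t t then l else (f t - f t) / (t - t)) = l).
  { destruct (Req_EM_T t t); congruence. }
  split; [|split]; auto.
  + apply continuous_eps. intros eps He. rewrite Ez.
    apply is_derive_Reals in H. destruct (H eps He) as [d K]. exists d; split. apply cond_pos.
    intros s Hs. destruct (Req_EM_T s t) as [E|E]. rewrite Rminus_diag, Rabs_R0. lra.
    specialize (K (s - t) ltac:(lra) Hs). replace (t + (s - t)) with s in K by ring. auto.
  + intros s. destruct (Req_EM_T s t) as [->|E]. ring. change (f s - f t = (f s - f t) / (s - t) * (s - t)). field. lra.
- intros [phi [Hc [El Hs]]]. apply is_derive_Reals. intros eps He.
  apply continuous_eps with (eps := eps) in Hc; auto. destruct Hc as [d [Hd K]]. exists (mkposreal d Hd).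
  intros h Hh Hh'. simpl in Hh'. specialize (K (t + h)). rewrite El in K.
  replace (t + h - t) with h in K by ring. specialize (Hs (t + h)).
  replace (t + h - t) with h in Hs by ring. rewrite Hs. replace (phi (t + h) * h / h) with (phi (t+h)) by (field; auto). auto.
Qed.

Lemma rder_slope f t l : rder f t l <->
  exists phi, rcont phi t /\ phi t = l /\ forall s, (f s - f t = phi s * RtoC (s - t))%C.
Proof.
unfold rder. rewrite !is_derive_slope. split.
- intros [[p [P1 [P2 P3]]] [q [Q1 [Q2 Q3]]]]. exists (fun s => (p s, q s)). split; [|split].
  split; auto. rewrite P2, Q2. destruct l; reflexivity.
  intros s. apply injective_projections; simpl.
  change (fst (f s) + - fst (f t)) with (Re (f s) - Re (f t)). rewrite P3. rring.
  change (snd (f s) + - snd (f t)) with (Im (f s) - Im (f t)). rewrite Q3. rring.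
- intros [phi [[H1 H2] [El Hs]]]. split; [exists (fun s => Re (phi s))|exists (fun s => Im (phi s))];
  (split; [auto|split; [now rewrite El|]]); intros s.
  change (Re (f s - f t)%C = Re (phi s) * (s - t)). rewrite Hs. simpl. unfold Re, Im. rring.
  change (Im (f s - f t)%C = Im (phi s) * (s - t)). rewrite Hs. simpl. unfold Re, Im. rring.
Qed.

Lemma rder_rcont f t l : rder f t l -> rcont f t.
Proof.
intros [H1 H2]. split.
apply (ex_derive_continuous (K := R_AbsRing) (V := R_NormedModule) (fun s => Re (f s))). eexists; eauto.
apply (ex_derive_continuous (K := R_AbsRing) (V := R_NormedModule) (fun s => Im (f s))). eexists; eauto.
Qed.

Lemma rder_comp F f t l m : cder F (f t) l -> rder f t m -> rder (fun s => F (f s)) t (l * m)%C.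
Proof.
intros H1 H2. 
pose proof (rder_rcont _ _ _ H2).
revert H1 H2. rewrite cder_slope, !rder_slope.
intros [p [P1 [P2 P3]]] [q [Q1 [Q2 Q3]]]. exists (fun s => p (f s) * q s)%C. split; [|split].
apply rcont_mult; auto. now apply rcont_comp. now rewrite P2, Q2. intros s. rewrite P3, Q3. ring.
Qed.

Definition CI (f : R -> C) (a b : R) : C :=
  (RInt (fun t => Re (f t)) a b, RInt (fun t => Im (f t)) a b).

Definition rcont_on (f : R -> C) (a b : R) := forall t, Rmin a b <= t <= Rmax a b -> rcont f t.

Lemma rcont_on_ex_Re f a b : rcont_on f a b -> ex_RInt (fun t => Re (f t)) a b.
Proof. intros H. apply (ex_RInt_continuous (V := R_CompleteNormedModule)). intros t Ht. apply (H t Ht). Qed.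
Lemma rcont_on_ex_Im f a b : rcont_on f a b -> ex_RInt (fun t => Im (f t)) a b.
Proof. intros H. apply (ex_RInt_continuous (V := R_CompleteNormedModule)). intros t Ht. apply (H t Ht). Qed.
Hint Resolve rcont_on_ex_Re rcont_on_ex_Im : core.

Lemma CI_ext f g a b : (forall t, Rmin a b < t < Rmax a b -> f t = g t) -> CI f a b = CI g a b.
Proof. intros H. unfold CI. f_equal; apply RInt_ext; intros t Ht; now rewrite H. Qed.

Lemma CI_plus f g a b : rcont_on f a b -> rcont_on g a b ->
  CI (fun t => f t + g t)%C a b = (CI f a b + CI g a b)%C.
Proof. intros. unfold CI. apply injective_projections; simpl.
 apply (RInt_plus (fun t => Re (f t)) (fun t => Re (g t))); auto.
 apply (RInt_plus (fun t => Im (f t)) (fun t => Im (g t))); auto. Qed.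

Lemma CI_scal k f a b : rcont_on f a b -> CI (fun t => k * f t)%C a b = (k * CI f a b)%C.
Proof.
intros H. unfold CI. apply injective_projections; simpl.
- rewrite (RInt_ext _ (fun t => minus (scal (Re k) (Re (f t))) (scal (Im k) (Im (f t))))).
  rewrite (RInt_minus (fun t => scal (Re k) (Re (f t))) (fun t => scal (Im k) (Im (f t)))).
  rewrite (RInt_scal (fun t => Re (f t))), (RInt_scal (fun t => Im (f t))); auto.
  apply (ex_RInt_scal (fun t => Re (f t))); auto. apply (ex_RInt_scal (fun t => Im (f t))); auto.
  intros. reflexivity.
- rewrite (RInt_ext _ (fun t => plus (scal (Re k) (Im (f t))) (scal (Im k) (Re (f t))))).
  rewrite (RInt_plus (fun t => scal (Re k) (Im (f t))) (fun t => scal (Im k) (Re (f t)))).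
  rewrite (RInt_scal (fun t => Re (f t))), (RInt_scal (fun t => Im (f t))); auto.
  apply (ex_RInt_scal (fun t => Im (f t))); auto. apply (ex_RInt_scal (fun t => Re (f t))); auto.
  intros. reflexivity.
Qed.

Lemma rcont_on_scal k f a b : rcont_on f a b -> rcont_on (fun t => k * f t)%C a b.
Proof. intros H t Ht. apply rcont_mult. apply rcont_const. auto. Qed.

Lemma CI_minus f g a b : rcont_on f a b -> rcont_on g a b ->
  CI (fun t => f t - g t)%C a b = (CI f a b - CI g a b)%C.
Proof. intros. unfold CI. apply injective_projections; simpl.
 apply (RInt_minus (fun t => Re (f t)) (fun t => Re (g t))); auto.
 apply (RInt_minus (fun t => Im (f t)) (fun t => Im (g t))); auto. Qed.

Lemma rcont_on_sub f a b c d : rcont_on f a b -> Rmin a b <= c <= Rmax a b -> Rmin a b <= d <= Rmax a b ->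
  rcont_on f c d.
Proof. intros H Hc Hd t Ht. apply H. revert Ht. unfold Rmin at 1, Rmax at 1. destruct (Rle_dec c d); lra. Qed.

Lemma CI_Chasles f a b c : rcont_on f a b -> rcont_on f b c -> (CI f a b + CI f b c)%C = CI f a c.
Proof. intros. unfold CI. apply injective_projections; simpl.
 apply (RInt_Chasles (fun t => Re (f t))); auto.
 apply (RInt_Chasles (fun t => Im (f t))); auto. Qed.

Lemma Re_CI f a b : Re (CI f a b) = RInt (fun t => Re (f t)) a b. Proof. reflexivity. Qed.

(** Multiplication by the unit [k = conj I / |I|] makes the integral [I] real and nonnegative; then
    the real integrals of Re (k f) and [g] are compared. The case [I = 0] is separate because [k] is
    not defined there. *)
Lemma CI_norm f g a b : a <= b -> rcont_on f a b -> ex_RInt g a b ->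
  (forall t, a <= t <= b -> Cmod (f t) <= g t) -> Cmod (CI f a b) <= RInt g a b.
Proof.
intros Hab Hf Hg Hle.
destruct (Req_dec (Cmod (CI f a b)) 0) as [E|E].
- rewrite E. apply RInt_ge_0; auto. intros t Ht. eapply Rle_trans. apply Cmod_ge_0. apply Hle. lra.
- set (I := CI f a b) in *. set (k := (Cconj I / RtoC (Cmod I))%C).
  assert (N : RtoC (Cmod I) <> RtoC 0) by (intros X; apply RtoC_inj in X; auto).
  assert (Ek : Cmod k = 1).
  { unfold k. rewrite Cmod_div by auto. rewrite Cmod_conj, Cmod_R, Rabs_pos_eq by apply Cmod_ge_0. field. auto. }
  assert (EI : (k * I)%C = RtoC (Cmod I)).
  { unfold k. replace (Cconj I / RtoC (Cmod I) * I)%C with (I * Cconj I / RtoC (Cmod I))%C by (field; auto).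
    rewrite <- Cmod2_conj. rewrite RtoC_pow. field. auto. }
  assert (ER : Cmod I = Re (CI (fun t => k * f t)%C a b)).
  { rewrite CI_scal by auto. fold I. rewrite EI. reflexivity. }
  rewrite ER, Re_CI. apply RInt_le; auto.
  apply rcont_on_ex_Re. now apply rcont_on_scal.
  intros t Ht. eapply Rle_trans. apply Rle_abs. eapply Rle_trans. apply re_le_Cmod. rewrite Cmod_mult, Ek, Rmult_1_l.
  apply Hle. lra.
Qed.

Lemma CI_norm_const f M a b : a <= b -> rcont_on f a b ->
  (forall t, a <= t <= b -> Cmod (f t) <= M) -> Cmod (CI f a b) <= (b - a) * M.
Proof.
intros. eapply Rle_trans. apply (CI_norm f (fun _ => M)); auto. apply ex_RInt_const.
rewrite RInt_const. right; reflexivity.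
Qed.

Lemma CI_derive f f' a b : (forall t, Rmin a b <= t <= Rmax a b -> rder f t (f' t)) ->
  rcont_on f' a b -> CI f' a b = (f b - f a)%C.
Proof.
intros H Hc. unfold CI. apply injective_projections; simpl.
- apply is_RInt_unique. apply (is_RInt_derive (fun t => Re (f t)) (fun t => Re (f' t))).
  intros; now apply H. intros t Ht; exact (proj1 (Hc t Ht)).
- apply is_RInt_unique. apply (is_RInt_derive (fun t => Im (f t)) (fun t => Im (f' t))).
  intros; now apply H. intros t Ht; exact (proj2 (Hc t Ht)).
Qed.

Lemma CI_comp_lin f u v a b : rcont_on f (u * a + v) (u * b + v) ->
  CI (fun t => Cmult (RtoC u) (f (u * t + v))) a b = CI f (u * a + v) (u * b + v).
Proof.
intros H. unfold CI. apply injective_projections; simpl.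
- rewrite <- (RInt_comp_lin (fun t => Re (f t)) u v a b) by auto. apply RInt_ext. intros.
  change (@eq R (u * Re (f (u * x + v)) - 0 * Im (f (u * x + v))) (u * Re (f (u * x + v)))). ring.
- rewrite <- (RInt_comp_lin (fun t => Im (f t)) u v a b) by auto. apply RInt_ext. intros.
  change (@eq R (u * Im (f (u * x + v)) + 0 * Re (f (u * x + v))) (u * Im (f (u * x + v)))). ring.
Qed.

(** * Integrals along segments *)

Definition sgm (a b : C) (t : R) : C := (a + RtoC t * (b - a))%C.
Definition seg (F : C -> C) (a b : C) : C := CI (fun t => F (sgm a b t) * (b - a))%C 0 1.
Definition segcont (F : C -> C) (a b : C) := forall t, 0 <= t <= 1 -> ccont F (sgm a b t).

Lemma rder_sgm a b t : rder (sgm a b) t (b - a).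
Proof.
apply rder_slope. exists (fun _ => b - a)%C. split; [|split]; auto. apply rcont_const.
intros s. unfold sgm. rewrite RtoC_minus. ring.
Qed.

Lemma rcont_seg F a b : segcont F a b -> rcont_on (fun t => F (sgm a b t) * (b - a))%C 0 1.
Proof.
intros H t. rewrite Rmin_left, Rmax_right by lra. intros Ht. apply rcont_mult; [|apply rcont_const].
apply (rcont_comp F (sgm a b)). now apply H. eapply rder_rcont. apply rder_sgm.
Qed.

Lemma seg_bound F a b M : segcont F a b -> (forall t, 0 <= t <= 1 -> Cmod (F (sgm a b t)) <= M) ->
  Cmod (seg F a b) <= M * Cmod (b - a).
Proof.
intros Hc H. unfold seg.
eapply Rle_trans. apply CI_norm_const with (M := M * Cmod (b - a)); [lra|now apply rcont_seg|].
intros t Ht. rewrite Cmod_mult. apply Rmult_le_compat_r. apply Cmod_ge_0. auto. lra.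
Qed.

Lemma seg_prim F G a b : segcont F a b -> (forall t, 0 <= t <= 1 -> cder G (sgm a b t) (F (sgm a b t))) ->
  seg F a b = (G b - G a)%C.
Proof.
intros Hc HG. unfold seg.
rewrite (CI_derive (fun t => G (sgm a b t))).
f_equal. f_equal. unfold sgm. ring. f_equal. f_equal. unfold sgm. ring.
intros t. rewrite Rmin_left, Rmax_right by lra. intros Ht. apply rder_comp. auto. apply rder_sgm.
now apply rcont_seg.
Qed.

Lemma seg_rev F a b : segcont F a b -> seg F b a = (- seg F a b)%C.
Proof.
intros H. unfold seg at 1. 
pose proof (CI_comp_lin (fun t => F (sgm a b t) * (b - a))%C (-1) 1 0 1) as E.
replace (-1 * 0 + 1) with 1 in E by ring. replace (-1 * 1 + 1) with 0 in E by ring.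
rewrite (CI_ext _ (fun t : R => Cmult (RtoC (-1)) ((fun t => F (sgm a b t) * (b - a))%C (-1 * t + 1)))).
rewrite E.
replace (seg F a b) with (CI (fun t : R => (F (sgm a b t) * (b - a))%C) 0 1) by reflexivity.
assert (X : (CI (fun t : R => (F (sgm a b t) * (b - a))%C) 0 1 + CI (fun t : R => (F (sgm a b t) * (b - a))%C) 1 0)%C = 0%C).
{ rewrite CI_Chasles. unfold CI. rewrite !RInt_point. reflexivity. now apply rcont_seg. 
  intros t. rewrite Rmin_comm, Rmax_comm. now apply rcont_seg. }
replace (CI (fun t : R => (F (sgm a b t) * (b - a))%C) 1 0) with 
 (CI (fun t : R => (F (sgm a b t) * (b - a))%C) 0 1 + CI (fun t : R => (F (sgm a b t) * (b - a))%C) 1 0 - CI (fun t : R => (F (sgm a b t) * (b - a))%C) 0 1)%C by ring.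
rewrite X. ring.
intros t. rewrite Rmin_comm, Rmax_comm. now apply rcont_seg.
intros t Ht. replace (sgm b a t) with (sgm a b (-1 * t + 1)).
replace (RtoC (-1)) with (- (1))%C by (now rewrite <- RtoC_opp). ring.
unfold sgm. rewrite RtoC_plus, RtoC_mult. replace (RtoC (-1)) with (- (1))%C by (now rewrite <- RtoC_opp). ring.
Qed.

Lemma seg_sub F a b s1 s2 : segcont F a b -> 0 <= s1 <= 1 -> 0 <= s2 <= 1 ->
  seg F (sgm a b s1) (sgm a b s2) = CI (fun t => F (sgm a b t) * (b - a))%C s1 s2.
Proof.
intros H H1 H2. unfold seg.
pose proof (CI_comp_lin (fun t => F (sgm a b t) * (b - a))%C (s2 - s1) s1 0 1) as E.
replace ((s2 - s1) * 0 + s1) with s1 in E by ring. replace ((s2 - s1) * 1 + s1) with s2 in E by ring.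
rewrite <- E. apply CI_ext. intros t _. 
replace (sgm (sgm a b s1) (sgm a b s2) t) with (sgm a b ((s2 - s1) * t + s1)).
unfold sgm at 2 3. rewrite RtoC_minus. generalize (F (sgm a b ((s2 - s1) * t + s1))). intros k. ring.
unfold sgm. rewrite RtoC_plus, RtoC_mult, RtoC_minus. ring.
eapply rcont_on_sub. apply rcont_seg; eauto. rewrite Rmin_left, Rmax_right; lra. rewrite Rmin_left, Rmax_right; lra.
Qed.

Lemma sgm_0 a b : sgm a b 0 = a. Proof. unfold sgm. ring. Qed.
Lemma sgm_1 a b : sgm a b 1 = b. Proof. unfold sgm. ring. Qed.

Lemma seg_split F a b s : segcont F a b -> 0 <= s <= 1 ->
  seg F a b = (seg F a (sgm a b s) + seg F (sgm a b s) b)%C.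
Proof.
intros H Hs.
replace (seg F a (sgm a b s)) with (seg F (sgm a b 0) (sgm a b s)) by now rewrite sgm_0.
replace (seg F (sgm a b s) b) with (seg F (sgm a b s) (sgm a b 1)) by now rewrite sgm_1.
rewrite !seg_sub by (auto; lra). rewrite CI_Chasles. reflexivity.
all: eapply rcont_on_sub; [apply rcont_seg; eauto| |]; rewrite Rmin_left, Rmax_right; lra.
Qed.

Lemma seg_minus F G a b : segcont F a b -> segcont G a b ->
  seg (fun z => F z - G z)%C a b = (seg F a b - seg G a b)%C.
Proof.
intros. unfold seg. rewrite <- CI_minus by now apply rcont_seg. apply CI_ext. intros. ring.
Qed.

(** * Goursat and Cauchy *)

(** Convergence with an explicit rate. Applied to both coordinates, it yields the common point of
    the nested triangles in Goursat's argument. *)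
Lemma geometric_cauchy (u : nat -> R) : (forall n, Rabs (u (S n) - u n) <= (/2) ^ n) ->
  exists l, forall n, Rabs (u n - l) <= 2 * (/2) ^ n.
Proof.
intros H.
assert (P : forall n, 0 < (/2)^n) by (intros; apply pow_lt; lra).
assert (A : forall n k, Rabs (u (n + k)%nat - u n) <= 2 * (/2)^n - 2 * (/2)^(n + k)).
{ intros n k. induction k. rewrite Nat.add_0_r, Rminus_diag, Rabs_R0. lra.
  replace (n + S k)%nat with (S (n + k)) by lia. specialize (H (n + k)%nat).
  replace (u (S (n + k)) - u n) with ((u (S (n + k)) - u (n + k)%nat) + (u (n + k)%nat - u n)) by ring.
  eapply Rle_trans. apply Rabs_triang. simpl. simpl in IHk. lra. }
assert (C : ex_finite_lim_seq u).
{ apply ex_lim_seq_cauchy_corr. intros eps.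
  assert (L : is_lim_seq (fun n => (/2)^n) 0). { apply is_lim_seq_geom. rewrite Rabs_pos_eq; lra. }
  apply is_lim_seq_spec in L. destruct (L (mkposreal (eps / 4) ltac:(generalize (cond_pos eps); lra))) as [N HN].
  exists N. intros n m Hn Hm.
  specialize (HN N ltac:(lia)). simpl in HN. rewrite Rminus_0_r, Rabs_pos_eq in HN by (left; auto).
  pose proof (A N (n - N)%nat) as A1. pose proof (A N (m - N)%nat) as A2.
  replace (N + (n - N))%nat with n in A1 by lia. replace (N + (m - N))%nat with m in A2 by lia.
  replace (u n - u m) with ((u n - u N) - (u m - u N)) by ring.
  eapply Rle_lt_trans. apply Rabs_triang. rewrite Rabs_Ropp. generalize (P n) (P m). lra. }
destruct C as [l Hl]. exists l. intros n.
apply Rnot_lt_le. intros Hlt.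
apply is_lim_seq_spec in Hl.
destruct (Hl (mkposreal (Rabs (u n - l) - 2 * (/2)^n) ltac:(lra))) as [N HN].
specialize (HN (n + N)%nat ltac:(lia)). simpl in HN. specialize (A n N).
assert (Rabs (u n - l) <= Rabs (u (n + N)%nat - l) + Rabs (u (n + N)%nat - u n)).
{ replace (u n - l) with ((u (n+N)%nat - l) - (u (n+N)%nat - u n)) by ring.
  eapply Rle_trans. apply Rabs_triang. rewrite Rabs_Ropp. lra. }
generalize (P (n + N)%nat). lra.
Qed.

Definition tri (F : C -> C) a b c : C := (seg F a b + seg F b c + seg F c a)%C.

(** Two real coordinates are packed into one complex number, so that [a], [b], [c] are the images of
    0, 1 and i. The bisection runs in this reference triangle, and degenerate triangles need no
    special treatment. *)
Definition bary (a b c s : C) : C := (a + RtoC (Re s) * (b - a) + RtoC (Im s) * (c - a))%C.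
Definition unit_tri (s : C) := 0 <= Re s /\ 0 <= Im s /\ Re s + Im s <= 1.

Lemma bary_sgm a b c x y t : sgm (bary a b c x) (bary a b c y) t = bary a b c (sgm x y t).
Proof.
unfold sgm, bary. destruct x as [x1 x2], y as [y1 y2]. apply injective_projections; simpl; ring.
Qed.

Lemma unit_tri_sgm x y t : unit_tri x -> unit_tri y -> 0 <= t <= 1 -> unit_tri (sgm x y t).
Proof.
unfold unit_tri, sgm. destruct x as [x1 x2], y as [y1 y2]. simpl. intros. repeat split; nra.
Qed.

Lemma seg_prim_tri F G a b c :
  (forall z, cder G z (F z)) -> (forall z, ccont F z) -> tri F a b c = RtoC 0.
Proof.
intros HG Hc. unfold tri. rewrite !(seg_prim F G) by (intros t Ht; auto). ring.
Qed.

(** The primitive is explicit. Subtracting the tangent at the limit point therefore changes no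
    integral over a small triangle. *)
Lemma affine_tri k l p a b c : tri (fun z => k + l * (z - p))%C a b c = RtoC 0.
Proof.
apply seg_prim_tri with (fun z => k * z + l / 2 * (z - p) * (z - p))%C.
intros z. eapply cder_eq. apply cder_plus. apply cder_mult. apply cder_const. apply cder_id.
apply cder_mult. apply cder_mult. apply cder_const. apply cder_minus. apply cder_id. apply cder_const.
apply cder_minus. apply cder_id. apply cder_const. cbv beta. field.
intros z. apply ccont_plus. apply ccont_const. apply ccont_mult. apply ccont_const. 
apply ccont_plus. apply ccont_id. apply ccont_const.
Qed.

Definition midp (x y : C) := sgm x y (/2).

Section Goursat.
Variables (F : C -> C) (a b c : C).
Hypothesis HF : forall s, unit_tri s -> cdiff F (bary a b c s).

Let J (x y z : C) := tri F (bary a b c x) (bary a b c y) (bary a b c z).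

Lemma goursat_segcont x y : unit_tri x -> unit_tri y -> segcont F (bary a b c x) (bary a b c y).
Proof.
intros Hx Hy t Ht. rewrite bary_sgm. apply cdiff_ccont, HF. now apply unit_tri_sgm.
Qed.

Lemma midp_in x y : unit_tri x -> unit_tri y -> unit_tri (midp x y).
Proof. intros. apply unit_tri_sgm; auto. lra. Qed.

Lemma goursat_split x y z : unit_tri x -> unit_tri y -> unit_tri z ->
  J x y z = (J x (midp x y) (midp z x) + J (midp x y) y (midp y z) + J (midp z x) (midp y z) z
    + J (midp x y) (midp y z) (midp z x))%C.
Proof.
intros Hx Hy Hz. unfold J, tri.
assert (S : forall u v, unit_tri u -> unit_tri v -> seg F (bary a b c u) (bary a b c v) =
  (seg F (bary a b c u) (bary a b c (midp u v)) + seg F (bary a b c (midp u v)) (bary a b c v))%C).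
{ intros u v Hu Hv. unfold midp. rewrite <- bary_sgm. apply seg_split. now apply goursat_segcont. lra. }
rewrite (S x y), (S y z), (S z x) by auto.
pose proof (midp_in _ _ Hx Hy). pose proof (midp_in _ _ Hy Hz). pose proof (midp_in _ _ Hz Hx).
rewrite (seg_rev F _ (bary a b c (midp z x)) (goursat_segcont (midp x y) (midp z x) ltac:(auto) ltac:(auto))).
rewrite (seg_rev F _ (bary a b c (midp x y)) (goursat_segcont (midp y z) (midp x y) ltac:(auto) ltac:(auto))).
rewrite (seg_rev F _ (bary a b c (midp y z)) (goursat_segcont (midp z x) (midp y z) ltac:(auto) ltac:(auto))).
ring.
Qed.

Let goursat_step (T : C * C * C) : C * C * C :=
  let '(x, y, z) := T in
  let m1 := midp x y in let m2 := midp y z in let m3 := midp z x in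
  let q := Cmod (J x y z) / 4 in
  if Rle_dec q (Cmod (J x m1 m3)) then (x, m1, m3) else
  if Rle_dec q (Cmod (J m1 y m2)) then (m1, y, m2) else
  if Rle_dec q (Cmod (J m3 m2 z)) then (m3, m2, z) else (m1, m2, m3).

(** The factor 2 covers the longest side, sqrt 2, of the reference triangle. *)
Let good n (T : C * C * C) :=
  let '(x, y, z) := T in
  unit_tri x /\ unit_tri y /\ unit_tri z /\
  Cmod (x - y) <= 2 * (/2)^n /\ Cmod (y - z) <= 2 * (/2)^n /\ Cmod (z - x) <= 2 * (/2)^n.

Let JT (T : C * C * C) := let '(x, y, z) := T in J x y z.
Let vx (T : C * C * C) := let '(x, y, z) := T in x.

Lemma goursat_step_good n T : good n T ->
  good (S n) (goursat_step T) /\ Cmod (JT T) / 4 <= Cmod (JT (goursat_step T)) /\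
  Cmod (vx (goursat_step T) - vx T) <= (/2)^n.
Proof.
destruct T as [[x y] z]. intros [Hx [Hy [Hz [D1 [D2 D3]]]]].
pose proof (midp_in _ _ Hx Hy). pose proof (midp_in _ _ Hy Hz). pose proof (midp_in _ _ Hz Hx).
assert (Hh : forall u, Cmod (u / 2) = Cmod u / 2).
{ intros u. rewrite Cmod_div, Cmod_R, Rabs_pos_eq; try lra. intros E; apply RtoC_inj in E; lra. }
assert (N2 : RtoC 2 <> RtoC 0) by (intros E; apply RtoC_inj in E; lra).
assert (HI : RtoC (/2) = (/ RtoC 2)%C) by (rewrite RtoC_inv; auto; lra).
assert (E1 : (x - midp x y = (x - y) / 2)%C) by (unfold midp, sgm; rewrite HI; field; auto).
assert (E2 : (midp x y - y = (x - y) / 2)%C) by (unfold midp, sgm; rewrite HI; field; auto).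
assert (E3 : (y - midp y z = (y - z) / 2)%C) by (unfold midp, sgm; rewrite HI; field; auto).
assert (E4 : (midp y z - z = (y - z) / 2)%C) by (unfold midp, sgm; rewrite HI; field; auto).
assert (E5 : (z - midp z x = (z - x) / 2)%C) by (unfold midp, sgm; rewrite HI; field; auto).
assert (E6 : (midp z x - x = (z - x) / 2)%C) by (unfold midp, sgm; rewrite HI; field; auto).
assert (E7 : (midp x y - midp z x = (y - z) / 2)%C) by (unfold midp, sgm; rewrite HI; field; auto).
assert (E8 : (midp y z - midp x y = (z - x) / 2)%C) by (unfold midp, sgm; rewrite HI; field; auto).
assert (E9 : (midp z x - midp y z = (x - y) / 2)%C) by (unfold midp, sgm; rewrite HI; field; auto).
assert (M : forall u v, Cmod (u - v) = Cmod (v - u)) by apply Cmod_minus_sym.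
pose proof (goursat_split x y z Hx Hy Hz) as SP.
assert (TR : Cmod (J x y z) <= Cmod (J x (midp x y) (midp z x)) + Cmod (J (midp x y) y (midp y z)) +
  Cmod (J (midp z x) (midp y z) z) + Cmod (J (midp x y) (midp y z) (midp z x))).
{ rewrite SP at 1. eapply Rle_trans. apply Cmod_triangle. apply Rplus_le_compat_r.
  eapply Rle_trans. apply Cmod_triangle. apply Rplus_le_compat_r. apply Cmod_triangle. }
assert (M1 : Cmod (midp x y - x) = Cmod (x - y) / 2) by (rewrite M, E1, Hh; auto).
assert (M2 : Cmod (midp z x - x) = Cmod (z - x) / 2) by (rewrite E6, Hh; auto).
assert (P : 0 < (/2)^n) by (apply pow_lt; lra).
unfold goursat_step. 
repeat match goal with |- context [Rle_dec ?u ?v] => destruct (Rle_dec u v) end;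
unfold good, JT, vx; (split; [do 3 (split; [assumption|]); split; [|split]; simpl pow|split; [lra|]]);
rewrite ?E1, ?E2, ?E3, ?E4, ?E5, ?E6, ?E7, ?E8, ?E9, ?Hh, ?Cmod_minus_self; try lra;
rewrite ?M1, ?M2; try lra.
all: try (rewrite M, ?E1, ?E2, ?E3, ?E4, ?E5, ?E6, ?E7, ?E8, ?E9, ?Hh; lra).
Qed.

Let T0 : C * C * C := (RtoC 0, RtoC 1, Ci).
Let Tn n := Nat.iter n goursat_step T0.

Lemma goursat_Tn n : good n (Tn n) /\ Cmod (JT T0) * (/4)^n <= Cmod (JT (Tn n)).
Proof.
induction n.
- split. 
  assert (S2 : sqrt 2 <= 2). { rewrite <- (sqrt_square 2) at 2 by lra. apply sqrt_le_1; lra. }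
  unfold good, unit_tri. simpl. repeat split; try lra.
  + replace (0 - 1)%C with (- (1))%C by ring. rewrite Cmod_opp, Cmod_1. lra.
  + eapply Rle_trans. apply Cmod_2Rmax. simpl. rewrite Rplus_0_l, Ropp_0, Rplus_0_r, Rabs_Ropp, !Rabs_R1, Rmax_left by lra. lra.
  + replace (Ci - 0)%C with Ci by ring. unfold Cmod; simpl. rewrite !Rmult_0_l, !Rmult_1_l, Rplus_0_l, sqrt_1. lra.
  + simpl. lra.
- destruct IHn as [G H]. destruct (goursat_step_good n _ G) as [G' [H' _]]. split; auto.
  change (Tn (S n)) with (goursat_step (Tn n)). simpl pow. lra.
Qed.

Lemma bary_lip s t : Cmod (bary a b c s - bary a b c t) <= (Cmod (b - a) + Cmod (c - a)) * Cmod (s - t).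
Proof.
replace (bary a b c s - bary a b c t)%C with (RtoC (Re (s - t)) * (b - a) + RtoC (Im (s - t)) * (c - a))%C.
2:{ unfold bary. destruct s as [s1 s2], t as [t1 t2]. apply injective_projections; simpl; ring. }
eapply Rle_trans. apply Cmod_triangle. rewrite !Cmod_mult, !Cmod_R.
pose proof (Rmax_Cmod (s - t)%C) as M.
pose proof (Rle_trans _ _ _ (Rmax_l _ _) M). pose proof (Rle_trans _ _ _ (Rmax_r _ _) M).
change (fst (s - t)%C) with (Re (s - t)%C) in *. change (snd (s - t)%C) with (Im (s - t)%C) in *.
generalize (Cmod_ge_0 (b - a)) (Cmod_ge_0 (c - a)). nra.
Qed.

Lemma goursat : tri F a b c = RtoC 0.
Proof.
assert (E0 : JT T0 = tri F a b c).
{ unfold JT, T0, J. replace (bary a b c 0) with a. replace (bary a b c 1) with b. replace (bary a b c Ci) with c. reflexivity.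
  all: unfold bary; apply injective_projections; simpl; ring. }
rewrite <- E0. apply Cmod_eq_0. apply Rle_antisym; [|apply Cmod_ge_0].
(* The first vertices move by at most [(/2)^n] at step [n], hence converge; the limit lies in the
   closed reference triangle. *)
set (xs n := vx (Tn n)).
assert (Hx : forall n, Cmod (xs (S n) - xs n) <= (/2)^n).
{ intros n. apply (goursat_step_good n (Tn n)). apply goursat_Tn. }
assert (Hs : exists s, unit_tri s /\ forall n, Cmod (xs n - s) <= 4 * (/2)^n).
{ destruct (geometric_cauchy (fun n => Re (xs n))) as [l1 H1].
  { intros n. eapply Rle_trans; [|apply (Hx n)]. eapply Rle_trans; [|apply Rmax_Cmod]. apply (Rmax_l (Rabs (Re (xs (S n)) - Re (xs n)))). }
  destruct (geometric_cauchy (fun n => Im (xs n))) as [l2 H2].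
  { intros n. eapply Rle_trans; [|apply (Hx n)]. eapply Rle_trans; [|apply Rmax_Cmod]. apply (Rmax_r _ (Rabs (Im (xs (S n)) - Im (xs n)))). }
  assert (S2 : sqrt 2 <= 2). { rewrite <- (sqrt_square 2) at 2 by lra. apply sqrt_le_1; lra. }
  exists (l1, l2). split.
  - assert (L : is_lim_seq (fun n => (/2)^n) 0). { apply is_lim_seq_geom. rewrite Rabs_pos_eq; lra. }
    apply is_lim_seq_spec in L.
    assert (Lb : forall v, 0 < v -> exists n, (/2)^n < v).
    { intros v Hv. destruct (L (mkposreal v Hv)) as [N HN]. exists N. specialize (HN N ltac:(lia)). simpl in HN.
      rewrite Rminus_0_r in HN. eapply Rle_lt_trans; [apply Rle_abs|apply HN]. }
    assert (U : forall n, unit_tri (xs n)).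
    { intros n. destruct (goursat_Tn n) as [G _]. unfold xs. destruct (Tn n) as [[x y] z]. apply G. }
    unfold unit_tri; simpl. split; [|split]; apply Rnot_lt_le; intros Hlt.
    + destruct (Lb (- l1 / 2) ltac:(lra)) as [n Hn]. specialize (H1 n). destruct (U n) as [U1 _].
      apply Rabs_le_between in H1. lra.
    + destruct (Lb (- l2 / 2) ltac:(lra)) as [n Hn]. specialize (H2 n). destruct (U n) as [_ [U1 _]].
      apply Rabs_le_between in H2. lra.
    + destruct (Lb ((l1 + l2 - 1) / 4) ltac:(lra)) as [n Hn]. specialize (H1 n). specialize (H2 n).
      destruct (U n) as [_ [_ U1]].
      apply Rabs_le_between in H1. apply Rabs_le_between in H2. lra.
  - intros n. eapply Rle_trans. apply Cmod_2Rmax.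
    assert (P : 0 < (/2)^n) by (apply pow_lt; lra).
    assert (Rmax (Rabs (fst (xs n - (l1, l2))%C)) (Rabs (snd (xs n - (l1, l2))%C)) <= 2 * (/2)^n).
    { apply Rmax_lub. apply H1. apply H2. }
    assert (0 <= Rmax (Rabs (fst (xs n - (l1, l2))%C)) (Rabs (snd (xs n - (l1, l2))%C))).
    { eapply Rle_trans. apply Rabs_pos. apply Rmax_l. }
    generalize (sqrt_pos 2). nra. }
destruct Hs as [s [Us Hs]].
set (p := bary a b c s) in *.
destruct (proj1 (cdiff_cder F p) (HF s Us)) as [l Hl].
set (M := Cmod (b - a) + Cmod (c - a)).
assert (HM : 0 <= M) by (unfold M; generalize (Cmod_ge_0 (b - a)) (Cmod_ge_0 (c - a)); lra).
apply le_epsilon. intros eps' He'. rewrite Rplus_0_l.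
(* Each of the three sides of the small triangle contributes at most 12 eps M^2 (1/4)^n, which gives
   36; the summand 1 covers [M = 0]. *)
set (eps := eps' / (36 * M * M + 1)).
assert (He : 0 < eps). { apply Rdiv_lt_0_compat; auto. nra. }
destruct (Hl eps He) as [d [Hd K]].
assert (Hn : exists n, 6 * M * (/2)^n < d).
{ assert (L : is_lim_seq (fun n => (/2)^n) 0). { apply is_lim_seq_geom. rewrite Rabs_pos_eq; lra. }
  apply is_lim_seq_spec in L. destruct (L (mkposreal (d / (6 * M + 1)) ltac:(apply Rdiv_lt_0_compat; lra))) as [n H].
  exists n. specialize (H n ltac:(lia)). simpl in H. rewrite Rminus_0_r in H.
  assert (P : 0 < (/2)^n) by (apply pow_lt; lra). rewrite Rabs_pos_eq in H by lra.
  apply Rmult_lt_compat_r with (r := 6 * M + 1) in H; [|lra].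
  unfold Rdiv in H. rewrite Rmult_assoc, Rinv_l in H by lra. nra. }
destruct Hn as [n Hn]. assert (P : 0 < (/2)^n) by (apply pow_lt; lra).
destruct (goursat_Tn n) as [G HJ]. specialize (Hs n). unfold xs in Hs. 
destruct (Tn n) as [[x y] z] eqn:ET. destruct G as [Ux [Uy [Uz [D1 [D2 D3]]]]]. simpl in Hs.
change (JT (x, y, z)) with (J x y z) in HJ.
assert (near : forall u v t, unit_tri u -> unit_tri v -> Cmod (u - x) <= 2 * (/2)^n -> Cmod (v - x) <= 2 * (/2)^n ->
  0 <= t <= 1 -> Cmod (sgm (bary a b c u) (bary a b c v) t - p) <= 6 * M * (/2)^n).
{ intros u v t Hu Hv Du Dv Ht. rewrite bary_sgm. unfold p. eapply Rle_trans. apply bary_lip. fold M.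
  assert (Cmod (sgm u v t - s) <= 6 * (/2)^n); [|nra].
  replace (sgm u v t - s)%C with (RtoC (1 - t) * (u - x) + RtoC t * (v - x) + (x - s))%C by (unfold sgm; rewrite RtoC_minus; ring).
  eapply Rle_trans. apply Cmod_triangle. eapply Rle_trans. apply Rplus_le_compat_r. apply Cmod_triangle.
  rewrite !Cmod_mult, !Cmod_R, !Rabs_pos_eq by lra. nra. }
set (A := fun w => (F p + l * (w - p))%C).
assert (CA : forall w, ccont A w).
{ intros w. unfold A. apply ccont_plus. apply ccont_const. apply ccont_mult. apply ccont_const. 
  apply ccont_plus. apply ccont_id. apply ccont_const. }
assert (SB : forall u v, unit_tri u -> unit_tri v -> Cmod (u - x) <= 2 * (/2)^n -> Cmod (v - x) <= 2 * (/2)^n ->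
  Cmod (v - u) <= 2 * (/2)^n ->
  Cmod (seg F (bary a b c u) (bary a b c v) - seg A (bary a b c u) (bary a b c v)) <= 12 * eps * M * M * ((/2)^n * (/2)^n)).
{ intros u v Hu Hv Du Dv Duv. 
  rewrite <- seg_minus. 2: now apply goursat_segcont. 2: intros t Ht; apply CA.
  eapply Rle_trans. apply seg_bound with (M := eps * (6 * M * (/2)^n)).
  { intros t Ht. apply (ccont_plus F (fun w => - A w)%C). now apply goursat_segcont. 
    eapply ccont_local with (F := fun w => (-(1) * A w)%C). apply Rlt_0_1. intros; ring. apply ccont_mult. apply ccont_const. apply CA. }
  { intros t Ht. pose proof (near u v t Hu Hv Du Dv Ht) as N.
    eapply Rle_trans; [|apply Rmult_le_compat_l; [lra|apply N]].
    unfold A. replace (F (sgm (bary a b c u) (bary a b c v) t) - (F p + l * (sgm (bary a b c u) (bary a b c v) t - p)))%C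
     with (F (sgm (bary a b c u) (bary a b c v) t) - F p - l * (sgm (bary a b c u) (bary a b c v) t - p))%C by ring.
    apply K. lra. }
  pose proof (bary_lip v u) as BL. fold M in BL.
  assert (Cmod (bary a b c v - bary a b c u) <= 2 * M * (/2)^n) by nra.
  replace (12 * eps * M * M * ((/2)^n * (/2)^n)) with (eps * (6 * M * (/2)^n) * (2 * M * (/2)^n)) by ring.
  apply Rmult_le_compat_l; auto. apply Rmult_le_pos. lra. nra. }
assert (Z : Cmod (x - x) <= 2 * (/2)^n) by (rewrite Cmod_minus_self; lra).
rewrite (Cmod_minus_sym x y) in D1. rewrite (Cmod_minus_sym y z) in D2.
pose proof (SB x y Ux Uy Z D1 D1) as B1. pose proof (SB y z Uy Uz D1 D3 D2) as B2.
pose proof (SB z x Uz Ux D3 Z ltac:(now rewrite Cmod_minus_sym)) as B3.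
assert (BJ : Cmod (J x y z) <= 36 * eps * M * M * ((/2)^n * (/2)^n)).
{ unfold J. rewrite <- (Cplus_0_r (tri _ _ _ _)). rewrite <- Copp_0.
  rewrite <- (affine_tri (F p) l p (bary a b c x) (bary a b c y) (bary a b c z)). fold A. unfold tri.
  match goal with |- Cmod (?s1 + ?s2 + ?s3 + - (?t1 + ?t2 + ?t3)) <= _ =>
   replace (s1 + s2 + s3 + - (t1 + t2 + t3))%C with ((s1 - t1) + (s2 - t2) + (s3 - t3))%C by ring end.
  eapply Rle_trans. apply Cmod_triangle. eapply Rle_trans. apply Rplus_le_compat_r. apply Cmod_triangle. lra. }
assert (E4 : (/4)^n = (/2)^n * (/2)^n). { rewrite <- Rpow_mult_distr. f_equal. lra. }
rewrite E4 in HJ. 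
assert (Pq : 0 < (/2)^n * (/2)^n) by nra.
assert (Cmod (JT T0) <= 36 * eps * M * M).
{ apply Rmult_le_reg_r with ((/2)^n * (/2)^n); auto. lra. }
eapply Rle_trans. apply H. replace (36 * eps * M * M) with (eps * (36 * M * M)) by ring.
unfold eps. apply Rle_trans with (eps' / (36 * M * M + 1) * (36 * M * M + 1)).
apply Rmult_le_compat_l. fold eps. lra. lra. right. field. nra.
Qed.
End Goursat.

Lemma RtoC_neq (x : R) : x <> 0 -> RtoC x <> RtoC 0.
Proof. intros H E. apply RtoC_inj in E. auto. Qed.

Lemma Cmod_RtoC_pos x : 0 <= x -> Cmod (RtoC x) = x.
Proof. intros. now rewrite Cmod_R, Rabs_pos_eq. Qed.

Lemma ccont_minus F G z : ccont F z -> ccont G z -> ccont (fun w => F w - G w)%C z.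
Proof.
intros HF HG. apply (ccont_plus F (fun w => - G w)%C); auto.
apply ccont_local with (F := fun w => (-(1) * G w)%C) (r := 1). lra. intros; ring.
apply ccont_mult; auto. apply ccont_const.
Qed.

Lemma disc_convex z0 R a b t : Cmod (a - z0) < R -> Cmod (b - z0) < R -> 0 <= t <= 1 ->
  Cmod (sgm a b t - z0) < R.
Proof.
intros Ha Hb Ht.
replace (sgm a b t - z0)%C with (RtoC (1 - t) * (a - z0) + RtoC t * (b - z0))%C by (unfold sgm; rewrite RtoC_minus; ring).
eapply Rle_lt_trans. apply Cmod_triangle. rewrite !Cmod_mult, !Cmod_RtoC_pos by lra.
destruct (Req_dec t 0) as [->|]. lra. nra.
Qed.

Lemma open_disc_in z0 R w : Cmod (w - z0) < R -> forall z, Cmod (z - w) < R - Cmod (w - z0) -> Cmod (z - z0) < R.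
Proof. intros H z Hz. generalize (Cmod_diff_triangle z w z0). lra. Qed.

(** * Primitives in a disc with one exceptional point *)

Section Primitive.
Variables (F : C -> C) (z0 w : C) (R : R).
Hypothesis Hcont : forall z, Cmod (z - z0) < R -> ccont F z.
Hypothesis Hdiff : forall z, Cmod (z - z0) < R -> z <> w -> cdiff F z.
Hypothesis Hw : Cmod (w - z0) < R.

Lemma primitive_segcont a b : Cmod (a - z0) < R -> Cmod (b - z0) < R -> segcont F a b.
Proof. intros Ha Hb t Ht. apply Hcont. now apply disc_convex. Qed.

Lemma seg_refl a : seg F a a = RtoC 0.
Proof.
unfold seg. rewrite (CI_ext _ (fun _ => RtoC 0)). 2: intros; ring.
unfold CI. apply injective_projections; simpl; rewrite RInt_const; unfold scal; simpl; unfold mult; simpl; ring.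
Qed.

Lemma goursat_away a b c : Cmod (a - z0) < R -> Cmod (b - z0) < R -> Cmod (c - z0) < R ->
  (forall s, unit_tri s -> bary a b c s <> w) -> tri F a b c = RtoC 0.
Proof.
intros Ha Hb Hc H. apply goursat. intros s Hs. apply Hdiff; auto.
destruct Hs as [H1 [H2 H3]].
replace (bary a b c s - z0)%C with (RtoC (1 - Re s - Im s) * (a - z0) + RtoC (Re s) * (b - z0) + RtoC (Im s) * (c - z0))%C
 by (unfold bary; rewrite !RtoC_minus; ring).
eapply Rle_lt_trans. apply Cmod_triangle. 
eapply Rle_lt_trans. apply Rplus_le_compat_r. apply Cmod_triangle. rewrite !Cmod_mult, !Cmod_RtoC_pos by lra.
destruct (Req_dec (Re s + Im s) 1) as [E|E].
replace (1 - Re s - Im s) with 0 by lra. 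
destruct (Req_dec (Re s) 0) as [E0|E0]. rewrite E0. replace (Im s) with 1 by lra. lra. nra.
nra.
Qed.

(** The exceptional point is the vertex [w]. A corner of size [t] is cut off there: its integral
    tends to 0 with [t] because [F] is bounded near [w], and Goursat's theorem applies to the two
    remaining triangles, which avoid [w]. The assumption on [z'] keeps [w] off the side from [z] to
    [z']. *)
Lemma goursat_exceptional z z' : Cmod (z - z0) < R -> Cmod (z' - z0) < R ->
  z = w \/ Cmod (z' - z) < Cmod (z - w) -> tri F w z z' = RtoC 0.
Proof.
intros Hz Hz' [->|Hn].
{ unfold tri. rewrite seg_refl, (seg_rev F w z') by now apply primitive_segcont. ring. }
apply Cmod_eq_0. apply Rle_antisym; [|apply Cmod_ge_0].
apply le_epsilon. intros eps He. rewrite Rplus_0_l.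
set (L := Cmod (z - w) + Cmod (z' - w) + 1).
assert (HL : 1 <= L) by (unfold L; generalize (Cmod_ge_0 (z - w)) (Cmod_ge_0 (z' - w)); lra).
set (M := Cmod (F w) + 1). assert (HM : 1 <= M) by (unfold M; generalize (Cmod_ge_0 (F w)); lra).
destruct (Hcont w Hw 1 ltac:(lra)) as [d [Hd K]].
set (t := Rmin 1 (Rmin (d / (2 * L)) (eps / (4 * L * M)))).
assert (Ht : 0 < t). { repeat apply Rmin_pos. lra. apply Rdiv_lt_0_compat; lra. apply Rdiv_lt_0_compat; nra. }
assert (Ht1 : t <= 1) by apply Rmin_l.
assert (Htd : t * L < d).
{ apply Rle_lt_trans with (d / (2 * L) * L). apply Rmult_le_compat_r. lra. eapply Rle_trans. apply Rmin_r. apply Rmin_l.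
  replace (d / (2 * L) * L) with (d / 2) by (field; lra). lra. }
assert (Hte : t * (4 * L * M) <= eps).
{ apply Rle_trans with (eps / (4 * L * M) * (4 * L * M)). apply Rmult_le_compat_r. nra. eapply Rle_trans. apply Rmin_r. apply Rmin_r.
  right. field. lra. }
set (x := sgm w z t). set (y := sgm w z' t).
assert (Dx : Cmod (x - z0) < R) by (apply disc_convex; auto; lra).
assert (Dy : Cmod (y - z0) < R) by (apply disc_convex; auto; lra).
(* If such a point were [w], then (al + be) |z - w| = be |z' - z|, which is impossible when |z' - z|
   < |z - w|. *)
assert (away : forall al be, 0 <= al -> 0 <= be -> t <= al + be -> 
  (w + RtoC al * (z - w) + RtoC be * (z' - w))%C <> w).
{ intros al be Ha Hb Hab E.
  assert (E2 : (RtoC (al + be) * (z - w) = - (RtoC be * (z' - z)))%C).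
  { rewrite RtoC_plus. 
    replace ((al + be) * (z - w))%C with ((w + RtoC al * (z - w) + RtoC be * (z' - w)) - w - (RtoC be * (z' - z)))%C by ring.
    rewrite E. ring. }
  apply (f_equal Cmod) in E2. rewrite Cmod_opp, !Cmod_mult, !Cmod_RtoC_pos in E2 by lra.
  generalize (Cmod_ge_0 (z' - z)). intros. destruct (Req_dec be 0) as [->|]; nra. }
assert (SC : forall a b, Cmod (a - z0) < R -> Cmod (b - z0) < R -> segcont F a b) by apply primitive_segcont.
assert (T1 : tri F x z y = RtoC 0).
{ apply goursat_away; auto. intros s [H1 [H2 H3]].
  replace (bary x z y s) with (w + RtoC ((1 - Re s - Im s) * t + Re s) * (z - w) + RtoC (Im s * t) * (z' - w))%C.
  apply away; nra. unfold bary, x, y, sgm. rewrite RtoC_plus, !RtoC_mult, !RtoC_minus. ring. }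
assert (T2 : tri F y z z' = RtoC 0).
{ apply goursat_away; auto. intros s [H1 [H2 H3]].
  replace (bary y z z' s) with (w + RtoC (Re s) * (z - w) + RtoC ((1 - Re s - Im s) * t + Im s) * (z' - w))%C.
  apply away; nra. unfold bary, x, y, sgm. rewrite RtoC_plus, !RtoC_mult, !RtoC_minus. ring. }
assert (E : tri F w z z' = (tri F w x y + tri F x z y + tri F y z z')%C).
{ unfold tri. rewrite (seg_split F w z t) by (auto; lra). fold x.
  rewrite (seg_rev F w z') by auto. rewrite (seg_split F w z' t) by (auto; lra). fold y.
  rewrite (seg_rev F x y), (seg_rev F y z), (seg_rev F y z'), (seg_rev F w y) by auto. 
  ring. }
rewrite E, T1, T2, !Cplus_0_r.
assert (near : forall u v s, 0 <= s <= 1 -> Cmod (u - w) <= t * L -> Cmod (v - w) <= t * L -> Cmod (F (sgm u v s)) <= M).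
{ intros u v s Hs Hu Hv. unfold M.
  assert (Cmod (F (sgm u v s) - F w) < 1). { apply K. apply disc_convex; auto; lra. }
  generalize (Cmod_rev_triangle (F (sgm u v s)) (F w)). lra. }
assert (Bx : Cmod (x - w) <= t * L).
{ replace (x - w)%C with (RtoC t * (z - w))%C by (unfold x, sgm; ring). rewrite Cmod_mult, Cmod_RtoC_pos by lra.
  apply Rmult_le_compat_l. lra. unfold L. generalize (Cmod_ge_0 (z' - w)). lra. }
assert (By : Cmod (y - w) <= t * L).
{ replace (y - w)%C with (RtoC t * (z' - w))%C by (unfold y, sgm; ring). rewrite Cmod_mult, Cmod_RtoC_pos by lra.
  apply Rmult_le_compat_l. lra. unfold L. generalize (Cmod_ge_0 (z - w)). lra. }
assert (Bw : Cmod (w - w) <= t * L) by (rewrite Cmod_minus_self; nra).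
pose proof (seg_bound F w x M ltac:(auto) ltac:(intros; now apply near)) as S1.
pose proof (seg_bound F x y M ltac:(auto) ltac:(intros; now apply near)) as S2.
pose proof (seg_bound F y w M ltac:(auto) ltac:(intros; now apply near)) as S3.
rewrite (Cmod_minus_sym w y) in S3.
assert (Cmod (y - x) <= 2 * (t * L)).
{ eapply Rle_trans. apply (Cmod_diff_triangle y w x). rewrite (Cmod_minus_sym w x). lra. }
unfold tri. eapply Rle_trans. apply Cmod_triangle. eapply Rle_trans. apply Rplus_le_compat_r. apply Cmod_triangle.
assert (0 <= t * L) by nra.
nra.
Qed.

Lemma primitive_exceptional : forall z, Cmod (z - z0) < R -> cder (seg F w) z (F z).
Proof.
intros z Hz eps He.
destruct (Hcont z Hz eps He) as [d [Hd K]].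
assert (Hn : exists e, 0 < e /\ (z = w \/ e <= Cmod (z - w))).
{ destruct (Ceq_dec z w) as [E|E]. exists 1. split; [lra|auto]. exists (Cmod (z - w)). split. now apply Cmod_minus_pos. right; lra. }
destruct Hn as [e [He1 He2]].
exists (Rmin d (Rmin e (R - Cmod (z - z0)))). split. { repeat apply Rmin_pos; auto. lra. }
intros z' Hz'. 
assert (D1 : Cmod (z' - z) < d) by (eapply Rlt_le_trans; [apply Hz'|apply Rmin_l]).
assert (D2 : Cmod (z' - z) < e) by (eapply Rlt_le_trans; [apply Hz'|eapply Rle_trans; [apply Rmin_r|apply Rmin_l]]).
assert (D3 : Cmod (z' - z) < R - Cmod (z - z0)) by (eapply Rlt_le_trans; [apply Hz'|eapply Rle_trans; [apply Rmin_r|apply Rmin_r]]).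
assert (D4 : Cmod (z' - z0) < R) by (eapply open_disc_in; eauto).
assert (T : tri F w z z' = RtoC 0). { apply goursat_exceptional; auto. destruct He2; auto. right. lra. }
unfold tri in T. rewrite (seg_rev F w z') in T by now apply primitive_segcont.
assert (E : (seg F w z' - seg F w z = seg F z z')%C).
{ replace (seg F w z' - seg F w z)%C with (seg F z z' - (seg F w z + seg F z z' + - seg F w z'))%C by ring.
  rewrite T. ring. }
rewrite E.
replace (F z * (z' - z))%C with (seg (fun _ => F z) z z').
2:{ rewrite (seg_prim (fun _ => F z) (fun u => F z * u)%C). ring. intros t Ht; apply ccont_const.
    intros t Ht. eapply cder_eq. apply cder_mult. apply cder_const. apply cder_id. cbv beta. ring. }
rewrite <- seg_minus. 2: now apply primitive_segcont. 2: intros t Ht; apply ccont_const.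
apply seg_bound. intros t Ht. apply ccont_minus. now apply primitive_segcont. apply ccont_const.
intros t Ht. left. apply K. apply disc_convex; auto. rewrite Cmod_minus_self; lra.
Qed.
End Primitive.

(** * Integrals over circles and Cauchy's formula *)

Lemma Cmod_circ r t : 0 <= r -> Cmod (circ r t) = r.
Proof.
intros. unfold circ, Cmod; simpl. replace (r * cos t * (r * cos t * 1) + r * sin t * (r * sin t * 1)) with (r * r * (Rsqr (sin t) + Rsqr (cos t))) by (unfold Rsqr; ring).
rewrite sin2_cos2, Rmult_1_r. now apply sqrt_square.
Qed.

Lemma rder_circ r t : rder (circ r) t (Ci * circ r t).
Proof.
unfold rder, circ, Re, Im, Ci; simpl. split.
- auto_derive. auto. ring.
- auto_derive. auto. ring.
Qed.

Lemma rcont_circ r t : rcont (circ r) t.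
Proof. eapply rder_rcont, rder_circ. Qed.

Lemma rcont_zcirc z0 r t : rcont (fun s => z0 + circ r s)%C t.
Proof. apply rcont_plus. apply rcont_const. apply rcont_circ. Qed.

Lemma circ_2PI r : circ r (2 * PI) = circ r 0.
Proof. unfold circ. now rewrite cos_2PI, sin_2PI, cos_0, sin_0. Qed.

Lemma zcirc_in z0 r t : 0 <= r -> Cmod (z0 + circ r t - z0) = r.
Proof. intros. replace (z0 + circ r t - z0)%C with (circ r t) by ring. now apply Cmod_circ. Qed.

Lemma circle_primitive F G z0 r :
  (forall t, ccont F (z0 + circ r t)) -> (forall t, cder G (z0 + circ r t) (F (z0 + circ r t)))%C ->
  CI (fun t => F (z0 + circ r t) * (Ci * circ r t))%C 0 (2 * PI) = RtoC 0.
Proof.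
intros HF HG.
rewrite (CI_derive (fun t => G (z0 + circ r t))%C). rewrite circ_2PI. ring.
intros t _. apply rder_comp. apply HG. 
apply rder_slope. destruct (proj1 (rder_slope _ _ _) (rder_circ r t)) as [phi [H1 [H2 H3]]].
exists phi. split; [|split]; auto. intros s. rewrite <- H3. ring.
intros t _. apply rcont_mult. apply (rcont_comp F (fun t => z0 + circ r t)%C). apply HF. apply rcont_zcirc.
apply rcont_mult. apply rcont_const. apply rcont_circ.
Qed.

(* the factor Ci of the arc-length element is dropped *)
Lemma circle_exceptional F z0 w r R : 0 <= r < R -> Cmod (w - z0) < R ->
  (forall z, Cmod (z - z0) < R -> ccont F z) ->
  (forall z, Cmod (z - z0) < R -> z <> w -> cdiff F z) ->
  CI (fun t => F (z0 + circ r t) * circ r t)%C 0 (2 * PI) = RtoC 0.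
Proof.
intros Hr Hw Hc Hd.
assert (C2 : rcont_on (fun t => F (z0 + circ r t) * circ r t)%C 0 (2 * PI)).
{ intros t _. apply rcont_mult. apply (rcont_comp F (fun t => z0 + circ r t)%C). apply Hc. rewrite zcirc_in; lra. apply rcont_zcirc.
  apply rcont_circ. }
assert (E : (Ci * CI (fun t => F (z0 + circ r t) * circ r t) 0 (2 * PI) = 0)%C).
{ rewrite <- CI_scal by auto. 
  rewrite <- (circle_primitive F (seg F w) z0 r). apply CI_ext. intros; ring.
  intros t. apply Hc. rewrite zcirc_in; lra.
  intros t. apply primitive_exceptional with z0 R; auto. rewrite zcirc_in; lra. }
replace (CI (fun t => F (z0 + circ r t) * circ r t) 0 (2 * PI))%C with 
  (- Ci * (Ci * CI (fun t => F (z0 + circ r t) * circ r t) 0 (2 * PI)))%C.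
rewrite E. ring. rewrite Cmult_assoc. replace (- Ci * Ci)%C with (RtoC 1). ring.
apply injective_projections; simpl; ring.
Qed.

Lemma CI_const k a b : CI (fun _ => k) a b = (RtoC (b - a) * k)%C.
Proof. unfold CI. rewrite !RInt_const. apply injective_projections; simpl; unfold scal; simpl; unfold mult; simpl; unfold Re, Im; ring. Qed.

Lemma CI_conj f a b : rcont_on f a b -> CI (fun t => Cconj (f t)) a b = Cconj (CI f a b).
Proof.
intros H. unfold CI. apply injective_projections; simpl. reflexivity.
rewrite <- (RInt_opp (fun t => Im (f t))) by auto. reflexivity.
Qed.

Lemma Cconj_circ r t : 0 < r -> (Cconj (circ r t) = RtoC (r * r) / circ r t)%C.
Proof.
intros Hr. assert (circ r t <> RtoC 0). { intros E. apply (f_equal Cmod) in E. rewrite Cmod_circ, Cmod_0 in E; lra. }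
assert (E : (circ r t * Cconj (circ r t) = RtoC (r * r))%C).
{ rewrite <- Cmod2_conj, Cmod_circ by lra. f_equal. ring. }
rewrite <- E. field. auto.
Qed.

Lemma circ_neq0 r t : 0 < r -> circ r t <> RtoC 0.
Proof. intros Hr E. apply (f_equal Cmod) in E. rewrite Cmod_circ, Cmod_0 in E; lra. Qed.

Lemma circ_minus_neq r t u : 0 < r -> Cmod u < r -> (circ r t - u)%C <> RtoC 0.
Proof.
intros Hr Hu E. apply (f_equal Cmod) in E. rewrite Cmod_0 in E.
generalize (Cmod_rev_triangle (circ r t) u). rewrite Cmod_circ by lra. lra.
Qed.

Lemma Cconj_RtoC x : Cconj (RtoC x) = RtoC x.
Proof. unfold Cconj, RtoC; simpl. now rewrite Ropp_0. Qed.

(** The integrand is 1 + u / (zeta - u). On the circle conj zeta = r^2 / zeta, so the conjugate of u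
    / (zeta - u) is zeta times a function holomorphic on a larger disc and integrates to 0. *)
Lemma cauchy_one u r : 0 < r -> Cmod u < r ->
  CI (fun t => circ r t / (circ r t - u))%C 0 (2 * PI) = RtoC (2 * PI).
Proof.
intros Hr Hu.
destruct (Ceq_dec u 0) as [->|Nu].
{ rewrite (CI_ext _ (fun _ => RtoC 1)). rewrite CI_const. rewrite Rminus_0_r. ring.
  intros t _. field. now apply circ_neq0. }
pose proof (Cmod_pos_neq _ Nu) as Pu.
set (H := fun z => (Cconj u / (RtoC (r * r) - Cconj u * z))%C).
assert (Hd : forall z, Cmod (z - 0) < r * r / Cmod u -> cdiff H z).
{ intros z Hz. unfold H. apply cdiff_div; [|apply cdiff_const|apply cdiff_minus; [apply cdiff_const|apply cdiff_mult; [apply cdiff_const|apply cdiff_id]]].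
  intros E. apply (f_equal Cmod) in E. rewrite Cmod_0 in E.
  generalize (Cmod_rev_triangle (RtoC (r * r)) (Cconj u * z)). rewrite E, Cmod_mult, Cmod_conj, Cmod_RtoC_pos by nra.
  replace (z - 0)%C with z in Hz by ring. apply Rmult_lt_compat_r with (r := Cmod u) in Hz; auto.
  unfold Rdiv in Hz. rewrite Rmult_assoc, Rinv_l in Hz by lra. lra. }
assert (Hrr : r < r * r / Cmod u).
{ apply Rmult_lt_reg_r with (Cmod u); auto. unfold Rdiv. rewrite Rmult_assoc, Rinv_l by lra. nra. }
pose proof (circle_exceptional H 0 0 r (r * r / Cmod u) ltac:(lra) ltac:(rewrite Cmod_minus_self; lra)
 ltac:(intros; now apply cdiff_ccont, Hd) ltac:(intros; now apply Hd)) as Z.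
assert (NC : forall t, (circ r t - u)%C <> RtoC 0) by (intros; now apply circ_minus_neq).
assert (RC : rcont_on (fun t => u / (circ r t - u))%C 0 (2 * PI)).
{ intros t _. apply rcont_div. auto. apply rcont_const. apply rcont_minus. apply rcont_circ. apply rcont_const. }
assert (E1 : CI (fun t => u / (circ r t - u))%C 0 (2 * PI) = RtoC 0).
{ rewrite <- (Cconj_conj (CI (fun t => u / (circ r t - u))%C 0 (2 * PI))). rewrite <- CI_conj by auto.
  rewrite (CI_ext _ (fun t => H (0 + circ r t) * circ r t)%C). rewrite Z. apply Cconj_RtoC.
  intros t _. unfold H. rewrite Cplus_0_l. rewrite Cdiv_conj by auto. rewrite Cminus_conj, Cconj_circ by auto. 
  assert (NN : (RtoC (r * r) / circ r t - Cconj u)%C <> 0).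
  { rewrite <- Cconj_circ by auto. rewrite <- Cminus_conj. intros E. apply (f_equal Cmod) in E. rewrite Cmod_conj, Cmod_0 in E.
    apply (NC t). now apply Cmod_eq_0. }
  pose proof (circ_neq0 r t Hr). field. repeat split; auto.
  intros E. apply NN. replace (RtoC (r * r) / circ r t - Cconj u)%C with ((RtoC (r * r) - Cconj u * circ r t) / circ r t)%C by (field; auto).
  rewrite E. field. auto. }
rewrite (CI_ext _ (fun t => 1 + u / (circ r t - u))%C). 2:{ intros t _. field. auto. }
rewrite CI_plus; auto. rewrite E1, CI_const, Rminus_0_r. ring.
intros t _. apply rcont_const.
Qed.

Lemma slope_ccont F w l : cder F w l ->
  ccont (fun z => if excluded_middle_informative (z = w) then l else (F z - F w) / (z - w))%C w.
Proof.
intros H eps He. destruct (H (eps/2) ltac:(lra)) as [d [Hd K]]. exists d. split; auto. intros z Hz.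
destruct (excluded_middle_informative (w = w)) as [_|]; [|congruence].
destruct (excluded_middle_informative (z = w)) as [E|E]. rewrite Cmod_minus_self; lra.
pose proof (Cmod_minus_pos _ _ E) as P.
replace ((F z - F w) / (z - w) - l)%C with ((F z - F w - l * (z - w)) / (z - w))%C
  by (field; now apply Cminus_neq).
rewrite Cmod_div by now apply Cminus_neq.
apply Rle_lt_trans with (eps/2); [|lra].
apply Rmult_le_reg_r with (Cmod (z - w)); auto. unfold Rdiv at 1. rewrite Rmult_assoc, Rinv_l, Rmult_1_r by lra.
now apply K.
Qed.

Lemma cdiff_off_point F w l z : z <> w -> cdiff F z ->
  cdiff (fun z => if excluded_middle_informative (z = w) then l else (F z - F w) / (z - w))%C z.
Proof.
intros N H. apply (cdiff_local (fun z => (F z - F w) / (z - w))%C) with (r := Cmod (z - w)).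
now apply Cmod_minus_pos.
intros u Hu. destruct (excluded_middle_informative (u = w)) as [->|]; auto.
exfalso. rewrite Cmod_minus_sym in Hu. lra.
apply cdiff_div. now apply Cminus_neq. apply cdiff_minus; auto. apply cdiff_const. apply cdiff_minus. apply cdiff_id. apply cdiff_const.
Qed.

(** The difference quotient at [w], completed there by the derivative, is continuous at [w] and
    differentiable elsewhere. This is the situation for which an exceptional point was allowed. *)
Theorem cauchy_formula F z0 R r w : holo_on_disc F z0 R -> 0 < r < R -> Cmod (w - z0) < r ->
  CI (fun t => F (z0 + circ r t) * circ r t / (circ r t - (w - z0)))%C 0 (2 * PI) = (RtoC (2 * PI) * F w)%C.
Proof.
intros HF Hr Hw.
destruct (proj1 (cdiff_cder F w) (HF w ltac:(lra))) as [l Hl].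
set (g := fun z => if excluded_middle_informative (z = w) then l else ((F z - F w) / (z - w))%C).
assert (Hgd : forall z, Cmod (z - z0) < R -> z <> w -> cdiff g z).
{ intros z Hz N. apply cdiff_off_point; auto. }
assert (Hgc : forall z, Cmod (z - z0) < R -> ccont g z).
{ intros z Hz. destruct (Ceq_dec z w) as [->|N]. now apply slope_ccont. apply cdiff_ccont; auto. }
pose proof (circle_exceptional g z0 w r R ltac:(lra) ltac:(lra) Hgc Hgd) as Z.
assert (NC : forall t, (circ r t - (w - z0))%C <> RtoC 0) by (intros; apply circ_minus_neq; lra).
rewrite (CI_ext _ (fun t => F (z0 + circ r t) * circ r t / (circ r t - (w - z0)) - F w * (circ r t / (circ r t - (w - z0))))%C) in Z.
2:{ intros t _. unfold g. destruct (excluded_middle_informative (z0 + circ r t = w)%C) as [E|E].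
    exfalso. apply (NC t). rewrite <- E. ring.
    pose proof (NC t). replace (z0 + circ r t - w)%C with (circ r t - (w - z0))%C by ring. field. replace (circ r t - w + z0)%C with (circ r t - (w - z0))%C by ring. auto. }
assert (R1 : rcont_on (fun t => F (z0 + circ r t) * circ r t / (circ r t - (w - z0)))%C 0 (2 * PI)).
{ intros t _. apply rcont_div. auto. apply rcont_mult. apply (rcont_comp F (fun t => z0 + circ r t)%C).
  apply cdiff_ccont, HF. rewrite zcirc_in; lra. apply rcont_zcirc. apply rcont_circ. apply rcont_minus. apply rcont_circ. apply rcont_const. }
assert (R2 : rcont_on (fun t => circ r t / (circ r t - (w - z0)))%C 0 (2 * PI)).
{ intros t _. apply rcont_div. auto. apply rcont_circ. apply rcont_minus. apply rcont_circ. apply rcont_const. }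
rewrite CI_minus, CI_scal, cauchy_one in Z; auto; try lra.
2: now apply rcont_on_scal.
match goal with |- ?x = _ => replace x with (x - F w * RtoC (2 * PI) + F w * RtoC (2 * PI))%C by ring end.
rewrite Z. ring.
Qed.

Lemma rcont_Cmod f t : rcont f t -> continuous (fun s => Cmod (f s)) t.
Proof.
rewrite rcont_eps, continuous_eps. intros H eps He. destruct (H eps He) as [d [Hd K]]. exists d; split; auto.
intros s Hs. eapply Rle_lt_trans; [|apply (K s Hs)]. apply Rabs_le.
generalize (Cmod_rev_triangle (f s) (f t)) (Cmod_rev_triangle (f t) (f s)). rewrite (Cmod_minus_sym (f t)). lra.
Qed.

(** Differentiation under the integral sign. The quadratic remainder, uniform in [t], takes the
    place of a limit theorem for integrals. *)
Lemma cder_CI_param (phi : R -> C) (k : C -> R -> C) (k' : R -> C) w B d :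
  0 < d -> 0 <= B -> (forall t, rcont phi t) ->
  (forall w' t, Cmod (w' - w) < d -> rcont (k w') t) -> (forall t, rcont k' t) ->
  (forall w' t, Cmod (w' - w) < d -> Cmod (k w' t - k w t - k' t * (w' - w)) <= B * (Cmod (w' - w))^2) ->
  cder (fun w => CI (fun t => phi t * k w t)%C 0 (2 * PI)) w (CI (fun t => phi t * k' t)%C 0 (2 * PI)).
Proof.
intros Hd HB Hp Hk Hk' H eps He.
assert (Ex : forall c, ex_RInt (fun t => c * Cmod (phi t)) 0 (2 * PI)).
{ intros c. apply (ex_RInt_continuous (V := R_CompleteNormedModule)). intros t _. 
  apply (continuous_mult (fun _ => c) (fun t => Cmod (phi t))). apply continuous_const. now apply rcont_Cmod. }
set (M := RInt (fun t => Cmod (phi t)) 0 (2 * PI)).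
assert (HM : 0 <= M).
{ apply RInt_ge_0. generalize PI_RGT_0; lra. 
  eapply ex_RInt_ext; [|apply (Ex 1)]. intros; cbv beta. apply Rmult_1_l. intros; apply Cmod_ge_0. }
exists (Rmin d (eps / (B * M + 1))). split. { apply Rmin_pos; auto. apply Rdiv_lt_0_compat; nra. }
intros w' Hw'.
assert (D1 : Cmod (w' - w) < d) by (eapply Rlt_le_trans; [apply Hw'|apply Rmin_l]).
assert (D2 : Cmod (w' - w) * (B * M + 1) < eps).
{ apply Rmult_lt_reg_r with (/ (B * M + 1)). apply Rinv_0_lt_compat; nra. rewrite Rmult_assoc, Rinv_r, Rmult_1_r by nra.
  eapply Rlt_le_trans; [apply Hw'|apply Rmin_r]. }
assert (D0 : Cmod (w - w) < d) by (rewrite Cmod_minus_self; auto).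
assert (C1 : rcont_on (fun t => phi t * k w' t)%C 0 (2 * PI)) by (intros t _; apply rcont_mult; auto).
assert (C2 : rcont_on (fun t => phi t * k w t)%C 0 (2 * PI)) by (intros t _; apply rcont_mult; auto).
assert (C3 : rcont_on (fun t => phi t * k' t)%C 0 (2 * PI)) by (intros t _; apply rcont_mult; auto).
rewrite (Cmult_comm _ (w' - w)). rewrite <- CI_scal by auto. rewrite <- !CI_minus; auto.
3: now apply rcont_on_scal. 2: intros t Ht; apply rcont_minus; auto.
set (h := Cmod (w' - w)) in *. assert (Hh : 0 <= h) by apply Cmod_ge_0.
eapply Rle_trans. apply (CI_norm _ (fun t => (B * h^2) * Cmod (phi t))). generalize PI_RGT_0; lra.
- intros t Ht. apply rcont_minus. apply rcont_minus; auto. apply rcont_mult; auto. apply rcont_const.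
- apply Ex.
- intros t Ht. replace (phi t * k w' t - phi t * k w t - (w' - w) * (phi t * k' t))%C with
   (phi t * (k w' t - k w t - k' t * (w' - w)))%C by ring.
  rewrite Cmod_mult, Rmult_comm. apply Rmult_le_compat_r. apply Cmod_ge_0. now apply H.
- rewrite (RInt_scal (fun t => Cmod (phi t))).
  change (B * h^2 * M <= eps * h). simpl. nra. 
  eapply ex_RInt_ext; [|apply (Ex 1)]. intros; cbv beta. apply Rmult_1_l.
Qed.

Section CauchyKernel.
Variables (phi : R -> C) (z0 : C) (r : R).
Hypothesis Hr : 0 < r.
Hypothesis Hphi : forall t, rcont phi t.

Lemma kernel_lower w t : Cmod (w - z0) < r -> r - Cmod (w - z0) <= Cmod (circ r t - (w - z0)).
Proof. intros. generalize (Cmod_rev_triangle (circ r t) (w - z0)). rewrite Cmod_circ by lra. auto. Qed.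

Lemma rcont_kernel w t : Cmod (w - z0) < r -> rcont (fun t => / (circ r t - (w - z0)))%C t.
Proof. intros. apply rcont_inv. now apply circ_minus_neq. apply rcont_minus. apply rcont_circ. apply rcont_const. Qed.

Lemma kernel_half w w' t : Cmod (w - z0) < r -> Cmod (w' - w) < (r - Cmod (w - z0)) / 2 ->
  Cmod (w' - z0) < r /\ (r - Cmod (w - z0)) / 2 <= Cmod (circ r t - (w' - z0)).
Proof.
intros H1 H2. pose proof (Cmod_diff_triangle w' w z0). split. lra.
pose proof (kernel_lower w' t ltac:(lra)). lra.
Qed.

Lemma cder_cauchy1 w : Cmod (w - z0) < r ->
  cder (fun w => CI (fun t => phi t * / (circ r t - (w - z0)))%C 0 (2 * PI)) w
    (CI (fun t => phi t * (/ (circ r t - (w - z0)) * / (circ r t - (w - z0))))%C 0 (2 * PI)).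
Proof.
intros Hw. set (m := r - Cmod (w - z0)). assert (Hm : 0 < m) by (unfold m; lra).
apply (cder_CI_param phi (fun w t => / (circ r t - (w - z0)))%C _ w (2 / m^3) (m / 2)); auto; try lra.
- apply Rlt_le, Rdiv_lt_0_compat; [lra|apply pow_lt; lra].
- intros w' t H. apply rcont_kernel. now apply (kernel_half w w' t).
- intros t. apply rcont_mult; now apply rcont_kernel.
- intros w' t H. destruct (kernel_half w w' t Hw H) as [H1 H2]. fold m in H2.
  pose proof (kernel_lower w t Hw) as H3. fold m in H3.
  pose proof (circ_minus_neq r t (w - z0) Hr Hw) as N1. pose proof (circ_minus_neq r t (w' - z0) Hr H1) as N2.
  replace (w' - w)%C with ((circ r t - (w - z0)) - (circ r t - (w' - z0)))%C by ring.
  set (b := (circ r t - (w - z0))%C) in *. set (a := (circ r t - (w' - z0))%C) in *.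
  replace (/ a - / b - / b * / b * (b - a))%C with ((b - a) * (b - a) / (a * b * b))%C by (field; auto).
  rewrite Cmod_div by (repeat apply Cmult_neq_0; auto). rewrite !Cmod_mult.
  assert (Pa : 0 < Cmod a) by lra. assert (Pb : 0 < Cmod b) by lra.
  replace (2 / m ^ 3 * Cmod (b - a) ^ 2) with (Cmod (b - a) * Cmod (b - a) * / (m / 2 * m * m)) by (field; lra).
  apply Rmult_le_compat_l. generalize (Cmod_ge_0 (b - a)); nra.
  apply Rinv_le_contravar. repeat apply Rmult_lt_0_compat; lra.
  repeat apply Rmult_le_compat; try lra. nra.
Qed.

Lemma cder_cauchy2 w : Cmod (w - z0) < r ->
  cder (fun w => CI (fun t => phi t * (/ (circ r t - (w - z0)) * / (circ r t - (w - z0))))%C 0 (2 * PI)) w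
    (CI (fun t => phi t * (2 * (/ (circ r t - (w - z0)) * / (circ r t - (w - z0)) * / (circ r t - (w - z0)))))%C 0 (2 * PI)).
Proof.
intros Hw. set (m := r - Cmod (w - z0)). assert (Hm : 0 < m) by (unfold m; lra).
apply (cder_CI_param phi (fun w t => / (circ r t - (w - z0)) * / (circ r t - (w - z0)))%C _ w (8 / m^4) (m / 2)); auto; try lra.
- apply Rlt_le, Rdiv_lt_0_compat; [lra|apply pow_lt; lra].
- intros w' t H. apply rcont_mult; apply rcont_kernel; now apply (kernel_half w w' t).
- intros t. apply rcont_mult. apply rcont_const. apply (rcont_mult (fun t => / (circ r t - (w - z0)) * / (circ r t - (w - z0)))%C). apply rcont_mult; now apply rcont_kernel. now apply rcont_kernel.
- intros w' t H. destruct (kernel_half w w' t Hw H) as [H1 H2]. fold m in H2.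
  pose proof (kernel_lower w t Hw) as H3. fold m in H3.
  pose proof (circ_minus_neq r t (w - z0) Hr Hw) as N1. pose proof (circ_minus_neq r t (w' - z0) Hr H1) as N2.
  replace (w' - w)%C with ((circ r t - (w - z0)) - (circ r t - (w' - z0)))%C by ring.
  set (b := (circ r t - (w - z0))%C) in *. set (a := (circ r t - (w' - z0))%C) in *.
  replace (/ a * / a - / b * / b - 2 * (/ b * / b * / b) * (b - a))%C with 
    ((b - a) * (b - a) * (/ (a * a * b * b) + 2 * / (a * b * b * b)))%C by (field; auto).
  rewrite !Cmod_mult. 
  replace (8 / m ^ 4 * Cmod (b - a) ^ 2) with (Cmod (b - a) * Cmod (b - a) * (8 / m^4)) by ring.
  apply Rmult_le_compat_l. generalize (Cmod_ge_0 (b - a)); nra.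
  eapply Rle_trans. apply Cmod_triangle. rewrite Cmod_mult, !Cmod_inv, !Cmod_mult, Cmod_RtoC_pos by (try lra; repeat apply Cmult_neq_0; auto).
  assert (A : / (Cmod a * Cmod a * Cmod b * Cmod b) <= / (m / 2 * (m / 2) * m * m)).
  { apply Rinv_le_contravar. repeat apply Rmult_lt_0_compat; lra. repeat apply Rmult_le_compat; try lra; nra. }
  assert (B : / (Cmod a * Cmod b * Cmod b * Cmod b) <= / (m / 2 * m * m * m)).
  { apply Rinv_le_contravar. repeat apply Rmult_lt_0_compat; lra. repeat apply Rmult_le_compat; try lra; nra. }
  replace (8 / m ^ 4) with (/ (m / 2 * (m / 2) * m * m) + 2 * / (m / 2 * m * m * m)) by (field; lra).
  lra.
Qed.
End CauchyKernel.

Lemma rcont_circle F z0 r : 0 <= r -> (forall z, Cmod (z - z0) = r -> ccont F z) -> forall t, rcont (fun t => F (z0 + circ r t)%C) t.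
Proof.
intros Hr H t. apply (rcont_comp F (fun t => z0 + circ r t)%C). apply H. now apply zcirc_in. apply rcont_zcirc.
Qed.

(** Cauchy's formula on a circle between |w - z0| and [R] expresses [F] by a kernel that can be
    differentiated twice in its parameter. *)
Theorem derivative_cdiff F z0 R : holo_on_disc F z0 R -> holo_on_disc (C_derive F) z0 R.
Proof.
intros HF w Hw.
set (r := (Cmod (w - z0) + R) / 2). assert (Hr : 0 < r) by (unfold r; generalize (Cmod_ge_0 (w - z0)); lra).
assert (Hwr : Cmod (w - z0) < r) by (unfold r; lra). assert (HrR : r < R) by (unfold r; lra).
set (phi := fun t => (F (z0 + circ r t) * circ r t)%C).
assert (Hphi : forall t, rcont phi t).
{ intros t. apply rcont_mult; [|apply rcont_circ]. apply rcont_circle. lra. intros z Hz. apply cdiff_ccont, HF. lra. }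
assert (PI2 : RtoC (2 * PI) <> RtoC 0) by (apply RtoC_neq; generalize PI_RGT_0; lra).
assert (E : forall u, Cmod (u - z0) < r -> F u = (/ RtoC (2 * PI) * CI (fun t => phi t * / (circ r t - (u - z0)))%C 0 (2 * PI))%C).
{ intros u Hu. change (CI (fun t => phi t * / (circ r t - (u - z0)))%C 0 (2 * PI)) with 
   (CI (fun t => F (z0 + circ r t) * circ r t / (circ r t - (u - z0)))%C 0 (2 * PI)).
  rewrite (cauchy_formula F z0 R r u) by (auto; lra). field. auto. }
assert (E1 : forall u, Cmod (u - z0) < r -> cder F u (/ RtoC (2 * PI) * CI (fun t => phi t * (/ (circ r t - (u - z0)) * / (circ r t - (u - z0))))%C 0 (2 * PI))).
{ intros u Hu. eapply cder_local with (r := r - Cmod (u - z0)). lra.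
  intros v Hv. symmetry. apply E. eapply open_disc_in; eauto.
  eapply cder_eq. apply cder_mult. apply cder_const. now apply cder_cauchy1. cbv beta. ring. }
apply cdiff_cder. eexists. eapply cder_local with (r := r - Cmod (w - z0)). lra.
intros v Hv. symmetry. apply cder_C_derive. apply E1. eapply open_disc_in; eauto.
apply cder_mult. apply cder_const. now apply cder_cauchy2.
Qed.

Lemma holo_C_derive F z0 R w : holo_on_disc F z0 R -> Cmod (w - z0) < R -> cder F w (C_derive F w).
Proof. intros H Hw. apply C_derive_cder. now apply H. Qed.

(** [F] is the derivative of its own primitive based at [w], and the derivative of a holomorphic
    function is holomorphic. *)
Theorem removable_continuous F z0 R w : Cmod (w - z0) < R ->
  (forall z, Cmod (z - z0) < R -> ccont F z) -> (forall z, Cmod (z - z0) < R -> z <> w -> cdiff F z) ->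
  holo_on_disc F z0 R.
Proof.
intros Hw Hc Hd.
assert (P : forall z, Cmod (z - z0) < R -> cder (seg F w) z (F z)).
{ intros. now apply primitive_exceptional with z0 R. }
assert (HG : holo_on_disc (seg F w) z0 R) by (intros z Hz; apply cdiff_cder; eexists; eauto).
intros z Hz. apply (cdiff_local (C_derive (seg F w))) with (r := R - Cmod (z - z0)). lra.
intros u Hu. apply cder_C_derive, P. eapply open_disc_in; eauto.
now apply (derivative_cdiff _ z0 R).
Qed.

Theorem divide_root F z0 R p : holo_on_disc F z0 R -> Cmod (p - z0) < R -> F p = RtoC 0 ->
  exists G, holo_on_disc G z0 R /\ forall z, Cmod (z - z0) < R -> F z = ((z - p) * G z)%C.
Proof.
intros HF Hp E0. destruct (proj1 (cdiff_cder F p) (HF p Hp)) as [l Hl].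
exists (fun z => if excluded_middle_informative (z = p) then l else ((F z - F p) / (z - p))%C).
split.
- apply removable_continuous with p; auto.
  + intros z Hz. destruct (Ceq_dec z p) as [->|N]. now apply slope_ccont. apply cdiff_ccont, cdiff_off_point; auto.
  + intros z Hz N. apply cdiff_off_point; auto.
- intros z Hz. destruct (excluded_middle_informative (z = p)) as [->|N]. rewrite E0. ring.
  rewrite E0. field. now apply Cminus_neq.
Qed.

Theorem mean_value F z0 R r : holo_on_disc F z0 R -> 0 < r < R ->
  CI (fun t => F (z0 + circ r t))%C 0 (2 * PI) = (RtoC (2 * PI) * F z0)%C.
Proof.
intros HF Hr. rewrite <- (cauchy_formula F z0 R r z0) by (auto; rewrite ?Cmod_minus_self; lra).
apply CI_ext. intros t _. pose proof (circ_neq0 r t ltac:(lra)). 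
replace (circ r t - (z0 - z0))%C with (circ r t) by ring. field. auto.
Qed.

(** A weak maximum principle, read off Cauchy's formula. The loss of the factor r / (r - |w - z0|)
    is harmless for counting zeros. *)
Lemma holo_bound F z0 R r w : holo_on_disc F z0 R -> 0 < r < R -> Cmod (w - z0) < r ->
  forall M, (forall t, 0 <= t <= 2 * PI -> Cmod (F (z0 + circ r t)%C) <= M) -> Cmod (F w) <= M * r / (r - Cmod (w - z0)).
Proof.
intros HF Hr Hw M HM.
assert (P2 : 0 < 2 * PI) by (generalize PI_RGT_0; lra).
pose proof (cauchy_formula F z0 R r w HF Hr Hw) as E.
assert (B : Cmod (CI (fun t => F (z0 + circ r t) * circ r t / (circ r t - (w - z0)))%C 0 (2 * PI)) <= (2 * PI - 0) * (M * r / (r - Cmod (w - z0)))).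
{ apply CI_norm_const. lra.
  - intros t _. apply rcont_div. apply circ_minus_neq; lra. apply rcont_mult; [|apply rcont_circ].
    apply rcont_circle. lra. intros z Hz. apply cdiff_ccont, HF. lra. apply rcont_minus. apply rcont_circ. apply rcont_const.
  - intros t Ht. rewrite Cmod_div by (apply circ_minus_neq; lra). rewrite Cmod_mult, Cmod_circ by lra.
    pose proof (kernel_lower z0 r ltac:(lra) w t Hw). 
    apply Rmult_le_compat. apply Rmult_le_pos. apply Cmod_ge_0. lra. left. apply Rinv_0_lt_compat. lra.
    apply Rmult_le_compat_r. lra. apply HM; auto. apply Rinv_le_contravar; lra. }
rewrite E, Cmod_mult, Cmod_RtoC_pos in B by lra. apply Rmult_le_reg_l with (2 * PI); lra.
Qed.

(** * Zeros and means over circles *)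

Definition lprod (l : list C) (z : C) : C := fold_right (fun a acc => (z - a) * acc)%C (RtoC 1) l.

Lemma cdiff_lprod l z : cdiff (lprod l) z.
Proof.
induction l; simpl. apply cdiff_const. apply (cdiff_mult (fun z => z - a)%C (lprod l)); auto.
apply cdiff_minus. apply cdiff_id. apply cdiff_const.
Qed.

Lemma lprod_neq0 l z : ~ In z l -> lprod l z <> RtoC 0.
Proof.
induction l; simpl; intros H. apply RtoC_neq; lra. apply Cmult_neq_0. apply Cminus_neq. intros E; apply H; left; auto.
apply IHl. intros I; apply H; auto.
Qed.

Lemma lprod_in l z : In z l -> lprod l z = RtoC 0.
Proof.
induction l; simpl. tauto. intros [->|H]. ring. rewrite IHl; auto. ring.
Qed.

Lemma lprod_lower l z m : 0 <= m -> (forall a, In a l -> m <= Cmod (z - a)) -> m ^ length l <= Cmod (lprod l z).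
Proof.
intros Hm. induction l; simpl; intros H. rewrite Cmod_1; lra. rewrite Cmod_mult. apply Rmult_le_compat; auto. now apply pow_le.
Qed.

Lemma lprod_upper l z m : 0 <= m -> (forall a, In a l -> Cmod (z - a) <= m) -> Cmod (lprod l z) <= m ^ length l.
Proof.
intros Hm. induction l; simpl; intros H. rewrite Cmod_1; lra. rewrite Cmod_mult. apply Rmult_le_compat; auto; apply Cmod_ge_0.
Qed.

Lemma circle_bounded F r : 0 <= r -> (forall z, Cmod z = r -> ccont F z) ->
  exists M, 0 < M /\ forall t, 0 <= t <= 2 * PI -> Cmod (F (circ r t)) <= M.
Proof.
intros Hr H.
destruct (continuity_ab_maj (fun t => Cmod (F (circ r t))) 0 (2 * PI)) as [t0 [H1 H2]].
generalize PI_RGT_0; lra.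
intros t _. apply continuity_pt_filterlim. apply rcont_Cmod. apply (rcont_comp F (circ r)).
apply H. now apply Cmod_circ. apply rcont_circ.
exists (Cmod (F (circ r t0)) + 1). split. generalize (Cmod_ge_0 (F (circ r t0))); lra.
intros t Ht. specialize (H1 t Ht). lra.
Qed.

Lemma Cmod_minus_0 z : Cmod (z - 0) = Cmod z.
Proof. f_equal. ring. Qed.

(* A zero count bound from one non-zero value, on a disc four times larger, replaces
   compactness and the identity theorem. *)
Theorem zero_factorization F p r R : 0 < r -> 4 * r < R -> holo_on_disc F 0 R -> Cmod p < r -> F p <> RtoC 0 ->
  exists l G, (forall a, In a l -> Cmod a < r) /\ holo_on_disc G 0 R /\
    (forall z, Cmod z < R -> F z = (lprod l z * G z)%C) /\ forall z, Cmod z < r -> G z <> RtoC 0.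
Proof.
intros Hr HR HF Hp Hnz.
destruct (circle_bounded F (4 * r)) as [M [HM0 HM]]. lra.
{ intros z Hz. apply cdiff_ccont, HF. rewrite Cmod_minus_0. lra. }
pose proof (Cmod_pos_neq _ Hnz) as Pp.
(* A root of modulus below [r] contributes at least [3 * r] to the product on |z| = 4 r and at most
   [2 * r] at [p]; hence a factor 2/3 for each root. *)
assert (bound : forall l G, (forall a, In a l -> Cmod a < r) -> holo_on_disc G 0 R ->
   (forall z, Cmod z < R -> F z = (lprod l z * G z)%C) -> Cmod (F p) <= (2 / 3) ^ length l * (4 / 3 * M)).
{ intros l G Hl HG E.
  set (n := length l).
  assert (P3 : 0 < (3 * r) ^ n) by (apply pow_lt; lra).
  assert (BG : Cmod (G p) <= (M / (3 * r)^n) * (4 * r) / (4 * r - Cmod (p - 0))).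
  { apply (holo_bound G 0 R); auto. lra. rewrite Cmod_minus_0; lra.
    intros t Ht. rewrite Cplus_0_l. 
    assert (Hc : Cmod (circ (4 * r) t) = 4 * r) by (apply Cmod_circ; lra).
    specialize (HM t Ht). rewrite E, Cmod_mult in HM by lra.
    assert ((3 * r) ^ n <= Cmod (lprod l (circ (4 * r) t))).
    { apply lprod_lower. lra. intros a Ha. specialize (Hl a Ha). generalize (Cmod_rev_triangle (circ (4 * r) t) a). lra. }
    apply Rmult_le_reg_r with ((3 * r)^n); auto. unfold Rdiv. rewrite Rmult_assoc, Rinv_l, Rmult_1_r by lra.
    generalize (Cmod_ge_0 (G (circ (4 * r) t))). nra. }
  rewrite Cmod_minus_0 in BG.
  assert (BG2 : Cmod (G p) <= M / (3 * r)^n * (4 / 3)).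
  { eapply Rle_trans. apply BG. unfold Rdiv at 1. rewrite Rmult_assoc. apply Rmult_le_compat_l.
    apply Rlt_le, Rdiv_lt_0_compat; auto. apply Rmult_le_reg_r with (4 * r - Cmod p). lra. rewrite Rmult_assoc, Rinv_l by lra. lra. }
  rewrite E by lra. rewrite Cmod_mult.
  assert (BL : Cmod (lprod l p) <= (2 * r)^n).
  { apply lprod_upper. lra. intros a Ha. specialize (Hl a Ha). eapply Rle_trans. apply Cmod_triangle. rewrite Cmod_opp. lra. }
  replace ((2 / 3)^n * (4 / 3 * M)) with ((2 * r)^n * (M / (3 * r)^n * (4 / 3))).
  apply Rmult_le_compat; auto; apply Cmod_ge_0.
  unfold Rdiv. rewrite !Rpow_mult_distr, pow_inv. field. split; apply pow_nonzero; lra. }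
assert (exists N, (2 / 3) ^ N * (4 / 3 * M) < Cmod (F p)) as [N HN].
{ assert (L : is_lim_seq (fun n => (2/3)^n) 0). { apply is_lim_seq_geom. rewrite Rabs_pos_eq; lra. }
  apply is_lim_seq_spec in L. destruct (L (mkposreal (Cmod (F p) / (4 / 3 * M)) ltac:(apply Rdiv_lt_0_compat; lra))) as [n H].
  exists n. specialize (H n ltac:(lia)). simpl in H. rewrite Rminus_0_r, Rabs_pos_eq in H by (apply pow_le; lra).
  apply Rmult_lt_compat_r with (r := 4 / 3 * M) in H; [|lra].
  replace (Cmod (F p) / (4 / 3 * M) * (4 / 3 * M)) with (Cmod (F p)) in H by (field; lra). lra. }
(* Roots are divided out one at a time. The fuel [k] would run out only after [N] roots, and [bound]
   excludes that many. *)
assert (ind : forall k l G, (N <= length l + k)%nat -> (forall a, In a l -> Cmod a < r) -> holo_on_disc G 0 R ->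
   (forall z, Cmod z < R -> F z = (lprod l z * G z)%C) ->
   exists l G, (forall a, In a l -> Cmod a < r) /\ holo_on_disc G 0 R /\
    (forall z, Cmod z < R -> F z = (lprod l z * G z)%C) /\ forall z, Cmod z < r -> G z <> RtoC 0).
{ induction k; intros l G Hk Hl HG E.
  - exfalso. pose proof (bound l G Hl HG E).
    assert ((2 / 3)^length l <= (2/3)^N). { replace (length l) with (N + (length l - N))%nat by lia. rewrite pow_add.
      rewrite <- (Rmult_1_r ((2/3)^N)) at 2. apply Rmult_le_compat_l. apply pow_le; lra. rewrite <- (pow1 (length l - N)). apply pow_incr. lra. }
    nra.
  - destruct (classic (exists z, Cmod z < r /\ G z = RtoC 0)) as [[q [Hq Hq0]]|H].
    + destruct (divide_root G 0 R q HG ltac:(rewrite Cmod_minus_0; lra) Hq0) as [G1 [HG1 E1]].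
      apply (IHk (q :: l) G1). simpl; lia. intros a [<-|Ha]; auto. auto.
      intros z Hz. rewrite E by auto. rewrite E1 by (rewrite Cmod_minus_0; auto). simpl. ring.
    + exists l, G. repeat split; auto. intros z Hz E0. apply H. eauto. }
apply (ind N nil F). simpl; lia. simpl; tauto. auto. intros. simpl. ring.
Qed.

(** With this default value, ln |g| equals half of ln (|g|^2) at every parameter, zeros of g
    included, so the derivative can be transferred by a global identity. *)
Lemma ln_zero : ln 0 = 0.
Proof. unfold ln. destruct (Rlt_dec 0 0) as [H|H]. exfalso; lra. reflexivity. Qed.

Lemma is_derive_half_ln (u v : R -> R) t (u' v' : R) : is_derive u t u' -> is_derive v t v' ->
  0 < u t * u t + v t * v t ->
  is_derive (fun s => / 2 * ln (u s * u s + v s * v s)) t ((u t * u' + v t * v') / (u t * u t + v t * v t)).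
Proof.
intros H1 H2 P. auto_derive.
- repeat split; try (eexists; eauto); auto.
- replace (Derive (fun x => u x) t) with u' by (symmetry; now apply is_derive_unique).
  replace (Derive (fun x => v x) t) with v' by (symmetry; now apply is_derive_unique). field. lra.
Qed.

Lemma rder_ln_Cmod g t m : g t <> RtoC 0 -> rder g t m ->
  is_derive (fun s => ln (Cmod (g s))) t (Re (m / g t)).
Proof.
intros N [H1 H2].
assert (P : 0 < Re (g t) * Re (g t) + Im (g t) * Im (g t)).
{ pose proof (Cmod_pos_neq _ N) as Q. unfold Cmod in Q.
  destruct (Rle_lt_dec (Re (g t) * Re (g t) + Im (g t) * Im (g t)) 0); auto.
  rewrite sqrt_neg_0 in Q. lra. unfold Re, Im in *. simpl. lra. }
apply (is_derive_ext (fun s => / 2 * ln (Re (g s) * Re (g s) + Im (g s) * Im (g s)))).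
{ intros s. unfold Cmod. replace (fst (g s)^2 + snd (g s)^2) with (Re (g s) * Re (g s) + Im (g s) * Im (g s)) by (unfold Re, Im; simpl; ring).
  set (q := Re (g s) * Re (g s) + Im (g s) * Im (g s)). assert (0 <= q) by (unfold q; nra).
  match goal with |- ?a = ?b => change (@eq R a b) end.
  destruct (Req_dec q 0) as [->|]. rewrite sqrt_0, ln_zero. ring.
  rewrite <- (sqrt_sqrt q) at 1 by auto. rewrite ln_mult by (apply sqrt_lt_R0; lra). field. }
replace (Re (m / g t)) with ((Re (g t) * Re m + Im (g t) * Im m) / (Re (g t) * Re (g t) + Im (g t) * Im (g t))).
now apply (is_derive_half_ln (fun s => Re (g s)) (fun s => Im (g s))).
unfold Re, Im in *. simpl. unfold Re, Im. field. lra.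
Qed.

Lemma rder_scal_id z t : rder (fun s => RtoC s * z)%C t z.
Proof.
apply rder_slope. exists (fun _ => z). split; [|split]; auto. apply rcont_const. intros s. rewrite RtoC_minus. ring.
Qed.

Lemma Cmod_scal_lt t z R : 0 <= t <= 1 -> Cmod z < R -> Cmod (RtoC t * z - 0) < R.
Proof. intros. rewrite Cmod_minus_0, Cmod_mult, Cmod_RtoC_pos by lra. generalize (Cmod_ge_0 z). nra. Qed.

(** [h] is the primitive of G' / G with Re h(0) = ln |G(0)|. The identity for the real part follows
    by differentiation along the segment from 0 to [z]; no complex exponential is involved. *)
Theorem holo_log G R : 0 < R -> holo_on_disc G 0 R -> (forall z, Cmod z < R -> G z <> RtoC 0) ->
  exists h, holo_on_disc h 0 R /\ forall z, Cmod z < R ->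
    C_derive h z = (C_derive G z / G z)%C /\ ln (Cmod (G z)) = Re (h z).
Proof.
intros HR HG HN.
set (g := fun z => (C_derive G z / G z)%C).
assert (Hg : holo_on_disc g 0 R).
{ intros z Hz. apply cdiff_div. apply HN. now rewrite Cmod_minus_0 in Hz. now apply (derivative_cdiff G 0 R). now apply HG. }
assert (H0 : Cmod (0 - 0) < R) by (rewrite Cmod_minus_self; auto).
assert (HH : forall z, Cmod (z - 0) < R -> cder (seg g (RtoC 0)) z (g z)).
{ intros z Hz. apply primitive_exceptional with (RtoC 0) R; auto. intros; now apply cdiff_ccont, Hg. }
set (h := fun z => (seg g (RtoC 0) z + RtoC (ln (Cmod (G 0))))%C).
assert (Hh : forall z, Cmod (z - 0) < R -> cder h z (g z)).
{ intros z Hz. eapply cder_eq. apply cder_plus. now apply HH. apply cder_const. ring. }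
exists h. split. intros z Hz. apply cdiff_cder. eexists; eauto.
intros z Hz. split. apply cder_C_derive. apply Hh. now rewrite Cmod_minus_0.
assert (E : ln (Cmod (G (RtoC 0 * z)%C)) - Re (h (RtoC 0 * z)%C) = ln (Cmod (G (RtoC 1 * z)%C)) - Re (h (RtoC 1 * z)%C)).
{ apply (eq_is_derive (fun t => ln (Cmod (G (RtoC t * z)%C)) - Re (h (RtoC t * z)%C)) 0 1); [|lra].
  intros t Ht. pose proof (Cmod_scal_lt t z R Ht Hz) as Hd.
  assert (Hd2 : Cmod (RtoC t * z) < R) by now rewrite Cmod_minus_0 in Hd.
  replace (@zero R_NormedModule) with (minus (Re (C_derive G (t * z) * z / G (t * z))%C) (Re (g (t * z) * z)%C)).
  apply (is_derive_minus (fun t => ln (Cmod (G (RtoC t * z)%C))) (fun t => Re (h (RtoC t * z)%C))).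
  apply (rder_ln_Cmod (fun t => G (RtoC t * z)%C)). now apply HN. apply rder_comp. now apply (holo_C_derive G 0 R). apply rder_scal_id.
  apply (rder_comp h (fun t => RtoC t * z)%C). now apply Hh. apply rder_scal_id.
  unfold g. replace (C_derive G (t * z) * z / G (t * z))%C with (C_derive G (t * z) / G (t * z) * z)%C.
  unfold minus, plus, opp, zero; simpl. rring. unfold Cdiv. ring. }
rewrite Cmult_1_l, Cmult_0_l in E. 
assert (E0 : Re (h (RtoC 0)) = ln (Cmod (G (RtoC 0)))).
{ unfold h. rewrite seg_refl. unfold Re; simpl. ring. }
lra.
Qed.

(** * Means over circles centred at 0 *)

Definition mn (F : C -> R) (r : R) : R := RInt (fun t => F (circ r t)) 0 (2 * PI) / (2 * PI).
Definition ccirc (F : C -> R) (r : R) : Prop := forall t, continuous (fun t => F (circ r t)) t.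

Lemma twoPI_pos : 0 < 2 * PI. Proof. generalize PI_RGT_0; lra. Qed.

Lemma ccirc_ex F r : ccirc F r -> ex_RInt (fun t => F (circ r t)) 0 (2 * PI).
Proof. intros H. apply (ex_RInt_continuous (V := R_CompleteNormedModule)). intros; apply H. Qed.

Lemma mn_le F G r : ccirc F r -> ccirc G r -> (forall t, F (circ r t) <= G (circ r t)) -> mn F r <= mn G r.
Proof.
intros HF HG H. apply Rmult_le_compat_r. left. apply Rinv_0_lt_compat, twoPI_pos.
apply RInt_le. generalize twoPI_pos; lra. now apply ccirc_ex. now apply ccirc_ex. intros; apply H.
Qed.
Lemma mn_ext F G r : (forall t, F (circ r t) = G (circ r t)) -> mn F r = mn G r.
Proof. intros H. unfold mn. f_equal. apply RInt_ext. intros; apply H. Qed.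
Lemma mn_plus F G r : ccirc F r -> ccirc G r -> mn (fun z => F z + G z) r = mn F r + mn G r.
Proof. intros HF HG. unfold mn. rewrite (RInt_plus (fun t => F (circ r t)) (fun t => G (circ r t))); try now apply ccirc_ex. 
 apply Rdiv_plus_distr. Qed.
Lemma mn_minus F G r : ccirc F r -> ccirc G r -> mn (fun z => F z - G z) r = mn F r - mn G r.
Proof. intros HF HG. unfold mn. rewrite (RInt_minus (fun t => F (circ r t)) (fun t => G (circ r t))); try now apply ccirc_ex. 
 unfold minus, plus, opp; simpl. unfold Rdiv. ring. Qed.
Lemma mn_scal k F r : ccirc F r -> mn (fun z => k * F z) r = k * mn F r.
Proof. intros HF. unfold mn. rewrite (RInt_scal (fun t => F (circ r t))); try now apply ccirc_ex. 
 unfold scal; simpl. unfold mult; simpl. unfold Rdiv; ring. Qed.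
Lemma mn_const k r : mn (fun _ => k) r = k.
Proof. unfold mn. rewrite RInt_const. unfold scal; simpl. unfold mult; simpl. field. generalize twoPI_pos; lra. Qed.

Lemma ccirc_const k r : ccirc (fun _ => k) r. Proof. intros t. apply continuous_const. Qed.
Lemma ccirc_plus F G r : ccirc F r -> ccirc G r -> ccirc (fun z => F z + G z) r.
Proof. intros HF HG t. apply (continuous_plus (fun t => F (circ r t)) (fun t => G (circ r t))). apply HF. apply HG. Qed.
Lemma ccirc_minus F G r : ccirc F r -> ccirc G r -> ccirc (fun z => F z - G z) r.
Proof. intros HF HG t. apply (continuous_minus (fun t => F (circ r t)) (fun t => G (circ r t))). apply HF. apply HG. Qed.
Lemma ccirc_mult F G r : ccirc F r -> ccirc G r -> ccirc (fun z => F z * G z) r.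
Proof. intros HF HG t. apply (continuous_mult (fun t => F (circ r t)) (fun t => G (circ r t))). apply HF. apply HG. Qed.
Lemma ccirc_scal k F r : ccirc F r -> ccirc (fun z => k * F z) r.
Proof. intros. apply ccirc_mult; auto. apply ccirc_const. Qed.
Lemma ccirc_ext F G r : (forall t, F (circ r t) = G (circ r t)) -> ccirc F r -> ccirc G r.
Proof. intros E H t. apply (continuous_ext (fun t => F (circ r t))); auto. Qed.
Lemma ccirc_comp (g : R -> R) F r : ccirc F r -> (forall t, continuous g (F (circ r t))) -> ccirc (fun z => g (F z)) r.
Proof. intros HF Hg t. apply (continuous_comp (fun t => F (circ r t)) g). apply HF. apply Hg. Qed.
Lemma ccirc_abs F r : ccirc F r -> ccirc (fun z => Rabs (F z)) r.
Proof. intros. apply (ccirc_comp Rabs); auto. intros. apply continuous_Rabs. Qed.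

Lemma mn_abs F r : ccirc F r -> Rabs (mn F r) <= mn (fun z => Rabs (F z)) r.
Proof.
intros H. apply Rabs_le. split.
- replace (- mn (fun z => Rabs (F z)) r) with (mn (fun z => (-1) * Rabs (F z)) r).
  apply mn_le; auto. apply ccirc_scal. now apply ccirc_abs. intros. generalize (Rle_abs (- F (circ r t))). rewrite Rabs_Ropp. lra.
  rewrite mn_scal by now apply ccirc_abs. ring.
- apply mn_le; auto. now apply ccirc_abs. intros. apply Rle_abs.
Qed.

Lemma continuous_ln x : 0 < x -> continuous ln x.
Proof. intros. apply (ex_derive_continuous (K := R_AbsRing) (V := R_NormedModule)). auto_derive. auto. Qed.

Lemma ccirc_Cmod F r : (forall t, ccont F (circ r t)) -> ccirc (fun z => Cmod (F z)) r.
Proof. intros H t. apply rcont_Cmod. apply (rcont_comp F (circ r)). apply H. apply rcont_circ. Qed.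

Lemma ccirc_lnCmod F r : (forall t, ccont F (circ r t) /\ F (circ r t) <> RtoC 0) -> ccirc (fun z => ln (Cmod (F z))) r.
Proof. intros H. apply ccirc_comp. apply ccirc_Cmod. apply H. intros t. apply continuous_ln. apply Cmod_pos_neq. apply H. Qed.

Lemma ccirc_Re F r : (forall t, ccont F (circ r t)) -> ccirc (fun z => Re (F z)) r.
Proof. intros H t. apply (rcont_comp F (circ r) t (H t) (rcont_circ r t)). Qed.

Lemma mn_Re h R r : holo_on_disc h 0 R -> 0 < r < R -> mn (fun z => Re (h z)) r = Re (h (RtoC 0)).
Proof.
intros H Hr. pose proof (mean_value h 0 R r H Hr) as E. apply (f_equal Re) in E. rewrite Re_CI in E.
unfold mn. rewrite (RInt_ext _ (fun t => Re (h (0 + circ r t)%C))). 2: intros; now rewrite Cplus_0_l.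
rewrite E. unfold Re; simpl. field. generalize twoPI_pos; lra.
Qed.

Lemma mn_ln_nonvanishing G R r : 0 < r < R -> holo_on_disc G 0 R -> (forall z, Cmod z < R -> G z <> RtoC 0) ->
  mn (fun z => ln (Cmod (G z))) r = ln (Cmod (G (RtoC 0))).
Proof.
intros Hr HG HN. destruct (holo_log G R ltac:(lra) HG HN) as [h [Hh E]].
rewrite (mn_ext _ (fun z => Re (h z))). rewrite (mn_Re h R) by auto. symmetry. apply E. rewrite Cmod_0; lra.
intros t. apply E. rewrite Cmod_circ; lra.
Qed.

(** For |a| < r the right-hand side is the modulus of a function without zeros in the closed unit
    disc, so the mean value property applies to its logarithm. *)
Lemma Cmod_circ_reflect r a t : 0 < r -> Cmod (circ r t - a) = Cmod (RtoC r - Cconj a * circ 1 t).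
Proof.
intros Hr. rewrite <- (Cmod_conj (circ r t - a)). rewrite Cminus_conj, Cconj_circ by auto.
assert (E : circ r t = (RtoC r * circ 1 t)%C).
{ unfold circ. apply injective_projections; simpl; ring. }
rewrite E. pose proof (circ_neq0 1 t ltac:(lra)) as N. pose proof (RtoC_neq r ltac:(lra)).
replace (RtoC (r * r) / (r * circ 1 t) - Cconj a)%C with ((RtoC r - Cconj a * circ 1 t) / circ 1 t)%C by (rewrite RtoC_mult; field; auto).
rewrite Cmod_div, (Cmod_circ 1) by (auto; lra). field.
Qed.

Theorem mn_ln_minus a r : 0 < r -> Cmod a <> r -> mn (fun z => ln (Cmod (z - a))) r = ln (Rmax r (Cmod a)).
Proof.
intros Hr Ha. destruct (Rlt_le_dec r (Cmod a)) as [H|H].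
- rewrite Rmax_right by lra. rewrite (mn_ln_nonvanishing (fun z => z - a)%C (Cmod a)).
  f_equal. replace (0 - a)%C with (- a)%C by ring. apply Cmod_opp. lra.
  intros z _. apply cdiff_minus. apply cdiff_id. apply cdiff_const.
  intros z Hz E. apply (f_equal Cmod) in E. rewrite Cmod_0 in E. generalize (Cmod_rev_triangle a z). rewrite Cmod_minus_sym. lra.
- rewrite Rmax_left by lra.
  replace (mn (fun z => ln (Cmod (z - a))) r) with (mn (fun z => ln (Cmod (RtoC r - Cconj a * z))) 1).
  2:{ unfold mn. f_equal. apply RInt_ext. intros. now rewrite Cmod_circ_reflect. }
  destruct (Req_dec (Cmod a) 0) as [E0|E0].
  + apply Cmod_eq_0 in E0. rewrite (mn_ext _ (fun _ => ln r)). apply mn_const. intros t. f_equal. rewrite E0.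
    replace (RtoC r - Cconj 0 * circ 1 t)%C with (RtoC r). apply Cmod_RtoC_pos; lra. rewrite Cconj_RtoC. ring.
  + assert (Pa : 0 < Cmod a) by (generalize (Cmod_ge_0 a); lra).
    rewrite (mn_ln_nonvanishing (fun z => RtoC r - Cconj a * z)%C (r / Cmod a)).
    f_equal. rewrite Cmult_0_r. replace (RtoC r - 0)%C with (RtoC r) by ring. apply Cmod_RtoC_pos; lra.
    split. lra. apply Rmult_lt_reg_r with (Cmod a); auto. unfold Rdiv. rewrite Rmult_assoc, Rinv_l by lra. lra.
    intros z _. apply cdiff_minus. apply cdiff_const. apply cdiff_mult. apply cdiff_const. apply cdiff_id.
    intros z Hz E. apply (f_equal Cmod) in E. rewrite Cmod_0 in E.
    generalize (Cmod_rev_triangle (RtoC r) (Cconj a * z)). rewrite Cmod_mult, Cmod_conj, Cmod_RtoC_pos by lra.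
    apply Rmult_lt_compat_r with (r := Cmod a) in Hz; auto. unfold Rdiv in Hz. rewrite Rmult_assoc, Rinv_l in Hz by lra. lra.
Qed.

(** * Jensen and Poisson-Jensen formulas *)

Definition lsum (phi : C -> R) (l : list C) : R := fold_right (fun a s => phi a + s) 0 l.
Definition csum (phi : C -> C) (l : list C) : C := fold_right (fun a s => phi a + s)%C (RtoC 0) l.

Lemma lsum_le phi psi l : (forall a, In a l -> phi a <= psi a) -> lsum phi l <= lsum psi l.
Proof. induction l; simpl; intros H. lra. apply Rplus_le_compat; auto. Qed.
Lemma lsum_ext phi psi l : (forall a, In a l -> phi a = psi a) -> lsum phi l = lsum psi l.
Proof. induction l; simpl; intros H. lra. f_equal; auto. Qed.
Lemma lsum_const k l : lsum (fun _ => k) l = INR (length l) * k.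
Proof. induction l. simpl; ring. change (k + lsum (fun _ => k) l = INR (S (length l)) * k). rewrite IHl, S_INR. ring. Qed.
Lemma lsum_minus phi psi l : lsum (fun a => phi a - psi a) l = lsum phi l - lsum psi l.
Proof. induction l; simpl. ring. rewrite IHl. ring. Qed.
Lemma lsum_plus phi psi l : lsum (fun a => phi a + psi a) l = lsum phi l + lsum psi l.
Proof. induction l; simpl. ring. rewrite IHl. ring. Qed.
Lemma lsum_nonneg phi l : (forall a, In a l -> 0 <= phi a) -> 0 <= lsum phi l.
Proof. induction l; simpl; intros H. lra. apply Rplus_le_le_0_compat; auto. Qed.
Lemma lsum_abs phi l : Rabs (lsum phi l) <= lsum (fun a => Rabs (phi a)) l.
Proof. induction l; simpl. rewrite Rabs_R0; lra. eapply Rle_trans. apply Rabs_triang. lra. Qed.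

Lemma mn_lsum (phi : C -> C -> R) l r : (forall a, In a l -> ccirc (phi a) r) ->
  ccirc (fun z => lsum (fun a => phi a z) l) r /\
  mn (fun z => lsum (fun a => phi a z) l) r = lsum (fun a => mn (phi a) r) l.
Proof.
induction l; intros H; simpl. split. apply ccirc_const. apply mn_const.
destruct IHl as [H1 H2]. intros; apply H; now right.
split. apply (ccirc_plus (phi a)); auto. apply H; now left.
rewrite (mn_plus (phi a)); auto. now rewrite H2. apply H; now left.
Qed.

(** The factorization of F into the product of the z - a and a zero-free factor with logarithm [h],
    in the form in which it is used: for ln |F| and for F'. The identity for ln |F| forces [l] to
    repeat each zero according to its multiplicity. *)
Definition zrep (F : C -> C) (R : R) (l : list C) (h : C -> C) : Prop :=
  holo_on_disc F 0 R /\ holo_on_disc h 0 R /\ (forall a, In a l -> Cmod a < R) /\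
  forall z, Cmod z < R -> (In z l -> F z = RtoC 0) /\
    (~ In z l -> F z <> RtoC 0 /\ ln (Cmod (F z)) = lsum (fun a => ln (Cmod (z - a))) l + Re (h z) /\
      C_derive F z = (F z * (csum (fun a => / (z - a)) l + C_derive h z))%C).

Lemma ln_lprod l z : ~ In z l -> ln (Cmod (lprod l z)) = lsum (fun a => ln (Cmod (z - a))) l.
Proof.
induction l; simpl; intros H. rewrite Cmod_1. apply ln_1.
assert (z <> a) by (intros E; apply H; left; auto). assert (~ In z l) by tauto.
rewrite Cmod_mult, ln_mult. now rewrite IHl. now apply Cmod_minus_pos. now apply Cmod_pos_neq, lprod_neq0.
Qed.

Lemma cder_lprod l z : ~ In z l -> cder (lprod l) z (lprod l z * csum (fun a => / (z - a))%C l)%C.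
Proof.
induction l; simpl; intros H. eapply cder_eq. apply cder_const. ring.
assert (z <> a) by (intros E; apply H; left; auto). assert (~ In z l) by tauto.
eapply cder_eq. apply (cder_mult (fun z => z - a)%C (lprod l)). apply cder_minus. apply cder_id. apply cder_const.
now apply IHl. cbv beta. field. now apply Cminus_neq.
Qed.

Definition generic (r : R) (l : list C) := forall a, In a l -> Cmod a <> r.

Lemma circ_notin r l t : 0 <= r -> generic r l -> ~ In (circ r t) l.
Proof. intros Hr H I. apply (H _ I). now apply Cmod_circ. Qed.

Lemma ccont_minus_const a z : ccont (fun z => z - a)%C z.
Proof. apply ccont_minus. apply ccont_id. apply ccont_const. Qed.

Lemma ccirc_ln_minus a r : 0 <= r -> Cmod a <> r -> ccirc (fun z => ln (Cmod (z - a))) r.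
Proof.
intros Hr H. apply ccirc_lnCmod. intros t. split. apply ccont_minus_const.
apply Cminus_neq. intros E. apply H. rewrite <- E. now apply Cmod_circ.
Qed.

Lemma zrep_ccirc F R l h r : zrep F R l h -> 0 <= r < R -> generic r l -> ccirc (fun z => ln (Cmod (F z))) r.
Proof.
intros [HF [_ [_ H]]] Hr G. apply ccirc_lnCmod. intros t. 
assert (Hc : Cmod (circ r t) < R) by (rewrite Cmod_circ; lra). split.
apply cdiff_ccont, HF. now rewrite Cmod_minus_0. apply (H _ Hc). apply circ_notin; auto; lra.
Qed.

Theorem jensen F R l h r : zrep F R l h -> 0 < r < R -> generic r l ->
  mn (fun z => ln (Cmod (F z))) r = lsum (fun a => ln (Rmax r (Cmod a))) l + Re (h (RtoC 0)).
Proof.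
intros [HF [Hh [_ H]]] Hr G.
destruct (mn_lsum (fun a z => ln (Cmod (z - a))) l r) as [H1 H2]. { intros a Ha. apply ccirc_ln_minus; auto. lra. }
rewrite (mn_ext _ (fun z => lsum (fun a => ln (Cmod (z - a))) l + Re (h z))).
rewrite mn_plus; auto. rewrite (mn_Re h R) by auto. rewrite H2. f_equal. apply lsum_ext. intros a Ha. apply mn_ln_minus; auto. lra.
apply ccirc_Re. intros t. apply cdiff_ccont, Hh. rewrite Cmod_minus_0, Cmod_circ; lra.
intros t. apply H. rewrite Cmod_circ; lra. apply circ_notin; auto; lra.
Qed.

Lemma ln_le_mono x y : 0 < x -> x <= y -> ln x <= ln y.
Proof. intros. destruct H0. left; now apply ln_increasing. subst; lra. Qed.

Lemma jensen_mono F R l h r0 r : zrep F R l h -> 0 < r0 <= r -> r < R -> generic r0 l -> generic r l ->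
  mn (fun z => ln (Cmod (F z))) r0 <= mn (fun z => ln (Cmod (F z))) r.
Proof.
intros H Hr HR G0 G. rewrite !(jensen F R l h) by (auto; lra). apply Rplus_le_compat_r. apply lsum_le.
intros a _. apply ln_le_mono. apply Rlt_le_trans with r0. lra. apply Rmax_l.
apply Rle_max_compat_r. lra.
Qed.

Definition ncount (r : R) (l : list C) : R := lsum (fun a => if Rlt_dec (Cmod a) r then 1 else 0) l.

Lemma lsum_scal k phi l : lsum (fun a => k * phi a) l = k * lsum phi l.
Proof. induction l; simpl. ring. rewrite IHl. ring. Qed.

(** In the difference of two Jensen formulas each zero with |a| < s contributes at least ln (r / s),
    and no zero contributes a negative amount. *)
Lemma jensen_count F R l h r0 s r : zrep F R l h -> 0 < r0 <= s -> s < r < R -> generic r0 l -> generic r l ->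
  ncount s l * ln (r / s) <= mn (fun z => ln (Cmod (F z))) r - mn (fun z => ln (Cmod (F z))) r0.
Proof.
intros H Hr HR G0 G. rewrite !(jensen F R l h) by (auto; lra).
replace (lsum (fun a => ln (Rmax r (Cmod a))) l + Re (h (RtoC 0)) - (lsum (fun a => ln (Rmax r0 (Cmod a))) l + Re (h (RtoC 0))))
 with (lsum (fun a => ln (Rmax r (Cmod a)) - ln (Rmax r0 (Cmod a))) l) by (rewrite lsum_minus; ring).
unfold ncount. rewrite Rmult_comm, <- lsum_scal. apply lsum_le. intros a _.
assert (E : ln (r / s) = ln r - ln s) by (unfold Rdiv; rewrite ln_mult, ln_Rinv by (try apply Rinv_0_lt_compat; lra); ring).
destruct (Rlt_dec (Cmod a) s).
- rewrite Rmult_1_r, E. rewrite (Rmax_left r) by lra.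
  assert (ln (Rmax r0 (Cmod a)) <= ln s); [|lra]. apply ln_le_mono. eapply Rlt_le_trans; [|apply Rmax_l]. lra. apply Rmax_lub; lra.
- rewrite Rmult_0_r. 
  assert (ln (Rmax r0 (Cmod a)) <= ln (Rmax r (Cmod a))); [|lra]. apply ln_le_mono. eapply Rlt_le_trans; [|apply Rmax_l]. lra.
  apply Rle_max_compat_r. lra.
Qed.

(** * The Poisson kernel *)

(** The Poisson kernel as the real part of the Schwarz kernel: the Poisson integral of [U] is then
    visibly the real part of a holomorphic function of [z]. *)
Definition PK (r : R) (z zeta : C) : R := Re ((zeta + z) / (zeta - z))%C.
Definition PI_ (r : R) (U : C -> R) (z : C) : R := mn (fun zeta => PK r z zeta * U zeta) r.

Lemma circ_minus_neq' R t z : Cmod z < R -> (circ R t - z)%C <> RtoC 0.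
Proof. intros. apply circ_minus_neq; auto. generalize (Cmod_ge_0 z); lra. Qed.

Lemma Cmod_sqr z : Cmod z * Cmod z = Re z * Re z + Im z * Im z.
Proof. unfold Cmod. rewrite sqrt_sqrt. unfold Re, Im; simpl; ring. generalize (pow2_ge_0 (fst z)) (pow2_ge_0 (snd z)); lra. Qed.

Lemma RtoC_sqr_conj z : RtoC (Cmod z * Cmod z) = (z * Cconj z)%C.
Proof. rewrite <- Cmod2_conj. f_equal. ring. Qed.

Lemma Re_mult_R x z : Re (RtoC x * z)%C = x * Re z.
Proof. unfold Re; simpl. ring. Qed.

(** The first identity splits the kernel into the Cauchy kernel and a term holomorphic in zeta on a
    larger disc; the second is the usual form (R^2 - |z|^2) / |zeta - z|^2. *)
Lemma PK_eq R t z : Cmod z < R ->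
  RtoC (PK R z (circ R t)) = (circ R t / (circ R t - z) + Cconj z * circ R t / (RtoC (R * R) - Cconj z * circ R t))%C /\
  PK R z (circ R t) * (Cmod (circ R t - z) * Cmod (circ R t - z)) = R * R - Cmod z * Cmod z.
Proof.
intros Hz. pose proof (circ_minus_neq' R t z Hz) as N. assert (HR : 0 < R) by (generalize (Cmod_ge_0 z); lra).
set (e := circ R t) in *.
assert (Ne : e <> RtoC 0) by (apply circ_neq0; auto).
assert (Nc : (Cconj e - Cconj z)%C <> RtoC 0).
{ rewrite <- Cminus_conj. intros E. apply N. apply Cmod_eq_0. rewrite <- Cmod_conj, E. apply Cmod_0. }
assert (Nce : Cconj e <> RtoC 0).
{ intros E. apply Ne. apply Cmod_eq_0. rewrite <- Cmod_conj, E. apply Cmod_0. }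
assert (ER : RtoC (R * R) = (e * Cconj e)%C). { rewrite <- RtoC_sqr_conj. unfold e. now rewrite Cmod_circ by lra. }
assert (E1 : RtoC (PK R z e) = (e / (e - z) + Cconj z * e / (RtoC (R * R) - Cconj z * e))%C).
{ unfold PK. rewrite re_alt. rewrite Cdiv_conj, Cplus_conj, Cminus_conj by auto. rewrite ER.
  assert (RtoC 2 <> 0) by (apply RtoC_neq; lra). field. repeat split; auto.
  replace (e * Cconj e - Cconj z * e)%C with (e * (Cconj e - Cconj z))%C by ring. now apply Cmult_neq_0. }
split; auto.
apply RtoC_inj. rewrite RtoC_mult, E1, RtoC_minus, !RtoC_sqr_conj. rewrite Cminus_conj, ER. field. split; auto.
replace (e * Cconj e - Cconj z * e)%C with (e * (Cconj e - Cconj z))%C by ring. now apply Cmult_neq_0.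
Qed.

Lemma PK_pos R t z : Cmod z < R -> 0 < PK R z (circ R t).
Proof.
intros Hz. pose proof (Cmod_pos_neq _ (circ_minus_neq' R t z Hz)) as P. destruct (PK_eq R t z Hz) as [_ E].
generalize (Cmod_ge_0 z). intros. 
assert (0 < R * R - Cmod z * Cmod z) by nra. rewrite <- E in H0.
apply Rmult_lt_reg_r with (Cmod (circ R t - z) * Cmod (circ R t - z)). nra. lra.
Qed.

Lemma ccirc_PK R z : Cmod z < R -> ccirc (PK R z) R.
Proof.
intros Hz t. assert (X : rcont (fun t => (circ R t + z) / (circ R t - z))%C t); [|exact (proj1 X)].
apply rcont_div. now apply circ_minus_neq'.
apply rcont_plus. apply rcont_circ. apply rcont_const. apply rcont_minus. apply rcont_circ. apply rcont_const.
Qed.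

Theorem poisson h R1 R z : holo_on_disc h 0 R1 -> Cmod z < R < R1 -> PI_ R (fun w => Re (h w)) z = Re (h z).
Proof.
intros Hh [Hz HR]. assert (P : 0 < R) by (generalize (Cmod_ge_0 z); lra).
(* A radius beyond [R] that still satisfies R2 |z| < R^2, because (2 R - |z|) |z| < R^2 is the same
   as (R - |z|)^2 > 0. *)
set (R2 := Rmin R1 (R + (R - Cmod z))).
assert (HR2 : R < R2) by (apply Rmin_glb_lt; lra).
assert (HR2' : R2 * Cmod z < R * R).
{ apply Rle_lt_trans with ((R + (R - Cmod z)) * Cmod z). apply Rmult_le_compat_r. apply Cmod_ge_0. apply Rmin_r.
  generalize (Cmod_ge_0 z); nra. }
(* The product of [h] with the second part of the kernel. It vanishes at 0, so its mean over the
   circle is 0. *)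
set (k := fun w => (h w * (Cconj z * w) / (RtoC (R * R) - Cconj z * w))%C).
assert (Nk : forall w, Cmod w < R2 -> (RtoC (R * R) - Cconj z * w)%C <> RtoC 0).
{ intros w Hw E. apply (f_equal Cmod) in E. rewrite Cmod_0 in E.
  generalize (Cmod_rev_triangle (RtoC (R * R)) (Cconj z * w)). rewrite Cmod_mult, Cmod_conj, Cmod_RtoC_pos by nra.
  generalize (Cmod_ge_0 z) (Cmod_ge_0 w). nra. }
assert (Hk : holo_on_disc k 0 R2).
{ intros w Hw. rewrite Cmod_minus_0 in Hw. apply cdiff_div. now apply Nk.
  apply cdiff_mult. apply Hh. rewrite Cmod_minus_0. eapply Rlt_le_trans; [apply Hw|apply Rmin_l]. apply cdiff_mult. apply cdiff_const. apply cdiff_id.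
  apply cdiff_minus. apply cdiff_const. apply cdiff_mult. apply cdiff_const. apply cdiff_id. }
pose proof (mean_value k 0 R2 R Hk ltac:(lra)) as M1.
replace (k 0)%C with (RtoC 0) in M1 by (unfold k; field; apply RtoC_neq; nra).
pose proof (cauchy_formula h 0 R1 R z Hh ltac:(lra) ltac:(rewrite Cmod_minus_0; lra)) as M2.
assert (E : (CI (fun t => RtoC (PK R z (circ R t)) * h (circ R t))%C 0 (2 * PI) = RtoC (2 * PI) * h z)%C).
{ rewrite <- M2. rewrite <- (Cplus_0_r (CI _ _ _)) at 1. 
  replace (CI (fun t => RtoC (PK R z (circ R t)) * h (circ R t))%C 0 (2 * PI)) with
   (CI (fun t => h (0 + circ R t) * circ R t / (circ R t - (z - 0)) + k (0 + circ R t))%C 0 (2 * PI)).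
  2:{ apply CI_ext. intros t _. destruct (PK_eq R t z Hz) as [Ek _]. rewrite Ek. unfold k. rewrite Cplus_0_l. 
      replace (z - 0)%C with z by ring. field. split. apply Nk. rewrite Cmod_circ; lra. now apply circ_minus_neq'. }
  rewrite CI_plus. rewrite M1. ring.
  - intros t _. apply rcont_div. replace (z - 0)%C with z by ring. now apply circ_minus_neq'.
    apply rcont_mult; [|apply rcont_circ]. apply rcont_circle. lra. intros u Hu. apply cdiff_ccont, Hh. lra.
    apply rcont_minus. apply rcont_circ. apply rcont_const.
  - intros t _. apply rcont_circle. lra. intros u Hu. apply cdiff_ccont, Hk. lra. }
apply (f_equal Re) in E. rewrite Re_mult_R, Re_CI in E.
unfold PI_, mn. rewrite (RInt_ext _ (fun t => Re (RtoC (PK R z (circ R t)) * h (circ R t))%C)).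
rewrite E. field. generalize twoPI_pos; lra.
intros t _. now rewrite Re_mult_R.
Qed.

Lemma PI_plus R U V z : Cmod z < R -> ccirc U R -> ccirc V R -> PI_ R (fun w => U w + V w) z = PI_ R U z + PI_ R V z.
Proof.
intros Hz HU HV. unfold PI_. rewrite <- mn_plus by (apply ccirc_mult; auto; now apply ccirc_PK).
apply mn_ext. intros; ring.
Qed.
Lemma PI_minus R U V z : Cmod z < R -> ccirc U R -> ccirc V R -> PI_ R (fun w => U w - V w) z = PI_ R U z - PI_ R V z.
Proof.
intros Hz HU HV. unfold PI_. rewrite <- mn_minus by (apply ccirc_mult; auto; now apply ccirc_PK).
apply mn_ext. intros; ring.
Qed.
Lemma PI_ext R U V z : (forall t, U (circ R t) = V (circ R t)) -> PI_ R U z = PI_ R V z.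
Proof. intros H. apply mn_ext. intros. now rewrite H. Qed.

(** Minus the Green function of the disc with pole at [a], extended by 0 to |a| >= r so that sums
    can run over the whole list of zeros. *)
Definition green (r : R) (z a : C) : R :=
  if Rlt_dec (Cmod a) r then ln (Cmod (z - a)) - ln (Cmod (RtoC r - Cconj a / RtoC r * z)) else 0.

Lemma reflect_neq R a z : 0 < R -> Cmod a * Cmod z < R * R -> (RtoC R - Cconj a / RtoC R * z)%C <> RtoC 0.
Proof.
intros P Hz E. apply (f_equal Cmod) in E. rewrite Cmod_0 in E.
generalize (Cmod_rev_triangle (RtoC R) (Cconj a / RtoC R * z)). rewrite Cmod_mult, Cmod_div, Cmod_conj, Cmod_RtoC_pos by (try apply RtoC_neq; lra).
assert (Cmod a / R * Cmod z < R); [|lra].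
apply Rmult_lt_reg_l with R; auto. replace (R * (Cmod a / R * Cmod z)) with (Cmod a * Cmod z) by (field; lra). auto.
Qed.

Lemma circ_scal r t : circ r t = (RtoC r * circ 1 t)%C.
Proof. unfold circ. apply injective_projections; simpl; ring. Qed.

Lemma Cmod_reflect_circ R a t : 0 < R -> Cmod (RtoC R - Cconj a / RtoC R * circ R t) = Cmod (circ R t - a).
Proof.
intros HR. rewrite Cmod_circ_reflect by auto. f_equal. rewrite (circ_scal R). field. apply RtoC_neq; lra.
Qed.

Lemma poisson_ln G R1 R z : holo_on_disc G 0 R1 -> (forall w, Cmod w < R1 -> G w <> RtoC 0) -> Cmod z < R < R1 ->
  PI_ R (fun w => ln (Cmod (G w))) z = ln (Cmod (G z)).
Proof.
intros HG HN Hz. assert (P : 0 < R1) by (generalize (Cmod_ge_0 z); lra).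
destruct (holo_log G R1 P HG HN) as [h [Hh E]].
rewrite (PI_ext R _ (fun w => Re (h w))). rewrite (poisson h R1) by auto. symmetry; apply E; lra.
intros t. apply E. rewrite Cmod_circ; generalize (Cmod_ge_0 z); lra.
Qed.

Lemma poisson_ln_minus R a z : Cmod a <> R -> Cmod z < R ->
  ln (Cmod (z - a)) = PI_ R (fun w => ln (Cmod (w - a))) z + green R z a.
Proof.
intros Ha Hz. assert (P : 0 < R) by (generalize (Cmod_ge_0 z); lra). unfold green. destruct (Rlt_dec (Cmod a) R) as [H|H].
- rewrite (PI_ext R _ (fun w => ln (Cmod (RtoC R - Cconj a / RtoC R * w)))).
  2:{ intros t. now rewrite Cmod_reflect_circ. }
  rewrite (poisson_ln (fun w => RtoC R - Cconj a / RtoC R * w)%C (R + (R - Cmod a))). ring.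
  + intros w _. apply cdiff_minus. apply cdiff_const. apply cdiff_mult. apply cdiff_const. apply cdiff_id.
  + intros w Hw. apply reflect_neq; auto. generalize (Cmod_ge_0 a) (Cmod_ge_0 w). nra.
  + lra.
- rewrite (poisson_ln (fun w => w - a)%C (Cmod a)). ring.
  + intros w _. apply cdiff_minus. apply cdiff_id. apply cdiff_const.
  + intros w Hw E. apply (f_equal Cmod) in E. rewrite Cmod_0 in E. generalize (Cmod_rev_triangle a w). rewrite Cmod_minus_sym. lra.
  + lra.
Qed.

Lemma PI_lsum r (phi : C -> C -> R) l z : Cmod z < r -> (forall a, In a l -> ccirc (phi a) r) ->
  PI_ r (fun w => lsum (fun a => phi a w) l) z = lsum (fun a => PI_ r (phi a) z) l.
Proof.
intros Hz. induction l; intros H; simpl. unfold PI_. rewrite (mn_ext _ (fun _ => 0)). apply mn_const. intros; ring.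
rewrite (PI_plus r (phi a)); auto. rewrite IHl. auto. intros; apply H; now right. apply H; now left.
apply mn_lsum. intros; apply H; now right.
Qed.

Theorem poisson_jensen F R1 l h R z : zrep F R1 l h -> Cmod z < R < R1 -> generic R l -> ~ In z l ->
  ln (Cmod (F z)) = PI_ R (fun w => ln (Cmod (F w))) z + lsum (green R z) l.
Proof.
intros [HF [Hh [_ H]]] Hz G Hn. assert (P : 0 < R) by (generalize (Cmod_ge_0 z); lra).
destruct (H z ltac:(lra)) as [_ Hz2]. destruct (Hz2 Hn) as [_ [E _]]. rewrite E.
assert (HC : forall a, In a l -> ccirc (fun w => ln (Cmod (w - a))) R) by (intros a Ha; apply ccirc_ln_minus; [lra|now apply G]).
rewrite (PI_ext R _ (fun w => lsum (fun a => ln (Cmod (w - a))) l + Re (h w))).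
2:{ intros t. apply H. rewrite Cmod_circ; lra. apply circ_notin; auto; lra. }
rewrite PI_plus.
- rewrite (poisson h R1) by auto. rewrite (PI_lsum R (fun a w => ln (Cmod (w - a)))) by (auto; lra).
  rewrite (lsum_ext _ (fun a => PI_ R (fun w => ln (Cmod (w - a))) z + green R z a)).
  rewrite lsum_plus. rring. intros a Ha. apply poisson_ln_minus. now apply G. lra.
- lra.
- now apply (mn_lsum (fun a w => ln (Cmod (w - a)))).
- apply ccirc_Re. intros t. apply cdiff_ccont, Hh. rewrite Cmod_minus_0, Cmod_circ; lra.
Qed.

Lemma PK_diff R t z c : Cmod z < R -> 2 * Cmod c <= R - Cmod z ->
  Rabs (PK R (z + c) (circ R t) - PK R z (circ R t)) <= 4 * R * Cmod c / (Cmod (circ R t - z) * Cmod (circ R t - z)).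
Proof.
intros Hz Hc. assert (P : 0 < R) by (generalize (Cmod_ge_0 z); lra).
pose proof (Cmod_triangle z c) as T.
destruct (Req_dec (Cmod c) 0) as [E0|E0].
{ apply Cmod_eq_0 in E0. subst c. rewrite Cplus_0_r, Rminus_diag, Rabs_R0, Cmod_0. right. unfold Rdiv; ring. }
assert (Pc : 0 < Cmod c) by (generalize (Cmod_ge_0 c); lra).
pose proof (circ_minus_neq' R t z Hz) as N1. pose proof (circ_minus_neq' R t (z + c) ltac:(lra)) as N2.
unfold PK. replace (Re ((circ R t + (z + c)) / (circ R t - (z + c)))%C - Re ((circ R t + z) / (circ R t - z))%C)
 with (Re ((circ R t + (z + c)) / (circ R t - (z + c)) - (circ R t + z) / (circ R t - z))%C) by reflexivity.
eapply Rle_trans. apply re_le_Cmod.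
replace ((circ R t + (z + c)) / (circ R t - (z + c)) - (circ R t + z) / (circ R t - z))%C with
  (2 * circ R t * c / ((circ R t - (z + c)) * (circ R t - z)))%C by (field; auto).
rewrite Cmod_div, !Cmod_mult, Cmod_circ, Cmod_RtoC_pos by (try apply Cmult_neq_0; auto; lra).
set (u := Cmod (circ R t - z)). set (v := Cmod (circ R t - (z + c))).
assert (Hu : R - Cmod z <= u). { unfold u. generalize (Cmod_rev_triangle (circ R t) z). rewrite Cmod_circ; lra. }
assert (Hv : u - Cmod c <= v). { unfold u, v. generalize (Cmod_rev_triangle (circ R t - z) c). 
  replace (circ R t - z - c)%C with (circ R t - (z + c))%C by ring. auto. }
assert (0 < u) by lra. assert (u / 2 <= v) by lra.
replace (4 * R * Cmod c / (u * u)) with (2 * R * Cmod c * / (u / 2 * u)) by (field; lra).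
unfold Rdiv at 1. apply Rmult_le_compat_l. apply Rmult_le_pos; lra. apply Rinv_le_contravar; nra.
Qed.

(** The bound for the difference of two kernels is a multiple of the Poisson kernel itself. Hence
    the Poisson integral of |U| appears on the right, and its mean over a smaller circle is known
    exactly. *)
Lemma PI_diff R U z c : Cmod z < R -> 2 * Cmod c <= R - Cmod z -> ccirc U R ->
  Rabs (PI_ R U (z + c) - PI_ R U z) <= 4 * R * Cmod c / (R * R - Cmod z * Cmod z) * PI_ R (fun w => Rabs (U w)) z.
Proof.
intros Hz Hc HU. assert (P : 0 < R) by (generalize (Cmod_ge_0 z); lra).
assert (Hzc : Cmod (z + c) < R). { pose proof (Cmod_triangle z c). generalize (Cmod_ge_0 c). lra. }
assert (HP : ccirc (fun w => PK R z w * Rabs (U w)) R) by (apply ccirc_mult; [now apply ccirc_PK|now apply ccirc_abs]).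
unfold PI_. rewrite <- mn_minus by (apply ccirc_mult; auto; now apply ccirc_PK).
eapply Rle_trans. apply mn_abs. apply ccirc_minus; apply ccirc_mult; auto; now apply ccirc_PK.
rewrite <- mn_scal by auto. apply mn_le.
- apply ccirc_abs. apply ccirc_minus; apply ccirc_mult; auto; now apply ccirc_PK.
- now apply ccirc_scal.
- intros t. rewrite <- Rmult_minus_distr_r, Rabs_mult, <- Rmult_assoc. apply Rmult_le_compat_r. apply Rabs_pos.
  eapply Rle_trans. now apply PK_diff. destruct (PK_eq R t z Hz) as [_ E]. rewrite <- E.
  pose proof (Cmod_pos_neq _ (circ_minus_neq' R t z Hz)). pose proof (PK_pos R t z Hz). right. field. lra.
Qed.

(* The Poisson integral is the real part of a Schwarz integral, holomorphic in z: its mean over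
   an inner circle is its value at the centre, which replaces Fubini's theorem. *)
Lemma mn_PI R r U : 0 < r < R -> ccirc U R -> mn (PI_ R U) r = mn U R /\ ccirc (PI_ R U) r.
Proof.
intros Hr HU.
set (phi := fun t => (RtoC (U (circ R t)) * circ R t)%C).
assert (Hphi : forall t, rcont phi t) by (intros t; apply rcont_mult; [apply rcont_RtoC, HU|apply rcont_circ]).
assert (HUr : rcont_on (fun t => RtoC (U (circ R t))) 0 (2 * PI)) by (intros t _; apply rcont_RtoC, HU).
set (S := fun z => (/ RtoC (2 * PI) * (RtoC 2 * CI (fun t => phi t * / (circ R t - (z - 0)))%C 0 (2 * PI) - CI (fun t => RtoC (U (circ R t))) 0 (2 * PI)))%C).
assert (HS : holo_on_disc S 0 R).
{ intros z Hz. unfold S. apply cdiff_mult. apply cdiff_const. apply cdiff_minus. apply cdiff_mult. apply cdiff_const.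
  apply cdiff_cder. eexists. apply (cder_cauchy1 phi 0 R ltac:(lra) Hphi z Hz). apply cdiff_const. }
assert (ES : forall z, Cmod z < R -> PI_ R U z = Re (S z)).
{ intros z Hz. unfold PI_, mn, S. rewrite <- RtoC_inv by (generalize twoPI_pos; lra). rewrite Re_mult_R. 
  rewrite <- CI_scal. rewrite <- CI_minus; auto.
  rewrite Re_CI. unfold Rdiv. rewrite (Rmult_comm (RInt _ _ _)). f_equal. apply RInt_ext. intros t _. unfold phi, PK.
  pose proof (circ_minus_neq' R t z Hz) as N.
  rewrite Rmult_comm, <- Re_mult_R. f_equal. replace (z - 0)%C with z by ring. field. auto.
  - apply rcont_on_scal. intros t _. apply rcont_mult; auto. apply rcont_kernel; [lra|now rewrite Cmod_minus_0].
  - intros t _. apply rcont_mult; auto. apply rcont_kernel; [lra|now rewrite Cmod_minus_0]. }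
split.
- rewrite (mn_ext _ (fun z => Re (S z))). rewrite (mn_Re S R) by auto. rewrite <- ES by (rewrite Cmod_0; lra).
  unfold PI_. apply mn_ext. intros t. unfold PK. replace ((circ R t + 0) / (circ R t - 0))%C with (RtoC 1). simpl. ring.
  pose proof (circ_neq0 R t ltac:(lra)). field. auto.
  intros t. apply ES. rewrite Cmod_circ; lra.
- apply (ccirc_ext (fun z => Re (S z))). intros t. symmetry. apply ES. rewrite Cmod_circ; lra.
  apply ccirc_Re. intros t. apply cdiff_ccont, HS. rewrite Cmod_minus_0, Cmod_circ; lra.
Qed.

Lemma ln_le_sub1 x : 0 < x -> ln x <= x - 1.
Proof. intros. generalize (exp_ineq1_le (ln x)). rewrite exp_ln by auto. lra. Qed.

Lemma ln_1p_le x : 0 <= x -> ln (1 + x) <= x.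
Proof. intros. generalize (ln_le_sub1 (1 + x)). lra. Qed.

Lemma ln_nonneg x : 1 <= x -> 0 <= ln x.
Proof. intros. rewrite <- ln_1. apply ln_le_mono; lra. Qed.

Lemma ln_div x y : 0 < x -> 0 < y -> ln (x / y) = ln x - ln y.
Proof. intros. unfold Rdiv. rewrite ln_mult, ln_Rinv by (try apply Rinv_0_lt_compat; auto). ring. Qed.

(** * Averages of ln (1 + d / |z - a|) *)

(** Controls the change of ln |z - a| under a translation of length [d]. Its mean over |z| = r will
    turn out to be of order (d / r) ln (r / d), uniformly in [a]; this is what makes translations
    cheap. *)
Definition nearness (d : R) (a z : C) : R := ln (1 + d / Cmod (z - a)).

Lemma circ_minus_pos r a t : 0 <= r -> Cmod a <> r -> 0 < Cmod (circ r t - a).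
Proof. intros Hr H. apply Cmod_minus_pos. intros E. apply H. rewrite <- E. now apply Cmod_circ. Qed.

Lemma nearness_nonneg d a z : 0 <= d -> z <> a -> 0 <= nearness d a z.
Proof.
intros Hd N. apply ln_nonneg. pose proof (Cmod_minus_pos _ _ N). assert (0 <= d / Cmod (z - a)); [|lra].
apply Rmult_le_pos; auto. left. now apply Rinv_0_lt_compat.
Qed.

Lemma ccirc_nearness d a r : 0 <= r -> Cmod a <> r -> 0 <= d -> ccirc (nearness d a) r.
Proof.
intros Hr Ha Hd. unfold nearness.
apply (ccirc_comp ln (fun z => 1 + d / Cmod (z - a))).
- apply (ccirc_plus (fun _ => 1)). apply ccirc_const. apply (ccirc_mult (fun _ => d) (fun z => / Cmod (z - a))). apply ccirc_const.
  apply (ccirc_comp Rinv (fun z => Cmod (z - a))). apply ccirc_Cmod. intros; apply ccont_minus_const.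
  intros t. apply continuous_Rinv. pose proof (circ_minus_pos r a t Hr Ha). lra.
- intros t. apply continuous_ln. pose proof (circ_minus_pos r a t Hr Ha).
  assert (0 <= d / Cmod (circ r t - a)); [|lra]. apply Rmult_le_pos; auto. left. now apply Rinv_0_lt_compat.
Qed.

Lemma mn_ln_sqr_le d a r : 0 < r -> Cmod a <> r -> 0 < d ->
  mn (fun z => ln (Cmod (z - a) * Cmod (z - a) + d * d)) r <= 2 * ln (Rmax r (Cmod a) + d).
Proof.
intros Hr Ha Hd. set (m := Rmax r (Cmod a)). set (M := m + d).
assert (Hm1 : r <= m) by apply Rmax_l. assert (Hm2 : Cmod a <= m) by apply Rmax_r.
assert (Pm : 0 < M) by (unfold M; lra).
assert (Ca := Cmod_ge_0 a).
assert (Hra : r * Cmod a <= m * m) by (apply Rmult_le_compat; lra).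
(* With this centre the terms linear in cos t and sin t are the same in |r e^(it) - a|^2 and |M
   e^(it) - b|^2, so the squares are compared by their constant terms; and ln |z - b| has mean ln M
   over |z| = M. *)
set (b := (RtoC (r / M) * a)%C).
assert (Cb : Cmod b = r * Cmod a / M). { unfold b. rewrite Cmod_mult, Cmod_RtoC_pos. field. lra. left. apply Rdiv_lt_0_compat; auto. }
assert (Hb : Cmod b < M).
{ rewrite Cb. apply Rmult_lt_reg_r with M; auto. unfold Rdiv. rewrite Rmult_assoc, Rinv_l by lra. unfold M. nra. }
replace (2 * ln M) with (mn (fun z => 2 * ln (Cmod (z - b))) M).
2:{ rewrite mn_scal by (apply ccirc_ln_minus; lra). rewrite mn_ln_minus by lra. now rewrite Rmax_left by lra. }
unfold mn. apply Rmult_le_compat_r. left; apply Rinv_0_lt_compat, twoPI_pos.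
apply RInt_le. generalize twoPI_pos; lra.
- apply (ccirc_ex (fun z => ln (Cmod (z - a) * Cmod (z - a) + d * d))). apply (ccirc_comp ln (fun z => Cmod (z - a) * Cmod (z - a) + d * d)).
  apply (ccirc_plus (fun z => Cmod (z - a) * Cmod (z - a))). apply ccirc_mult; apply ccirc_Cmod; intros; apply ccont_minus_const. apply ccirc_const.
  intros t. apply continuous_ln. pose proof (circ_minus_pos r a t ltac:(lra) Ha). nra.
- apply (ccirc_ex (fun z => 2 * ln (Cmod (z - b)))). apply (ccirc_scal 2 (fun z => ln (Cmod (z - b)))). apply ccirc_ln_minus; lra.
- intros t _.
  pose proof (circ_minus_pos r a t ltac:(lra) Ha) as P1. pose proof (circ_minus_pos M b t ltac:(lra) ltac:(lra)) as P2.
  replace (2 * ln (Cmod (circ M t - b))) with (ln (Cmod (circ M t - b) * Cmod (circ M t - b))) by (rewrite ln_mult by auto; ring).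
  apply ln_le_mono. nra.
  set (q := cos t * Re a + sin t * Im a).
  assert (sc : sin t * sin t + cos t * cos t = 1) by apply sin2_cos2.
  assert (E1 : Cmod (circ r t - a) * Cmod (circ r t - a) = r * r + Cmod a * Cmod a - 2 * r * q).
  { rewrite !Cmod_sqr. unfold q, circ, Re, Im. simpl. 
    replace (r * r) with (r * r * (sin t * sin t + cos t * cos t)) by (rewrite sc; ring). ring. }
  assert (E2 : Cmod (circ M t - b) * Cmod (circ M t - b) = M * M + (r * Cmod a / M) * (r * Cmod a / M) - 2 * r * q).
  { replace ((r * Cmod a / M) * (r * Cmod a / M)) with ((r / M) * (r / M) * (Cmod a * Cmod a)) by (field; lra).
    rewrite !Cmod_sqr. unfold q, b, circ, Re, Im. simpl. 
    replace (M * M) with (M * M * (sin t * sin t + cos t * cos t)) by (rewrite sc; ring). field. lra. }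
  rewrite E1, E2.
  assert (K : r * r + Cmod a * Cmod a + d * d <= M * M + (r * Cmod a / M) * (r * Cmod a / M)); [|lra].
  assert (Emin : exists n, 0 <= n <= m /\ r * r + Cmod a * Cmod a = m * m + n * n /\ r * Cmod a = m * n).
  { unfold m, Rmax. destruct (Rle_dec r (Cmod a)); [exists r|exists (Cmod a)]; repeat split; try lra. }
  destruct Emin as [n [Hn [E3 E4]]]. rewrite E3, E4.
  assert (Pm0 : 0 < m) by lra.
  assert (n * n * (1 - (m / M) * (m / M)) <= 2 * m * d).
  { assert (F : 1 - (m / M) * (m / M) = d * (2 * m + d) / (M * M)) by (unfold M; field; unfold M in Pm; lra).
    assert (0 <= d * (2 * m + d) / (M * M)). { apply Rmult_le_pos. nra. left. apply Rinv_0_lt_compat. nra. }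
    rewrite F. apply Rle_trans with (m * m * (d * (2 * m + d) / (M * M))).
    apply Rmult_le_compat_r; nra.
    apply Rmult_le_reg_r with (M * M). nra. unfold Rdiv. 
    replace (m * m * (d * (2 * m + d) * / (M * M)) * (M * M)) with (m * m * (d * (2 * m + d))) by (field; lra).
    unfold M. assert (0 < m * d) by nra. nra. }
  replace (m * n / M * (m * n / M)) with (n * n - n * n * (1 - (m / M) * (m / M))) by (field; lra).
  unfold M at 1 2. nra.
Qed.

(** From (1 + x)^2 <= (1 + x^2) (1 + 2 x) with x = d / |z - a|: half the logarithm of the first
    factor has mean at most d / r by the preceding comparison, and the second factor is the nearness
    at the doubled distance. *)
Lemma nearness_step d a r : 0 < r -> Cmod a <> r -> 0 < d ->
  mn (nearness d a) r <= d / r + / 2 * mn (nearness (2 * d) a) r.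
Proof.
intros Hr Ha Hd.
assert (C0 : ccirc (fun z => ln (Cmod (z - a))) r) by (apply ccirc_ln_minus; lra).
assert (C1 : ccirc (fun z => ln (Cmod (z - a) * Cmod (z - a) + d * d)) r).
{ apply (ccirc_comp ln (fun z => Cmod (z - a) * Cmod (z - a) + d * d)).
  apply (ccirc_plus (fun z => Cmod (z - a) * Cmod (z - a))). apply ccirc_mult; apply ccirc_Cmod; intros; apply ccont_minus_const. apply ccirc_const.
  intros t. apply continuous_ln. pose proof (circ_minus_pos r a t ltac:(lra) Ha). nra. }
assert (C2 : ccirc (nearness (2 * d) a) r) by (apply ccirc_nearness; lra).
apply Rle_trans with (mn (fun z => / 2 * (ln (Cmod (z - a) * Cmod (z - a) + d * d) - 2 * ln (Cmod (z - a))) + / 2 * nearness (2 * d) a z) r).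
- apply mn_le. apply ccirc_nearness; lra. apply ccirc_plus; apply ccirc_scal; auto. apply ccirc_minus; auto. now apply ccirc_scal.
  intros t. unfold nearness. pose proof (circ_minus_pos r a t ltac:(lra) Ha) as P. set (u := Cmod (circ r t - a)) in *.
  replace (ln (u * u + d * d) - 2 * ln u) with (ln (1 + d / u * (d / u))).
  2:{ replace (1 + d / u * (d / u)) with ((u * u + d * d) / (u * u)) by (field; lra). rewrite ln_div, ln_mult by nra. ring. }
  set (x := d / u). assert (0 < x) by (apply Rdiv_lt_0_compat; auto). replace (2 * d / u) with (2 * x) by (unfold x; field; lra).
  assert (2 * ln (1 + x) <= ln (1 + x * x) + ln (1 + 2 * x)); [|lra].
  replace (2 * ln (1 + x)) with (ln ((1 + x) * (1 + x))) by (rewrite ln_mult by lra; ring).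
  rewrite <- ln_mult by nra. apply ln_le_mono; nra.
- rewrite mn_plus by (try apply ccirc_scal; auto; apply ccirc_minus; auto; now apply ccirc_scal).
  rewrite !mn_scal by (auto; apply ccirc_minus; auto; now apply ccirc_scal).
  apply Rplus_le_compat_r. rewrite mn_minus, mn_scal by (auto; now apply ccirc_scal).
  rewrite mn_ln_minus by auto. pose proof (mn_ln_sqr_le d a r Hr Ha Hd) as B.
  set (m := Rmax r (Cmod a)) in *. assert (r <= m) by apply Rmax_l.
  assert (E : ln (m + d) - ln m <= d / r).
  { rewrite <- ln_div by lra. replace ((m + d) / m) with (1 + d / m) by (field; lra).
    eapply Rle_trans. apply ln_1p_le. apply Rlt_le, Rdiv_lt_0_compat; lra. apply Rmult_le_compat_l. lra. apply Rinv_le_contravar; lra. }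
  lra.
Qed.

(** With m = max (r, |a|), the quantity |z - a| + d is at most 3 m while ln |z - a| has mean ln m;
    what remains is ln 3. *)
Lemma nearness_base d a r : 0 < r -> Cmod a <> r -> 0 < d <= r -> mn (nearness d a) r <= 2.
Proof.
intros Hr Ha Hd. set (m := Rmax r (Cmod a)). assert (r <= m) by apply Rmax_l. assert (Cmod a <= m) by apply Rmax_r.
assert (C0 : ccirc (fun z => ln (Cmod (z - a))) r) by (apply ccirc_ln_minus; lra).
apply Rle_trans with (mn (fun z => ln (3 * m) - ln (Cmod (z - a))) r).
- apply mn_le. apply ccirc_nearness; lra. apply ccirc_minus; auto. apply ccirc_const.
  intros t. unfold nearness. pose proof (circ_minus_pos r a t ltac:(lra) Ha) as P.
  rewrite <- ln_div by lra. apply ln_le_mono. assert (0 < d / Cmod (circ r t - a)) by (apply Rdiv_lt_0_compat; lra). lra.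
  replace (1 + d / Cmod (circ r t - a)) with ((Cmod (circ r t - a) + d) / Cmod (circ r t - a)) by (field; lra).
  apply Rmult_le_compat_r. left; now apply Rinv_0_lt_compat.
  assert (Cmod (circ r t - a) <= r + Cmod a). { eapply Rle_trans. apply Cmod_triangle. rewrite Cmod_opp, Cmod_circ; lra. } lra.
- rewrite mn_minus by (auto; apply ccirc_const). rewrite mn_const, mn_ln_minus by auto. fold m. rewrite ln_mult by lra.
  generalize (ln_le_sub1 3). lra.
Qed.

(** The distance is doubled [k] times while the weight is halved. Each step costs d / r, and the
    remainder is the crude bound 2 divided by 2^k. *)
Lemma nearness_bound k : forall d a r, 0 < r -> Cmod a <> r -> 0 < d -> 2 ^ k * d <= r ->
  mn (nearness d a) r <= INR k * d / r + 2 / 2 ^ k.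
Proof.
induction k; intros d a r Hr Ha Hd Hk.
- simpl in *. eapply Rle_trans. apply nearness_base; lra. right. field. lra.
- eapply Rle_trans. now apply nearness_step. simpl in Hk.
  eapply Rle_trans. apply Rplus_le_compat_l. apply Rmult_le_compat_l. lra. apply IHk; auto; lra.
  rewrite S_INR. simpl. right. field. split; [apply pow_nonzero|]; lra.
Qed.

(** * Differences of logarithms of meromorphic functions *)

Lemma ln_shift_le z c a : z <> a -> (z + c)%C <> a ->
  Rabs (ln (Cmod (z + c - a)) - ln (Cmod (z - a))) <= nearness (Cmod c) a z + nearness (Cmod c) (a - c) z.
Proof.
intros N1 N2. assert (N3 : z <> (a - c)%C) by (intros ->; apply N2; ring).
pose proof (nearness_nonneg (Cmod c) a z (Cmod_ge_0 _) N1). pose proof (nearness_nonneg (Cmod c) (a - c) z (Cmod_ge_0 _) N3).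
pose proof (Cmod_minus_pos _ _ N1) as P1. pose proof (Cmod_minus_pos _ _ N2) as P2.
assert (A : ln (Cmod (z + c - a)) - ln (Cmod (z - a)) <= nearness (Cmod c) a z).
{ unfold nearness. rewrite <- ln_div by auto. apply ln_le_mono. now apply Rdiv_lt_0_compat.
  replace (1 + Cmod c / Cmod (z - a)) with ((Cmod (z - a) + Cmod c) / Cmod (z - a)) by (field; lra).
  apply Rmult_le_compat_r. left; now apply Rinv_0_lt_compat. replace (z + c - a)%C with ((z - a) + c)%C by ring. apply Cmod_triangle. }
assert (B : ln (Cmod (z - a)) - ln (Cmod (z + c - a)) <= nearness (Cmod c) (a - c) z).
{ unfold nearness. replace (z - (a - c))%C with (z + c - a)%C by ring. rewrite <- ln_div by auto. apply ln_le_mono. now apply Rdiv_lt_0_compat.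
  replace (1 + Cmod c / Cmod (z + c - a)) with ((Cmod (z + c - a) + Cmod c) / Cmod (z + c - a)) by (field; lra).
  apply Rmult_le_compat_r. left; now apply Rinv_0_lt_compat. replace (z - a)%C with ((z + c - a) + (- c))%C by ring. 
  eapply Rle_trans. apply Cmod_triangle. rewrite Cmod_opp. lra. }
apply Rabs_le. lra.
Qed.

Definition refl_pt (R : R) (a : C) : C := (RtoC (R * R) / Cconj a)%C.

Lemma Cmod_refl_pt R a : 0 < R -> a <> RtoC 0 -> Cmod (refl_pt R a) = R * R / Cmod a.
Proof.
intros HR Ha. unfold refl_pt. rewrite Cmod_div, Cmod_conj, Cmod_RtoC_pos; auto. nra.
intros E. apply Ha. apply Cmod_eq_0. rewrite <- Cmod_conj, E. apply Cmod_0.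
Qed.

(** The reflected factor of the Green function is a constant times the distance to the reflected
    point, and the constant cancels when two values of [z] are compared. *)
Lemma ln_reflect R a z : 0 < R -> a <> RtoC 0 -> Cmod a * Cmod z < R * R ->
  ln (Cmod (RtoC R - Cconj a / RtoC R * z)) = ln (Cmod a / R) + ln (Cmod (z - refl_pt R a)) /\ z <> refl_pt R a.
Proof.
intros HR Ha Hz. pose proof (Cmod_pos_neq _ Ha) as Pa.
assert (Na : Cconj a <> RtoC 0). { intros E. apply Ha. apply Cmod_eq_0. rewrite <- Cmod_conj, E. apply Cmod_0. }
assert (N : z <> refl_pt R a).
{ intros E. apply (f_equal Cmod) in E. rewrite Cmod_refl_pt in E by auto. rewrite E in Hz.
  replace (Cmod a * (R * R / Cmod a)) with (R * R) in Hz by (field; lra). lra. }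
split; auto. pose proof (Cmod_minus_pos _ _ N). pose proof (RtoC_neq R ltac:(lra)).
replace (RtoC R - Cconj a / RtoC R * z)%C with (- (Cconj a / RtoC R * (z - refl_pt R a)))%C by (unfold refl_pt; rewrite RtoC_mult; field; auto).
rewrite Cmod_opp, Cmod_mult, Cmod_div, Cmod_conj, Cmod_RtoC_pos by (auto; lra).
apply ln_mult; auto. apply Rdiv_lt_0_compat; auto.
Qed.

(** For [a = 0] the reflected factor is the constant [r], which contributes nothing to a
    difference. *)
Definition greenbound (c : C) (r : R) (a z : C) : R :=
  if Rlt_dec (Cmod a) r then
    nearness (Cmod c) a z + nearness (Cmod c) (a - c) z + 
    (if Ceq_dec a (RtoC 0) then 0 else nearness (Cmod c) (refl_pt r a) z + nearness (Cmod c) (refl_pt r a - c) z)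
  else 0.

Lemma green_diff R a z c : Cmod z + Cmod c < R -> z <> a -> (z + c)%C <> a ->
  Rabs (green R (z + c) a - green R z a) <= greenbound c R a z.
Proof.
intros Hz N1 N2. assert (HR : 0 < R) by (generalize (Cmod_ge_0 z) (Cmod_ge_0 c); lra).
unfold green, greenbound. destruct (Rlt_dec (Cmod a) R) as [Ha|Ha].
2:{ rewrite Rminus_diag, Rabs_R0. lra. }
match goal with |- Rabs (?u - ?v - (?x - ?y)) <= _ => replace (u - v - (x - y)) with ((u - x) - (v - y)) by ring end.
eapply Rle_trans. apply Rabs_triang. apply Rplus_le_compat. now apply ln_shift_le.
rewrite Rabs_Ropp. 
pose proof (Cmod_triangle z c).
destruct (Ceq_dec a 0) as [->|Na].
- rewrite !Cconj_RtoC. replace (RtoC R - 0 / R * (z + c))%C with (RtoC R - 0 / R * z)%C by (field; apply RtoC_neq; lra).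
  rewrite Rminus_diag, Rabs_R0. lra.
- destruct (ln_reflect R a z HR Na) as [E1 M1]. { generalize (Cmod_ge_0 a) (Cmod_ge_0 z) (Cmod_ge_0 c); nra. }
  destruct (ln_reflect R a (z + c) HR Na) as [E2 M2]. { generalize (Cmod_ge_0 a) (Cmod_ge_0 (z + c)); nra. }
  rewrite E1, E2. 
  match goal with |- Rabs (?u + ?v - (?u + ?y)) <= _ => replace (u + v - (u + y)) with (v - y) by ring end.
  now apply ln_shift_le.
Qed.

Lemma greenbound_mean c r R a M : 0 < r -> r + Cmod c < R -> Cmod a <> r -> Cmod (a - c) <> r ->
  (forall x, Cmod x <> r -> mn (nearness (Cmod c) x) r <= M) ->
  ccirc (greenbound c R a) r /\ mn (greenbound c R a) r <= 4 * M * (if Rlt_dec (Cmod a) R then 1 else 0).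
Proof.
intros Hr HR H1 H2 HM. assert (Hc := Cmod_ge_0 c). unfold greenbound. 
assert (Cn : forall x, Cmod x <> r -> ccirc (nearness (Cmod c) x) r) by (intros; apply ccirc_nearness; lra).
assert (M0 : 0 <= M).
{ eapply Rle_trans; [|apply (HM a H1)]. rewrite <- (mn_const 0 r). apply mn_le. apply ccirc_const. auto.
  intros t. apply nearness_nonneg; auto. intros E. apply H1. rewrite <- E. apply Cmod_circ; lra. }
destruct (Rlt_dec (Cmod a) R) as [Ha|Ha].
2:{ split. apply ccirc_const. rewrite mn_const. lra. }
destruct (Ceq_dec a 0) as [Ea|Ea].
- split. apply ccirc_plus. apply ccirc_plus; auto. apply ccirc_const.
  rewrite mn_plus by (try apply ccirc_plus; auto; apply ccirc_const). rewrite mn_plus, mn_const by auto.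
  generalize (HM _ H1) (HM _ H2). lra.
- assert (Ra : R < Cmod (refl_pt R a)).
  { rewrite Cmod_refl_pt by (auto; lra). pose proof (Cmod_pos_neq _ Ea). apply Rmult_lt_reg_r with (Cmod a); auto.
    unfold Rdiv. rewrite Rmult_assoc, Rinv_l by lra. nra. }
  assert (H3 : Cmod (refl_pt R a) <> r) by lra.
  assert (H4 : Cmod (refl_pt R a - c) <> r). { generalize (Cmod_rev_triangle (refl_pt R a) c). lra. }
  split. apply ccirc_plus; apply ccirc_plus; auto.
  rewrite mn_plus by (apply ccirc_plus; auto). rewrite !mn_plus by auto.
  generalize (HM _ H1) (HM _ H2) (HM _ H3) (HM _ H4). lra.
Qed.

Definition shift_generic (r : R) (c : C) (l : list C) := forall a, In a l -> Cmod a <> r /\ Cmod (a - c) <> r.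

(** Poisson-Jensen at [z] and at [z + c]. The Poisson integrals differ by at most a multiple of the
    Poisson integral of |V|, whose mean over |z| = r is the mean of |V| over |z| = R; each zero of P
    or Q in |a| < R contributes at most four nearness terms. *)
Theorem log_difference P Q lP hP lQ hQ c R1 R r M :
  zrep P R1 lP hP -> zrep Q R1 lQ hQ -> 0 < r -> R < R1 -> 2 * Cmod c <= R - r -> r < R -> 
  generic R lP -> generic R lQ -> shift_generic r c lP -> shift_generic r c lQ ->
  (forall x, Cmod x <> r -> mn (nearness (Cmod c) x) r <= M) ->
  let V := fun z => ln (Cmod (P z)) - ln (Cmod (Q z)) in
  ccirc (fun z => V (z + c)%C) r /\ ccirc V r /\
  mn (fun z => Rabs (V (z + c)%C - V z)) r <= 
    4 * Cmod c / (R - r) * mn (fun z => Rabs (V z)) R + 4 * M * (ncount R lP + ncount R lQ).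
Proof.
intros HP HQ Hr HR1 Hc HrR GP GQ SP SQ HM V.
assert (Hc0 := Cmod_ge_0 c).
assert (GPr : generic r lP) by (intros a Ha; now apply SP). assert (GQr : generic r lQ) by (intros a Ha; now apply SQ).
assert (nin : forall l t, shift_generic r c l -> ~ In (circ r t) l /\ ~ In (circ r t + c)%C l).
{ intros l t S. split. apply circ_notin. lra. intros a Ha; now apply S.
  intros I. apply (proj2 (S _ I)). replace (circ r t + c - c)%C with (circ r t) by ring. apply Cmod_circ; lra. }
assert (Hcirc : forall t, Cmod (circ r t + c) < R).
{ intros t. eapply Rle_lt_trans. apply Cmod_triangle. rewrite Cmod_circ; lra. }
assert (CV : ccirc V r) by (apply ccirc_minus; [eapply zrep_ccirc with (F := P)|eapply zrep_ccirc with (F := Q)]; eauto; lra).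
assert (CVR : ccirc V R) by (apply ccirc_minus; [eapply zrep_ccirc with (F := P)|eapply zrep_ccirc with (F := Q)]; eauto; lra).
assert (CVc : ccirc (fun z => V (z + c)%C) r).
{ assert (X : forall F l h, zrep F R1 l h -> shift_generic r c l -> ccirc (fun z => ln (Cmod (F (z + c)%C))) r).
  { intros F l h [HF [_ [_ H]]] S. apply (ccirc_lnCmod (fun z => F (z + c)%C)). intros t. specialize (Hcirc t). split.
    apply (ccont_comp F (fun z => z + c)%C). apply ccont_plus. apply ccont_id. apply ccont_const.
    apply cdiff_ccont, HF. cbv beta; rewrite Cmod_minus_0; eapply Rlt_trans; [apply Hcirc|apply HR1]. apply (H (circ r t + c)%C ltac:(lra)). now apply nin. }
  apply ccirc_minus; eapply X; eauto. }
split; [|split]; auto.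
destruct (mn_PI R r (fun z => Rabs (V z)) ltac:(lra) ltac:(now apply ccirc_abs)) as [EPI CPI].
set (gb := fun l z => lsum (fun a => greenbound c R a z) l).
assert (Cgb : forall l, shift_generic r c l -> ccirc (gb l) r /\ mn (gb l) r <= 4 * M * ncount R l).
{ intros l S. destruct (mn_lsum (fun a z => greenbound c R a z) l r) as [H1 H2].
  { intros a Ha. apply (greenbound_mean c r R a M); auto; try lra; now apply S. }
  split; auto. unfold gb. rewrite H2. unfold ncount. rewrite <- lsum_scal. apply lsum_le. intros a Ha.
  apply (greenbound_mean c r R a M); auto; try lra; now apply S. }
destruct (Cgb lP SP) as [CP MP]. destruct (Cgb lQ SQ) as [CQ MQ].
set (K := 4 * Cmod c / (R - r)).
assert (K0 : 0 <= K). { apply Rmult_le_pos. lra. left; apply Rinv_0_lt_compat; lra. }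
apply Rle_trans with (mn (fun z => K * PI_ R (fun z => Rabs (V z)) z + (gb lP z + gb lQ z)) r).
2:{ rewrite mn_plus, mn_scal, mn_plus by (auto; try apply ccirc_plus; auto; now apply ccirc_scal). rewrite EPI. lra. }
apply mn_le.
- apply ccirc_abs. now apply ccirc_minus.
- apply ccirc_plus. now apply ccirc_scal. now apply ccirc_plus.
- intros t. specialize (Hcirc t). set (z := circ r t) in *.
  assert (Hz : Cmod z = r) by (apply Cmod_circ; lra).
  destruct (nin lP t SP) as [NP1 NP2]. destruct (nin lQ t SQ) as [NQ1 NQ2]. fold z in NP1, NP2, NQ1, NQ2.
  assert (CPR : ccirc (fun w => ln (Cmod (P w))) R) by (eapply zrep_ccirc; eauto; lra).
  assert (CQR : ccirc (fun w => ln (Cmod (Q w))) R) by (eapply zrep_ccirc; eauto; lra).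
  assert (EV : forall u, Cmod u < R -> ~ In u lP -> ~ In u lQ -> 
     V u = PI_ R V u + (lsum (green R u) lP - lsum (green R u) lQ)).
  { intros u Hu I1 I2. unfold V at 1. rewrite (poisson_jensen P R1 lP hP R u HP), (poisson_jensen Q R1 lQ hQ R u HQ) by (auto; lra).
    unfold V. rewrite PI_minus by auto. ring. }
  rewrite (EV z), (EV (z + c)%C) by (auto; lra).
  replace (PI_ R V (z + c) + (lsum (green R (z + c)) lP - lsum (green R (z + c)) lQ) - (PI_ R V z + (lsum (green R z) lP - lsum (green R z) lQ)))
   with ((PI_ R V (z + c) - PI_ R V z) + (lsum (fun a => green R (z + c) a - green R z a) lP + - lsum (fun a => green R (z + c) a - green R z a) lQ))
   by (rewrite !lsum_minus; ring).
  eapply Rle_trans. apply Rabs_triang. apply Rplus_le_compat.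
  + eapply Rle_trans. apply PI_diff; auto; lra. apply Rmult_le_compat_r.
    { unfold PI_. rewrite <- (mn_const 0 R). apply mn_le. apply ccirc_const. apply ccirc_mult. apply ccirc_PK; lra. now apply ccirc_abs.
      intros s. apply Rmult_le_pos. left. apply PK_pos; lra. apply Rabs_pos. }
    rewrite Hz. unfold K. 
    replace (4 * R * Cmod c / (R * R - r * r)) with (4 * Cmod c / (R - r) * (R / (R + r))) by (field; repeat split; nra).
    rewrite <- (Rmult_1_r (4 * Cmod c / (R - r))) at 2. apply Rmult_le_compat_l; auto.
    apply Rmult_le_reg_r with (R + r). lra. unfold Rdiv. rewrite Rmult_assoc, Rinv_l; lra.
  + eapply Rle_trans. apply Rabs_triang. rewrite Rabs_Ropp. apply Rplus_le_compat; (eapply Rle_trans; [apply lsum_abs|]); apply lsum_le; intros a Ha;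
    (apply green_diff; [lra| |]; intros E; first [apply NP1; rewrite E; exact Ha|apply NP2; rewrite E; exact Ha|apply NQ1; rewrite E; exact Ha|apply NQ2; rewrite E; exact Ha]).
Qed.

(** * Logarithmic derivatives on circles avoiding the zeros *)

(** A displacement [w] in the direction conj l makes [l * w] real and positive, so increments of the
    real part alone control |l|. *)
Lemma cder_bound_Re h z l B d : cder h z l -> 0 < d -> 0 <= B ->
  (forall w, Cmod w < d -> Rabs (Re (h (z + w)%C) - Re (h z)) <= B * Cmod w) -> Cmod l <= B.
Proof.
intros Hl Hd HB H. destruct (Req_dec (Cmod l) 0) as [->|N]; auto.
assert (Pl : 0 < Cmod l) by (generalize (Cmod_ge_0 l); lra).
apply le_epsilon. intros eps He. destruct (Hl eps He) as [d' [Hd' K]].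
set (s := Rmin d d' / 2). assert (0 < Rmin d d') by now apply Rmin_pos. assert (Hs : 0 < s) by (unfold s; lra).
set (w := (RtoC (s / Cmod l) * Cconj l)%C).
assert (Ew : Cmod w = s). { unfold w. rewrite Cmod_mult, Cmod_conj, Cmod_RtoC_pos. field; auto. left; apply Rdiv_lt_0_compat; auto. }
assert (Es1 : s < d) by (unfold s; generalize (Rmin_l d d'); lra). assert (Es2 : s < d') by (unfold s; generalize (Rmin_r d d'); lra).
specialize (H w ltac:(lra)). specialize (K (z + w)%C). replace (z + w - z)%C with w in K by ring. specialize (K ltac:(lra)).
assert (Elw : (l * w)%C = RtoC (s * Cmod l)).
{ unfold w. replace (l * (RtoC (s / Cmod l) * Cconj l))%C with (RtoC (s / Cmod l) * (l * Cconj l))%C by ring.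
  rewrite <- RtoC_sqr_conj, <- RtoC_mult. f_equal. field. auto. }
rewrite Elw in K. rewrite Ew in *.
pose proof (Rle_trans _ _ _ (re_le_Cmod _) K) as K2.
replace (Re (h (z + w)%C - h z - RtoC (s * Cmod l))%C) with (Re (h (z + w)%C) - Re (h z) - s * Cmod l) in K2 by (unfold Re; simpl; ring).
apply Rabs_le_between in H. apply Rabs_le_between in K2.
apply Rmult_le_reg_l with s; auto. lra.
Qed.

Lemma PK_le R t z : Cmod z < R -> PK R z (circ R t) <= (R + Cmod z) / (R - Cmod z).
Proof.
intros Hz. pose proof (Cmod_pos_neq _ (circ_minus_neq' R t z Hz)) as P. destruct (PK_eq R t z Hz) as [_ E].
assert (HR : 0 < R) by (generalize (Cmod_ge_0 z); lra).
assert (Hu : R - Cmod z <= Cmod (circ R t - z)). { generalize (Cmod_rev_triangle (circ R t) z). rewrite Cmod_circ; lra. }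
pose proof (PK_pos R t z Hz).
apply Rmult_le_reg_r with (R - Cmod z). lra. unfold Rdiv. rewrite Rmult_assoc, Rinv_l, Rmult_1_r by lra.
apply Rmult_le_reg_r with (R - Cmod z). lra.
apply Rle_trans with (PK R z (circ R t) * (Cmod (circ R t - z) * Cmod (circ R t - z))).
rewrite Rmult_assoc. apply Rmult_le_compat_l. lra. apply Rmult_le_compat; lra. rewrite E. right; ring.
Qed.

Theorem derivative_bound h R1 R z : holo_on_disc h 0 R1 -> Cmod z < R < R1 ->
  Cmod (C_derive h z) <= 4 * R / ((R - Cmod z) * (R - Cmod z)) * mn (fun w => Rabs (Re (h w))) R.
Proof.
intros Hh Hz. assert (HR : 0 < R) by (generalize (Cmod_ge_0 z); lra).
assert (CU : ccirc (fun w => Re (h w)) R). { apply ccirc_Re. intros t. apply cdiff_ccont, Hh. rewrite Cmod_minus_0, Cmod_circ; lra. }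
set (A := mn (fun w => Rabs (Re (h w))) R).
assert (A0 : 0 <= A). { unfold A. rewrite <- (mn_const 0 R). apply mn_le. apply ccirc_const. now apply ccirc_abs. intros; apply Rabs_pos. }
assert (P1 : PI_ R (fun w => Rabs (Re (h w))) z <= (R + Cmod z) / (R - Cmod z) * A).
{ unfold A. rewrite <- mn_scal by now apply ccirc_abs. apply mn_le. apply ccirc_mult. apply ccirc_PK; lra. now apply ccirc_abs.
  apply ccirc_scal. now apply ccirc_abs. intros t. apply Rmult_le_compat_r. apply Rabs_pos. apply PK_le; lra. }
assert (Pd : 0 < (R - Cmod z) * (R - Cmod z)) by nra.
apply (cder_bound_Re h z _ _ ((R - Cmod z) / 2)).
- apply (holo_C_derive h 0 R1); auto. rewrite Cmod_minus_0; lra.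
- lra.
- apply Rmult_le_pos; auto. apply Rmult_le_pos. lra. left; now apply Rinv_0_lt_compat.
- intros w Hw. pose proof (Cmod_triangle z w).
  rewrite <- (poisson h R1 R z), <- (poisson h R1 R (z + w)%C) by (auto; lra).
  eapply Rle_trans. apply PI_diff; auto; lra.
  assert (Pz : 0 < R * R - Cmod z * Cmod z) by (generalize (Cmod_ge_0 z); nra).
  eapply Rle_trans. apply Rmult_le_compat_l; [|apply P1]. apply Rmult_le_pos. apply Rmult_le_pos. lra. apply Cmod_ge_0. left; now apply Rinv_0_lt_compat.
  right. fold A. field. generalize (Cmod_ge_0 z). intros. repeat split; lra.
Qed.

Lemma Cmod_csum phi l : Cmod (csum phi l) <= lsum (fun a => Cmod (phi a)) l.
Proof. induction l; simpl. rewrite Cmod_0; lra. eapply Rle_trans. apply Cmod_triangle. lra. Qed.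

(** F' / F is the sum of the 1 / (z - a) plus h'. The sum is bounded by the distance to the zeros;
    h' is bounded through Re h = ln |F| - sum of ln |z - a| on the circle of radius [R], which must
    therefore keep the same distance. *)
Theorem log_derivative F R1 l h R r eps z : zrep F R1 l h -> 0 < r < R -> R < R1 -> 1 <= R1 -> 0 < eps <= 1 ->
  (forall a, In a l -> eps <= Rabs (Cmod a - r) /\ eps <= Rabs (Cmod a - R)) -> Cmod z = r ->
  Cmod (C_derive F z / F z) <= INR (length l) / eps + 
    4 * R / ((R - r) * (R - r)) * (mn (fun w => Rabs (ln (Cmod (F w)))) R + INR (length l) * (ln (2 * R1) - ln eps)).
Proof.
intros H Hr HR HR1 He Hl Hz. pose proof H as [HF [Hh [Hin HH]]].
assert (far : forall a w s, In a l -> Cmod w = s -> eps <= Rabs (Cmod a - s) -> eps <= Cmod (w - a)).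
{ intros a w s Ha Hw Hs. eapply Rle_trans. apply Hs. rewrite <- Hw. apply Rabs_le.
  generalize (Cmod_rev_triangle w a) (Cmod_rev_triangle a w). rewrite (Cmod_minus_sym a w). lra. }
assert (nin : ~ In z l).
{ intros I. generalize (far z z r I Hz (proj1 (Hl z I))). rewrite Cmod_minus_self. lra. }
assert (GR : generic R l). { intros a Ha E. generalize (proj2 (Hl a Ha)). rewrite E, Rminus_diag, Rabs_R0. lra. }
destruct (proj2 (HH z ltac:(lra)) nin) as [NF [_ ED]].
replace (C_derive F z / F z)%C with (csum (fun a => / (z - a))%C l + C_derive h z)%C by (rewrite ED; field; auto).
eapply Rle_trans. apply Cmod_triangle. apply Rplus_le_compat.
- eapply Rle_trans. apply Cmod_csum. unfold Rdiv. rewrite <- lsum_const. apply lsum_le. intros a Ha.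
  pose proof (far a z r Ha Hz (proj1 (Hl a Ha))).
  rewrite Cmod_inv. apply Rinv_le_contravar; lra. intros E. rewrite E, Cmod_0 in H0. lra.
- rewrite <- Hz. eapply Rle_trans. apply (derivative_bound h R1 R z); auto. lra.
  apply Rmult_le_compat_l. apply Rmult_le_pos. lra. left; apply Rinv_0_lt_compat. rewrite Hz. nra.
  assert (CF : ccirc (fun w => ln (Cmod (F w))) R) by (eapply zrep_ccirc; eauto; lra).
  rewrite <- (mn_const (INR (length l) * (ln (2 * R1) - ln eps)) R). rewrite <- mn_plus by (try apply ccirc_const; now apply ccirc_abs).
  apply mn_le.
  + apply ccirc_abs. apply ccirc_Re. intros t. apply cdiff_ccont, Hh. rewrite Cmod_minus_0, Cmod_circ; lra.
  + apply ccirc_plus. now apply ccirc_abs. apply ccirc_const.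
  + intros t. assert (Hc : Cmod (circ R t) = R) by (apply Cmod_circ; lra).
    destruct (proj2 (HH (circ R t) ltac:(lra)) ltac:(apply circ_notin; auto; lra)) as [_ [E _]].
    replace (Re (h (circ R t))) with (ln (Cmod (F (circ R t))) + - lsum (fun a => ln (Cmod (circ R t - a))) l) by (rewrite E; ring).
    eapply Rle_trans. apply Rabs_triang. apply Rplus_le_compat_l. rewrite Rabs_Ropp. 
    eapply Rle_trans. apply lsum_abs. rewrite <- lsum_const. apply lsum_le. intros a Ha.
    pose proof (far a (circ R t) R Ha Hc (proj2 (Hl a Ha))) as L.
    assert (U : Cmod (circ R t - a) <= 2 * R1). { eapply Rle_trans. apply Cmod_triangle. rewrite Cmod_opp, Hc. specialize (Hin a Ha). lra. }
    pose proof (ln_le_mono _ _ (proj1 He) L). assert (P0 : 0 < Cmod (circ R t - a)) by lra. pose proof (ln_le_mono _ _ P0 U).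
    assert (ln eps <= 0). { rewrite <- ln_1. apply ln_le_mono; lra. } assert (0 <= ln (2 * R1)) by (apply ln_nonneg; lra).
    apply Rabs_le. lra.
Qed.

(** * Poles and local quotient representations *)

Lemma punctured_point z r : 0 < r -> exists w, 0 < Cmod (w - z) < r.
Proof.
intros. exists (z + RtoC (r / 2))%C. replace (z + RtoC (r / 2) - z)%C with (RtoC (r / 2)) by ring.
rewrite Cmod_RtoC_pos; lra.
Qed.

Lemma ccont_unique g1 g2 z r : 0 < r -> ccont g1 z -> ccont g2 z ->
  (forall w, 0 < Cmod (w - z) < r -> g1 w = g2 w) -> g1 z = g2 z.
Proof.
intros Hr H1 H2 E. apply NNPP. intros N. pose proof (Cmod_minus_pos _ _ N) as P.
destruct (H1 (Cmod (g1 z - g2 z) / 2) ltac:(lra)) as [d1 [D1 K1]].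
destruct (H2 (Cmod (g1 z - g2 z) / 2) ltac:(lra)) as [d2 [D2 K2]].
destruct (punctured_point z (Rmin r (Rmin d1 d2))) as [w Hw]. { repeat apply Rmin_pos; auto. }
assert (A1 : Cmod (w - z) < r) by (eapply Rlt_le_trans; [apply Hw|apply Rmin_l]).
assert (A2 : Cmod (w - z) < d1) by (eapply Rlt_le_trans; [apply Hw|eapply Rle_trans; [apply Rmin_r|apply Rmin_l]]).
assert (A3 : Cmod (w - z) < d2) by (eapply Rlt_le_trans; [apply Hw|eapply Rle_trans; [apply Rmin_r|apply Rmin_r]]).
specialize (K1 w A2). specialize (K2 w A3). rewrite (E w) in K1 by tauto.
pose proof (Cmod_diff_triangle (g1 z) (g2 w) (g2 z)). rewrite (Cmod_minus_sym (g1 z) (g2 w)) in H. lra.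
Qed.

Lemma holo_ccont_center g z r : 0 < r -> holo_on_disc g z r -> ccont g z.
Proof. intros Hr H. apply cdiff_ccont, H. rewrite Cmod_minus_self; auto. Qed.

Lemma holo_cdiff_center g z r : 0 < r -> holo_on_disc g z r -> cdiff g z.
Proof. intros Hr H. apply H. rewrite Cmod_minus_self; auto. Qed.

Lemma holo_mono g z r r' : r' <= r -> holo_on_disc g z r -> holo_on_disc g z r'.
Proof. intros H Hg w Hw. apply Hg. lra. Qed.

Lemma holo_sub g z r w s : holo_on_disc g z r -> s <= r - Cmod (w - z) -> holo_on_disc g w s.
Proof. intros H Hs u Hu. apply H. generalize (Cmod_diff_triangle u w z). lra. Qed.

Lemma ccont_nonzero_near g z : ccont g z -> g z <> RtoC 0 -> exists d, 0 < d /\ forall w, Cmod (w - z) < d -> g w <> RtoC 0.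
Proof.
intros H N. destruct (H _ (Cmod_pos_neq _ N)) as [d [Hd K]]. exists d; split; auto. intros w Hw E.
specialize (K w Hw). rewrite E in K. replace (0 - g z)%C with (- g z)%C in K by ring. rewrite Cmod_opp in K. lra.
Qed.

(** The value at [z] is that of some local holomorphic extension; two extensions agree at [z] by
    continuity, so every one of them computes the chosen function. *)
Theorem glue (u : C -> C) (Om : C -> Prop) :
  (forall z, Om z -> exists e, 0 < e /\ forall w, Cmod (w - z) < e -> Om w) ->
  (forall z, Om z -> exists r g, 0 < r /\ holo_on_disc g z r /\ forall w, 0 < Cmod (w - z) < r -> u w = g w) ->
  exists E, forall z r g, Om z -> 0 < r -> holo_on_disc g z r -> (forall w, 0 < Cmod (w - z) < r -> u w = g w) ->
    E z = g z /\ cdiff E z.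
Proof.
intros Hop Hloc.
set (good := fun z e => exists r g, 0 < r /\ holo_on_disc g z r /\ (forall w, 0 < Cmod (w - z) < r -> u w = g w) /\ e = g z).
exists (fun z => epsilon (inhabits (RtoC 0)) (good z)).
assert (V : forall z r g, Om z -> 0 < r -> holo_on_disc g z r -> (forall w, 0 < Cmod (w - z) < r -> u w = g w) ->
   epsilon (inhabits (RtoC 0)) (good z) = g z).
{ intros z r g Hz Hr Hg Hu.
  assert (S : good z (epsilon (inhabits (RtoC 0)) (good z))).
  { apply epsilon_spec. exists (g z), r, g. auto. }
  unfold good at 1 in S. destruct S as [r' [g' [Hr' [Hg' [Hu' E]]]]].
  rewrite E. apply ccont_unique with (Rmin r r'). now apply Rmin_pos.
  apply (holo_ccont_center g' z r'); auto. apply (holo_ccont_center g z r); auto.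
  intros w [W1 W2]. rewrite <- Hu', <- Hu; auto. split; auto. eapply Rlt_le_trans; [apply W2|apply Rmin_l].
  split; auto. eapply Rlt_le_trans; [apply W2|apply Rmin_r]. }
intros z r g Hz Hr Hg Hu. split. now apply (V z r g).
destruct (Hop z Hz) as [e [He Ho]].
apply (cdiff_local g) with (r := Rmin e (r / 2)). apply Rmin_pos; lra.
2: now apply holo_cdiff_center in Hg.
intros w Hw. symmetry.
assert (W1 : Cmod (w - z) < e) by (eapply Rlt_le_trans; [apply Hw|apply Rmin_l]).
assert (W2 : Cmod (w - z) < r / 2) by (eapply Rlt_le_trans; [apply Hw|apply Rmin_r]).
destruct (Ceq_dec w z) as [->|N]. now apply (V z r g).
pose proof (Cmod_minus_pos _ _ N) as P.
apply V with (r := Cmod (w - z)); auto. apply holo_sub with z r; auto. lra.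
intros v [V1 V2]. apply Hu. generalize (Cmod_diff_triangle v w z). intros. split; [|lra].
apply Cmod_minus_pos. intros ->. rewrite Cmod_minus_sym in V2. lra.
Qed.

Lemma glue_disc (u : C -> C) X :
  (forall z, Cmod z < X -> exists r g, 0 < r /\ holo_on_disc g z r /\ forall w, 0 < Cmod (w - z) < r -> u w = g w) ->
  exists E, forall z r g, Cmod z < X -> 0 < r -> holo_on_disc g z r -> (forall w, 0 < Cmod (w - z) < r -> u w = g w) ->
    E z = g z /\ cdiff E z.
Proof.
apply glue. intros z Hz. exists (X - Cmod z). split. lra. intros w Hw. generalize (Cmod_rev_triangle w z). lra.
Qed.

Lemma cdiff_pow z0 n z : cdiff (fun w => (w - z0) ^ n)%C z.
Proof.
induction n. apply (cdiff_local (fun _ => RtoC 1) _ z 1); [lra|reflexivity|apply cdiff_const].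
apply (cdiff_local (fun w => (w - z0) * (w - z0) ^ n)%C _ z 1). lra. reflexivity.
apply cdiff_mult; auto. apply cdiff_minus. apply cdiff_id. apply cdiff_const.
Qed.

Lemma Cpow_neq0 (z : C) n : z <> RtoC 0 -> (z ^ n)%C <> RtoC 0.
Proof. intros. now apply Cpow_nz. Qed.

Lemma Cpow_0_S n : (0 ^ S n)%C = RtoC 0.
Proof. rewrite Cpow_S. ring. Qed.

Lemma Cminus_diag (z : C) : (z - z)%C = RtoC 0.
Proof. ring. Qed.

Lemma punct_neq (w z : C) : 0 < Cmod (w - z) -> (w - z)%C <> RtoC 0.
Proof. intros H E. rewrite E, Cmod_0 in H. lra. Qed.

Lemma holo_not_pole f z : holo_at f z -> ~ is_pole f z.
Proof.
intros [r [Hr Hf]] [m [Hm [r' [g [Hr' [Hg [Ng E]]]]]]].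
destruct m as [|m]; [lia|].
assert (X : ((z - z) ^ S m * f z)%C = g z).
{ apply (ccont_unique (fun w => (w - z) ^ S m * f w)%C g z (Rmin r r')). now apply Rmin_pos.
  apply ccont_mult. apply cdiff_ccont, cdiff_pow. now apply (holo_ccont_center f z r). now apply (holo_ccont_center g z r').
  intros w [W1 W2]. rewrite E by (split; auto; eapply Rlt_le_trans; [apply W2|apply Rmin_r]).
  field. apply Cpow_neq0. now apply punct_neq. }
rewrite Cminus_diag, Cpow_0_S in X. apply Ng. rewrite <- X. ring.
Qed.

Lemma pole_order_le f z m m' : pole_order f z m -> pole_order f z m' -> (m' <= m)%nat.
Proof.
intros [Hm [r [g [Hr [Hg [Ng E]]]]]] [Hm' [r' [g' [Hr' [Hg' [Ng' E']]]]]].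
destruct (Nat.le_gt_cases m' m) as [|H]; auto. exfalso.
assert (X : ((z - z) ^ (m' - m) * g z)%C = g' z).
{ apply (ccont_unique (fun w => (w - z) ^ (m' - m) * g w)%C g' z (Rmin r r')). now apply Rmin_pos.
  apply ccont_mult. apply cdiff_ccont, cdiff_pow. now apply (holo_ccont_center g z r). now apply (holo_ccont_center g' z r').
  intros w [W1 W2]. pose proof (punct_neq _ _ W1) as N.
  specialize (E w ltac:(split; auto; eapply Rlt_le_trans; [apply W2|apply Rmin_l])).
  specialize (E' w ltac:(split; auto; eapply Rlt_le_trans; [apply W2|apply Rmin_r])).
  rewrite E' in E. replace m' with (m + (m' - m))%nat in E by lia. rewrite Cpow_add_r in E.
  pose proof (Cpow_neq0 _ m N). pose proof (Cpow_neq0 _ (m' - m) N).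
  replace (g w) with (g w / (w - z) ^ m * (w - z)^m)%C by (field; auto). rewrite <- E. field. auto. }
replace (m' - m)%nat with (S (m' - m - 1)) in X by lia.
rewrite Cminus_diag, Cpow_0_S in X. apply Ng'. rewrite <- X. ring.
Qed.

Lemma pole_order_unique f z m m' : pole_order f z m -> pole_order f z m' -> m' = m.
Proof. intros. apply Nat.le_antisymm; eapply pole_order_le; eauto. Qed.

Lemma pole_isolated f z m : pole_order f z m -> exists r, 0 < r /\ forall w, 0 < Cmod (w - z) < r -> holo_at f w.
Proof.
intros [Hm [r [g [Hr [Hg [Ng E]]]]]]. exists r. split; auto. intros w [W1 W2].
set (s := Rmin (Cmod (w - z)) (r - Cmod (w - z))).
exists s. split. { apply Rmin_pos; lra. }
intros v Hv. 
assert (V1 : Cmod (v - w) < Cmod (w - z)) by (eapply Rlt_le_trans; [apply Hv|apply Rmin_l]).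
assert (V2 : Cmod (v - w) < r - Cmod (w - z)) by (eapply Rlt_le_trans; [apply Hv|apply Rmin_r]).
assert (V3 : 0 < Cmod (v - z)). { apply Cmod_minus_pos. intros ->. rewrite Cmod_minus_sym in V1. lra. }
assert (V4 : Cmod (v - z) < r) by (generalize (Cmod_diff_triangle v w z); lra).
apply (cdiff_local (fun x => g x / (x - z) ^ m)%C) with (r := Rmin (Cmod (v - z)) (r - Cmod (v - z))).
apply Rmin_pos; lra.
intros x Hx. symmetry. apply E. 
assert (X1 : Cmod (x - v) < Cmod (v - z)) by (eapply Rlt_le_trans; [apply Hx|apply Rmin_l]).
assert (X2 : Cmod (x - v) < r - Cmod (v - z)) by (eapply Rlt_le_trans; [apply Hx|apply Rmin_r]).
split. apply Cmod_minus_pos. intros ->. rewrite Cmod_minus_sym in X1. lra.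
generalize (Cmod_diff_triangle x v z); lra.
apply cdiff_div. apply Cpow_neq0. now apply punct_neq. now apply Hg. apply cdiff_pow.
Qed.

Lemma poles_discrete f z : meromorphic f -> exists r, 0 < r /\ forall w, 0 < Cmod (w - z) < r -> ~ is_pole f w.
Proof.
intros Hf. destruct (Hf z) as [[r [Hr Hh]]|[m Hm]].
- exists r; split; auto. intros w [_ Hw]. apply holo_not_pole. exists (r - Cmod (w - z)). split. lra.
  eapply holo_sub; eauto. lra.
- destruct (pole_isolated f z m Hm) as [r [Hr H]]. exists r; split; auto. intros w Hw. apply holo_not_pole. auto.
Qed.

(** Compactness of the square of half-side [X]: each point has a cell that contains no pole except
    possibly its centre, so the centres of a finite cover form the list. The factor 2 passes from
    coordinatewise distance to the modulus. *)
Lemma poles_finite f X : meromorphic f -> exists L : list C, forall z, Cmod z <= X -> is_pole f z -> In z L.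
Proof.
intros Hf.
assert (D : forall z, {d : posreal | forall w, 0 < Cmod (w - z) < 2 * d -> ~ is_pole f w}).
{ intros z. apply constructive_indefinite_description. destruct (poles_discrete f z Hf) as [r [Hr H]].
  exists (mkposreal (r / 2) ltac:(lra)). simpl. intros w Hw. apply H. lra. }
pose (delta := fun t : Compactness.Tn 2 R => proj1_sig (D (fst t, fst (snd t)))).
pose proof (compactness_list 2 (- X, (- X, tt)) (X, (X, tt)) delta) as CL. apply NNPP in CL. destruct CL as [l Hl].
exists (map (fun t => (fst t, fst (snd t))) l).
intros z Hz Hp. pose proof (Rmax_Cmod z) as M.
assert (Z1 : Rabs (fst z) <= X) by (eapply Rle_trans; [apply Rmax_l|eapply Rle_trans; [apply M|apply Hz]]).
assert (Z2 : Rabs (snd z) <= X) by (eapply Rle_trans; [apply Rmax_r|eapply Rle_trans; [apply M|apply Hz]]).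
apply Rabs_le_between in Z1. apply Rabs_le_between in Z2.
destruct (Hl (fst z, (snd z, tt))) as [t [It [_ Ht]]]. { simpl. repeat split; lra. }
apply in_map_iff. exists t. split; auto.
unfold delta in Ht. destruct t as [t1 [t2 []]]. simpl in Ht. destruct (D (t1, t2)) as [d Hd]. simpl in Ht.
destruct Ht as [T1 [T2 _]]. simpl.
apply NNPP. intros N. apply (Hd z); auto. split. apply Cmod_minus_pos. congruence.
eapply Rle_lt_trans. apply Cmod_2Rmax. simpl.
assert (S2 : sqrt 2 <= 2). { rewrite <- (sqrt_square 2) at 2 by lra. apply sqrt_le_1; lra. }
assert (Rmax (Rabs (fst z + - t1)) (Rabs (snd z + - t2)) < d) by (apply Rmax_lub_lt; auto).
assert (0 <= Rmax (Rabs (fst z + - t1)) (Rabs (snd z + - t2))). { eapply Rle_trans. apply Rabs_pos. apply Rmax_l. }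
generalize (sqrt_pos 2). nra.
Qed.

Definition order_sum (l : list (C * nat)) : nat := fold_right (fun p acc => (snd p + acc)%nat) 0%nat l.

Theorem pole_count_exists f t : meromorphic f -> exists N, pole_count f t N.
Proof.
intros Hf. destruct (poles_finite f t Hf) as [L HL].
assert (A : forall L, exists l : list (C * nat), NoDup (map fst l) /\
   (forall z, In z L -> Cmod z <= t -> is_pole f z -> In z (map fst l)) /\
   (forall z m, In (z, m) l -> Cmod z <= t /\ pole_order f z m)).
{ clear. induction L as [|z L [l [H1 [H2 H3]]]].
  - exists nil. simpl. repeat split; try constructor; tauto.
  - destruct (classic (Cmod z <= t /\ is_pole f z /\ ~ In z (map fst l))) as [[Hz [[m Hm] Hn]]|H].
    + exists ((z, m) :: l). simpl. split; [|split]. now constructor.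
      intros w [->|I] W1 W2; auto. intros w k [E|I]; auto. injection E as <- <-. auto.
    + exists l. split; [|split]; auto. intros w [<-|I] W1 W2; auto. apply NNPP. intros N. apply H. auto. }
destruct (A L) as [l [H1 [H2 H3]]]. exists (order_sum l), l. split; [|split; [|split]]; auto.
Qed.

Lemma order_sum_app l1 l2 : order_sum (l1 ++ l2) = (order_sum l1 + order_sum l2)%nat.
Proof. induction l1; simpl; auto. unfold order_sum in *. simpl. rewrite IHl1. lia. Qed.

Lemma order_sum_incl l l' : NoDup l -> incl l l' -> (order_sum l <= order_sum l')%nat.
Proof.
revert l'. induction l as [|a l IH]; intros l' ND I. simpl; lia.
destruct (in_split a l') as [l1 [l2 ->]]. apply I; now left. inversion ND; subst.
assert (IH' : (order_sum l <= order_sum (l1 ++ l2))%nat).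
{ apply IH; auto. intros x Hx. specialize (I x (or_intror Hx)). apply in_app_iff in I. apply in_app_iff.
  destruct I as [|[<-|]]; auto. contradiction. }
rewrite order_sum_app in *. unfold order_sum in *. simpl. lia.
Qed.

Lemma pole_count_mono f t t' N N' : t <= t' -> pole_count f t N -> pole_count f t' N' -> (N <= N')%nat.
Proof.
intros Ht [l [H1 [H2 [H3 ->]]]] [l' [H1' [H2' [H3' ->]]]]. apply order_sum_incl. now apply NoDup_map_inv in H1.
intros [z m] I. destruct (H3 z m I) as [Z1 Z2].
assert (J : In z (map fst l')). { apply H2'. lra. exists m; auto. }
apply in_map_iff in J. destruct J as [[z' m'] [E J]]. simpl in E. subst z'.
destruct (H3' z m' J) as [_ Z3]. now rewrite (pole_order_unique f z m' m Z3 Z2).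
Qed.

Lemma npoles_count f t : meromorphic f -> pole_count f t (npoles f t).
Proof. intros Hf. unfold npoles. apply epsilon_spec. now apply pole_count_exists. Qed.

Definition expand (l : list (C * nat)) : list C := flat_map (fun p => repeat (fst p) (snd p)) l.

Lemma length_expand l : length (expand l) = order_sum l.
Proof. induction l; simpl; auto. rewrite length_app, repeat_length, IHl. reflexivity. Qed.

Lemma in_expand l z : In z (expand l) -> In z (map fst l).
Proof.
induction l; simpl; auto. rewrite in_app_iff. intros [H|H]; auto. apply repeat_spec in H. auto.
Qed.

Lemma lprod_app l1 l2 z : lprod (l1 ++ l2) z = (lprod l1 z * lprod l2 z)%C.
Proof. induction l1; simpl. ring. rewrite IHl1. ring. Qed.

Lemma lprod_repeat a n z : lprod (repeat a n) z = ((z - a) ^ n)%C.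
Proof. induction n; simpl. reflexivity. now rewrite IHn. Qed.

Lemma lprod_expand_split l a m : NoDup (map fst l) -> In (a, m) l -> exists l1, ~ In a l1 /\
  forall z, lprod (expand l) z = ((z - a) ^ m * lprod l1 z)%C.
Proof.
intros ND I. destruct (in_split _ _ I) as [l1 [l2 ->]]. rewrite map_app in ND. simpl in ND.
apply NoDup_remove_2 in ND. rewrite <- map_app in ND.
exists (expand (l1 ++ l2)). split. intros J. now apply in_expand in J.
intros z. unfold expand. rewrite !flat_map_app, !lprod_app. simpl. rewrite lprod_app, lprod_repeat. ring.
Qed.

(* Makes the mean of ln |Q| over |z| = r0 vanish for Q = norm_const r0 l * lprod l. *)
Definition norm_const (r0 : R) (l : list C) : R := exp (- lsum (fun b => ln (Rmax r0 (Cmod b))) l).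

(** f = P / Q on |z| < X without common zeros, in a form that never evaluates [f] at a pole. The
    last clause links the degree of [Q] to the counting function. *)
Definition fraction (f : C -> C) (r0 X : R) (B : list C) (P Q : C -> C) : Prop :=
  (forall z, Q z = (RtoC (norm_const r0 B) * lprod B z)%C) /\ holo_on_disc P 0 X /\
  (forall z, Cmod z < X -> (In z B <-> is_pole f z) /\ (In z B -> P z <> RtoC 0) /\ (~ In z B -> P z = (Q z * f z)%C)) /\
  INR (length B) = INR (npoles f X).

(** [P] is glued from local extensions of [Q f]: a pole of order m is cancelled by the factor of
    order m in [Q], and the extension is not zero there. *)
Theorem fraction_exists f r0 X : meromorphic f -> exists B P Q, fraction f r0 X B P Q.
Proof.
intros Hf. destruct (npoles_count f X Hf) as [l [H1 [H2 [H3 E]]]].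
set (B := expand l). set (Q := fun z => (RtoC (norm_const r0 B) * lprod B z)%C).
assert (Nk : RtoC (norm_const r0 B) <> 0) by (apply RtoC_neq, Rgt_not_eq, exp_pos).
assert (HQ : forall z, cdiff Q z). { intros z. apply cdiff_mult. apply cdiff_const. apply cdiff_lprod. }
assert (Hpole : forall z m, In (z, m) l -> exists r g, 0 < r /\ holo_on_disc g z r /\ (forall w, 0 < Cmod (w - z) < r -> (Q w * f w)%C = g w) /\ g z <> RtoC 0).
{ intros z m I. destruct (H3 z m I) as [_ [Hm [r [g [Hr [Hg [Ng Eg]]]]]]].
  destruct (lprod_expand_split l z m H1 I) as [l1 [N1 E1]].
  exists r, (fun w => RtoC (norm_const r0 B) * lprod l1 w * g w)%C. split; [|split; [|split]]; auto.
  intros w Hw. apply cdiff_mult. apply cdiff_mult. apply cdiff_const. apply cdiff_lprod. now apply Hg.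
  intros w Hw. unfold Q, B. rewrite E1, Eg by auto. field. apply Cpow_neq0. now apply punct_neq.
  repeat apply Cmult_neq_0; auto. now apply lprod_neq0. }
destruct (glue_disc (fun w => Q w * f w)%C X) as [P HP].
{ intros z Hz. destruct (Hf z) as [[r [Hr Hh]]|Hp].
  - exists r, (fun w => Q w * f w)%C. split; [|split]; auto. intros w Hw. apply cdiff_mult; auto.
  - assert (I : In z (map fst l)) by (apply H2; auto; lra). apply in_map_iff in I. destruct I as [[z' m] [<- I]].
    destruct (Hpole _ m I) as [r [g [Hr [Hg [Eg _]]]]]. exists r, g. auto. }
assert (IB : forall z, Cmod z < X -> (In z B <-> is_pole f z)).
{ intros z Hz. split.
  - intros I. apply in_expand in I. apply in_map_iff in I. destruct I as [[z' m] [<- I]]. exists m. apply (H3 _ _ I).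
  - intros Hp. assert (I : In z (map fst l)) by (apply H2; auto; lra). apply in_map_iff in I. destruct I as [[z' m] [<- I]].
    destruct (H3 _ _ I) as [_ [Hm _]]. unfold B, expand. apply in_flat_map. exists (z', m). split; auto. simpl. destruct m; [lia|]. now left. }
exists B, P, Q. split; [|split; [|split]]; auto.
- intros z Hz. rewrite Cmod_minus_0 in Hz. destruct (Hf z) as [[r [Hr Hh]]|Hp].
  + apply (HP z r (fun w => Q w * f w)%C); auto. intros w Hw. apply cdiff_mult; auto.
  + apply IB in Hp; auto. apply in_expand, in_map_iff in Hp. destruct Hp as [[z' m] [<- I]].
    destruct (Hpole _ m I) as [r [g [Hr [Hg [Eg _]]]]]. now apply (HP _ r g).
- intros z Hz. split; [|split]; auto.
  + intros I. apply in_expand, in_map_iff in I. destruct I as [[z' m] [<- I]].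
    destruct (Hpole _ m I) as [r [g [Hr [Hg [Eg Ng]]]]]. destruct (HP _ r g Hz Hr Hg Eg) as [-> _]. auto.
  + intros I. destruct (Hf z) as [[r [Hr Hh]]|Hp].
    * apply (HP z r (fun w => Q w * f w)%C); auto. intros w Hw. apply cdiff_mult; auto.
    * apply IB in Hp; auto. contradiction.
- unfold B. rewrite length_expand, E. reflexivity.
Qed.

(** * The quotient f(z + c) / f(z) *)

Ltac hm := eapply holo_mono; [|eassumption]; first [assumption | lra].

Lemma not_pole_holo f z : meromorphic f -> ~ is_pole f z -> holo_at f z.
Proof. intros H N. destruct (H z); tauto. Qed.

Lemma holo_shift f c z r : holo_on_disc f (z + c)%C r -> holo_on_disc (fun w => f (w + c)%C) z r.
Proof.
intros H w Hw. apply (cdiff_comp f (fun w => w + c)%C). apply cdiff_plus. apply cdiff_id. apply cdiff_const.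
apply H. replace (w + c - (z + c))%C with (w - z)%C by ring. auto.
Qed.

Lemma holo_plus f g z r : holo_on_disc f z r -> holo_on_disc g z r -> holo_on_disc (fun w => f w + g w)%C z r.
Proof. intros H1 H2 w Hw. apply cdiff_plus; auto. Qed.
Lemma holo_minus f g z r : holo_on_disc f z r -> holo_on_disc g z r -> holo_on_disc (fun w => f w - g w)%C z r.
Proof. intros H1 H2 w Hw. apply cdiff_minus; auto. Qed.
Lemma holo_mult f g z r : holo_on_disc f z r -> holo_on_disc g z r -> holo_on_disc (fun w => f w * g w)%C z r.
Proof. intros H1 H2 w Hw. apply cdiff_mult; auto. Qed.
Lemma holo_const k z r : holo_on_disc (fun _ => k) z r.
Proof. intros w Hw. apply cdiff_const. Qed.
Lemma holo_div f g z r : holo_on_disc f z r -> holo_on_disc g z r -> (forall w, Cmod (w - z) < r -> g w <> RtoC 0) ->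
  holo_on_disc (fun w => f w / g w)%C z r.
Proof. intros H1 H2 N w Hw. apply cdiff_div; auto. Qed.
Lemma holo_pow z0 n z r : holo_on_disc (fun w => (w - z0) ^ n)%C z r.
Proof. intros w Hw. apply cdiff_pow. Qed.

Lemma lprod_extract l a : exists n l', ~ In a l' /\ forall z, lprod l z = ((z - a) ^ n * lprod l' z)%C.
Proof.
induction l as [|b l [n [l' [H E]]]]. exists 0%nat, nil. split. simpl; tauto. intros; simpl; ring.
destruct (Ceq_dec b a) as [->|N].
- exists (S n), l'. split; auto. intros z. simpl. rewrite E. ring.
- exists n, (b :: l'). split. intros [I|I]; auto. intros z. simpl. rewrite E. ring.
Qed.

(** One nonvanishing value [F p] gives a finite order at every point of the smaller disc, through
    the factorization; the factor 4 is its loss of radius. *)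
Lemma order_at F R p z0 : holo_on_disc F 0 R -> 4 * Cmod p < R -> 4 * Cmod z0 < R -> F p <> RtoC 0 ->
  exists n r G, 0 < r /\ holo_on_disc G z0 r /\ (forall w, Cmod (w - z0) < r -> G w <> RtoC 0 /\ F w = ((w - z0) ^ n * G w)%C).
Proof.
intros HF Hp Hz Hn.
assert (exists s, Cmod p < s /\ Cmod z0 < s /\ 4 * s < R) as [s [S1 [S2 S3]]].
{ exists ((Rmax (Cmod p) (Cmod z0) + R / 4) / 2). unfold Rmax. destruct (Rle_dec (Cmod p) (Cmod z0)); lra. }
destruct (zero_factorization F p s R) as [l [G [Hl [HG [E N]]]]]; auto. generalize (Cmod_ge_0 p); lra.
destruct (lprod_extract l z0) as [n [l' [H El]]].
destruct (ccont_nonzero_near (lprod l') z0) as [d [Hd Kd]].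
apply cdiff_ccont, cdiff_lprod. now apply lprod_neq0.
exists n, (Rmin d (s - Cmod z0)), (fun w => lprod l' w * G w)%C. split; [|split].
- apply Rmin_pos; lra.
- intros w Hw. apply cdiff_mult. apply cdiff_lprod. apply HG. rewrite Cmod_minus_0.
  generalize (Cmod_ge_0 p) (Cmod_rev_triangle w z0) (Rmin_r d (s - Cmod z0)). lra.
- intros w Hw. assert (W1 : Cmod (w - z0) < d) by (eapply Rlt_le_trans; [apply Hw|apply Rmin_l]).
  assert (W2 : Cmod w < s) by (generalize (Cmod_rev_triangle w z0) (Rmin_r d (s - Cmod z0)); lra).
  split. apply Cmult_neq_0; auto. rewrite E by (generalize (Cmod_ge_0 p); lra). rewrite El. ring.
Qed.

Lemma fraction_value f r0 X B P Q z : fraction f r0 X B P Q -> Cmod z < X -> ~ is_pole f z ->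
  Q z <> RtoC 0 /\ P z = (Q z * f z)%C.
Proof.
intros [EQ [_ [H _]]] Hz N. destruct (H z Hz) as [I1 [_ I2]]. assert (~ In z B) by tauto. split; auto.
rewrite EQ. apply Cmult_neq_0. apply RtoC_neq, Rgt_not_eq, exp_pos. now apply lprod_neq0.
Qed.

Lemma fraction_pole f r0 X B P Q z : fraction f r0 X B P Q -> Cmod z < X -> is_pole f z ->
  Q z = RtoC 0 /\ P z <> RtoC 0.
Proof.
intros [EQ [_ [H _]]] Hz N. destruct (H z Hz) as [I1 [I2 _]]. assert (In z B) by tauto. split; auto.
rewrite EQ, lprod_in by auto. ring.
Qed.

Lemma fraction_holo_Q f r0 X B P Q z r : fraction f r0 X B P Q -> holo_on_disc Q z r.
Proof.
intros [EQ _] w _. apply (cdiff_local (fun z => RtoC (norm_const r0 B) * lprod B z)%C _ w 1). lra. auto.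
apply cdiff_mult. apply cdiff_const. apply cdiff_lprod.
Qed.

(** The identity theorem in the form needed: the order of [f - k] at [z0] is read off the
    holomorphic function [P - k Q] on a disc that contains both points. *)
Lemma value_order f k p z0 : meromorphic f -> ~ is_pole f p -> f p <> k -> ~ is_pole f z0 ->
  exists n r G, 0 < r /\ holo_on_disc G z0 r /\ (forall w, Cmod (w - z0) < r -> ~ is_pole f w /\ G w <> RtoC 0 /\ (f w - k = (w - z0) ^ n * G w)%C).
Proof.
intros Hf Hp Hk Hz.
set (X := 4 * (Cmod p + Cmod z0) + 1). pose proof (Cmod_ge_0 p). pose proof (Cmod_ge_0 z0).
destruct (fraction_exists f 1 X Hf) as [B [P [Q H1]]].
destruct (fraction_value _ _ _ _ _ _ p H1 ltac:(unfold X; lra) Hp) as [Np Ep].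
destruct (fraction_value _ _ _ _ _ _ z0 H1 ltac:(unfold X; lra) Hz) as [Nz Ez].
destruct (order_at (fun z => P z - k * Q z)%C X p z0) as [n [r [G [Hr [HG E]]]]].
- apply holo_minus. apply H1. apply holo_mult. apply holo_const. eapply fraction_holo_Q; eauto.
- unfold X; lra.
- unfold X; lra.
- rewrite Ep. replace (Q p * f p - k * Q p)%C with (Q p * (f p - k))%C by ring. apply Cmult_neq_0; auto. now apply Cminus_neq.
- destruct (ccont_nonzero_near Q z0) as [d [Hd Kd]]; auto.
  { eapply holo_ccont_center. apply Rlt_0_1. eapply fraction_holo_Q; eauto. }
  destruct (not_pole_holo f z0 Hf Hz) as [r2 [Hr2 Hh]].
  set (s := Rmin r (Rmin d (Rmin r2 (X - Cmod z0)))).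
  exists n, s, (fun w => G w / Q w)%C.
  assert (Hs : forall w, Cmod (w - z0) < s -> Cmod (w - z0) < r /\ Cmod (w - z0) < d /\ Cmod (w - z0) < r2 /\ Cmod w < X).
  { intros w Hw. unfold s in Hw.
    pose proof (Rmin_l r (Rmin d (Rmin r2 (X - Cmod z0)))). pose proof (Rmin_r r (Rmin d (Rmin r2 (X - Cmod z0)))).
    pose proof (Rmin_l d (Rmin r2 (X - Cmod z0))). pose proof (Rmin_r d (Rmin r2 (X - Cmod z0))).
    pose proof (Rmin_l r2 (X - Cmod z0)). pose proof (Rmin_r r2 (X - Cmod z0)). pose proof (Cmod_rev_triangle w z0). lra. }
  split; [|split].
  + unfold s, X. repeat apply Rmin_pos; lra.
  + apply holo_div. intros w Hw. apply HG. now apply Hs. eapply fraction_holo_Q; eauto. intros w Hw. apply Kd. now apply Hs.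
  + intros w Hw. destruct (Hs w Hw) as [W1 [W2 [W3 W4]]]. destruct (E w W1) as [NG EG].
    assert (Nw : ~ is_pole f w). { apply holo_not_pole. exists (r2 - Cmod (w - z0)). split. lra. eapply holo_sub; eauto. lra. }
    split; auto. split. apply Cmult_neq_0; auto. intros EI. apply (Kd w W2). 
    replace (Q w) with (Q w * Q w * / Q w)%C by (field; auto). rewrite EI. ring.
    destruct (fraction_value _ _ _ _ _ _ w H1 W4 Nw) as [NQ EP].
    replace ((w - z0)^n * (G w / Q w))%C with ((w - z0)^n * G w / Q w)%C by (unfold Cdiv; ring). rewrite <- EG, EP. field. auto.
Qed.

Lemma near_radius (l : list R) : (forall x, In x l -> 0 < x) -> exists s, 0 < s /\ forall x, In x l -> s <= x.
Proof.
induction l as [|a l IH]; intros H. exists 1; split. lra. simpl; tauto.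
destruct IH as [s [Hs K]]. intros; apply H; now right.
exists (Rmin a s). split. apply Rmin_pos; auto. apply H; now left. intros x [<-|I]. apply Rmin_l. eapply Rle_trans. apply Rmin_r. auto.
Qed.

Lemma pole_shift f c z q : pole_order f (z + c)%C q -> (0 < q)%nat /\ exists r g, 0 < r /\ holo_on_disc g z r /\ g z <> RtoC 0 /\
  forall w, 0 < Cmod (w - z) < r -> f (w + c)%C = (g w / (w - z) ^ q)%C.
Proof.
intros [Hq [r [g [Hr [Hg [Ng E]]]]]]. split; auto. exists r, (fun w => g (w + c)%C). split; [|split; [|split]]; auto.
now apply holo_shift. intros w Hw. rewrite E by (replace (w + c - (z + c))%C with (w - z)%C by ring; auto). f_equal. f_equal. ring.
Qed.

Section Quotient.
Variables (f : C -> C) (a b c p : C).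
Hypothesis Hf : meromorphic f.
Hypothesis Hp : ~ is_pole f p.
Hypothesis Hp0 : f p <> RtoC 0.
Hypothesis Ha : a <> RtoC 0.
Let L := fun z => (a * f (z + c) - b * f z)%C.
Hypothesis E0 : E_sub f (RtoC 0) L (RtoC 0).
Hypothesis Einf : E_sub_infty L f.

(** Two obstructions to a holomorphic extension of f(z + c) / f(z), each excluded by one inclusion.
    A pole of f(z + c) of higher order than that of f would be a pole of [L] of the same order; and
    at a zero of f, [L] and hence a f(z + c) vanish to at least the order of f. *)
Lemma quotient_local z0 : exists r g, 0 < r /\ holo_on_disc g z0 r /\ forall w, 0 < Cmod (w - z0) < r -> (f (w + c) / f w)%C = g w.
Proof.
destruct (classic (is_pole f z0)) as [[m Hm]|Nz].
- pose proof Hm as [Hm0 [r1 [g1 [Hr1 [Hg1 [Ng1 E1]]]]]].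
  destruct (ccont_nonzero_near g1 z0) as [d [Hd Kd]]; auto. now apply (holo_ccont_center g1 z0 r1).
  destruct (Hf (z0 + c)%C) as [[r2 [Hr2 H2]]|[q Hq]].
  + destruct (near_radius (r1 :: r2 :: d :: nil)) as [s [Hs Ks]]. { simpl. intros x [<-|[<-|[<-|[]]]]; auto. }
    pose proof (Ks r1 ltac:(simpl; auto)). pose proof (Ks r2 ltac:(simpl; auto)). pose proof (Ks d ltac:(simpl; auto)).
    exists s, (fun w => f (w + c) * (w - z0) ^ m / g1 w)%C. split; [|split]; auto.
    * apply holo_div. apply holo_mult. apply holo_shift. hm. apply holo_pow. hm. intros; apply Kd; lra.
    * intros w Hw. rewrite (E1 w) by lra. assert (g1 w <> 0) by (apply Kd; lra). field. split; auto. apply Cpow_neq0. now apply punct_neq.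
  + destruct (pole_shift f c z0 q Hq) as [Hq0 [r2 [g2 [Hr2 [Hg2 [Ng2 E2]]]]]].
    destruct (near_radius (r1 :: r2 :: d :: nil)) as [s [Hs Ks]]. { simpl. intros x [<-|[<-|[<-|[]]]]; auto. }
    pose proof (Ks r1 ltac:(simpl; auto)). pose proof (Ks r2 ltac:(simpl; auto)). pose proof (Ks d ltac:(simpl; auto)).
    destruct (Nat.le_gt_cases q m) as [Hqm|Hqm].
    * exists s, (fun w => g2 w * (w - z0) ^ (m - q) / g1 w)%C. split; [|split]; auto.
      -- apply holo_div. apply holo_mult. hm. apply holo_pow. hm. intros; apply Kd; lra.
      -- intros w Hw. rewrite (E1 w), E2 by lra. assert (g1 w <> 0) by (apply Kd; lra).
         pose proof (punct_neq _ _ (proj1 Hw)) as N. pose proof (Cpow_neq0 _ q N). pose proof (Cpow_neq0 _ (m - q) N).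
         replace m with (q + (m - q))%nat at 1 by lia. rewrite Cpow_add_r. field. auto.
    * exfalso. assert (PL : pole_order L z0 q).
      { split; auto. exists s, (fun w => a * g2 w - b * g1 w * (w - z0) ^ (q - m))%C. split; [|split; [|split]]; auto.
        - apply holo_minus. apply holo_mult. apply holo_const. hm. apply holo_mult. apply holo_mult. apply holo_const. hm. apply holo_pow.
        - replace (q - m)%nat with (S (q - m - 1)) by lia. rewrite Cminus_diag, Cpow_0_S, Cmult_0_r.
          replace (a * g2 z0 - 0)%C with (a * g2 z0)%C by ring. now apply Cmult_neq_0.
        - intros w Hw. unfold L. rewrite (E1 w), E2 by lra.
          pose proof (punct_neq _ _ (proj1 Hw)) as N. pose proof (Cpow_neq0 _ m N). pose proof (Cpow_neq0 _ (q - m) N).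
          replace q with (m + (q - m))%nat at 1 3 by lia. rewrite Cpow_add_r. field. auto. }
      destruct (Einf _ _ PL) as [k [Hk Pk]]. rewrite (pole_order_unique f z0 m k Hm Pk) in Hk. lia.
- destruct (value_order f 0 p z0 Hf Hp Hp0 Nz) as [n [r1 [G [Hr1 [HG EG]]]]].
  assert (Ef : forall w, Cmod (w - z0) < r1 -> f w = ((w - z0)^n * G w)%C).
  { intros w Hw. destruct (EG w Hw) as [_ [_ E]]. rewrite <- E. ring. }
  assert (NG : forall w, Cmod (w - z0) < r1 -> G w <> RtoC 0) by (intros w Hw; now apply EG).
  destruct n as [|n].
  + destruct (Hf (z0 + c)%C) as [[r2 [Hr2 H2]]|[q Hq]].
    * destruct (near_radius (r1 :: r2 :: nil)) as [s [Hs Ks]]. { simpl. intros x [<-|[<-|[]]]; auto. }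
      pose proof (Ks r1 ltac:(simpl; auto)). pose proof (Ks r2 ltac:(simpl; auto)).
      exists s, (fun w => f (w + c) / G w)%C. split; [|split]; auto.
      -- apply holo_div. apply holo_shift. hm. hm. intros; apply NG; lra.
      -- intros w Hw. f_equal. rewrite (Ef w) by lra. simpl. ring.
    * exfalso. apply Nz. destruct (pole_shift f c z0 q Hq) as [Hq0 [r2 [g2 [Hr2 [Hg2 [Ng2 E2]]]]]].
      destruct (near_radius (r1 :: r2 :: nil)) as [s [Hs Ks]]. { simpl. intros x [<-|[<-|[]]]; auto. }
      pose proof (Ks r1 ltac:(simpl; auto)). pose proof (Ks r2 ltac:(simpl; auto)).
      destruct (Einf z0 q) as [k [_ Pk]]; [|now exists k].
      split; auto. exists s, (fun w => a * g2 w - b * G w * (w - z0) ^ q)%C. split; [|split; [|split]]; auto.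
      -- apply holo_minus. apply holo_mult. apply holo_const. hm. apply holo_mult. apply holo_mult. apply holo_const. hm. apply holo_pow.
      -- destruct q; [lia|]. rewrite Cminus_diag, Cpow_0_S, Cmult_0_r.
         replace (a * g2 z0 - 0)%C with (a * g2 z0)%C by ring. now apply Cmult_neq_0.
      -- intros w Hw. unfold L. rewrite (Ef w), E2 by lra. pose proof (Cpow_neq0 _ q (punct_neq _ _ (proj1 Hw))). simpl. field. auto.
  + assert (AO : apoint_order f 0 z0 (S n)).
    { split. lia. exists r1, G. split; [|split; [|split]]; auto. apply NG. rewrite Cmod_minus_self; auto.
      intros w Hw. rewrite (Ef w) by lra. ring. }
    destruct (E0 _ _ AO) as [r2 [G2 [Hr2 [HG2 E2]]]].
    destruct (near_radius (r1 :: r2 :: nil)) as [s [Hs Ks]]. { simpl. intros x [<-|[<-|[]]]; auto. }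
    pose proof (Ks r1 ltac:(simpl; auto)). pose proof (Ks r2 ltac:(simpl; auto)).
    exists s, (fun w => (G2 w + b * G w) / (a * G w))%C. split; [|split]; auto.
    * apply holo_div. apply holo_plus. hm. apply holo_mult. apply holo_const. hm.
      apply holo_mult. apply holo_const. hm. intros; apply Cmult_neq_0; auto. apply NG; lra.
    * intros w Hw. specialize (E2 w ltac:(lra)). unfold L in E2.
      assert (X : f (w + c)%C = (((w - z0) ^ S n * G2 w + b * f w) / a)%C).
      { rewrite <- E2. field. auto. }
      rewrite X, (Ef w) by lra. pose proof (Cpow_neq0 _ (S n) (punct_neq _ _ (proj1 Hw))). pose proof (NG w ltac:(lra)). field. auto.
Qed.

(** The quotient says nothing at a zero of [f], so the product identity is extended by continuity
    from a punctured neighbourhood where [f] does not vanish. *)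
Theorem quotient_entire : exists K, (forall z, cdiff K z) /\
  (forall z, ~ is_pole f z -> ~ is_pole f (z + c)%C -> f (z + c)%C = (K z * f z)%C).
Proof.
destruct (glue (fun w => f (w + c) / f w)%C (fun _ => True)) as [K HK].
- intros z _. exists 1. split; auto. lra.
- intros z _. apply quotient_local.
- assert (HKd : forall z, cdiff K z).
  { intros z. destruct (quotient_local z) as [r [g [Hr [Hg E]]]]. now apply (HK z r g). }
  exists K. split; auto. intros z N1 N2.
  destruct (value_order f 0 p z Hf Hp Hp0 N1) as [n [r1 [G [Hr1 [HG EG]]]]].
  destruct (not_pole_holo f _ Hf N1) as [r2 [Hr2 H2]]. destruct (not_pole_holo f _ Hf N2) as [r3 [Hr3 H3]].
  destruct (near_radius (r1 :: r2 :: r3 :: nil)) as [s [Hs Ks]]. { simpl. intros x [<-|[<-|[<-|[]]]]; auto. }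
  pose proof (Ks r1 ltac:(simpl; auto)). pose proof (Ks r2 ltac:(simpl; auto)). pose proof (Ks r3 ltac:(simpl; auto)).
  apply (ccont_unique (fun w => f (w + c)%C) (fun w => K w * f w)%C z s); auto.
  + apply (holo_ccont_center (fun w => f (w + c)%C) z r3); auto. now apply holo_shift.
  + apply ccont_mult. now apply cdiff_ccont. now apply (holo_ccont_center f z r2).
  + intros w Hw.
    assert (Nf : forall v, 0 < Cmod (v - z) < s -> f v <> RtoC 0).
    { intros v Hv. destruct (EG v ltac:(lra)) as [_ [N E]]. replace (f v) with (f v - 0)%C by ring. rewrite E.
      apply Cmult_neq_0; auto. apply Cpow_neq0. now apply punct_neq. }
    set (e := Rmin (Cmod (w - z)) (s - Cmod (w - z))).
    assert (He : 0 < e) by (apply Rmin_pos; lra).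
    assert (Hv : forall v, Cmod (v - w) < e -> 0 < Cmod (v - z) < s).
    { intros v Hv. pose proof (Rmin_l (Cmod (w - z)) (s - Cmod (w - z))). pose proof (Rmin_r (Cmod (w - z)) (s - Cmod (w - z))). fold e in H4, H5.
      generalize (Cmod_diff_triangle v w z) (Cmod_diff_triangle w v z). rewrite (Cmod_minus_sym w v). lra. }
    destruct (HK w e (fun w => f (w + c) / f w)%C) as [EK _]; auto.
    * apply holo_div. intros v V. apply (holo_shift f c z r3 H3). specialize (Hv v V). lra. intros v V. apply H2. specialize (Hv v V). lra. 
      intros v V. apply Nf. now apply Hv.
    * rewrite EK. field. apply Nf. lra.
Qed.
End Quotient.

(** A function equal to [k] off its poles has no poles, because (w - z)^m k tends to 0 and not to a
    nonzero value; it would be constant, hence rational. *)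
Lemma meromorphic_nonconstant f k : meromorphic f -> ~ rational_fun f -> exists z, ~ is_pole f z /\ f z <> k.
Proof.
intros Hf Hr. apply NNPP. intros N.
assert (H : forall z, ~ is_pole f z -> f z = k).
{ intros z Hz. apply NNPP. intros Nk. apply N. eauto. }
assert (NP : forall z, ~ is_pole f z).
{ intros z [m Hm]. destruct (pole_isolated f z m Hm) as [r1 [Hr1 H1]]. pose proof Hm as [Hm0 [r [g [Hr0 [Hg [Ng E]]]]]].
  destruct m as [|m]; [lia|]. apply Ng.
  assert (X : ((z - z) ^ S m * k)%C = g z).
  { apply (ccont_unique (fun w => (w - z) ^ S m * k)%C g z (Rmin r r1)). now apply Rmin_pos.
    apply ccont_mult. apply cdiff_ccont, cdiff_pow. apply ccont_const. now apply (holo_ccont_center g z r).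
    intros w [W1 W2]. rewrite <- (H w). rewrite E by (split; auto; eapply Rlt_le_trans; [apply W2|apply Rmin_l]). field.
    apply Cpow_neq0. now apply punct_neq. apply holo_not_pole. apply H1. split; auto. eapply Rlt_le_trans; [apply W2|apply Rmin_r]. }
  rewrite <- X, Cminus_diag, Cpow_0_S. ring. }
apply Hr. exists (k :: nil), (RtoC 1 :: nil). split.
- exists (RtoC 1). split. simpl; auto. apply RtoC_neq; lra.
- intros z _. simpl. rewrite (H z) by apply NP. field.
Qed.

(* At a 1-point, L takes the value 1 only in the limit: z + c may be a zero of Q. *)
Lemma one_point f a b c K z p1 : meromorphic f -> ~ is_pole f p1 -> f p1 <> RtoC 1 -> a <> RtoC 0 ->
  Ebar_sub f (RtoC 1) (fun z => a * f (z + c) - b * f z)%C (RtoC 1) ->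
  (forall z, cdiff K z) -> (forall z, ~ is_pole f z -> ~ is_pole f (z + c)%C -> f (z + c)%C = (K z * f z)%C) ->
  ~ is_pole f z -> f z = RtoC 1 -> K z = ((1 + b) / a)%C.
Proof.
intros Hf Hp1 Hn1 Ha HE HK HfK Hz E1.
destruct (value_order f 1 p1 z Hf Hp1 Hn1 Hz) as [n [r1 [G [Hr1 [HG EG]]]]].
destruct n as [|n].
{ exfalso. destruct (EG z) as [_ [N E]]. rewrite Cmod_minus_self; auto. apply N. 
  replace (G z) with ((z - z) ^ 0 * G z)%C by (simpl; ring). rewrite <- E, E1. ring. }
assert (AO : apoint_order f 1 z (S n)).
{ split. lia. exists r1, G. split; [|split; [|split]]; auto. apply EG. rewrite Cmod_minus_self; auto.
  intros w Hw. apply EG. lra. }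
destruct (HE _ _ AO) as [r2 [G2 [Hr2 [HG2 E2]]]].
destruct (not_pole_holo f _ Hf Hz) as [r3 [Hr3 H3]].
destruct (poles_discrete f z Hf) as [r4 [Hr4 H4]]. destruct (poles_discrete f (z + c)%C Hf) as [r5 [Hr5 H5]].
destruct (near_radius (r1 :: r2 :: r3 :: r4 :: r5 :: nil)) as [s [Hs Ks]]. { simpl. intros x [<-|[<-|[<-|[<-|[<-|[]]]]]]; auto. }
pose proof (Ks r1 ltac:(simpl; auto)). pose proof (Ks r2 ltac:(simpl; auto)). pose proof (Ks r3 ltac:(simpl; auto)).
pose proof (Ks r4 ltac:(simpl; auto)). pose proof (Ks r5 ltac:(simpl; auto 6)).
assert (X : (a * (K z * f z) - b * f z)%C = (1 + (z - z) ^ 1 * G2 z)%C).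
{ apply (ccont_unique (fun z => a * (K z * f z) - b * f z)%C (fun w => 1 + (w - z) ^ 1 * G2 w)%C z s); auto.
  - apply ccont_minus. apply ccont_mult. apply ccont_const. apply ccont_mult. now apply cdiff_ccont. now apply (holo_ccont_center f z r3).
    apply ccont_mult. apply ccont_const. now apply (holo_ccont_center f z r3).
  - apply ccont_plus. apply ccont_const. apply ccont_mult. apply cdiff_ccont, cdiff_pow. now apply (holo_ccont_center G2 z r2).
  - intros w Hw. rewrite <- HfK. rewrite <- E2 by lra. ring.
    apply H4; lra. apply H5. replace (w + c - (z + c))%C with (w - z)%C by ring. lra. }
rewrite E1, Cminus_diag, Cpow_1_r, Cmult_0_l in X.
replace (K z) with ((a * (K z * 1) - b * 1 + b) / a)%C by (field; auto). rewrite X. f_equal. ring.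
Qed.

(** The relation f(z + c) = K f, cross-multiplied; by continuity it also holds where [z] or [z + c]
    is a pole. *)
Lemma fraction_shift f r0 X B P Q c K z : meromorphic f -> fraction f r0 X B P Q ->
  (forall z, cdiff K z) -> (forall z, ~ is_pole f z -> ~ is_pole f (z + c)%C -> f (z + c)%C = (K z * f z)%C) ->
  Cmod z < X -> Cmod (z + c) < X -> (P (z + c) * Q z = K z * P z * Q (z + c))%C.
Proof.
intros Hf H1 HK HfK Hz Hzc.
destruct (poles_discrete f z Hf) as [r4 [Hr4 H4]]. destruct (poles_discrete f (z + c)%C Hf) as [r5 [Hr5 H5]].
destruct (near_radius (r4 :: r5 :: X - Cmod z :: X - Cmod (z + c) :: nil)) as [s [Hs Ks]]. { simpl. intros x [<-|[<-|[<-|[<-|[]]]]]; auto; lra. }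
pose proof (Ks r4 ltac:(simpl; auto)). pose proof (Ks r5 ltac:(simpl; auto)).
pose proof (Ks (X - Cmod z) ltac:(simpl; auto)). pose proof (Ks (X - Cmod (z + c)) ltac:(simpl; auto)).
assert (CP : forall u, Cmod u < X -> ccont P u). { intros u Hu. apply cdiff_ccont. apply H1. now rewrite Cmod_minus_0. }
assert (CQ : forall u, ccont Q u). { intros u. eapply holo_ccont_center. apply Rlt_0_1. eapply fraction_holo_Q; eauto. }
assert (Csh : ccont (fun w => w + c)%C z). { apply ccont_plus. apply ccont_id. apply ccont_const. }
apply (ccont_unique (fun z => P (z + c) * Q z)%C (fun z => K z * P z * Q (z + c))%C z s); auto.
- apply ccont_mult; auto. apply (ccont_comp P (fun w => w + c)%C); auto.
- apply ccont_mult. apply ccont_mult; auto. now apply cdiff_ccont. apply (ccont_comp Q (fun w => w + c)%C); auto.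
- intros w Hw. assert (N1 : ~ is_pole f w) by (apply H4; lra).
  assert (N2 : ~ is_pole f (w + c)%C). { apply H5. replace (w + c - (z + c))%C with (w - z)%C by ring. lra. }
  assert (W2 : Cmod (w + c) < X). { generalize (Cmod_rev_triangle (w + c) (z + c)). replace (w + c - (z + c))%C with (w - z)%C by ring. lra. }
  destruct (fraction_value _ _ _ _ _ _ w H1 ltac:(generalize (Cmod_rev_triangle w z); lra) N1) as [_ ->].
  destruct (fraction_value _ _ _ _ _ _ (w + c)%C H1 W2 N2) as [_ ->]. rewrite HfK by auto. ring.
Qed.

(** * Zero lists and good radii *)

Definition inside (r : R) (l : list C) : list C := filter (fun a => if Rlt_dec (Cmod a) r then true else false) l.

Lemma in_inside r l a : In a (inside r l) <-> In a l /\ Cmod a < r.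
Proof. unfold inside. rewrite filter_In. destruct (Rlt_dec (Cmod a) r); intuition discriminate. Qed.

Lemma length_inside r l : INR (length (inside r l)) = ncount r l.
Proof.
unfold ncount, inside. induction l; simpl. reflexivity. destruct (Rlt_dec (Cmod a) r); simpl length; rewrite ?S_INR, IHl; ring.
Qed.

Lemma inside_all r l : (forall a, In a l -> Cmod a < r) -> inside r l = l.
Proof.
unfold inside. induction l; simpl; intros H; auto. destruct (Rlt_dec (Cmod a) r) as [|N]. f_equal; auto. exfalso; apply N; auto.
Qed.

Lemma ncount_nonneg r l : 0 <= ncount r l.
Proof. apply lsum_nonneg. intros. destruct (Rlt_dec (Cmod a) r); lra. Qed.

Lemma lprod_inside r l z : lprod l z = (lprod (inside r l) z * lprod (filter (fun a => if Rlt_dec (Cmod a) r then false else true) l) z)%C.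
Proof.
unfold inside. induction l; simpl. ring. destruct (Rlt_dec (Cmod a) r); simpl; rewrite IHl; ring.
Qed.

(** One list serves every smaller disc by restriction. An estimate near radius r then involves only
    the zeros in a comparable disc, whose number is bounded by Jensen's formula. *)
Definition zsys (F : C -> C) (S : R) (l : list C) : Prop :=
  (forall a, In a l -> Cmod a < S /\ F a = RtoC 0) /\ forall r, 0 < r <= S -> exists h, zrep F r (inside r l) h.

Theorem zsys_exists F p r R : 0 < r -> 4 * r < R -> holo_on_disc F 0 R -> Cmod p < r -> F p <> RtoC 0 ->
  exists l, zsys F r l.
Proof.
intros Hr HR HF Hp Hn. destruct (zero_factorization F p r R Hr HR HF Hp Hn) as [l [G [Hl [HG [E N]]]]].
exists l. split.
{ intros a Ha. split; auto. rewrite E, lprod_in by (auto; specialize (Hl a Ha); lra). ring. }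
intros r1 Hr1.
set (l1 := inside r1 l). set (l2 := filter (fun a => if Rlt_dec (Cmod a) r1 then false else true) l).
set (G1 := fun z => (lprod l2 z * G z)%C).
assert (HG1 : holo_on_disc G1 0 r1). { intros z Hz. apply cdiff_mult. apply cdiff_lprod. apply HG. lra. }
assert (N1 : forall z, Cmod z < r1 -> G1 z <> RtoC 0).
{ intros z Hz. apply Cmult_neq_0. apply lprod_neq0. unfold l2. rewrite filter_In. destruct (Rlt_dec (Cmod z) r1); [|lra]. intuition discriminate.
  apply N. lra. }
assert (E1 : forall z, Cmod z < r1 -> F z = (lprod l1 z * G1 z)%C).
{ intros z Hz. rewrite E by lra. rewrite (lprod_inside r1). fold l1 l2. unfold G1. ring. }
destruct (holo_log G1 r1 ltac:(lra) HG1 N1) as [h [Hh Eh]].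
exists h. split; [|split; [|split]]; auto. intros z Hz; apply HF; lra. intros a Ha. now apply in_inside in Ha.
intros z Hz. destruct (Eh z Hz) as [E2 E3]. split.
- intros I. rewrite E1, lprod_in by (auto; lra). ring.
- intros I. pose proof (lprod_neq0 l1 z I) as M1. pose proof (N1 z Hz) as M2. split; [|split].
  + rewrite E1 by lra. now apply Cmult_neq_0.
  + rewrite E1 by lra. rewrite Cmod_mult, ln_mult by now apply Cmod_pos_neq. now rewrite ln_lprod, E3.
  + apply cder_C_derive. apply cder_local with (F := fun z => (lprod l1 z * G1 z)%C) (r := r1 - Cmod z). lra.
    intros w Hw. symmetry. apply E1. generalize (Cmod_rev_triangle w z). lra.
    eapply cder_eq. apply cder_mult. now apply cder_lprod. apply (holo_C_derive G1 0 r1). auto. rewrite Cmod_minus_0; lra.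
    rewrite E1, E2 by lra. field. auto.
Qed.

Lemma zsys_zrep F S l : 0 < S -> zsys F S l -> exists h, zrep F S l h.
Proof. intros HS [H1 H2]. destruct (H2 S) as [h Hh]. lra. rewrite inside_all in Hh. eauto. intros a Ha. now apply H1. Qed.

Lemma zsys_generic F S l r : zsys F S l -> (forall z, Cmod z = r -> F z <> RtoC 0) -> generic r l.
Proof. intros [H _] N a Ha E. apply (N a E). now apply H. Qed.

Lemma zsys_nonzero F S l z : zsys F S l -> Cmod z < S -> ~ In z l -> F z <> RtoC 0.
Proof.
intros H Hz N. destruct (zsys_zrep F S l) as [h [_ [_ [_ Hh]]]]; auto. generalize (Cmod_ge_0 z); lra. now apply Hh.
Qed.

Lemma zsys_in F S l z : zsys F S l -> Cmod z < S -> F z = RtoC 0 -> In z l.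
Proof. intros H Hz E. apply NNPP. intros N. eapply zsys_nonzero; eauto. Qed.

Lemma zsys_ccirc F S l r : zsys F S l -> 0 <= r < S -> generic r l -> ccirc (fun z => ln (Cmod (F z))) r.
Proof. intros H Hr G. destruct (zsys_zrep F S l) as [h Hh]; auto. lra. eapply zrep_ccirc; eauto. Qed.

Lemma zsys_mono F S l r0 r : zsys F S l -> 0 < r0 <= r -> r < S -> generic r0 l -> generic r l ->
  mn (fun z => ln (Cmod (F z))) r0 <= mn (fun z => ln (Cmod (F z))) r.
Proof. intros H Hr HS G0 G. destruct (zsys_zrep F S l) as [h Hh]; auto. lra. eapply jensen_mono; eauto. Qed.

Lemma zsys_count F S l r0 s r : zsys F S l -> 0 < r0 <= s -> s < r < S -> generic r0 l -> generic r l ->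
  ncount s l * ln (r / s) <= mn (fun z => ln (Cmod (F z))) r - mn (fun z => ln (Cmod (F z))) r0.
Proof. intros H Hr HS G0 G. destruct (zsys_zrep F S l) as [h Hh]; auto. lra. eapply jensen_count; eauto. Qed.

Lemma ln_ratio_lower s r : 0 < s <= r -> (r - s) / r <= ln (r / s).
Proof.
intros H. replace (ln (r / s)) with (- ln (s / r)) by (rewrite !ln_div by lra; ring).
generalize (ln_le_sub1 (s / r) ltac:(apply Rdiv_lt_0_compat; lra)). replace ((r - s) / r) with (1 - s / r) by (field; lra). lra.
Qed.

Lemma zsys_count' F S l r0 s r : zsys F S l -> 0 < r0 <= s -> s < r < S -> generic r0 l -> generic r l ->
  ncount s l <= r / (r - s) * (mn (fun z => ln (Cmod (F z))) r - mn (fun z => ln (Cmod (F z))) r0).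
Proof.
intros H Hr HS G0 G. pose proof (zsys_count F S l r0 s r H Hr HS G0 G) as B.
pose proof (ln_ratio_lower s r ltac:(lra)) as L. pose proof (ncount_nonneg s l).
assert (ncount s l * ((r - s) / r) <= mn (fun z => ln (Cmod (F z))) r - mn (fun z => ln (Cmod (F z))) r0) by nra.
assert (P : 0 < r / (r - s)) by (apply Rdiv_lt_0_compat; lra).
apply Rmult_le_compat_l with (r := r / (r - s)) in H1; [|lra].
replace (r / (r - s) * (ncount s l * ((r - s) / r))) with (ncount s l) in H1 by (field; lra). auto.
Qed.

Lemma avoid_finite (xs : list R) a b : a < b -> exists r, a < r < b /\ forall x, In x xs -> x <> r.
Proof.
assert (A : forall xs a b, a < b -> exists a' b', a <= a' /\ b' <= b /\ a' < b' /\ forall x, In x xs -> ~ a' < x < b').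
{ clear. induction xs as [|x xs IH]; intros a b H. exists a, b. simpl. repeat split; try lra. tauto.
  destruct (IH a b H) as [a' [b' [H1 [H2 [H3 H4]]]]].
  destruct (Rlt_dec a' x); [destruct (Rlt_dec x b')|].
  - exists x, b'. repeat split; try lra. intros y [<-|I]; [lra|]. specialize (H4 y I). lra.
  - exists a', b'. repeat split; try lra. intros y [<-|I]; [lra|]. now apply H4.
  - exists a', b'. repeat split; try lra. intros y [<-|I]; [lra|]. now apply H4. }
intros H. destruct (A xs a b H) as [a' [b' [H1 [H2 [H3 H4]]]]]. exists ((a' + b') / 2). split. lra.
intros x I E. apply (H4 x I). lra.
Qed.

(** The candidates are [2 * eps] apart, so an element of [xs] comes within [eps] of at most one of
    them. *)
Lemma pigeonhole_separated (xs : list R) eps a (js : list nat) : 0 < eps -> NoDup js -> (length xs < length js)%nat ->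
  exists j, In j js /\ forall x, In x xs -> eps <= Rabs (x - (a + 2 * eps * INR j)).
Proof.
intros He. revert js. induction xs as [|x xs IH]; intros js ND HL.
- destruct js as [|j js]; simpl in HL; [lia|]. exists j. split. now left. simpl; tauto.
- destruct (classic (exists j, In j js /\ Rabs (x - (a + 2 * eps * INR j)) < eps)) as [[j0 [I0 H0]]|H].
  + destruct (in_split _ _ I0) as [l1 [l2 ->]]. pose proof (NoDup_remove_1 _ _ _ ND) as ND1. pose proof (NoDup_remove_2 _ _ _ ND) as ND2.
    destruct (IH (l1 ++ l2) ND1) as [j [Ij Hj]]. { rewrite length_app in *. simpl in HL. lia. }
    exists j. split. apply in_app_iff in Ij. apply in_app_iff. simpl. tauto.
    intros y [<-|Iy]; auto.
    assert (Nj : j <> j0) by (intros ->; auto).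
    assert (1 <= Rabs (INR j - INR j0)).
    { destruct (Nat.lt_total j j0) as [L|[L|L]]; [|lia|].
      - apply le_INR in L. rewrite S_INR in L. rewrite Rabs_left1; lra.
      - apply le_INR in L. rewrite S_INR in L. rewrite Rabs_pos_eq; lra. }
    assert (2 * eps * Rabs (INR j - INR j0) <= Rabs (x - (a + 2 * eps * INR j)) + Rabs (x - (a + 2 * eps * INR j0))).
    { rewrite <- (Rabs_pos_eq (2 * eps)) at 1 by lra. rewrite <- Rabs_mult.
      replace (2 * eps * (INR j - INR j0)) with (- (x - (a + 2 * eps * INR j)) + (x - (a + 2 * eps * INR j0))) by ring.
      eapply Rle_trans. apply Rabs_triang. rewrite Rabs_Ropp. lra. }
    nra.
  + destruct (IH js ND) as [j [Ij Hj]]. simpl in HL; lia. exists j. split; auto.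
    intros y [<-|Iy]; auto. apply Rnot_lt_le. intros Hlt. apply H. eauto.
Qed.

(** Separation from [xs] has to be quantitative, for logarithmic derivatives; from [ys] it only has
    to be strict, for the continuity of means. One of n + 1 candidates spaced by [4 * eps] keeps
    distance [2 * eps] from [xs], and a shift by less than [eps] then avoids [ys]. *)
Lemma good_radius (xs ys : list R) a : exists r, a < r < a + 1 /\
  (forall x, In x xs -> / (8 * (INR (length xs) + 1)) <= Rabs (x - r)) /\ forall y, In y ys -> y <> r.
Proof.
set (n := length xs). set (eps := / (8 * (INR n + 1))). pose proof (pos_INR n).
assert (He : 0 < eps) by (apply Rinv_0_lt_compat; lra).
assert (En : eps * (8 * (INR n + 1)) = 1) by (unfold eps; field; lra).
destruct (pigeonhole_separated xs (2 * eps) a (seq 0 (S n))) as [j [Ij Hj]]. lra. apply seq_NoDup. rewrite length_seq. unfold n; lia.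
destruct (avoid_finite ys (a + 2 * (2 * eps) * INR j) (a + 2 * (2 * eps) * INR j + eps)) as [r [Hr Hy]]. lra.
apply in_seq in Ij. assert (INR j <= INR n) by (apply le_INR; lia). pose proof (pos_INR j).
exists r. split; [|split]; auto.
- split. nra. nra.
- intros x Hx. specialize (Hj x Hx). apply Rabs_def2 in Hr || idtac.
  assert (Rabs (x - (a + 2 * (2 * eps) * INR j)) <= Rabs (x - r) + Rabs (r - (a + 2 * (2 * eps) * INR j))).
  { replace (x - (a + 2 * (2 * eps) * INR j)) with ((x - r) + (r - (a + 2 * (2 * eps) * INR j))) by ring. apply Rabs_triang. }
  rewrite (Rabs_pos_eq (r - _)) in H2 by lra. lra.
Qed.

(** * The characteristic of a quotient P / Q *)

Definition lr (P Q : C -> C) (z : C) : R := ln (Cmod (P z)) - ln (Cmod (Q z)).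

(* mean of ln max (|P|, |Q|) *)
Definition charT (P Q : C -> C) (r : R) : R :=
  (mn (fun z => ln (Cmod (P z))) r + mn (fun z => ln (Cmod (Q z))) r + mn (fun z => Rabs (lr P Q z)) r) / 2.

Lemma charT_ge P Q r : ccirc (fun z => ln (Cmod (P z))) r -> ccirc (fun z => ln (Cmod (Q z))) r ->
  mn (fun z => ln (Cmod (P z))) r <= charT P Q r /\ mn (fun z => ln (Cmod (Q z))) r <= charT P Q r.
Proof.
intros HP HQ. pose proof (mn_abs (lr P Q) r ltac:(now apply ccirc_minus)) as B. unfold charT.
replace (mn (lr P Q) r) with (mn (fun z => ln (Cmod (P z))) r - mn (fun z => ln (Cmod (Q z))) r) in B by (symmetry; now apply mn_minus).
apply Rabs_le_between in B. lra.
Qed.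

(* [cP] does not depend on the disc on which f = P / Q, because Q is normalised on the circle of radius r0. *)
Record frac_sys (P Q : C -> C) (S r0 cP : R) (lP lQ : list C) : Prop := {
  fs_P : zsys P S lP; fs_Q : zsys Q S lQ; fs_r0 : 0 < r0 < 1;
  fs_gP : generic r0 lP; fs_gQ : generic r0 lQ;
  fs_cP : mn (fun z => ln (Cmod (P z))) r0 = cP; fs_cQ : mn (fun z => ln (Cmod (Q z))) r0 = 0 }.

(** The means of ln |P| and ln |Q| increase with the radius, so they are at least [cP] and 0; the
    definition of [charT] turns this into a bound for the mean of |lr|. *)
Lemma frac_sys_abs P Q S r0 cP lP lQ r : frac_sys P Q S r0 cP lP lQ -> 1 <= r < S -> generic r lP -> generic r lQ ->
  mn (fun z => Rabs (lr P Q z)) r <= 2 * charT P Q r - cP /\ cP <= charT P Q r /\ 0 <= charT P Q r.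
Proof.
intros [HP HQ H0 GP GQ EP EQ] Hr G1 G2.
pose proof (zsys_mono P S lP r0 r HP ltac:(lra) ltac:(lra) GP G1) as M1.
pose proof (zsys_mono Q S lQ r0 r HQ ltac:(lra) ltac:(lra) GQ G2) as M2.
destruct (charT_ge P Q r) as [C1 C2]. eapply zsys_ccirc; eauto; lra. eapply zsys_ccirc; eauto; lra.
split; [|split]; try lra. unfold charT. lra.
Qed.

Lemma mn_nonneg F r : ccirc F r -> (forall t, 0 <= F (circ r t)) -> 0 <= mn F r.
Proof. intros H1 H2. rewrite <- (mn_const 0 r). apply mn_le; auto. apply ccirc_const. Qed.

(** The logarithmic difference with everything expressed by [charT]: the mean of |lr| on |z| = R
    directly, the numbers of zeros in |z| < R by Jensen's formula on |z| = R2. *)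
Theorem small_quotient P Q S r0 cP lP lQ c r R R2 M :
  frac_sys P Q S r0 cP lP lQ -> 1 <= r -> r < R -> R < R2 -> R2 < S -> 2 * Cmod c <= R - r ->
  shift_generic r c lP -> shift_generic r c lQ -> generic R lP -> generic R lQ -> generic R2 lP -> generic R2 lQ ->
  (forall x, Cmod x <> r -> mn (nearness (Cmod c) x) r <= M) ->
  ccirc (fun z => Rabs (lr P Q (z + c)%C - lr P Q z)) r /\
  mn (fun z => Rabs (lr P Q (z + c)%C - lr P Q z)) r <=
    4 * Cmod c / (R - r) * (2 * charT P Q R - cP) + 4 * M * (R2 / (R2 - R)) * (2 * charT P Q R2 - cP).
Proof.
intros HS Hr HR HR2 HR2S Hc SP SQ GP GQ GP2 GQ2 HM.
pose proof HS as [HP HQ H0 GP0 GQ0 EP EQ].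
destruct (zsys_zrep P S lP ltac:(lra) HP) as [hP RP]. destruct (zsys_zrep Q S lQ ltac:(lra) HQ) as [hQ RQ].
destruct (log_difference P Q lP hP lQ hQ c S R r M RP RQ) as [C1 [C2 B]]; auto; try lra.
change (fun z => Rabs (ln (Cmod (P (z + c)%C)) - ln (Cmod (Q (z + c)%C)) - (ln (Cmod (P z)) - ln (Cmod (Q z))))) with
 (fun z => Rabs (lr P Q (z + c)%C - lr P Q z)) in B.
split. apply ccirc_abs. now apply ccirc_minus.
destruct (frac_sys_abs _ _ _ _ _ _ _ R HS ltac:(lra) GP GQ) as [A1 [A2 A3]].
pose proof (zsys_count' P S lP r0 R R2 HP ltac:(lra) ltac:(lra) GP0 GP2) as N1.
pose proof (zsys_count' Q S lQ r0 R R2 HQ ltac:(lra) ltac:(lra) GQ0 GQ2) as N2.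
destruct (charT_ge P Q R2) as [T1 T2]. eapply zsys_ccirc; eauto; lra. eapply zsys_ccirc; eauto; lra.
assert (Hc0 := Cmod_ge_0 c).
assert (M0 : 0 <= M).
{ destruct (Rlt_dec r (r + 1)) as [L|]; [|lra]. 
  assert (Nx : Cmod (RtoC (r + 1)) <> r) by (rewrite Cmod_RtoC_pos; lra).
  eapply Rle_trans; [|apply (HM _ Nx)]. apply mn_nonneg. apply ccirc_nearness; lra.
  intros t. apply nearness_nonneg; auto. intros E. apply Nx. rewrite <- E. apply Cmod_circ; lra. }
assert (Pq : 0 < R2 / (R2 - R)) by (apply Rdiv_lt_0_compat; lra).
eapply Rle_trans. apply B. apply Rplus_le_compat.
- apply Rmult_le_compat_l. apply Rmult_le_pos. lra. left; apply Rinv_0_lt_compat; lra. exact A1.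
- rewrite !Rmult_assoc. apply Rmult_le_compat_l. lra. apply Rmult_le_compat_l; auto.
  rewrite EP in N1. rewrite EQ in N2. nra.
Qed.

(** * Local divisibility *)

(** Divisibility by (w - z)^n rather than an order, so that functions that vanish identically need
    no separate case. *)
Definition dv (F : C -> C) (z : C) (n : nat) : Prop :=
  exists r G, 0 < r /\ holo_on_disc G z r /\ forall w, Cmod (w - z) < r -> F w = ((w - z) ^ n * G w)%C.

Lemma dv_holo F z r : 0 < r -> holo_on_disc F z r -> dv F z 0.
Proof. intros Hr H. exists r, F. split; [|split]; auto. intros; simpl; ring. Qed.

Lemma dv_mult F G z n m : dv F z n -> dv G z m -> dv (fun w => F w * G w)%C z (n + m).
Proof.
intros [r1 [F1 [H1 [H2 H3]]]] [r2 [G1 [K1 [K2 K3]]]]. exists (Rmin r1 r2), (fun w => F1 w * G1 w)%C.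
pose proof (Rmin_l r1 r2). pose proof (Rmin_r r1 r2).
split; [|split]. now apply Rmin_pos. apply holo_mult; hm.
intros w Hw. rewrite H3, K3, Cpow_add_r by lra. ring.
Qed.

Lemma dv_minus F G z n : dv F z n -> dv G z n -> dv (fun w => F w - G w)%C z n.
Proof.
intros [r1 [F1 [H1 [H2 H3]]]] [r2 [G1 [K1 [K2 K3]]]]. exists (Rmin r1 r2), (fun w => F1 w - G1 w)%C.
pose proof (Rmin_l r1 r2). pose proof (Rmin_r r1 r2).
split; [|split]. now apply Rmin_pos. apply holo_minus; hm.
intros w Hw. rewrite H3, K3 by lra. ring.
Qed.

Lemma dv_le F z n m : (m <= n)%nat -> dv F z n -> dv F z m.
Proof.
intros L [r [G [H1 [H2 H3]]]]. exists r, (fun w => (w - z) ^ (n - m) * G w)%C. split; [|split]; auto.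
apply holo_mult; auto. apply holo_pow. intros w Hw. rewrite H3 by auto. replace n with (m + (n - m))%nat at 1 by lia.
rewrite Cpow_add_r. ring.
Qed.

Lemma dv_root F z r : 0 < r -> holo_on_disc F z r -> F z = RtoC 0 -> dv F z 1.
Proof.
intros Hr H E. destruct (divide_root F z r z H) as [G [HG EG]]; auto. rewrite Cmod_minus_self; auto.
exists r, G. split; [|split]; auto. intros w Hw. rewrite EG by auto. simpl. ring.
Qed.

Lemma cder_pow z n : forall w, cder (fun w => (w - z) ^ S n)%C w (RtoC (INR (S n)) * (w - z) ^ n)%C.
Proof.
induction n; intros w.
- eapply cder_ext; [|eapply cder_eq; [apply (cder_minus (fun w => w) (fun _ => z)); [apply cder_id|apply cder_const]|]].
  intros; cbv beta; simpl; ring. simpl; ring.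
- eapply cder_ext; [|eapply cder_eq; [apply (cder_mult (fun w => w - z)%C (fun w => (w - z) ^ S n)%C); [apply (cder_minus (fun w => w) (fun _ => z)); [apply cder_id|apply cder_const]|apply IHn]|]].
  intros; reflexivity. cbv beta. rewrite (S_INR (S n)), RtoC_plus. simpl. ring.
Qed.

Lemma dv_derive F z n : dv F z n -> dv (C_derive F) z (n - 1).
Proof.
intros [r [G [H1 [H2 H3]]]].
assert (HG' : holo_on_disc (C_derive G) z r) by now apply derivative_cdiff.
assert (HF : forall w l, Cmod (w - z) < r -> cder (fun w => (w - z) ^ n * G w)%C w l -> C_derive F w = l).
{ intros w l Hw Hl. apply cder_C_derive. apply (cder_local (fun w => (w - z) ^ n * G w)%C) with (r := r - Cmod (w - z)); auto. lra.
  intros v Hv. symmetry. apply H3. generalize (Cmod_diff_triangle v w z). lra. }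
destruct n as [|n].
- exists r, (C_derive G). split; [|split]; auto. intros w Hw. rewrite (HF w (C_derive G w) Hw). simpl; ring.
  eapply cder_ext; [|apply (holo_C_derive G z r w H2 Hw)]. intros; simpl; ring.
- exists r, (fun w => RtoC (INR (S n)) * G w + (w - z) * C_derive G w)%C. split; [|split]; auto.
  + apply holo_plus; apply holo_mult; auto. apply holo_const. apply holo_minus. intros w _; apply cdiff_id. apply holo_const.
  + intros w Hw. rewrite (HF w (RtoC (INR (S n)) * (w - z) ^ n * G w + (w - z) ^ S n * C_derive G w)%C Hw).
    replace (S n - 1)%nat with n by lia. rewrite (Cpow_S _ n). ring.
    apply cder_mult. apply cder_pow. now apply (holo_C_derive G z r).
Qed.

Lemma dv_ext F G z n r : 0 < r -> (forall w, Cmod (w - z) < r -> F w = G w) -> dv F z n -> dv G z n.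
Proof.
intros Hr E [s [G1 [H1 [H2 H3]]]]. exists (Rmin s r), G1. pose proof (Rmin_l s r). pose proof (Rmin_r s r).
split; [|split]. now apply Rmin_pos. hm. intros w Hw. rewrite <- E by lra. apply H3. lra.
Qed.

Lemma dv_cancel F G z n r : 0 < r -> holo_on_disc G z r -> G z <> RtoC 0 -> dv (fun w => F w * G w)%C z n -> dv F z n.
Proof.
intros Hr HG N [s [H [H1 [H2 H3]]]]. destruct (ccont_nonzero_near G z) as [d [Hd Kd]]; auto. now apply (holo_ccont_center G z r).
destruct (near_radius (s :: r :: d :: nil)) as [e [He Ke]]. { simpl. intros x [<-|[<-|[<-|[]]]]; auto. }
pose proof (Ke s ltac:(simpl; auto)). pose proof (Ke r ltac:(simpl; auto)). pose proof (Ke d ltac:(simpl; auto)).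
exists e, (fun w => H w / G w)%C. split; [|split]; auto.
apply holo_div; try hm. intros; apply Kd; lra.
intros w Hw. specialize (H3 w ltac:(lra)). pose proof (Kd w ltac:(lra)).
replace (F w) with (F w * G w / G w)%C by (field; auto). rewrite H3. unfold Cdiv. ring.
Qed.

Definition exact_order (F : C -> C) (z : C) (n : nat) : Prop :=
  exists r G, 0 < r /\ holo_on_disc G z r /\ forall w, Cmod (w - z) < r -> G w <> RtoC 0 /\ F w = ((w - z) ^ n * G w)%C.

Lemma exact_order_dv F z n : exact_order F z n -> dv F z n.
Proof. intros [r [G [H1 [H2 H3]]]]. exists r, G. split; [|split]; auto. intros w Hw. now apply H3. Qed.

Lemma exact_order_zero F z n : exact_order F z n -> (F z = RtoC 0 <-> n <> 0%nat).
Proof.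
intros [r [G [H1 [H2 H3]]]]. destruct (H3 z) as [N E]. rewrite Cmod_minus_self; auto. rewrite E, Cminus_diag.
destruct n. simpl. split; [|lia]. intros E0. exfalso. apply N. rewrite <- E0. ring. 
rewrite Cpow_0_S. split; [lia|]. intros; ring.
Qed.

Theorem quotient_extension (F G : C -> C) X :
  holo_on_disc F 0 X -> holo_on_disc G 0 X ->
  (forall z, Cmod z < X -> exists n, exact_order G z n /\ dv F z n) ->
  exists E, holo_on_disc E 0 X /\ forall z, Cmod z < X -> F z = (E z * G z)%C.
Proof.
intros HF HG H.
destruct (glue_disc (fun w => F w / G w)%C X) as [E HE].
{ intros z Hz. destruct (H z Hz) as [n [[r [G1 [Hr [HG1 E1]]]] [s [F1 [Hs [HF1 E2]]]]]].
  pose proof (Rmin_l r s). pose proof (Rmin_r r s).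
  exists (Rmin r s), (fun w => F1 w / G1 w)%C. split; [|split]. now apply Rmin_pos.
  apply holo_div; try hm. intros w Hw. apply E1. lra.
  intros w Hw. destruct (E1 w ltac:(lra)) as [N ->]. rewrite E2 by lra. field. split; auto. apply Cpow_neq0. now apply punct_neq. }
exists E. split.
- intros z Hz. rewrite Cmod_minus_0 in Hz. destruct (H z Hz) as [n [[r [G1 [Hr [HG1 E1]]]] [s [F1 [Hs [HF1 E2]]]]]].
  pose proof (Rmin_l r s). pose proof (Rmin_r r s).
  apply (HE z (Rmin r s) (fun w => F1 w / G1 w)%C); auto. now apply Rmin_pos.
  apply holo_div; try hm. intros w Hw. apply E1. lra.
  intros w Hw. destruct (E1 w ltac:(lra)) as [N ->]. rewrite E2 by lra. field. split; auto. apply Cpow_neq0. now apply punct_neq.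
- intros z Hz. destruct (H z Hz) as [n [[r [G1 [Hr [HG1 E1]]]] [s [F1 [Hs [HF1 E2]]]]]].
  pose proof (Rmin_l r s). pose proof (Rmin_r r s).
  destruct (HE z (Rmin r s) (fun w => F1 w / G1 w)%C) as [V _]; auto. now apply Rmin_pos.
  apply holo_div; try hm. intros w Hw. apply E1. lra.
  intros w Hw. destruct (E1 w ltac:(lra)) as [N ->]. rewrite E2 by lra. field. split; auto. apply Cpow_neq0. now apply punct_neq.
  destruct (E1 z) as [N EG]. rewrite Cmod_minus_self; auto. rewrite V, EG, E2 by (rewrite Cmod_minus_self; auto). field. auto.
Qed.

(** * The Wronskian inequality *)

Section Wronskian.
Variables (P Q k0 k1 k2 : C -> C) (d : C) (S : R).
Hypothesis HS : 0 < S.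
Hypothesis HP : holo_on_disc P 0 S.
Hypothesis HQ : holo_on_disc Q 0 S.
Hypothesis Hk0 : forall z, cdiff k0 z.
Hypothesis Hk1 : forall z, cdiff k1 z.
Hypothesis Hk2 : forall z, cdiff k2 z.
Hypothesis Hcop : forall z, Cmod z < S -> P z = RtoC 0 -> Q z = RtoC 0 -> False.

Definition w1 z := (P z - Q z)%C.
Definition w2 z := (k0 z * P z - Q z)%C.
Definition w3 z := (k0 z * k1 z * P z - Q z)%C.
Definition cA z := (k0 z - k0 z * k1 z)%C.
Definition cB z := (k0 z * k1 z - 1)%C.
Definition cC z := (1 - k0 z)%C.
Definition p1 z := (cA z * w1 z)%C.
Definition p2 z := (cB z * w2 z)%C.
Definition p3 z := (cC z * w3 z)%C.
Definition Wr z := (p1 z * C_derive p2 z - p2 z * C_derive p1 z)%C.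
(** A factor for each way in which [w1], [w2], [w3] can vanish: [k0 - d], [k1 - d], [k2 - d] at the
    1-points of f and their translates, [k0 * k1] where Q = 0, and [k0 - 1] for points where all
    three vanish. *)
Definition Sig z := ((k0 z - d) * (k0 z - 1) * ((k1 z - d) * (k2 z - d) * (k0 z * k1 z)))%C.

Hypothesis O1 : forall z, Cmod z < S -> w1 z = RtoC 0 -> Q z <> RtoC 0 -> k0 z = d.
Hypothesis O2 : forall z, Cmod z < S -> w2 z = RtoC 0 -> Q z <> RtoC 0 -> k1 z = d.
Hypothesis O3 : forall z, Cmod z < S -> w3 z = RtoC 0 -> Q z <> RtoC 0 -> k2 z = d.

Lemma p_sum z : (p1 z + p2 z + p3 z = 0)%C.
Proof. unfold p1, p2, p3, w1, w2, w3, cA, cB, cC. ring. Qed.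

Lemma cdiff_cA z : cdiff cA z. Proof. apply cdiff_minus; auto. apply cdiff_mult; auto. Qed.
Lemma cdiff_cB z : cdiff cB z. Proof. apply cdiff_minus. apply cdiff_mult; auto. apply cdiff_const. Qed.
Lemma cdiff_cC z : cdiff cC z. Proof. apply cdiff_minus; auto. apply cdiff_const. Qed.
Lemma holo_w1 : holo_on_disc w1 0 S. Proof. apply holo_minus; auto. Qed.
Lemma holo_w2 : holo_on_disc w2 0 S. Proof. apply holo_minus; auto. apply holo_mult; auto. intros z _; auto. Qed.
Lemma holo_w3 : holo_on_disc w3 0 S. Proof. apply holo_minus; auto. apply holo_mult; auto. intros z _; apply cdiff_mult; auto. Qed.
Lemma holo_p1 : holo_on_disc p1 0 S. Proof. apply holo_mult. intros z _; apply cdiff_cA. apply holo_w1. Qed.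
Lemma holo_p2 : holo_on_disc p2 0 S. Proof. apply holo_mult. intros z _; apply cdiff_cB. apply holo_w2. Qed.
Lemma holo_p3 : holo_on_disc p3 0 S. Proof. apply holo_mult. intros z _; apply cdiff_cC. apply holo_w3. Qed.
Lemma holo_Wr : holo_on_disc Wr 0 S.
Proof.
apply holo_minus; apply holo_mult.
exact holo_p1. apply derivative_cdiff, holo_p2. exact holo_p2. apply derivative_cdiff, holo_p1.
Qed.
Lemma cdiff_Sig z : cdiff Sig z.
Proof.
assert (M : forall k e, (forall z, cdiff k z) -> cdiff (fun z => k z - e)%C z) by (intros; apply cdiff_minus; auto; apply cdiff_const).
apply (cdiff_mult (fun z => (k0 z - d) * (k0 z - 1))%C (fun z => (k1 z - d) * (k2 z - d) * (k0 z * k1 z))%C).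
apply cdiff_mult; apply M; auto.
apply (cdiff_mult (fun z => (k1 z - d) * (k2 z - d))%C (fun z => k0 z * k1 z)%C).
apply cdiff_mult; apply M; auto. apply cdiff_mult; auto.
Qed.

Lemma derive_p3 z : Cmod z < S -> C_derive p3 z = (- (C_derive p1 z + C_derive p2 z))%C.
Proof.
intros Hz. rewrite <- Cmod_minus_0 in Hz. apply cder_C_derive. apply (cder_ext (fun z => - (p1 z + p2 z))%C).
intros w. pose proof (p_sum w). replace (p3 w) with (p1 w + p2 w + p3 w - (p1 w + p2 w))%C by ring. rewrite H. ring.
apply cder_opp. apply cder_plus; eapply holo_C_derive; eauto. apply holo_p1. apply holo_p2.
Qed.

Lemma Wr_23 z : Cmod z < S -> Wr z = (p2 z * C_derive p3 z - p3 z * C_derive p2 z)%C.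
Proof.
intros Hz. rewrite derive_p3 by auto. pose proof (p_sum z) as E.
replace (p3 z) with (p1 z + p2 z + p3 z - (p1 z + p2 z))%C by ring. rewrite E. unfold Wr. ring.
Qed.
Lemma Wr_31 z : Cmod z < S -> Wr z = (p3 z * C_derive p1 z - p1 z * C_derive p3 z)%C.
Proof.
intros Hz. rewrite derive_p3 by auto. pose proof (p_sum z) as E.
replace (p3 z) with (p1 z + p2 z + p3 z - (p1 z + p2 z))%C by ring. rewrite E. unfold Wr. ring.
Qed.

Lemma dv_wronskian F G z n m : dv F z n -> dv G z m -> dv (fun z => F z * C_derive G z - G z * C_derive F z)%C z (n + m - 1).
Proof.
intros H1 H2. apply dv_minus.
- apply dv_le with (n + (m - 1))%nat. lia. apply dv_mult; auto. now apply dv_derive.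
- apply dv_le with (m + (n - 1))%nat. lia. apply dv_mult; auto. now apply dv_derive.
Qed.

Lemma Sig_zero z : Cmod z < S -> w1 z = RtoC 0 \/ w2 z = RtoC 0 \/ w3 z = RtoC 0 -> Sig z = RtoC 0.
Proof.
intros Hz H. unfold Sig.
assert (NP : Q z = RtoC 0 -> P z <> RtoC 0) by (intros E1 E2; now apply (Hcop z)).
destruct (Ceq_dec (Q z) 0) as [EQ|NQ].
- destruct H as [H|[H|H]].
  + exfalso. apply (NP EQ). unfold w1 in H. rewrite EQ in H. rewrite <- H. ring.
  + assert (E : (k0 z * P z)%C = RtoC 0) by (unfold w2 in H; rewrite EQ in H; rewrite <- H; ring).
    destruct (Ceq_dec (k0 z) 0) as [E0|N0]. rewrite E0; ring. exfalso. now apply (Cmult_neq_0 _ _ N0 (NP EQ)).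
  + assert (E : (k0 z * k1 z * P z)%C = RtoC 0) by (unfold w3 in H; rewrite EQ in H; rewrite <- H; ring).
    destruct (Ceq_dec (k0 z * k1 z) 0) as [E0|N0]. rewrite E0; ring. exfalso. now apply (Cmult_neq_0 _ _ N0 (NP EQ)).
- destruct H as [H|[H|H]].
  + rewrite (O1 z) by auto. ring.
  + rewrite (O2 z) by auto. ring.
  + rewrite (O3 z) by auto. ring.
Qed.

Lemma entire_dv F z : (forall w, cdiff F w) -> dv F z 0.
Proof. intros H. apply (dv_holo F z 1). lra. intros w _; auto. Qed.

Lemma disc_dv F z : holo_on_disc F 0 S -> Cmod z < S -> dv F z 0.
Proof. intros H Hz. apply (dv_holo F z (S - Cmod z)). lra. eapply holo_sub; eauto. rewrite Cmod_minus_0. lra. Qed.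

(** Written with any two of [p1], [p2], [p3], the Wronskian vanishes to the sum of their orders
    minus one. If one of the three orders is 0, a zero of [Sig] supplies the missing one. If all are
    positive, (k0 - 1) P = w2 - w1 with P nonzero makes [k0 - 1] vanish to the smaller of [n1] and
    [n2], and [k0 - d] adds one. *)
Lemma Sig_Wr_divisible z n1 n2 n3 : Cmod z < S -> exact_order w1 z n1 -> exact_order w2 z n2 -> exact_order w3 z n3 ->
  dv (fun z => Sig z * Wr z)%C z (n1 + n2 + n3).
Proof.
intros Hz X1 X2 X3.
pose proof (exact_order_zero _ _ _ X1) as Z1. pose proof (exact_order_zero _ _ _ X2) as Z2. pose proof (exact_order_zero _ _ _ X3) as Z3.
assert (D1 : dv p1 z n1). { apply (dv_mult cA w1 z 0 n1). apply entire_dv, cdiff_cA. now apply exact_order_dv. }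
assert (D2 : dv p2 z n2). { apply (dv_mult cB w2 z 0 n2). apply entire_dv, cdiff_cB. now apply exact_order_dv. }
assert (D3 : dv p3 z n3). { apply (dv_mult cC w3 z 0 n3). apply entire_dv, cdiff_cC. now apply exact_order_dv. }
assert (near : forall w, Cmod (w - z) < S - Cmod z -> Cmod w < S) by (intros w Hw; generalize (Cmod_rev_triangle w z); lra).
assert (V12 : dv Wr z (n1 + n2 - 1)) by (apply (dv_wronskian p1 p2); auto).
assert (V23 : dv Wr z (n2 + n3 - 1)).
{ eapply dv_ext; [| |apply (dv_wronskian p2 p3 z n2 n3 D2 D3)]. instantiate (1 := S - Cmod z). lra.
  intros w Hw. symmetry. apply Wr_23; auto. }
assert (V31 : dv Wr z (n3 + n1 - 1)).
{ eapply dv_ext; [| |apply (dv_wronskian p3 p1 z n3 n1 D3 D1)]. instantiate (1 := S - Cmod z). lra.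
  intros w Hw. symmetry. apply Wr_31; auto. }
destruct (Nat.eq_dec (n1 + n2 + n3) 0) as [EN|NN].
{ rewrite EN. apply (dv_mult Sig Wr z 0 0). apply entire_dv, cdiff_Sig. apply disc_dv; auto. apply holo_Wr. }
assert (SZ : dv Sig z 1).
{ apply (dv_root Sig z 1). lra. intros w _; apply cdiff_Sig. apply Sig_zero; auto.
  destruct n1; [|left; apply Z1; lia]. destruct n2; [|right; left; apply Z2; lia]. right; right; apply Z3; lia. }
destruct (Nat.eq_dec n1 0) as [E1|M1]; [|destruct (Nat.eq_dec n2 0) as [E2|M2]; [|destruct (Nat.eq_dec n3 0) as [E3|M3]]].
- apply dv_le with (1 + (n2 + n3 - 1))%nat. lia. now apply (dv_mult Sig Wr).
- apply dv_le with (1 + (n3 + n1 - 1))%nat. lia. now apply (dv_mult Sig Wr).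
- apply dv_le with (1 + (n1 + n2 - 1))%nat. lia. now apply (dv_mult Sig Wr).
- assert (W1 : w1 z = RtoC 0) by (apply Z1; auto).
  assert (NQ : Q z <> RtoC 0). { intros E. apply (Hcop z); auto. unfold w1 in W1. rewrite E in W1. rewrite <- W1. ring. }
  assert (NP : P z <> RtoC 0). { intros E. apply NQ. unfold w1 in W1. rewrite E in W1. replace (Q z) with (- (0 - Q z))%C by ring. rewrite W1. ring. }
  assert (DM : forall n, (n <= n1)%nat -> (n <= n2)%nat -> dv (fun w => k0 w - 1)%C z n).
  { intros n L1 L2. apply (dv_cancel _ P z n (S - Cmod z)); auto. lra. eapply holo_sub; eauto. rewrite Cmod_minus_0. lra.
    apply (dv_ext (fun w => w2 w - w1 w)%C) with (r := 1). lra. intros; unfold w1, w2; ring.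
    apply dv_minus. apply dv_le with n2; auto. now apply exact_order_dv. apply dv_le with n1; auto. now apply exact_order_dv. }
  assert (DD : dv (fun w => k0 w - d)%C z 1).
  { apply (dv_root _ z 1). lra. intros w _. apply cdiff_minus; auto. apply cdiff_const. rewrite (O1 z); auto. ring. }
  assert (DR : dv (fun z => (k1 z - d) * (k2 z - d) * (k0 z * k1 z))%C z 0).
  { apply entire_dv. intros w. apply (cdiff_mult (fun z => (k1 z - d) * (k2 z - d))%C (fun z => k0 z * k1 z)%C).
    apply cdiff_mult; apply cdiff_minus; auto; apply cdiff_const. apply cdiff_mult; auto. }
  assert (DS : forall n, (n <= n1)%nat -> (n <= n2)%nat -> dv Sig z (1 + n)).
  { intros n L1 L2. replace (1 + n)%nat with (1 + n + 0)%nat by lia.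
    apply (dv_mult (fun z => (k0 z - d) * (k0 z - 1))%C (fun z => (k1 z - d) * (k2 z - d) * (k0 z * k1 z))%C); auto.
    apply (dv_mult (fun z => (k0 z - d))%C (fun z => (k0 z - 1))%C); auto. }
  destruct (Nat.le_gt_cases n1 n2).
  + apply dv_le with (1 + n1 + (n2 + n3 - 1))%nat. lia. apply (dv_mult Sig Wr); auto.
  + apply dv_le with (1 + n2 + (n3 + n1 - 1))%nat. lia. apply (dv_mult Sig Wr); auto. apply DS; lia.
Qed.

Definition small (z : C) : R := Rabs (ln (Cmod (k0 z))) + Rabs (ln (Cmod (k1 z))) + Rabs (ln (Cmod (k2 z))).

Lemma Cmod_le_exp k : Cmod k <= exp (Rabs (ln (Cmod k))).
Proof.
destruct (Req_dec (Cmod k) 0) as [->|N]. left; apply exp_pos.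
assert (0 < Cmod k) by (generalize (Cmod_ge_0 k); lra). rewrite <- (exp_ln (Cmod k)) at 1 by auto.
destruct (Rle_abs (ln (Cmod k))) as [L|L]. left; now apply exp_increasing. rewrite <- L. lra.
Qed.

Lemma exp_le x y : x <= y -> exp x <= exp y.
Proof. intros [H|H]. left; now apply exp_increasing. subst; lra. Qed.

Lemma small_bounds z : exists E, E = exp (small z) /\ 1 <= E /\ Cmod (k0 z) <= E /\ Cmod (k1 z) <= E /\ Cmod (k2 z) <= E.
Proof.
exists (exp (small z)). split; auto. unfold small.
pose proof (Rabs_pos (ln (Cmod (k0 z)))). pose proof (Rabs_pos (ln (Cmod (k1 z)))). pose proof (Rabs_pos (ln (Cmod (k2 z)))).
split. rewrite <- exp_0. apply exp_le. lra.
split; [|split]; (eapply Rle_trans; [apply Cmod_le_exp|apply exp_le; lra]).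
Qed.

Lemma Cmod_minus_le x y : Cmod (x - y) <= Cmod x + Cmod y.
Proof. eapply Rle_trans. apply Cmod_triangle. now rewrite Cmod_opp; lra. Qed.

Lemma coefficient_bounds z : Cmod (cA z) + Cmod (cB z) <= 4 * exp (2 * small z) /\ 1 + Cmod (k0 z) <= 2 * exp (small z) /\
  Cmod (Sig z) <= 2 * (1 + Cmod d) ^ 3 * exp (6 * small z).
Proof.
destruct (small_bounds z) as [E [EE [E1 [B0 [B1 B2]]]]].
replace (exp (2 * small z)) with (E ^ 2). replace (exp (6 * small z)) with (E ^ 6). rewrite <- EE.
2: rewrite EE; simpl; rewrite Rmult_1_r, <- !exp_plus; f_equal; ring. 2: rewrite EE; simpl; rewrite Rmult_1_r, <- !exp_plus; f_equal; ring.
pose proof (Cmod_ge_0 (k0 z)). pose proof (Cmod_ge_0 (k1 z)). pose proof (Cmod_ge_0 (k2 z)). pose proof (Cmod_ge_0 d).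
assert (B01 : Cmod (k0 z * k1 z) <= E ^ 2). { rewrite Cmod_mult. simpl. rewrite Rmult_1_r. apply Rmult_le_compat; auto. }
assert (E2 : E <= E ^ 2) by (simpl; nra).
split; [|split].
- unfold cA, cB. pose proof (Cmod_minus_le (k0 z) (k0 z * k1 z)). pose proof (Cmod_minus_le (k0 z * k1 z) 1). rewrite Cmod_1 in H4. lra.
- lra.
- unfold Sig. rewrite !Cmod_mult.
  assert (X : forall k, Cmod k <= E -> Cmod (k - d) <= (1 + Cmod d) * E). { intros k Hk. eapply Rle_trans. apply Cmod_minus_le. nra. }
  assert (Y : Cmod (k0 z - 1) <= 2 * E). { eapply Rle_trans. apply Cmod_minus_le. rewrite Cmod_1. lra. }
  rewrite Cmod_mult in B01.
  replace (2 * (1 + Cmod d) ^ 3 * E ^ 6) with ((1 + Cmod d) * E * (2 * E) * ((1 + Cmod d) * E * ((1 + Cmod d) * E) * E ^ 2)) by ring.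
  assert (PE : 0 <= E ^ 2) by nra.
  repeat (apply Rmult_le_compat; auto; try apply Cmod_ge_0; try (repeat apply Rmult_le_pos; apply Cmod_ge_0)).
Qed.

(** [P] and [Q] are recovered from [w1] and [w2] up to the factor [cC], which cancels in the
    pointwise inequality. *)
Lemma max_w z : Rmax (Cmod (P z)) (Cmod (Q z)) * Cmod (cC z) <= (1 + Cmod (k0 z)) * (Cmod (w1 z) + Cmod (w2 z)).
Proof.
pose proof (Cmod_ge_0 (w1 z)). pose proof (Cmod_ge_0 (w2 z)). pose proof (Cmod_ge_0 (k0 z)).
apply Rmax_case.
- rewrite <- Cmod_mult. replace (P z * cC z)%C with (w1 z - w2 z)%C by (unfold w1, w2, cC; ring).
  eapply Rle_trans. apply Cmod_minus_le. nra.
- rewrite <- Cmod_mult. replace (Q z * cC z)%C with (k0 z * w1 z - w2 z)%C by (unfold w1, w2, cC; ring).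
  eapply Rle_trans. apply Cmod_minus_le. rewrite Cmod_mult. nra.
Qed.

Definition lamsum (z : C) : R := Cmod (C_derive p1 z / p1 z) + Cmod (C_derive p2 z / p2 z) + Cmod (C_derive p3 z / p3 z).

(** Cartan's step: the Wronskian divided by p2 p3 is p3'/p3 - p2'/p2, so [E w1], and likewise
    [E w2], is a product of coefficients with a difference of logarithmic derivatives. Both contain
    [cC], which cancels the factor lost in recovering P and Q. The exponent 9 is 1 + 2 + 6 and the
    constant 16 is 2 * 4 * 2. *)
Theorem wronskian_pointwise E z : Cmod z < S -> (Sig z * Wr z = E z * (w1 z * w2 z * w3 z))%C ->
  p1 z <> RtoC 0 -> p2 z <> RtoC 0 -> p3 z <> RtoC 0 ->
  Rmax (Cmod (P z)) (Cmod (Q z)) * Cmod (E z) <= 16 * (1 + Cmod d) ^ 3 * exp (9 * small z) * lamsum z.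
Proof.
intros Hz HE N1 N2 N3.
assert (NC : cC z <> RtoC 0) by (intros X; apply N3; unfold p3; rewrite X; ring).
assert (NB : cB z <> RtoC 0) by (intros X; apply N2; unfold p2; rewrite X; ring).
assert (NA : cA z <> RtoC 0) by (intros X; apply N1; unfold p1; rewrite X; ring).
assert (M1 : w1 z <> RtoC 0) by (intros X; apply N1; unfold p1; rewrite X; ring).
assert (M2 : w2 z <> RtoC 0) by (intros X; apply N2; unfold p2; rewrite X; ring).
assert (M3 : w3 z <> RtoC 0) by (intros X; apply N3; unfold p3; rewrite X; ring).
assert (L1 : Cmod (E z) * Cmod (w1 z) <= Cmod (Sig z) * (Cmod (cB z) * Cmod (cC z)) * lamsum z).
{ assert (X : (E z * w1 z = Sig z * (cB z * cC z) * (C_derive p3 z / p3 z - C_derive p2 z / p2 z))%C).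
  { replace (E z * w1 z)%C with (E z * (w1 z * w2 z * w3 z) / (w2 z * w3 z))%C by (field; auto). rewrite <- HE, Wr_23 by auto.
    generalize (C_derive p2 z) (C_derive p3 z). intros D2 D3. unfold p2, p3. field. auto. }
  rewrite <- Cmod_mult, X, !Cmod_mult. apply Rmult_le_compat_l. repeat apply Rmult_le_pos; apply Cmod_ge_0.
  eapply Rle_trans. apply Cmod_minus_le. unfold lamsum. generalize (Cmod_ge_0 (C_derive p1 z / p1 z)). lra. }
assert (L2 : Cmod (E z) * Cmod (w2 z) <= Cmod (Sig z) * (Cmod (cA z) * Cmod (cC z)) * lamsum z).
{ assert (X : (E z * w2 z = Sig z * (cA z * cC z) * (C_derive p1 z / p1 z - C_derive p3 z / p3 z))%C).
  { replace (E z * w2 z)%C with (E z * (w1 z * w2 z * w3 z) / (w1 z * w3 z))%C by (field; auto). rewrite <- HE, Wr_31 by auto.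
    generalize (C_derive p1 z) (C_derive p3 z). intros D1 D3. unfold p1, p3. field. auto. }
  rewrite <- Cmod_mult, X, !Cmod_mult. apply Rmult_le_compat_l. repeat apply Rmult_le_pos; apply Cmod_ge_0.
  eapply Rle_trans. apply Cmod_minus_le. unfold lamsum. generalize (Cmod_ge_0 (C_derive p2 z / p2 z)). lra. }
pose proof (max_w z) as MW. destruct (coefficient_bounds z) as [CB1 [CB2 CB3]].
pose proof (Cmod_pos_neq _ NC) as PC. pose proof (Cmod_ge_0 (E z)) as PE. pose proof (Cmod_ge_0 (Sig z)) as PS.
assert (PL : 0 <= lamsum z). { unfold lamsum. generalize (Cmod_ge_0 (C_derive p1 z / p1 z)) (Cmod_ge_0 (C_derive p2 z / p2 z)) (Cmod_ge_0 (C_derive p3 z / p3 z)). lra. }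
assert (PK : 0 <= 1 + Cmod (k0 z)) by (generalize (Cmod_ge_0 (k0 z)); lra).
assert (PAB : 0 <= Cmod (cA z) + Cmod (cB z)) by (generalize (Cmod_ge_0 (cA z)) (Cmod_ge_0 (cB z)); lra).
apply Rmult_le_reg_r with (Cmod (cC z)); auto.
apply Rle_trans with ((1 + Cmod (k0 z)) * ((Cmod (cA z) + Cmod (cB z)) * (Cmod (Sig z) * (Cmod (cC z) * lamsum z)))).
{ replace (Rmax (Cmod (P z)) (Cmod (Q z)) * Cmod (E z) * Cmod (cC z)) with (Cmod (E z) * (Rmax (Cmod (P z)) (Cmod (Q z)) * Cmod (cC z))) by ring.
  apply Rle_trans with (Cmod (E z) * ((1 + Cmod (k0 z)) * (Cmod (w1 z) + Cmod (w2 z)))). now apply Rmult_le_compat_l.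
  replace (Cmod (E z) * ((1 + Cmod (k0 z)) * (Cmod (w1 z) + Cmod (w2 z)))) with ((1 + Cmod (k0 z)) * (Cmod (E z) * Cmod (w1 z) + Cmod (E z) * Cmod (w2 z))) by ring.
  apply Rmult_le_compat_l; auto. nra. }
replace (16 * (1 + Cmod d) ^ 3 * exp (9 * small z) * lamsum z * Cmod (cC z)) with
  (2 * exp (small z) * (4 * exp (2 * small z) * (2 * (1 + Cmod d) ^ 3 * exp (6 * small z) * (Cmod (cC z) * lamsum z)))).
2:{ replace (9 * small z) with (small z + (2 * small z + 6 * small z)) by ring. rewrite !exp_plus. ring. }
assert (PCL : 0 <= Cmod (cC z) * lamsum z) by (apply Rmult_le_pos; lra).
apply Rmult_le_compat; auto. apply Rmult_le_pos; auto. apply Rmult_le_pos; auto.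
apply Rmult_le_compat; auto. apply Rmult_le_pos; auto.
apply Rmult_le_compat_r; auto.
Qed.
End Wronskian.

(** * Reduction to three functions with zero sum *)

Lemma zeros_in_unit_disc F R p : holo_on_disc F 0 R -> 4 < R -> 4 * Cmod p < R -> F p <> RtoC 0 ->
  exists L : list C, forall z, Cmod z < 1 -> F z = RtoC 0 -> In z L.
Proof.
intros HF HR Hp Hn.
assert (exists s, 1 < s /\ Cmod p < s /\ 4 * s < R) as [s [S1 [S2 S3]]].
{ exists ((Rmax 1 (Cmod p) + R / 4) / 2). unfold Rmax. destruct (Rle_dec 1 (Cmod p)); lra. }
destruct (zero_factorization F p s R) as [l [G [Hl [HG [E N]]]]]; auto; try lra.
exists l. intros z Hz E0. apply NNPP. intros I. rewrite E in E0 by lra. 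
apply (Cmult_neq_0 _ _ (lprod_neq0 l z I) (N z ltac:(lra)) E0).
Qed.

Lemma common_circle (Fs : list (C -> C)) R : 4 < R ->
  (forall F, In F Fs -> holo_on_disc F 0 R /\ exists p, 4 * Cmod p < R /\ F p <> RtoC 0) ->
  exists r0, 0 < r0 < 1 /\ forall F z, In F Fs -> Cmod z = r0 -> F z <> RtoC 0.
Proof.
intros HR H.
assert (A : exists L : list C, forall F z, In F Fs -> Cmod z < 1 -> F z = RtoC 0 -> In z L).
{ induction Fs as [|F Fs IH]. exists nil. simpl; tauto.
  destruct IH as [L HL]. intros G HG. apply H. now right.
  destruct (H F (or_introl eq_refl)) as [HF [p [Hp Hn]]].
  destruct (zeros_in_unit_disc F R p HF HR Hp Hn) as [L' HL'].
  exists (L ++ L'). intros G z [<-|I] Hz E; apply in_app_iff. right; auto. left; eauto. }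
destruct A as [L HL]. destruct (avoid_finite (map Cmod L) 0 1) as [r0 [Hr0 Hav]]. lra.
exists r0. split; auto. intros F z I Hz E. apply (Hav (Cmod z)); auto. apply in_map. apply (HL F); auto. lra.
Qed.

(** A small perturbation of [q]. The translates must be regular points for f(z + c) = K f to be
    applicable there. *)
Lemma generic_point f k q c : meromorphic f -> ~ is_pole f q -> f q <> k ->
  exists q', ~ is_pole f q' /\ f q' <> k /\ ~ is_pole f (q' - c)%C /\ ~ is_pole f (q' - 2 * c)%C.
Proof.
intros Hf Hq Hk.
destruct (value_order f k q q Hf Hq Hk Hq) as [n [r1 [G [Hr1 [HG EG]]]]].
destruct (poles_discrete f (q - c)%C Hf) as [r2 [Hr2 H2]]. destruct (poles_discrete f (q - 2 * c)%C Hf) as [r3 [Hr3 H3]].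
destruct (near_radius (r1 :: r2 :: r3 :: nil)) as [s [Hs Ks]]. { simpl. intros x [<-|[<-|[<-|[]]]]; auto. }
pose proof (Ks r1 ltac:(simpl; auto)). pose proof (Ks r2 ltac:(simpl; auto)). pose proof (Ks r3 ltac:(simpl; auto)).
destruct (punctured_point q s Hs) as [w Hw]. exists w. destruct (EG w ltac:(lra)) as [N1 [N2 E]].
split; [|split; [|split]]; auto.
- intros X. rewrite X in E. replace (k - k)%C with (RtoC 0) in E by ring. symmetry in E. revert E. apply Cmult_neq_0; auto.
  apply Cpow_neq0. now apply punct_neq.
- apply H2. replace (w - c - (q - c))%C with (w - q)%C by ring. lra.
- apply H3. replace (w - 2 * c - (q - 2 * c))%C with (w - q)%C by ring. lra.
Qed.

Lemma fraction_mn_Q f r0 X B P Q r : fraction f r0 X B P Q -> 0 < r -> generic r B ->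
  mn (fun z => ln (Cmod (Q z))) r = lsum (fun b => ln (Rmax r (Cmod b)) - ln (Rmax r0 (Cmod b))) B /\
  ccirc (fun z => ln (Cmod (Q z))) r.
Proof.
intros [EQ _] Hr G.
destruct (mn_lsum (fun a z => ln (Cmod (z - a))) B r) as [H1 H2]. { intros a Ha. apply ccirc_ln_minus. lra. now apply G. }
assert (E : forall t, ln (Cmod (Q (circ r t))) = - lsum (fun b => ln (Rmax r0 (Cmod b))) B + lsum (fun a => ln (Cmod (circ r t - a))) B).
{ intros t. assert (I : ~ In (circ r t) B) by (apply circ_notin; [lra|auto]).
  rewrite EQ, Cmod_mult, Cmod_RtoC_pos by (left; apply exp_pos). rewrite ln_mult by first [apply exp_pos | apply Cmod_pos_neq, lprod_neq0; assumption].
  rewrite ln_lprod by auto. unfold norm_const. rewrite ln_exp. reflexivity. }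
split.
- rewrite (mn_ext _ (fun z => - lsum (fun b => ln (Rmax r0 (Cmod b))) B + lsum (fun a => ln (Cmod (z - a))) B)) by auto.
  rewrite mn_plus, mn_const by (auto; apply ccirc_const). rewrite H2, lsum_minus.
  rewrite (lsum_ext (fun a => mn (fun z => ln (Cmod (z - a))) r) (fun b => ln (Rmax r (Cmod b)))). ring.
  intros a Ha. apply mn_ln_minus; auto.
- apply (ccirc_ext (fun z => - lsum (fun b => ln (Rmax r0 (Cmod b))) B + lsum (fun a => ln (Cmod (z - a))) B)); auto.
  apply (ccirc_plus (fun _ => _)); auto. apply ccirc_const.
Qed.

(** As ln |Q| has mean zero on this circle, the mean of ln |F| depends only on F / Q. In the
    applications F / Q is expressed by f and K, so the mean is the same for every disc. *)
Lemma mn_quotient F Q G r : ccirc (fun z => ln (Cmod (F z))) r -> ccirc (fun z => ln (Cmod (Q z))) r ->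
  mn (fun z => ln (Cmod (Q z))) r = 0 ->
  (forall t, ln (Cmod (F (circ r t))) - ln (Cmod (Q (circ r t))) = G (circ r t)) ->
  mn (fun z => ln (Cmod (F z))) r = mn G r.
Proof.
intros HF HQ E0 E. rewrite <- (mn_ext (fun z => ln (Cmod (F z)) - ln (Cmod (Q z))) G r E).
rewrite mn_minus by auto. lra.
Qed.

Lemma mn_quotient' F Q G r : ccirc (fun z => ln (Cmod (F z))) r -> ccirc (fun z => ln (Cmod (Q z))) r ->
  mn (fun z => ln (Cmod (Q z))) r = 0 ->
  (forall t, ln (Cmod (F (circ r t))) + ln (Cmod (Q (circ r t))) = G (circ r t)) ->
  mn (fun z => ln (Cmod (F z))) r = mn G r.
Proof.
intros HF HQ E0 E. rewrite <- (mn_ext (fun z => ln (Cmod (F z)) + ln (Cmod (Q z))) G r E).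
rewrite mn_plus by auto. lra.
Qed.

Section Reduction.
Variables (f K : C -> C) (c d : C).
Hypothesis Hf : meromorphic f.
Hypothesis HK : forall z, cdiff K z.
Hypothesis HfK : forall z, ~ is_pole f z -> ~ is_pole f (z + c)%C -> f (z + c)%C = (K z * f z)%C.
Hypothesis HO : forall z, ~ is_pole f z -> f z = RtoC 1 -> K z = d.

Let k0 := K.
Let k1 := fun z => K (z + c)%C.
Let k2 := fun z => K (z + 2 * c)%C.

Lemma cdiff_k1 z : cdiff k1 z.
Proof. apply (cdiff_comp K (fun z => z + c)%C); auto. apply cdiff_plus. apply cdiff_id. apply cdiff_const. Qed.
Lemma cdiff_k2 z : cdiff k2 z.
Proof. apply (cdiff_comp K (fun z => z + 2 * c)%C); auto. apply cdiff_plus. apply cdiff_id. apply cdiff_const. Qed.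

Lemma fraction_coprime r0 X B P Q z : fraction f r0 X B P Q -> Cmod z < X -> P z = RtoC 0 -> Q z = RtoC 0 -> False.
Proof.
intros H Hz E1 E2. destruct (classic (is_pole f z)) as [I|N].
- now apply (proj2 (fraction_pole _ _ _ _ _ _ z H Hz I)).
- now apply (proj1 (fraction_value _ _ _ _ _ _ z H Hz N)).
Qed.

Lemma fraction_nonpole r0 X B P Q z : fraction f r0 X B P Q -> Cmod z < X -> Q z <> RtoC 0 -> ~ is_pole f z /\ f z = (P z / Q z)%C.
Proof.
intros H Hz N. assert (M : ~ is_pole f z). { intros I. apply N. eapply fraction_pole; eauto. } split; auto.
destruct (fraction_value _ _ _ _ _ _ z H Hz M) as [_ ->]. field. auto.
Qed.

Lemma fraction_one r0 X B P Q z : fraction f r0 X B P Q -> Cmod z < X -> P z = Q z -> K z = d.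
Proof.
intros H Hz E. assert (N : Q z <> RtoC 0). { intros EQ. apply (fraction_coprime _ _ _ _ _ z H Hz); congruence. }
destruct (fraction_nonpole _ _ _ _ _ z H Hz N) as [M Ef]. apply HO; auto. rewrite Ef, E. field. auto.
Qed.

Lemma Cmult_reg_l (a x y : C) : a <> RtoC 0 -> (a * x = a * y)%C -> x = y.
Proof. intros N E. replace x with (a * x / a)%C by (field; auto). rewrite E. field. auto. Qed.

Lemma fraction_one1 r0 X B P Q z : fraction f r0 X B P Q -> Cmod z < X -> Cmod (z + c) < X ->
  (K z * P z)%C = Q z -> Q z <> RtoC 0 -> P (z + c)%C = Q (z + c)%C.
Proof.
intros H Hz Hzc E N. pose proof (fraction_shift f r0 X B P Q c K z Hf H HK HfK Hz Hzc) as S.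
apply (Cmult_reg_l (Q z)); auto. rewrite Cmult_comm, S, E. ring.
Qed.

Lemma fraction_O2 r0 X B P Q z : fraction f r0 X B P Q -> Cmod z < X -> Cmod (z + c) < X ->
  (K z * P z - Q z)%C = RtoC 0 -> Q z <> RtoC 0 -> k1 z = d.
Proof.
intros H Hz Hzc E N. apply (fraction_one r0 X B P Q (z + c)%C H Hzc). eapply fraction_one1; eauto.
replace (Q z) with (K z * P z - (K z * P z - Q z))%C by ring. rewrite E. ring.
Qed.

Lemma fraction_O3 r0 X B P Q z : fraction f r0 X B P Q -> Cmod z < X -> Cmod (z + c) < X -> Cmod (z + 2 * c) < X ->
  (K z * k1 z * P z - Q z)%C = RtoC 0 -> Q z <> RtoC 0 -> k2 z = d.
Proof.
intros H Hz Hzc Hzcc E N. 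
pose proof (fraction_shift f r0 X B P Q c K z Hf H HK HfK Hz Hzc) as S.
assert (E' : (K z * k1 z * P z)%C = Q z). { replace (Q z) with (K z * k1 z * P z - (K z * k1 z * P z - Q z))%C by ring. rewrite E. ring. }
(* [z + c] is not a pole either: otherwise the cross-multiplied relation would give [Q z = 0]. *)
assert (NQ : Q (z + c)%C <> RtoC 0).
{ intros E0. rewrite E0 in S. replace (K z * P z * 0)%C with (RtoC 0) in S by ring.
  assert (P (z + c)%C <> RtoC 0) by (intros EP; apply (fraction_coprime _ _ _ _ _ _ H Hzc EP E0)).
  now apply (Cmult_neq_0 _ _ H0 N). }
unfold k2. replace (z + 2 * c)%C with (z + c + c)%C by ring. replace (z + 2 * c)%C with (z + c + c)%C in Hzcc by ring.
apply (fraction_one r0 X B P Q _ H Hzcc). apply (fraction_one1 r0 X B P Q _ H Hzc Hzcc); auto.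
apply (Cmult_reg_l (Q z)); auto. 
replace (Q z * (K (z + c) * P (z + c)))%C with (K (z + c) * (P (z + c) * Q z))%C by ring. rewrite S.
rewrite <- E'. unfold k1. ring.
Qed.

(** [p1], [p2], [p3] divided by [Q]: functions of f and K alone, hence independent of the disc. *)
Definition phi1 z := ((k0 z - k0 z * k1 z) * (f z - 1))%C.
Definition phi2 z := ((k0 z * k1 z - 1) * (k0 z * f z - 1))%C.
Definition phi3 z := ((1 - k0 z) * (k0 z * k1 z * f z - 1))%C.
Definition wf z := (phi1 z * C_derive phi2 z - phi2 z * C_derive phi1 z)%C.

Lemma p_phi r0 X B P Q z : fraction f r0 X B P Q -> Cmod z < X -> ~ is_pole f z ->
  p1 P Q k0 k1 z = (Q z * phi1 z)%C /\ p2 P Q k0 k1 z = (Q z * phi2 z)%C /\ p3 P Q k0 k1 z = (Q z * phi3 z)%C.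
Proof.
intros H Hz N. destruct (fraction_value _ _ _ _ _ _ z H Hz N) as [_ E].
unfold p1, p2, p3, w1, w2, w3, cA, cB, cC, phi1, phi2, phi3. rewrite E. split; [|split]; ring.
Qed.

Lemma Wr_wf r0 X B P Q z : fraction f r0 X B P Q -> Cmod z < X -> ~ is_pole f z ->
  Wr P Q k0 k1 z = (Q z * Q z * wf z)%C.
Proof.
intros H Hz N.
destruct (not_pole_holo f z Hf N) as [r [Hr Hh]].
assert (Df : cdiff f z) by now apply (holo_cdiff_center f z r).
assert (D1 : cdiff phi1 z).
{ apply (cdiff_mult (fun z => k0 z - k0 z * k1 z)%C (fun z => f z - 1)%C). now apply cdiff_cA; [|apply cdiff_k1].
  apply (cdiff_minus f (fun _ => RtoC 1)); auto. apply cdiff_const. }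
assert (D2 : cdiff phi2 z).
{ apply (cdiff_mult (fun z => k0 z * k1 z - 1)%C (fun z => k0 z * f z - 1)%C). now apply cdiff_cB; [|apply cdiff_k1].
  apply (cdiff_minus (fun z => k0 z * f z)%C (fun _ => RtoC 1)). apply (cdiff_mult k0 f); auto. apply cdiff_const. }
assert (DQ : cdiff Q z) by (apply (holo_cdiff_center Q z 1); [lra|eapply fraction_holo_Q; eauto]).
assert (NN : forall w, Cmod (w - z) < Rmin r (X - Cmod z) -> Cmod w < X /\ ~ is_pole f w).
{ intros w Hw. pose proof (Rmin_l r (X - Cmod z)). pose proof (Rmin_r r (X - Cmod z)). split.
  generalize (Cmod_rev_triangle w z); lra. apply holo_not_pole. exists (r - Cmod (w - z)). split. lra. eapply holo_sub; eauto. lra. }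
assert (Pm : 0 < Rmin r (X - Cmod z)) by (apply Rmin_pos; lra).
assert (E1 : C_derive (p1 P Q k0 k1) z = (C_derive Q z * phi1 z + Q z * C_derive phi1 z)%C).
{ apply cder_C_derive. apply (cder_local (fun w => Q w * phi1 w)%C) with (r := Rmin r (X - Cmod z)); auto.
  intros w Hw. symmetry. now apply (p_phi r0 X B P Q w H); apply NN. apply cder_mult; now apply C_derive_cder. }
assert (E2 : C_derive (p2 P Q k0 k1) z = (C_derive Q z * phi2 z + Q z * C_derive phi2 z)%C).
{ apply cder_C_derive. apply (cder_local (fun w => Q w * phi2 w)%C) with (r := Rmin r (X - Cmod z)); auto.
  intros w Hw. symmetry. now apply (p_phi r0 X B P Q w H); apply NN. apply cder_mult; now apply C_derive_cder. }
destruct (p_phi r0 X B P Q z H Hz N) as [F1 [F2 _]].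
unfold Wr. rewrite E1, E2, F1, F2. unfold wf. ring.
Qed.

Hypothesis N0 : exists q, ~ is_pole f q /\ f q <> RtoC 0.
Hypothesis N1 : exists q, ~ is_pole f q /\ f q <> RtoC 1.
Hypothesis NK1 : exists z, K z <> RtoC 1.
Hypothesis NKd : exists z, K z <> d.
Hypothesis NK2 : exists z, (K z * K (z + c))%C <> RtoC 1.

Definition nondegenerate := exists q, ~ is_pole f q /\ wf q <> RtoC 0.

(** For a regular point q' with f(q') different from k, the value of K f at q' - c and the value of
    K2 f at q' - 2 c are both f(q'). *)
Lemma wbase (k : C) : (exists q, ~ is_pole f q /\ f q <> k) -> exists z z', 
  (~ is_pole f z /\ ~ is_pole f (z + c)%C /\ (K z * f z)%C <> k) /\
  (~ is_pole f z' /\ ~ is_pole f (z' + c)%C /\ (K z' * k1 z' * f z')%C <> k).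
Proof.
intros [q [Hq Hk]]. destruct (generic_point f k q c Hf Hq Hk) as [q' [A1 [A2 [A3 A4]]]].
assert (B1 : (q' - c + c)%C = q') by ring. assert (B2 : (q' - 2 * c + c)%C = (q' - c)%C) by ring.
exists (q' - c)%C, (q' - 2 * c)%C. split; (split; [|split]); rewrite ?B1, ?B2; auto.
- rewrite <- HfK; rewrite ?B1; auto.
- unfold k1. rewrite B2. rewrite (Cmult_comm (K (q' - 2 * c))), <- Cmult_assoc. 
  rewrite <- (HfK (q' - 2 * c)%C); rewrite ?B2; auto. rewrite <- HfK; rewrite ?B1; auto.
Qed.

(** Each function that enters a normalisation constant is nonzero somewhere, so it has finitely many
    zeros in the unit disc, and one circle avoids the zeros of all of them. *)
Lemma circle_r0 : exists r0, 0 < r0 < 1 /\ forall z, Cmod z = r0 ->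
  ~ is_pole f z /\ f z <> RtoC 0 /\ phi1 z <> RtoC 0 /\ phi2 z <> RtoC 0 /\ phi3 z <> RtoC 0 /\ Sig k0 k1 k2 d z <> RtoC 0 /\
  (nondegenerate -> wf z <> RtoC 0).
Proof.
destruct N0 as [q0 [P0 Q0]]. destruct N1 as [q1 [P1 Q1]]. destruct NK1 as [q2 Q2]. destruct NKd as [q3 Q3]. destruct NK2 as [q4 Q4].
destruct (wbase 1 N1) as [q5 [q6 [[P5 [P5' Q5]] [P6 [P6' Q6]]]]].
destruct (wbase 0 N0) as [q7 [_ [[P7 [P7' Q7]] _]]].
assert (exists q8, ~ is_pole f q8 /\ (nondegenerate -> wf q8 <> RtoC 0)) as [q8 [P8 Q8]].
{ destruct (classic nondegenerate) as [[q [A B]]|Nn]. exists q; auto. exists q0. tauto. }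
assert (Q7' : K q7 <> RtoC 0). { intros E. apply Q7. rewrite E. ring. }
assert (SH : forall (k : C) q, K q <> k -> k1 (q - c)%C <> k /\ k2 (q - 2 * c)%C <> k).
{ intros k q Hq. unfold k1, k2. replace (q - c + c)%C with q by ring. replace (q - 2 * c + 2 * c)%C with q by ring. auto. }
(* For every function in the list [Fs] below, [pts] contains a point where it does not vanish; the
   disc is then taken large enough for all of them. *)
set (pts := q0 :: q1 :: q2 :: q3 :: q4 :: q5 :: q6 :: q7 :: q8 :: (q2 - c)%C :: (q3 - c)%C :: (q3 - 2 * c)%C :: (q7 - c)%C :: nil).
set (R := 4 * lsum Cmod pts + 5).
assert (HR : forall q, In q pts -> 4 * Cmod q < R).
{ assert (forall l q, In q l -> Cmod q <= lsum Cmod l).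
  { induction l as [|a l IH]; simpl; [tauto|]. intros q [->|I].
    assert (0 <= lsum Cmod l) by (apply lsum_nonneg; intros; apply Cmod_ge_0). lra. specialize (IH q I). generalize (Cmod_ge_0 a). lra. }
  intros q I. specialize (H pts q I). unfold R. lra. }
assert (R4 : 4 < R). { assert (0 <= lsum Cmod pts) by (apply lsum_nonneg; intros; apply Cmod_ge_0). unfold R. lra. }
destruct (fraction_exists f 1 R Hf) as [B [P [Q H]]].
assert (HP : holo_on_disc P 0 R) by apply H. assert (HQ : holo_on_disc Q 0 R) by (eapply fraction_holo_Q; eauto).
assert (Hent : forall F, (forall z, cdiff F z) -> holo_on_disc F 0 R) by (intros F HF z _; auto).
assert (V : forall q, In q pts -> ~ is_pole f q -> Q q <> RtoC 0 /\ P q = (Q q * f q)%C).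
{ intros q I Nq. apply (fraction_value f 1 R B P Q); auto. specialize (HR q I). generalize (Cmod_ge_0 q). lra. }
(* If the Wronskian vanishes identically, the last entry is the constant 1 instead, so that one
   circle can be chosen before the two cases are separated. *)
set (Fs := P :: Q :: w1 P Q :: w2 P Q k0 :: w3 P Q k0 k1 :: K :: k1 :: (fun z => K z - 1)%C :: (fun z => k1 z - 1)%C :: cB k0 k1 ::
   (fun z => K z - d)%C :: (fun z => k1 z - d)%C :: (fun z => k2 z - d)%C :: (fun z => if excluded_middle_informative nondegenerate then Wr P Q k0 k1 z else 1)%C :: nil).
destruct (common_circle Fs R R4) as [r0 [Hr0 Hc]].
{ assert (ent : forall F k, (forall z, cdiff F z) -> holo_on_disc (fun z => F z - k)%C 0 R).
  { intros F k HF. apply Hent. intros z. apply cdiff_minus; auto. apply cdiff_const. }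
  assert (wit : forall F q, In q pts -> F q <> RtoC 0 -> exists p, 4 * Cmod p < R /\ F p <> RtoC 0) by (intros F q I NF; exists q; auto).
  intros F I. unfold Fs in I. simpl in I.
  destruct I as [<-|[<-|[<-|[<-|[<-|[<-|[<-|[<-|[<-|[<-|[<-|[<-|[<-|[<-|[]]]]]]]]]]]]]]]; split.
  - auto. - apply (wit _ q0). simpl; auto. destruct (V q0) as [A ->]; simpl; auto. now apply Cmult_neq_0.
  - auto. - apply (wit _ q0). simpl; auto. now apply V; simpl; auto.
  - now apply holo_w1. - apply (wit _ q1). simpl; auto. destruct (V q1) as [A EP]; simpl; auto. unfold w1. rewrite EP.
    replace (Q q1 * f q1 - Q q1)%C with (Q q1 * (f q1 - 1))%C by ring. apply Cmult_neq_0; auto. now apply Cminus_neq.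
  - now apply holo_w2. - apply (wit _ q5). simpl; auto 10. destruct (V q5) as [A EP]; simpl; auto 10. unfold w2. rewrite EP.
    replace (k0 q5 * (Q q5 * f q5) - Q q5)%C with (Q q5 * (K q5 * f q5 - 1))%C by (unfold k0; ring). apply Cmult_neq_0; auto. now apply Cminus_neq.
  - apply holo_w3; auto. apply cdiff_k1. - apply (wit _ q6). simpl; auto 10. destruct (V q6) as [A EP]; simpl; auto 10. unfold w3. rewrite EP.
    replace (k0 q6 * k1 q6 * (Q q6 * f q6) - Q q6)%C with (Q q6 * (K q6 * k1 q6 * f q6 - 1))%C by (unfold k0; ring). apply Cmult_neq_0; auto. now apply Cminus_neq.
  - auto. - apply (wit _ q7); auto. simpl; auto 10.
  - apply Hent, cdiff_k1. - apply (wit _ (q7 - c)%C). simpl; auto 20. now apply SH.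
  - now apply ent. - apply (wit _ q2). simpl; auto. now apply Cminus_neq.
  - apply ent, cdiff_k1. - apply (wit _ (q2 - c)%C). simpl; auto 20. apply Cminus_neq. now apply SH.
  - apply Hent, cdiff_cB; auto. apply cdiff_k1. - apply (wit _ q4). simpl; auto 10. now apply Cminus_neq.
  - now apply ent. - apply (wit _ q3). simpl; auto. now apply Cminus_neq.
  - apply ent, cdiff_k1. - apply (wit _ (q3 - c)%C). simpl; auto 20. apply Cminus_neq. now apply SH.
  - apply ent, cdiff_k2. - apply (wit _ (q3 - 2 * c)%C). simpl; auto 20. apply Cminus_neq. now apply SH.
  - destruct (excluded_middle_informative nondegenerate). apply holo_Wr; auto. apply cdiff_k1. apply holo_const.
  - destruct (excluded_middle_informative nondegenerate) as [Hn|Hn]. 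
    + apply (wit _ q8). simpl; auto 12. rewrite (Wr_wf 1 R B P Q q8 H). apply Cmult_neq_0; auto. apply Cmult_neq_0; apply V; simpl; auto 12.
      assert (4 * Cmod q8 < R) by (apply HR; simpl; auto 12). generalize (Cmod_ge_0 q8); lra. auto.
    + apply (wit _ q8). simpl; auto 12. apply RtoC_neq; lra. }
exists r0. split; auto. intros z Hz.
assert (A : forall F, In F Fs -> F z <> RtoC 0) by (intros; now apply Hc).
assert (HzR : Cmod z < R) by lra.
pose proof (A P ltac:(simpl; auto)) as AP. pose proof (A Q ltac:(simpl; auto)) as AQ.
destruct (fraction_nonpole 1 R B P Q z H HzR AQ) as [Nz Ef].
pose proof (A (w1 P Q) ltac:(simpl; auto)) as A1. pose proof (A (w2 P Q k0) ltac:(simpl; auto)) as A2. pose proof (A (w3 P Q k0 k1) ltac:(simpl; auto 10)) as A3.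
pose proof (A K ltac:(simpl; auto 10)) as A4. pose proof (A k1 ltac:(simpl; auto 10)) as A5.
pose proof (A (fun z => K z - 1)%C ltac:(simpl; auto 10)) as A6. pose proof (A (fun z => k1 z - 1)%C ltac:(simpl; auto 12)) as A7.
pose proof (A (cB k0 k1) ltac:(simpl; auto 12)) as A8. pose proof (A (fun z => K z - d)%C ltac:(simpl; auto 14)) as A9.
pose proof (A (fun z => k1 z - d)%C ltac:(simpl; auto 14)) as A10. pose proof (A (fun z => k2 z - d)%C ltac:(simpl; auto 16)) as A11.
pose proof (A (fun z => if excluded_middle_informative nondegenerate then Wr P Q k0 k1 z else 1)%C ltac:(simpl; auto 16)) as A12.
assert (EP : P z = (Q z * f z)%C) by (rewrite Ef; field; auto).
split; [|split; [|split; [|split; [|split; [|split]]]]]; auto.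
- intros E. apply AP. rewrite EP, E. ring.
- unfold phi1. apply Cmult_neq_0.
  replace (k0 z - k0 z * k1 z)%C with (- (K z * (k1 z - 1)))%C by (unfold k0; ring). intros E. apply (Cmult_neq_0 _ _ A4 A7). 
  replace (K z * (k1 z - 1))%C with (- - (K z * (k1 z - 1)))%C by ring. rewrite E. ring.
  intros E. apply A1. unfold w1. rewrite EP. replace (Q z * f z - Q z)%C with (Q z * (f z - 1))%C by ring. rewrite E. ring.
- unfold phi2. apply Cmult_neq_0. exact A8. intros E. apply A2. unfold w2. rewrite EP. replace (k0 z * (Q z * f z) - Q z)%C with (Q z * (k0 z * f z - 1))%C by ring. rewrite E. ring.
- unfold phi3. apply Cmult_neq_0. intros E. apply A6. replace (K z - 1)%C with (- (1 - k0 z))%C by (unfold k0; ring). rewrite E. ring.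
  intros E. apply A3. unfold w3. rewrite EP. replace (k0 z * k1 z * (Q z * f z) - Q z)%C with (Q z * (k0 z * k1 z * f z - 1))%C by ring. rewrite E. ring.
- unfold Sig. repeat apply Cmult_neq_0; auto.
- intros Hn. destruct (excluded_middle_informative nondegenerate); [|contradiction]. intros E. apply A12. rewrite (Wr_wf 1 R B P Q z H HzR Nz), E. ring.
Qed.
End Reduction.

Lemma exact_order_mult F G z n m : exact_order F z n -> exact_order G z m -> exact_order (fun w => F w * G w)%C z (n + m).
Proof.
intros [r1 [F1 [H1 [H2 H3]]]] [r2 [G1 [K1 [K2 K3]]]]. exists (Rmin r1 r2), (fun w => F1 w * G1 w)%C.
pose proof (Rmin_l r1 r2). pose proof (Rmin_r r1 r2).
split; [|split]. now apply Rmin_pos. apply holo_mult; hm.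
intros w Hw. destruct (H3 w ltac:(lra)) as [N1 ->]. destruct (K3 w ltac:(lra)) as [N2 ->].
split. now apply Cmult_neq_0. rewrite Cpow_add_r. ring.
Qed.

Lemma exact_order_exists F R p z : holo_on_disc F 0 R -> 4 * Cmod p < R -> 4 * Cmod z < R -> F p <> RtoC 0 ->
  exists n, exact_order F z n.
Proof. intros H1 H2 H3 H4. destruct (order_at F R p z H1 H2 H3 H4) as [n [r [G [A [B D]]]]]. exists n, r, G. auto. Qed.

(** If F = (w - z1)^(n+1) H with H(z1) nonzero, the vanishing Wronskian divided by (w - z1)^n gives
    (n + 1) H(z1) G(z1) = 0 in the limit. This turns proportionality at one point into
    proportionality everywhere. *)
Lemma zero_wronskian_zero F G R p z1 : holo_on_disc F 0 R -> holo_on_disc G 0 R -> 4 * Cmod z1 < R -> 4 * Cmod p < R ->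
  F z1 = RtoC 0 -> G z1 <> RtoC 0 -> (forall z, Cmod z < R -> (F z * C_derive G z = G z * C_derive F z)%C) -> F p = RtoC 0.
Proof.
intros HF HG Hz1 Hp E1 NG HW. apply NNPP. intros NF.
destruct (order_at F R p z1 HF Hp Hz1 NF) as [n [r [H [Hr [HH EH]]]]].
destruct n as [|n].
{ destruct (EH z1) as [N E]. rewrite Cmod_minus_self; auto. apply N. replace (H z1) with ((z1 - z1) ^ 0 * H z1)%C by (simpl; ring). now rewrite <- E. }
assert (Hz1R : Cmod z1 < R) by (generalize (Cmod_ge_0 z1); lra).
set (s := Rmin r (R - Cmod z1)). assert (Hs : 0 < s) by (apply Rmin_pos; lra).
pose proof (Rmin_l r (R - Cmod z1)) as L1. pose proof (Rmin_r r (R - Cmod z1)) as L2. fold s in L1, L2.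
assert (DF : forall w, Cmod (w - z1) < s -> C_derive F w = (RtoC (INR (S n)) * (w - z1) ^ n * H w + (w - z1) ^ S n * C_derive H w)%C).
{ intros w Hw. apply cder_C_derive. apply (cder_local (fun w => (w - z1) ^ S n * H w)%C) with (r := s - Cmod (w - z1)). lra.
  intros v Hv. symmetry. apply EH. generalize (Cmod_diff_triangle v w z1). lra.
  apply cder_mult. apply cder_pow. apply (holo_C_derive H z1 r); auto. lra. }
assert (CH : ccont H z1) by now apply (holo_ccont_center H z1 r).
assert (HG1 : holo_on_disc G z1 s). { eapply holo_sub; eauto. rewrite Cmod_minus_0. lra. }
assert (CG : ccont G z1) by now apply (holo_ccont_center G z1 s).
assert (CG' : ccont (C_derive G) z1). { apply (holo_ccont_center (C_derive G) z1 s); auto. now apply derivative_cdiff. }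
assert (CH' : ccont (C_derive H) z1). { apply (holo_ccont_center (C_derive H) z1 r); auto. now apply derivative_cdiff. }
assert (X : ((z1 - z1) * (H z1 * C_derive G z1 - G z1 * C_derive H z1))%C = (RtoC (INR (S n)) * (H z1 * G z1))%C).
{ apply (ccont_unique (fun w => (w - z1) * (H w * C_derive G w - G w * C_derive H w))%C (fun w => RtoC (INR (S n)) * (H w * G w))%C z1 s); auto.
  - apply ccont_mult. apply ccont_minus_const. apply ccont_minus; now apply ccont_mult.
  - apply ccont_mult. apply ccont_const. now apply ccont_mult.
  - intros w Hw. pose proof (HW w ltac:(generalize (Cmod_rev_triangle w z1); lra)) as E. rewrite DF in E by lra.
    rewrite (proj2 (EH w ltac:(lra))) in E. rewrite !(Cpow_S _ n) in E.
    pose proof (Cpow_neq0 _ n (punct_neq _ _ (proj1 Hw))) as Np.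
    apply (Cmult_reg_l ((w - z1) ^ n)%C); auto.
    replace ((w - z1) ^ n * ((w - z1) * (H w * C_derive G w - G w * C_derive H w)))%C with
     ((w - z1) * (w - z1) ^ n * H w * C_derive G w - G w * ((w - z1) * (w - z1) ^ n * C_derive H w))%C by ring.
    rewrite E. ring. }
rewrite Cminus_diag, Cmult_0_l in X. symmetry in X. revert X. apply Cmult_neq_0. apply RtoC_neq, not_0_INR. lia.
apply Cmult_neq_0; auto. apply EH. rewrite Cmod_minus_self; auto.
Qed.

(** * The auxiliary function E and the data at a given scale *)

Section MainHolo.
Variables (f K : C -> C) (c d : C).
Hypothesis Hf : meromorphic f.
Hypothesis HK : forall z, cdiff K z.
Hypothesis HfK : forall z, ~ is_pole f z -> ~ is_pole f (z + c)%C -> f (z + c)%C = (K z * f z)%C.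
Hypothesis HO : forall z, ~ is_pole f z -> f z = RtoC 1 -> K z = d.
Hypothesis N0 : exists q, ~ is_pole f q /\ f q <> RtoC 0.
Hypothesis N1 : exists q, ~ is_pole f q /\ f q <> RtoC 1.
Hypothesis NK1 : exists z, K z <> RtoC 1.
Hypothesis NKd : exists z, K z <> d.
Hypothesis NK2 : exists z, (K z * K (z + c))%C <> RtoC 1.

Let k0 := K.
Let k1 := fun z => K (z + c)%C.
Let k2 := fun z => K (z + 2 * c)%C.
Let Hk1 := cdiff_k1 K c HK.
Let Hk2 := cdiff_k2 K c HK.

(** The conclusion shared by the two cases of the Wronskian, so that the rest of the argument does
    not distinguish them. *)
Definition bounded_by (P Q E : C -> C) (S C0 : R) : Prop :=
  forall z L, Cmod z < S -> p1 P Q k0 k1 z <> RtoC 0 -> p2 P Q k0 k1 z <> RtoC 0 -> p3 P Q k0 k1 z <> RtoC 0 ->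
    Q z <> RtoC 0 -> 1 <= L -> lamsum P Q k0 k1 z <= L ->
    Rmax (Cmod (P z)) (Cmod (Q z)) * Cmod (E z) <= C0 * exp (9 * small k0 k1 k2 z) * L.

(** [E] is the quotient of [Sig Wr] by [w1 w2 w3]. On |z| = r0 the product [E Q] is expressed by f
    and K alone, which makes the mean of ln |E| there independent of the scale. *)
Lemma nondegenerate_case r0 S B P Q : nondegenerate f K c -> 0 < r0 < 1 -> 1 < S ->
  (forall z, Cmod z = r0 ->
    ~ is_pole f z /\ f z <> RtoC 0 /\ phi1 f K c z <> RtoC 0 /\ phi2 f K c z <> RtoC 0 /\ phi3 f K c z <> RtoC 0 /\ Sig k0 k1 k2 d z <> RtoC 0 /\
    (nondegenerate f K c -> wf f K c z <> RtoC 0)) ->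
  fraction f r0 (20 * S + 10 + 3 * Cmod c) B P Q ->
  exists E, holo_on_disc E 0 (5 * S + 1) /\ bounded_by P Q E S (16 * (1 + Cmod d) ^ 3) /\
    forall z, Cmod z = r0 -> E z <> RtoC 0 /\ 
      (E z * Q z = Sig k0 k1 k2 d z * wf f K c z / ((f z - 1) * (k0 z * f z - 1) * (k0 z * k1 z * f z - 1)))%C.
Proof.
intros Hn Hr0 HS Hc H. pose proof (Cmod_ge_0 c) as Pc.
set (X := 20 * S + 10 + 3 * Cmod c) in *. set (S5 := 5 * S + 1).
assert (HPX : holo_on_disc P 0 X) by apply H. assert (HQX : holo_on_disc Q 0 X) by (eapply fraction_holo_Q; eauto).
assert (HP : holo_on_disc P 0 S5) by (eapply holo_mono; [|apply HPX]; unfold S5, X; lra).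
assert (HQ : holo_on_disc Q 0 S5) by (eapply holo_mono; [|apply HQX]; unfold S5, X; lra).
set (W1 := w1 P Q). set (W2 := w2 P Q k0). set (W3 := w3 P Q k0 k1).
set (z1 := circ r0 0). assert (Hz1 : Cmod z1 = r0) by (apply Cmod_circ; lra).
assert (val : forall z, Cmod z = r0 -> Q z <> RtoC 0 /\ W1 z = (Q z * (f z - 1))%C /\ W2 z = (Q z * (k0 z * f z - 1))%C /\ W3 z = (Q z * (k0 z * k1 z * f z - 1))%C /\
   (f z - 1)%C <> RtoC 0 /\ (k0 z * f z - 1)%C <> RtoC 0 /\ (k0 z * k1 z * f z - 1)%C <> RtoC 0).
{ intros z Hz. destruct (Hc z Hz) as [A1 [A2 [A3 [A4 [A5 _]]]]].
  destruct (fraction_value f r0 X B P Q z H ltac:(unfold X; lra) A1) as [NQ EP].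
  unfold W1, W2, W3, w1, w2, w3. rewrite EP. repeat split; auto; try ring; intros E.
  apply A3. unfold phi1. rewrite E. ring. apply A4. unfold phi2. change (K z * f z - 1)%C with (k0 z * f z - 1)%C. rewrite E. ring.
  apply A5. unfold phi3. change (K z * K (z + c) * f z - 1)%C with (k0 z * k1 z * f z - 1)%C. rewrite E. ring. }
destruct (val z1 Hz1) as [V0 [V1 [V2 [V3 [V4 [V5 V6]]]]]].
assert (HW1 : holo_on_disc W1 0 X) by now apply holo_w1. assert (HW2 : holo_on_disc W2 0 X) by now apply holo_w2.
assert (HW3 : holo_on_disc W3 0 X) by (apply holo_w3; auto).
destruct (quotient_extension (fun z => Sig k0 k1 k2 d z * Wr P Q k0 k1 z)%C (fun z => W1 z * W2 z * W3 z)%C S5) as [E [HE EE]].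
- apply holo_mult. intros z _; now apply cdiff_Sig. apply holo_Wr; auto.
- eapply holo_mono. 2: apply holo_mult; [apply holo_mult|]; eauto. unfold S5, X; lra.
- intros z Hz.
  assert (B1 : 4 * Cmod z1 < X) by (unfold X; lra). assert (B2 : 4 * Cmod z < X) by (unfold X, S5 in *; lra).
  destruct (exact_order_exists W1 X z1 z HW1 B1 B2) as [n1 O1]. rewrite V1. now apply Cmult_neq_0.
  destruct (exact_order_exists W2 X z1 z HW2 B1 B2) as [n2 O2]. rewrite V2. now apply Cmult_neq_0.
  destruct (exact_order_exists W3 X z1 z HW3 B1 B2) as [n3 O3]. rewrite V3. now apply Cmult_neq_0.
  exists (n1 + n2 + n3)%nat. split. now repeat apply exact_order_mult.
  assert (Sh : forall z, Cmod z < S5 -> Cmod z < X /\ Cmod (z + c) < X /\ Cmod (z + 2 * c) < X).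
  { intros w Hw. pose proof (Cmod_triangle w c). pose proof (Cmod_triangle w (2 * c)). rewrite Cmod_mult, (Cmod_RtoC_pos 2) in H1 by lra.
    unfold S5, X in *. lra. }
  apply (Sig_Wr_divisible P Q k0 k1 k2 d S5); auto.
  + intros w Hw. eapply fraction_coprime; eauto. now apply Sh.
  + intros w Hw EW NQ. eapply (fraction_one f K d HO r0 X B P Q w H). now apply Sh. unfold w1 in EW.
    replace (P w) with (P w - Q w + Q w)%C by ring. rewrite EW. ring.
  + intros w Hw EW NQ. apply (fraction_O2 f K c d Hf HK HfK HO r0 X B P Q w H); auto; now apply Sh.
  + intros w Hw EW NQ. apply (fraction_O3 f K c d Hf HK HfK HO r0 X B P Q w H); auto; now apply Sh.
- exists E. split; [|split]; auto.
  + intros z L Hz M1 M2 M3 _ HL1 HL. assert (Hz5 : Cmod z < S5) by (unfold S5; lra).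
    eapply Rle_trans. apply (wronskian_pointwise P Q k0 k1 k2 d S5 HP HQ HK Hk1 E z Hz5); auto.
    apply Rmult_le_compat_l; auto. apply Rmult_le_pos. apply Rmult_le_pos. lra. apply pow_le. generalize (Cmod_ge_0 d); lra. left; apply exp_pos.
  + intros z Hz. destruct (val z Hz) as [U0 [U1 [U2 [U3 [U4 [U5 U6]]]]]]. destruct (Hc z Hz) as [A1 [A2 [A3 [A4 [A5 [A6 A7]]]]]].
    pose proof (EE z ltac:(unfold S5; lra)) as X1. cbv beta in X1.
    assert (EW : Wr P Q k0 k1 z = (Q z * Q z * wf f K c z)%C) by (apply (Wr_wf f K c Hf HK r0 X B P Q z H); [unfold X; lra | auto]).
    rewrite EW in X1.
    rewrite U1, U2, U3 in X1. specialize (A7 Hn).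
    split.
    * intros E0. rewrite E0 in X1.
      assert (Y : (Sig k0 k1 k2 d z * (Q z * Q z * wf f K c z))%C = RtoC 0) by (first [rewrite X1 | rewrite <- X1]; ring).
      revert Y. apply Cmult_neq_0; [exact A6|]. apply Cmult_neq_0; [|exact A7]. now apply Cmult_neq_0.
    * apply (Cmult_reg_l (Q z * Q z)%C). now apply Cmult_neq_0.
      replace (Q z * Q z * (Sig k0 k1 k2 d z * wf f K c z / ((f z - 1) * (k0 z * f z - 1) * (k0 z * k1 z * f z - 1))))%C with
       (Sig k0 k1 k2 d z * (Q z * Q z * wf f K c z) / ((f z - 1) * (k0 z * f z - 1) * (k0 z * k1 z * f z - 1)))%C by (field; auto).
      rewrite X1. field. auto.
Qed.

(** With [kap] the constant ratio of [p1] to [p2], the relation p1 = kap p2 reads P v = Q u with u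
    and v built from K. As P and Q have no common zero, Q divides v, and the quotient E satisfies E
    P = u and E Q = v. *)
Lemma degenerate_case r0 S B P Q kap : ~ nondegenerate f K c -> 0 < r0 < 1 -> 1 < S ->
  (forall z, Cmod z = r0 ->
    ~ is_pole f z /\ f z <> RtoC 0 /\ phi1 f K c z <> RtoC 0 /\ phi2 f K c z <> RtoC 0 /\ phi3 f K c z <> RtoC 0 /\ Sig k0 k1 k2 d z <> RtoC 0 /\
    (nondegenerate f K c -> wf f K c z <> RtoC 0)) ->
  kap = (phi1 f K c (circ r0 0) / phi2 f K c (circ r0 0))%C ->
  fraction f r0 (20 * S + 10 + 3 * Cmod c) B P Q ->
  exists E, holo_on_disc E 0 (5 * S + 1) /\ bounded_by P Q E S (8 * (1 + Cmod kap)) /\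
    forall z, Cmod z = r0 -> E z <> RtoC 0 /\ (E z * Q z = cA k0 k1 z - kap * cB k0 k1 z * k0 z)%C.
Proof.
intros Hn Hr0 HS Hc Ek H. pose proof (Cmod_ge_0 c) as Pc.
set (X := 20 * S + 10 + 3 * Cmod c) in *. set (S5 := 5 * S + 1).
assert (HPX : holo_on_disc P 0 X) by apply H. assert (HQX : holo_on_disc Q 0 X) by (eapply fraction_holo_Q; eauto).
set (z1 := circ r0 0) in *. assert (Hz1 : Cmod z1 = r0) by (apply Cmod_circ; lra).
destruct (Hc z1 Hz1) as [A1 [A2 [A3 [A4 [A5 [A6 _]]]]]].
assert (Nk : kap <> RtoC 0). { rewrite Ek. intros E0. apply A3. replace (phi1 f K c z1) with (phi1 f K c z1 / phi2 f K c z1 * phi2 f K c z1)%C by (field; auto). rewrite E0. ring. }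
assert (F1 : p1 P Q k0 k1 z1 = (Q z1 * phi1 f K c z1)%C) by (apply (p_phi f K c r0 X B P Q z1 H); auto; unfold X; lra).
assert (F2 : p2 P Q k0 k1 z1 = (Q z1 * phi2 f K c z1)%C) by (apply (p_phi f K c r0 X B P Q z1 H); auto; unfold X; lra).
destruct (fraction_value f r0 X B P Q z1 H ltac:(unfold X; lra) A1) as [NQ1 _].
set (q1 := p1 P Q k0 k1). set (q2 := p2 P Q k0 k1).
assert (Hq1 : holo_on_disc q1 0 X) by (apply holo_p1; auto). assert (Hq2 : holo_on_disc q2 0 X) by (apply holo_p2; auto).
(* Off the poles of [f] the Wronskian is Q^2 times [wf], which vanishes there by assumption; the
   poles follow by continuity. *)
assert (WZ : forall z, Cmod z < X -> (q1 z * C_derive q2 z - q2 z * C_derive q1 z)%C = RtoC 0).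
{ intros z Hz. change (Wr P Q k0 k1 z = 0).
  assert (CW : ccont (Wr P Q k0 k1) z). { apply cdiff_ccont. apply (holo_Wr P Q k0 k1 X); auto. now rewrite Cmod_minus_0. }
  destruct (poles_discrete f z Hf) as [r [Hr HD]].
  apply (ccont_unique (Wr P Q k0 k1) (fun _ => RtoC 0) z (Rmin r (X - Cmod z))); auto. apply Rmin_pos; lra. apply ccont_const.
  intros w [W1 W2]. pose proof (Rmin_l r (X - Cmod z)). pose proof (Rmin_r r (X - Cmod z)).
  assert (Nw : ~ is_pole f w) by (apply HD; lra).
  assert (EW : Wr P Q k0 k1 w = (Q w * Q w * wf f K c w)%C) by (apply (Wr_wf f K c Hf HK r0 X B P Q w H); auto; generalize (Cmod_rev_triangle w z); lra).
  rewrite EW. assert (E0 : wf f K c w = RtoC 0). { apply NNPP. intros NW. apply Hn. exists w. auto. } rewrite E0. ring. }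
set (u := fun z => (cA k0 k1 z - kap * cB k0 k1 z)%C). set (v := fun z => (cA k0 k1 z - kap * cB k0 k1 z * k0 z)%C).
assert (cdA := cdiff_cA k0 k1 HK Hk1). assert (cdB := cdiff_cB k0 k1 HK Hk1).
assert (Hu : forall z, cdiff u z). { intros z. apply (cdiff_minus (cA k0 k1)). apply cdA. apply (cdiff_mult (fun _ => kap) (cB k0 k1)). apply cdiff_const. apply cdB. }
assert (Hv : forall z, cdiff v z). { intros z. apply (cdiff_minus (cA k0 k1)). apply cdA. apply (cdiff_mult (fun z => kap * cB k0 k1 z)%C k0). 
  apply (cdiff_mult (fun _ => kap) (cB k0 k1)). apply cdiff_const. apply cdB. apply HK. }
assert (PV : forall z, 4 * Cmod z < X -> (P z * v z)%C = (Q z * u z)%C).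
{ intros z Hz.
  assert (E0 : (q1 z - kap * q2 z)%C = RtoC 0).
  { apply (zero_wronskian_zero (fun z => q1 z - kap * q2 z)%C q2 X z z1); auto.
    - apply holo_minus; auto. apply holo_mult; auto. apply holo_const.
    - unfold X; lra.
    - unfold q1, q2. rewrite F1, F2, Ek. clear - A4. field. auto.
    - unfold q2. rewrite F2. now apply Cmult_neq_0.
    - intros w Hw. assert (Hw0 : Cmod (w - 0) < X) by now rewrite Cmod_minus_0.
      assert (ED : C_derive (fun z => q1 z - kap * q2 z)%C w = (C_derive q1 w - kap * C_derive q2 w)%C).
      { apply cder_C_derive. apply cder_minus. now apply (holo_C_derive q1 0 X). 
        eapply cder_eq. apply (cder_mult (fun _ => kap) q2). apply cder_const. now apply (holo_C_derive q2 0 X). cbv beta. ring. }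
      rewrite ED. pose proof (WZ w Hw) as EW.
      replace ((q1 w - kap * q2 w) * C_derive q2 w)%C with ((q1 w * C_derive q2 w - q2 w * C_derive q1 w) + q2 w * (C_derive q1 w - kap * C_derive q2 w))%C by ring.
      rewrite EW. ring. }
  replace (P z * v z)%C with ((q1 z - kap * q2 z) + Q z * u z)%C. rewrite E0. ring.
  unfold q1, q2, p1, p2, w1, w2, u, v. ring. }
destruct (quotient_extension v Q S5) as [E [HE EE]].
- intros z _; apply Hv.
- eapply holo_mono; [|apply HQX]; unfold S5, X; lra.
- intros z Hz. assert (Hz4 : 4 * Cmod z < X) by (unfold S5, X in *; lra).
  destruct (exact_order_exists Q X z1 z HQX ltac:(unfold X; lra) Hz4 NQ1) as [n On]. exists n. split; auto.
  destruct (Nat.eq_dec n 0) as [->|Nn]. apply entire_dv; auto.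
  apply (dv_cancel v P z n (X - Cmod z)). generalize (Cmod_ge_0 z); lra. eapply holo_sub; eauto. rewrite Cmod_minus_0; lra.
  intros EP. apply (fraction_coprime f r0 X B P Q z H); auto. generalize (Cmod_ge_0 z); lra. now apply (exact_order_zero Q z n).
  apply (dv_ext (fun w => Q w * u w)%C) with (r := X / 4 - Cmod z). lra.
  intros w Hw. rewrite <- PV. ring. generalize (Cmod_rev_triangle w z); lra.
  replace n with (n + 0)%nat by lia. apply (dv_mult Q u). now apply exact_order_dv. now apply entire_dv.
- exists E. split; [|split]; auto.
  + intros z L Hz M1 M2 M3 NQ HL1 HL. assert (Hz5 : Cmod z < S5) by (unfold S5; lra).
    pose proof (EE z Hz5) as Ev. pose proof (PV z ltac:(unfold X; lra)) as Eu.
    assert (Eu' : u z = (P z * E z)%C). { apply (Cmult_reg_l (Q z)); auto. rewrite <- Eu, Ev. ring. }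
    assert (BB : Rmax (Cmod (P z)) (Cmod (Q z)) * Cmod (E z) <= Cmod (cA k0 k1 z) + Cmod kap * Cmod (cB k0 k1 z) * (1 + Cmod (k0 z))).
    { pose proof (Cmod_ge_0 kap). pose proof (Cmod_ge_0 (cB k0 k1 z)). pose proof (Cmod_ge_0 (k0 z)).
      assert (0 <= Cmod kap * Cmod (cB k0 k1 z)) by now apply Rmult_le_pos.
      apply Rmax_case; rewrite <- Cmod_mult.
      - rewrite <- Eu'. unfold u. eapply Rle_trans. apply Cmod_minus_le. rewrite Cmod_mult. nra.
      - rewrite Cmult_comm, <- Ev. unfold v. eapply Rle_trans. apply Cmod_minus_le. rewrite !Cmod_mult. nra. }
    destruct (coefficient_bounds k0 k1 k2 d z) as [C1 [C2 _]].
    pose proof (Cmod_ge_0 kap). pose proof (Cmod_ge_0 (cA k0 k1 z)). pose proof (Cmod_ge_0 (cB k0 k1 z)). pose proof (Cmod_ge_0 (k0 z)).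
    eapply Rle_trans. apply BB.
    set (s := small k0 k1 k2 z) in *.
    assert (Ps : 0 <= s). { unfold s, small. generalize (Rabs_pos (ln (Cmod (k0 z)))) (Rabs_pos (ln (Cmod (k1 z)))) (Rabs_pos (ln (Cmod (k2 z)))). lra. }
    assert (Pe := exp_pos (9 * s)).
    apply Rle_trans with ((1 + Cmod kap) * (4 * exp (2 * s)) * (2 * exp s)).
    * apply Rle_trans with ((1 + Cmod kap) * (Cmod (cA k0 k1 z) + Cmod (cB k0 k1 z)) * (1 + Cmod (k0 z))).
      assert (0 <= Cmod kap * Cmod (cA k0 k1 z)) by now apply Rmult_le_pos. 
      assert (0 <= Cmod kap * Cmod (cB k0 k1 z)) by now apply Rmult_le_pos. nra.
      apply Rmult_le_compat; try lra. apply Rmult_le_pos; lra. apply Rmult_le_compat_l; lra.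
    * replace ((1 + Cmod kap) * (4 * exp (2 * s)) * (2 * exp s)) with (8 * (1 + Cmod kap) * exp (2 * s + s)) by (rewrite exp_plus; ring).
      rewrite <- (Rmult_1_r (8 * (1 + Cmod kap) * exp (2 * s + s))). apply Rmult_le_compat; try lra. apply Rmult_le_pos. lra. left; apply exp_pos.
      apply Rmult_le_compat_l. lra. apply exp_le. lra.
  + intros z Hz. pose proof (EE z ltac:(unfold S5; lra)) as Ev. split; [|now rewrite <- Ev].
    intros E0. rewrite E0, Cmult_0_l in Ev.
    destruct (Hc z Hz) as [B1 [B2 [B3 [B4 [B5 _]]]]].
    destruct (fraction_value f r0 X B P Q z H ltac:(unfold X; lra) B1) as [NQ _].
    pose proof (PV z ltac:(unfold X; lra)) as Eu. rewrite Ev, Cmult_0_r in Eu.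
    assert (U0 : u z = RtoC 0). { apply (Cmult_reg_l (Q z)); auto. rewrite <- Eu. ring. }
    (* A zero of [E] on |z| = r0 would be a common zero of [u] and [v], but their difference has no
       zero on this circle. *)
    assert (X0 : (kap * (cB k0 k1 z * (1 - k0 z)))%C = RtoC 0).
    { replace (kap * (cB k0 k1 z * (1 - k0 z)))%C with (v z - u z)%C by (unfold u, v; ring). rewrite Ev, U0. ring. }
    revert X0. apply Cmult_neq_0; auto. apply Cmult_neq_0.
    intros EB. apply B4. unfold phi2. change (K z * K (z + c) - 1)%C with (cB k0 k1 z). rewrite EB. ring.
    intros EB. apply B5. unfold phi3. change (1 - K z)%C with (1 - k0 z)%C. rewrite EB. ring.
Qed.

(** The radius 20 S + 10 + 3 |c| leaves room for two losses of a factor 4: E is constructed on the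
    disc of radius 5 S + 1, and its zeros are listed in |z| < S. It also leaves room for the
    translations by c and 2 c. *)
Record scale_data (r0 cP cE c1 c2 c3 C0 S : R) (B : list C) (P Q E : C -> C) (lP lQ lE l1 l2 l3 : list C) : Prop := {
  sd_frac : fraction f r0 (20 * S + 10 + 3 * Cmod c) B P Q;
  sd_sys : frac_sys P Q S r0 cP lP lQ;
  sd_bound : bounded_by P Q E S C0;
  sd_E : zsys E S lE; sd_gE : generic r0 lE; sd_cE : mn (fun z => ln (Cmod (E z))) r0 = cE;
  sd_1 : zsys (p1 P Q k0 k1) S l1; sd_g1 : generic r0 l1; sd_c1 : mn (fun z => ln (Cmod (p1 P Q k0 k1 z))) r0 = c1;
  sd_2 : zsys (p2 P Q k0 k1) S l2; sd_g2 : generic r0 l2; sd_c2 : mn (fun z => ln (Cmod (p2 P Q k0 k1 z))) r0 = c2;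
  sd_3 : zsys (p3 P Q k0 k1) S l3; sd_g3 : generic r0 l3; sd_c3 : mn (fun z => ln (Cmod (p3 P Q k0 k1 z))) r0 = c3 }.

(* None of the constants depends on the scale S. *)
Theorem scale_data_exists : exists r0 cP cE c1 c2 c3 C0, 0 < r0 < 1 /\ 1 <= C0 /\ forall S, 1 < S ->
  exists B P Q E lP lQ lE l1 l2 l3, scale_data r0 cP cE c1 c2 c3 C0 S B P Q E lP lQ lE l1 l2 l3.
Proof.
destruct (circle_r0 f K c d Hf HK HfK N0 N1 NK1 NKd NK2) as [r0 [Hr0 Hc]].
set (kap := (phi1 f K c (circ r0 0) / phi2 f K c (circ r0 0))%C).
assert (Hcase : exists C0 (G : C -> C), 1 <= C0 /\ forall S B P Q, 1 < S -> fraction f r0 (20 * S + 10 + 3 * Cmod c) B P Q ->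
  exists E, holo_on_disc E 0 (5 * S + 1) /\ bounded_by P Q E S C0 /\ forall z, Cmod z = r0 -> E z <> RtoC 0 /\ (E z * Q z = G z)%C).
{ destruct (classic (nondegenerate f K c)) as [Hn|Hn].
  - exists (16 * (1 + Cmod d) ^ 3), (fun z => Sig k0 k1 k2 d z * wf f K c z / ((f z - 1) * (k0 z * f z - 1) * (k0 z * k1 z * f z - 1)))%C.
    split. { assert (1 <= (1 + Cmod d) ^ 3) by (apply pow_R1_Rle; generalize (Cmod_ge_0 d); lra). lra. }
    intros S B P Q HS H. now apply (nondegenerate_case r0 S B).
  - exists (8 * (1 + Cmod kap)), (fun z => cA k0 k1 z - kap * cB k0 k1 z * k0 z)%C.
    split. generalize (Cmod_ge_0 kap); lra. intros S B P Q HS H. now apply (degenerate_case r0 S B). }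
destruct Hcase as [C0 [G [HC0 HG]]].
exists r0, (mn (fun z => ln (Cmod (f z))) r0), (mn (fun z => ln (Cmod (G z))) r0), (mn (fun z => ln (Cmod (phi1 f K c z))) r0),
  (mn (fun z => ln (Cmod (phi2 f K c z))) r0), (mn (fun z => ln (Cmod (phi3 f K c z))) r0), C0.
split; [|split]; auto. intros S HS. pose proof (Cmod_ge_0 c) as Pc. set (X := 20 * S + 10 + 3 * Cmod c).
destruct (fraction_exists f r0 X Hf) as [B [P [Q H]]].
destruct (HG S B P Q HS H) as [E [HE [HB HE0]]].
assert (HPX : holo_on_disc P 0 X) by apply H. assert (HQX : holo_on_disc Q 0 X) by (eapply fraction_holo_Q; eauto).
set (z1 := circ r0 0) in *. assert (Hz1 : Cmod z1 = r0) by (apply Cmod_circ; lra).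
assert (val : forall z, Cmod z = r0 -> Q z <> RtoC 0 /\ P z = (Q z * f z)%C /\ f z <> RtoC 0 /\
   p1 P Q k0 k1 z = (Q z * phi1 f K c z)%C /\ p2 P Q k0 k1 z = (Q z * phi2 f K c z)%C /\ p3 P Q k0 k1 z = (Q z * phi3 f K c z)%C /\
   phi1 f K c z <> RtoC 0 /\ phi2 f K c z <> RtoC 0 /\ phi3 f K c z <> RtoC 0).
{ intros z Hz. destruct (Hc z Hz) as [A1 [A2 [A3 [A4 [A5 _]]]]].
  destruct (fraction_value f r0 X B P Q z H ltac:(unfold X; lra) A1) as [NQ EP].
  destruct (p_phi f K c r0 X B P Q z H ltac:(unfold X; lra) A1) as [F1 [F2 F3]]. repeat (split; [assumption|]). assumption. }
assert (NP : forall z, Cmod z = r0 -> P z <> RtoC 0). { intros z Hz. destruct (val z Hz) as [V0 [-> [V2 _]]]. now apply Cmult_neq_0. }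
assert (NQ : forall z, Cmod z = r0 -> Q z <> RtoC 0) by (intros z Hz; now apply val).
assert (NE : forall z, Cmod z = r0 -> E z <> RtoC 0) by (intros z Hz; now apply HE0).
assert (M1 : forall z, Cmod z = r0 -> p1 P Q k0 k1 z <> RtoC 0). { intros z Hz. destruct (val z Hz) as [V0 [_ [_ [-> [_ [_ [V _]]]]]]]. now apply Cmult_neq_0. }
assert (M2 : forall z, Cmod z = r0 -> p2 P Q k0 k1 z <> RtoC 0). { intros z Hz. destruct (val z Hz) as [V0 [_ [_ [_ [-> [_ [_ [V _]]]]]]]]. now apply Cmult_neq_0. }
assert (M3 : forall z, Cmod z = r0 -> p3 P Q k0 k1 z <> RtoC 0). { intros z Hz. destruct (val z Hz) as [V0 [_ [_ [_ [_ [-> [_ [_ V]]]]]]]]. now apply Cmult_neq_0. }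
assert (ZS : forall F R, 4 * S < R -> holo_on_disc F 0 R -> (forall z, Cmod z = r0 -> F z <> RtoC 0) -> exists l, zsys F S l /\ generic r0 l /\ ccirc (fun z => ln (Cmod (F z))) r0).
{ intros F R HR HF NF. destruct (zsys_exists F z1 S R ltac:(lra) HR HF ltac:(lra) (NF z1 Hz1)) as [l Hl]. exists l.
  assert (generic r0 l) by (eapply zsys_generic; eauto). split; [|split]; auto. eapply zsys_ccirc; eauto. lra. }
destruct (ZS P X ltac:(unfold X; lra) HPX NP) as [lP [ZP [GP CP]]].
destruct (ZS Q X ltac:(unfold X; lra) HQX NQ) as [lQ [ZQ [GQ CQ]]].
destruct (ZS E (5 * S + 1) ltac:(lra) HE NE) as [lE [ZE [GE CE]]].
destruct (ZS (p1 P Q k0 k1) X ltac:(unfold X; lra) ltac:(apply holo_p1; auto) M1) as [l1 [Z1 [G1 C1]]].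
destruct (ZS (p2 P Q k0 k1) X ltac:(unfold X; lra) ltac:(apply holo_p2; auto) M2) as [l2 [Z2 [G2 C2]]].
destruct (ZS (p3 P Q k0 k1) X ltac:(unfold X; lra) ltac:(apply holo_p3; auto) M3) as [l3 [Z3 [G3 C3]]].
assert (GB : generic r0 B). { intros b Hb Eb. apply (NQ b Eb). destruct H as [-> _]. rewrite lprod_in by auto. ring. }
assert (cQ : mn (fun z => ln (Cmod (Q z))) r0 = 0).
{ destruct (fraction_mn_Q f r0 X B P Q r0 H ltac:(lra) GB) as [-> _]. rewrite (lsum_ext _ (fun _ => 0)). rewrite lsum_const. ring. intros; ring. }
assert (circ0 : forall t, Cmod (circ r0 t) = r0) by (intros; apply Cmod_circ; lra).
assert (QU : forall F G, ccirc (fun z => ln (Cmod (F z))) r0 -> (forall z, Cmod z = r0 -> F z = (Q z * G z)%C /\ G z <> RtoC 0) ->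
   mn (fun z => ln (Cmod (F z))) r0 = mn (fun z => ln (Cmod (G z))) r0).
{ intros F G0 CF EF. apply (mn_quotient F Q (fun z => ln (Cmod (G0 z)))); auto. intros t. destruct (EF _ (circ0 t)) as [-> NG].
  rewrite Cmod_mult, ln_mult by (apply Cmod_pos_neq; auto). ring. }
exists B, P, Q, E, lP, lQ, lE, l1, l2, l3. split; auto.
- split; auto. apply QU; auto. intros z Hz. destruct (val z Hz) as [V0 [V1 [V2 _]]]. auto.
- apply (mn_quotient' E Q (fun z => ln (Cmod (G z)))); auto. intros t. destruct (HE0 _ (circ0 t)) as [N <-].
  rewrite Cmod_mult, ln_mult by (apply Cmod_pos_neq; auto). ring.
- apply QU; auto. intros z Hz. destruct (val z Hz) as [V0 [V1 [V2 [V3 [V4 [V5 [V6 [V7 V8]]]]]]]]. auto.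
- apply QU; auto. intros z Hz. destruct (val z Hz) as [V0 [V1 [V2 [V3 [V4 [V5 [V6 [V7 V8]]]]]]]]. auto.
- apply QU; auto. intros z Hz. destruct (val z Hz) as [V0 [V1 [V2 [V3 [V4 [V5 [V6 [V7 V8]]]]]]]]. auto.
Qed.
End MainHolo.

(** * The main inequality at a given scale *)

Lemma Cmod_scal_pos x c : 0 <= x -> Cmod (RtoC x * c) = x * Cmod c.
Proof.
intros. rewrite Cmod_mult. f_equal. unfold Cmod, RtoC; simpl. replace (x * (x * 1) + 0 * (0 * 1)) with (Rsqr x) by (unfold Rsqr; ring).
now apply sqrt_Rsqr.
Qed.

Definition bad_radii (c : C) (lP lQ lE l1 l2 l3 : list C) : list R :=
  map Cmod (lP ++ lQ ++ lE ++ l1 ++ l2 ++ l3) ++ map (fun a => Cmod (a - 1 * c)) (lP ++ lQ) ++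
  map (fun a => Cmod (a - 2 * c)) (lP ++ lQ) ++ map (fun a => Cmod (a - 3 * c)) (lP ++ lQ).

(** Each factor |z - b| / max (r0, |b|) is at most 1 + |z| / r0, so the bound depends on the poles
    through their number only. *)
Lemma lprod_factor_upper l r0 z : 0 < r0 -> Cmod (RtoC (norm_const r0 l) * lprod l z) <= (1 + Cmod z / r0) ^ length l.
Proof.
intros Hr. rewrite Cmod_scal_pos by (left; apply exp_pos). unfold norm_const.
induction l as [|b l IH]; simpl. { rewrite Ropp_0, exp_0, Cmod_1. lra. }
rewrite Ropp_plus_distr, exp_plus, Cmod_mult.
replace (exp (- ln (Rmax r0 (Cmod b))) * exp (- lsum (fun b0 => ln (Rmax r0 (Cmod b0))) l) * (Cmod (z - b) * Cmod (lprod l z))) with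
 ((exp (- ln (Rmax r0 (Cmod b))) * Cmod (z - b)) * (exp (- lsum (fun b0 => ln (Rmax r0 (Cmod b0))) l) * Cmod (lprod l z))) by ring.
pose proof (Rmax_l r0 (Cmod b)). pose proof (Rmax_r r0 (Cmod b)). set (m := Rmax r0 (Cmod b)) in *.
apply Rmult_le_compat; auto.
- apply Rmult_le_pos. left; apply exp_pos. apply Cmod_ge_0.
- apply Rmult_le_pos. left; apply exp_pos. apply Cmod_ge_0.
- rewrite exp_Ropp, exp_ln by lra. pose proof (Cmod_minus_le z b). pose proof (Cmod_ge_0 z).
  apply Rle_trans with (/ m * (Cmod z + m)). apply Rmult_le_compat_l. left; apply Rinv_0_lt_compat; lra. lra.
  replace (/ m * (Cmod z + m)) with (1 + Cmod z * / m) by (field; lra). apply Rplus_le_compat_l. apply Rmult_le_compat_l; auto.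
  apply Rinv_le_contravar; lra.
Qed.

Lemma ln_shift_quotient f K c S X r0 B P Q lP lQ z : meromorphic f -> (forall z, cdiff K z) ->
  (forall z, ~ is_pole f z -> ~ is_pole f (z + c)%C -> f (z + c)%C = (K z * f z)%C) ->
  fraction f r0 X B P Q -> S <= X -> zsys P S lP -> zsys Q S lQ ->
  Cmod z < S -> Cmod (z + c) < S -> ~ In z lP -> ~ In z lQ -> ~ In (z + c)%C lP -> ~ In (z + c)%C lQ ->
  ln (Cmod (K z)) = lr P Q (z + c)%C - lr P Q z.
Proof.
intros Hf HK HfK FR HX ZP ZQ H1 H2 A1 A2 A3 A4.
assert (E0 := fraction_shift f r0 X B P Q c K z Hf FR HK HfK ltac:(lra) ltac:(lra)).
pose proof (zsys_nonzero P S lP z ZP H1 A1) as B1. pose proof (zsys_nonzero Q S lQ z ZQ H1 A2) as B2.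
pose proof (zsys_nonzero P S lP _ ZP H2 A3) as B3. pose proof (zsys_nonzero Q S lQ _ ZQ H2 A4) as B4.
assert (EK : K z = (P (z + c) * Q z / (P z * Q (z + c)))%C) by (rewrite E0; field; auto).
rewrite EK, Cmod_div, !Cmod_mult by (now apply Cmult_neq_0). unfold lr.
rewrite ln_div, !ln_mult by (try apply Rmult_lt_0_compat; now apply Cmod_pos_neq). ring.
Qed.

Lemma circ_shift_notin c r t x l : 0 <= r -> shift_generic r (RtoC x * c) l -> ~ In (circ r t + RtoC x * c)%C l.
Proof.
intros Hr H I. destruct (H _ I) as [_ N]. apply N. replace (circ r t + RtoC x * c - RtoC x * c)%C with (circ r t) by ring. now apply Cmod_circ.
Qed.

Section Scale.
Variables (f K : C -> C) (c d : C).
Hypothesis Hf : meromorphic f.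
Hypothesis HK : forall z, cdiff K z.
Hypothesis HfK : forall z, ~ is_pole f z -> ~ is_pole f (z + c)%C -> f (z + c)%C = (K z * f z)%C.
Hypothesis Hc : c <> RtoC 0.

Let k0 := K.
Let k1 := fun z => K (z + c)%C.
Let k2 := fun z => K (z + 2 * c)%C.

Variables (r0 cP cE c1 c2 c3 C0 S : R) (B : list C) (P Q E : C -> C) (lP lQ lE l1 l2 l3 : list C).
Hypothesis SD : scale_data f K c r0 cP cE c1 c2 c3 C0 S B P Q E lP lQ lE l1 l2 l3.
Hypothesis HS : 1 < S.
Hypothesis HC0 : 1 <= C0.

Definition good_for (r : R) := ~ In r (bad_radii c lP lQ lE l1 l2 l3).

Lemma good_generic r : good_for r -> generic r lP /\ generic r lQ /\ generic r lE /\ generic r l1 /\ generic r l2 /\ generic r l3.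
Proof using.
clear k0 k1 k2. intros H. clear - H. assert (A : forall a, In a (lP ++ lQ ++ lE ++ l1 ++ l2 ++ l3) -> Cmod a <> r).
{ intros a I Ea. apply H. apply in_app_iff. left. rewrite <- Ea. now apply in_map. }
repeat split; intros a I; apply A; rewrite !in_app_iff; tauto.
Qed.

Lemma good_shift r : good_for r -> forall x, x = 1 \/ x = 2 \/ x = 3 -> shift_generic r (RtoC x * c) lP /\ shift_generic r (RtoC x * c) lQ.
Proof using.
clear k0 k1 k2. intros H x Hx. clear - H Hx. destruct (good_generic r H) as [GP [GQ _]].
assert (A : forall a, In a (lP ++ lQ) -> Cmod (a - RtoC x * c) <> r).
{ intros a I Ea. apply H. unfold bad_radii. rewrite !in_app_iff. right. rewrite <- Ea.
  destruct Hx as [->|[->| ->]]. left. now apply (in_map (fun a => Cmod (a - 1 * c))). right; left. now apply (in_map (fun a => Cmod (a - 2 * c))).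
  right; right. now apply (in_map (fun a => Cmod (a - 3 * c))). }
split; intros a I; (split; [auto|]); apply A; rewrite in_app_iff; auto.
Qed.

(** With u_j the value of [lr] at z + j c, this bounds |u1 - u0| + |u2 - u1| + |u3 - u2| by
    differences with u0 alone, since logarithmic differences are estimated on the circle |z| = r and
    not on its translates. Hence the weights 2, 2, 1. *)
Definition diffsum z := 2 * Rabs (lr P Q (z + 1 * c)%C - lr P Q z) + 2 * Rabs (lr P Q (z + 2 * c)%C - lr P Q z) + Rabs (lr P Q (z + 3 * c)%C - lr P Q z).

Lemma ln_K z : Cmod z < S -> Cmod (z + c) < S -> ~ In z lP -> ~ In z lQ -> ~ In (z + c)%C lP -> ~ In (z + c)%C lQ ->
  ln (Cmod (K z)) = lr P Q (z + c)%C - lr P Q z.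
Proof.
destruct SD as [FR [ZP ZQ _ _ _ _ _] _ _ _ _ _ _ _ _ _ _ _ _ _]. pose proof (Cmod_ge_0 c).
apply (ln_shift_quotient f K c S (20 * S + 10 + 3 * Cmod c) r0 B P Q lP lQ z); auto. lra.
Qed.

Lemma small_circ r t : 0 <= r -> r + 3 * Cmod c < S -> good_for r -> small k0 k1 k2 (circ r t) <= diffsum (circ r t).
Proof.
intros Hr HrS G. set (z := circ r t). assert (Hz : Cmod z = r) by now apply Cmod_circ.
destruct (good_generic r G) as [GP [GQ _]].
pose proof (good_shift r G 1 ltac:(auto)) as [P1 Q1]. pose proof (good_shift r G 2 ltac:(auto)) as [P2 Q2]. pose proof (good_shift r G 3 ltac:(auto)) as [P3 Q3].
pose proof (circ_shift_notin c r t 1 _ Hr P1) as N1. pose proof (circ_shift_notin c r t 1 _ Hr Q1) as M1.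
pose proof (circ_shift_notin c r t 2 _ Hr P2) as N2. pose proof (circ_shift_notin c r t 2 _ Hr Q2) as M2.
pose proof (circ_shift_notin c r t 3 _ Hr P3) as N3. pose proof (circ_shift_notin c r t 3 _ Hr Q3) as M3.
pose proof (circ_notin r lP t Hr GP) as N0. pose proof (circ_notin r lQ t Hr GQ) as M0. fold z in N0, N1, N2, N3, M0, M1, M2, M3.
pose proof (Cmod_ge_0 c) as Pc.
assert (T : forall x, 0 <= x <= 3 -> Cmod (z + RtoC x * c) < S).
{ intros x Hx. eapply Rle_lt_trans. apply Cmod_triangle. rewrite Cmod_scal_pos by lra. rewrite Hz. nra. }
assert (T0 : Cmod z < S) by (rewrite Hz; lra).
pose proof (T 1 ltac:(lra)) as T1. pose proof (T 2 ltac:(lra)) as T2. pose proof (T 3 ltac:(lra)) as T3.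
assert (e1 : (z + 1 * c)%C = (z + c)%C) by ring. assert (e2 : (z + 2 * c)%C = (z + c + c)%C) by ring. assert (e3 : (z + 3 * c)%C = (z + 2 * c + c)%C) by ring.
unfold small, diffsum. unfold k0, k1, k2.
rewrite (ln_K z) by (rewrite ?e1 in *; auto).
rewrite e1 in N1, M1, T1.
rewrite (ln_K (z + c)%C) by (rewrite <- ?e2; auto).
rewrite (ln_K (z + 2 * c)%C) by (rewrite <- ?e3; auto).
rewrite <- e3, <- e2, e1.
set (u0 := lr P Q z). set (u1 := lr P Q (z + c)%C). set (u2 := lr P Q (z + 2 * c)%C). set (u3 := lr P Q (z + 3 * c)%C).
unfold Rabs. repeat destruct Rcase_abs; lra.
Qed.

Definition excess r := 2 * charT P Q r - cP.

(** 5 is the sum of the weights of [diffsum], and 12 |c| is 4 times the largest translation 3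
    |c|. *)
Lemma mean_diffsum r R R2 mu : 1 <= r -> r < R -> R < R2 -> R2 < S -> 6 * Cmod c <= R - r -> good_for r -> good_for R -> good_for R2 ->
  (forall dd x, 0 < dd <= 3 * Cmod c -> Cmod x <> r -> mn (nearness dd x) r <= mu) ->
  ccirc diffsum r /\ mn diffsum r <= 5 * (12 * Cmod c / (R - r) * excess R + 4 * mu * (R2 / (R2 - R)) * excess R2).
Proof.
intros Hr HR HR2 HR2S Hcr G G1 G2 HM. pose proof (Cmod_pos_neq c Hc) as Pc.
destruct (good_generic R G1) as [GP1 [GQ1 _]]. destruct (good_generic R2 G2) as [GP2 [GQ2 _]].
assert (FS : frac_sys P Q S r0 cP lP lQ) by apply SD.
assert (A : forall x, x = 1 \/ x = 2 \/ x = 3 -> ccirc (fun z => Rabs (lr P Q (z + RtoC x * c)%C - lr P Q z)) r /\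
  mn (fun z => Rabs (lr P Q (z + RtoC x * c)%C - lr P Q z)) r <= 12 * Cmod c / (R - r) * excess R + 4 * mu * (R2 / (R2 - R)) * excess R2).
{ intros x Hx. destruct (good_shift r G x Hx) as [SP SQ]. assert (Hx' : 1 <= x <= 3) by lra.
  destruct (small_quotient P Q S r0 cP lP lQ (RtoC x * c)%C r R R2 mu) as [Y1 Y2]; auto; try (rewrite Cmod_scal_pos by lra; nra).
  - intros y Hy. apply HM; auto. rewrite Cmod_scal_pos by lra. nra.
  - split; auto. eapply Rle_trans. apply Y2. unfold excess. apply Rplus_le_compat_r. apply Rmult_le_compat_r.
    destruct (frac_sys_abs _ _ _ _ _ _ _ R FS ltac:(lra) GP1 GQ1) as [_ [Z1 Z2]]. lra.
    apply Rmult_le_compat_r. left; apply Rinv_0_lt_compat; lra. rewrite Cmod_scal_pos by lra. nra. }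
destruct (A 1 ltac:(auto)) as [X1 Y1]. destruct (A 2 ltac:(auto)) as [X2 Y2]. destruct (A 3 ltac:(auto)) as [X3 Y3].
assert (Z1 := ccirc_scal 2 _ r X1). assert (Z2 := ccirc_scal 2 _ r X2). cbv beta in Z1, Z2.
assert (Z3 := ccirc_plus _ _ r Z1 Z2). cbv beta in Z3.
split. { exact (ccirc_plus _ _ r Z3 X3). }
unfold diffsum.
rewrite (mn_plus (fun z => 2 * Rabs (lr P Q (z + 1 * c)%C - lr P Q z) + 2 * Rabs (lr P Q (z + 2 * c)%C - lr P Q z)) (fun z => Rabs (lr P Q (z + 3 * c)%C - lr P Q z))) by auto.
rewrite (mn_plus (fun z => 2 * Rabs (lr P Q (z + 1 * c)%C - lr P Q z)) (fun z => 2 * Rabs (lr P Q (z + 2 * c)%C - lr P Q z))) by auto.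
rewrite (mn_scal 2 (fun z => Rabs (lr P Q (z + 1 * c)%C - lr P Q z))), (mn_scal 2 (fun z => Rabs (lr P Q (z + 2 * c)%C - lr P Q z))) by auto.
lra.
Qed.

Definition lnmax z := (ln (Cmod (P z)) + ln (Cmod (Q z)) + Rabs (lr P Q z)) / 2.

Lemma max_exp z : P z <> RtoC 0 -> Q z <> RtoC 0 -> Rmax (Cmod (P z)) (Cmod (Q z)) = exp (lnmax z).
Proof.
intros NP NQ. apply Cmod_pos_neq in NP, NQ. unfold lnmax, lr, Rabs. 
destruct (Rcase_abs (ln (Cmod (P z)) - ln (Cmod (Q z)))) as [A|A].
- rewrite Rmax_right. rewrite <- (exp_ln _ NQ) at 1. f_equal. field. left. apply ln_lt_inv; lra.
- rewrite Rmax_left. rewrite <- (exp_ln _ NP) at 1. f_equal. field.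
  destruct (Req_dec (ln (Cmod (P z))) (ln (Cmod (Q z)))) as [e|n]. right. symmetry. now apply ln_inv. left. apply ln_lt_inv; lra.
Qed.

Lemma good_nonzero r t : 0 <= r < S -> good_for r -> P (circ r t) <> RtoC 0 /\ Q (circ r t) <> RtoC 0 /\ E (circ r t) <> RtoC 0 /\
  p1 P Q k0 k1 (circ r t) <> RtoC 0 /\ p2 P Q k0 k1 (circ r t) <> RtoC 0 /\ p3 P Q k0 k1 (circ r t) <> RtoC 0.
Proof.
intros Hr G. destruct (good_generic r G) as [G1 [G2 [G3 [G4 [G5 G6]]]]].
assert (A : forall F l, zsys F S l -> generic r l -> F (circ r t) <> RtoC 0).
{ intros F l Z g. apply (zsys_nonzero F S l _ Z). rewrite Cmod_circ; lra. apply circ_notin; auto; lra. }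
destruct SD as [FR [ZP ZQ _ _ _ _ _] _ ZE _ _ Z1 _ _ Z2 _ _ Z3 _ _].
repeat split; eapply A; eauto.
Qed.

Lemma good_ccirc F l r : zsys F S l -> 0 <= r < S -> generic r l -> ccirc (fun z => ln (Cmod (F z))) r.
Proof. intros. eapply zsys_ccirc; eauto. Qed.

Lemma good_ccirc_lnmax r : 0 <= r < S -> good_for r -> ccirc (fun z => ln (Cmod (P z))) r /\ ccirc (fun z => ln (Cmod (Q z))) r /\
  ccirc (fun z => Rabs (lr P Q z)) r /\ ccirc lnmax r /\ mn lnmax r = charT P Q r.
Proof.
intros Hr G. destruct (good_generic r G) as [G1 [G2 _]]. destruct SD as [_ [ZP ZQ _ _ _ _ _] _ _ _ _ _ _ _ _ _ _ _ _ _].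
assert (CP := good_ccirc P lP r ZP Hr G1). assert (CQ := good_ccirc Q lQ r ZQ Hr G2).
assert (CR : ccirc (fun z => Rabs (lr P Q z)) r) by (apply ccirc_abs; now apply ccirc_minus).
assert (C1 := ccirc_plus _ _ r CP CQ). assert (C2 := ccirc_plus _ _ r C1 CR). cbv beta in C1, C2.
assert (C3 := ccirc_scal (/ 2) _ r C2). cbv beta in C3.
set (U := fun z => / 2 * (ln (Cmod (P z)) + ln (Cmod (Q z)) + Rabs (lr P Q z))) in C3.
assert (EX : forall t, U (circ r t) = lnmax (circ r t)) by (intros; unfold U, lnmax; field).
split; [|split; [|split; [|split]]]; auto.
- exact (ccirc_ext U lnmax r EX C3).
- rewrite <- (mn_ext U lnmax r EX). unfold U.
  rewrite (mn_scal (/ 2) (fun z => ln (Cmod (P z)) + ln (Cmod (Q z)) + Rabs (lr P Q z)) r C2).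
  rewrite (mn_plus (fun z => ln (Cmod (P z)) + ln (Cmod (Q z))) (fun z => Rabs (lr P Q z)) r C1 CR).
  rewrite (mn_plus (fun z => ln (Cmod (P z))) (fun z => ln (Cmod (Q z))) r CP CQ). unfold charT. field.
Qed.

(** The mean over |z| = r of the logarithm of the pointwise bound. By Jensen's formula ln |E| has
    mean at least [cE], wherever the zeros of E lie. *)
Lemma mean_inequality r L : 1 <= r -> r + 3 * Cmod c < S -> good_for r -> ccirc diffsum r -> 1 <= L ->
  (forall t, lamsum P Q k0 k1 (circ r t) <= L) -> charT P Q r + cE <= ln C0 + 9 * mn diffsum r + ln L.
Proof.
intros Hr HrS G CD HL HLam. pose proof (Cmod_ge_0 c) as Pc. assert (HrS' : 0 <= r < S) by lra.
destruct (good_ccirc_lnmax r HrS' G) as [_ [_ [_ [CM EM]]]]. destruct (good_generic r G) as [_ [_ [GE _]]].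
pose proof SD as [_ [_ _ Hr0 _ _ _ _] HB ZE GE0 EE _ _ _ _ _ _ _ _ _].
assert (CE := good_ccirc E lE r ZE HrS' GE).
assert (ME : cE <= mn (fun z => ln (Cmod (E z))) r) by (rewrite <- EE; apply (zsys_mono E S lE r0 r ZE); auto; lra).
assert (C9 := ccirc_scal 9 _ r CD). cbv beta in C9.
assert (CR := ccirc_plus _ _ r (ccirc_const (ln C0 + ln L) r) C9). cbv beta in CR.
assert (CL := ccirc_plus _ _ r CM CE). cbv beta in CL.
assert (I : mn (fun z => lnmax z + ln (Cmod (E z))) r <= mn (fun z => (ln C0 + ln L) + 9 * diffsum z) r).
{ apply mn_le; auto. intros t. destruct (good_nonzero r t HrS' G) as [NP [NQ [NE [M1 [M2 M3]]]]].
  pose proof (small_circ r t ltac:(lra) ltac:(lra) G) as Sm.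
  assert (Hz : Cmod (circ r t) = r) by (apply Cmod_circ; lra).
  pose proof (HB (circ r t) L ltac:(lra) M1 M2 M3 NQ HL (HLam t)) as X. rewrite max_exp in X by auto.
  apply Cmod_pos_neq in NE. rewrite <- (exp_ln _ NE) in X. rewrite <- exp_plus in X.
  rewrite <- (exp_ln C0) in X by lra. rewrite <- (exp_ln L) in X at 1 by lra. rewrite <- !exp_plus in X.
  assert (Y : forall x y, exp x <= exp y -> x <= y). { intros x y [Hl|He]. left; now apply exp_lt_inv. right. now apply exp_inv. }
  apply Y in X. cbv beta in X.
  change (lnmax (circ r t) + ln (Cmod (E (circ r t))) <= ln C0 + 9 * small k0 k1 k2 (circ r t) + ln L) in X. lra. }
rewrite (mn_plus lnmax (fun z => ln (Cmod (E z))) r CM CE) in I.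
rewrite (mn_plus (fun _ => ln C0 + ln L) (fun z => 9 * diffsum z) r (ccirc_const _ r) C9) in I.
rewrite mn_const, (mn_scal 9 diffsum r CD), EM in I. lra.
Qed.

Definition dominated (F : C -> C) := forall z, Cmod (F z) <= 4 * exp (3 * small k0 k1 k2 z) * Rmax (Cmod (P z)) (Cmod (Q z)).

Lemma dominated_p : dominated (p1 P Q k0 k1) /\ dominated (p2 P Q k0 k1) /\ dominated (p3 P Q k0 k1).
Proof.
assert (A : forall z, let e := exp (small k0 k1 k2 z) in let M := Rmax (Cmod (P z)) (Cmod (Q z)) in
  1 <= e /\ Cmod (k0 z) <= e /\ Cmod (k0 z * k1 z) <= e * e /\ 0 <= M /\ Cmod (P z) <= M /\ Cmod (Q z) <= M /\ exp (3 * small k0 k1 k2 z) = e * e * e).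
{ intros z e M. destruct (small_bounds k0 k1 k2 z) as [e' [Ee [E1 [B0 [B1 B2]]]]]. fold e in Ee. rewrite Ee in *.
  assert (Cmod (P z) <= M) by apply Rmax_l. assert (Cmod (Q z) <= M) by apply Rmax_r. pose proof (Cmod_ge_0 (P z)).
  pose proof (Cmod_ge_0 (k0 z)). pose proof (Cmod_ge_0 (k1 z)).
  repeat split; try lra. rewrite Cmod_mult. apply Rmult_le_compat; lra. unfold e. rewrite <- !exp_plus. f_equal. ring. }
assert (T : forall (u v : C) p q, Cmod u <= p -> Cmod v <= q -> Cmod (u * v) <= p * q).
{ intros. rewrite Cmod_mult. apply Rmult_le_compat; auto using Cmod_ge_0. }
assert (W : forall (u v : C) p q, Cmod u <= p -> Cmod v <= q -> Cmod (u - v) <= p + q).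
{ intros. eapply Rle_trans. apply Cmod_minus_le. lra. }
assert (T1 : Cmod 1 <= 1) by (rewrite Cmod_1; lra).
split; [|split]; intros z; destruct (A z) as [e1 [e2 [e3 [e4 [e5 [e6 ->]]]]]]; 
  set (e := exp (small k0 k1 k2 z)) in *; set (M := Rmax (Cmod (P z)) (Cmod (Q z))) in *;
  assert (ee : e <= e * e) by nra; assert (eee : e * e <= e * e * e) by nra; assert (eM : M <= e * M) by nra; assert (eeM : e * M <= e * e * M) by nra; assert (eeeM : e * e * M <= e * e * e * M) by nra.
- eapply Rle_trans. apply T. apply W. exact e2. exact e3. apply W. exact e5. exact e6. nra.
- eapply Rle_trans. apply T. apply W. exact e3. exact T1. apply W. apply T. exact e2. exact e5. exact e6. nra.
- eapply Rle_trans. apply T. apply W. exact T1. exact e2. apply W. apply T. exact e3. exact e5. exact e6. nra.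
Qed.

Definition poles_weight r := INR (length B) * ln (1 + r / r0).

(** If x <= U and 0 <= U, then |x| <= 2 U - x. With x = ln |F| an upper bound alone suffices,
    because the mean of ln |F| is at least [cF]. *)
Lemma crude_mean F l cF r : dominated F -> zsys F S l -> generic r0 l -> mn (fun z => ln (Cmod (F z))) r0 = cF ->
  1 <= r -> r + 3 * Cmod c < S -> good_for r -> generic r l -> ccirc diffsum r ->
  mn (fun z => Rabs (ln (Cmod (F z)))) r <= 2 * (ln 4 + 3 * mn diffsum r + poles_weight r + excess r) - cF.
Proof.
intros DF ZF G0 EF Hr HrS G Gl CD. pose proof (Cmod_ge_0 c) as Pc. assert (HrS' : 0 <= r < S) by lra.
destruct (good_ccirc_lnmax r HrS' G) as [_ [_ [CA _]]]. destruct (good_generic r G) as [GP [GQ _]].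
pose proof SD as [FR FS _ _ _ _ _ _ _ _ _ _ _ _ _]. pose proof FS as [_ _ Hr0 _ _ _ _].
assert (CF := good_ccirc F l r ZF HrS' Gl).
assert (MF : cF <= mn (fun z => ln (Cmod (F z))) r) by (rewrite <- EF; apply (zsys_mono F S l r0 r ZF); auto; lra).
destruct (frac_sys_abs _ _ _ _ _ _ _ r FS ltac:(lra) GP GQ) as [AA _].
set (k := 2 * (ln 4 + poles_weight r)).
assert (C6 := ccirc_scal 6 _ r CD). assert (C2 := ccirc_scal 2 _ r CA). cbv beta in C6, C2.
assert (C3 := ccirc_plus _ _ r (ccirc_const k r) C6). cbv beta in C3.
assert (C4 := ccirc_plus _ _ r C3 C2). cbv beta in C4. assert (C5 := ccirc_minus _ _ r C4 CF). cbv beta in C5.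
assert (I : mn (fun z => Rabs (ln (Cmod (F z)))) r <= mn (fun z => k + 6 * diffsum z + 2 * Rabs (lr P Q z) - ln (Cmod (F z))) r).
{ apply mn_le; auto. now apply ccirc_abs. intros t. set (z := circ r t). assert (Hz : Cmod z = r) by (apply Cmod_circ; lra).
  destruct (good_nonzero r t HrS' G) as [NP [NQ _]]. fold z in NP, NQ.
  pose proof (small_circ r t ltac:(lra) ltac:(lra) G) as Sm. fold z in Sm.
  assert (NF : F z <> RtoC 0) by (apply (zsys_nonzero F S l _ ZF); [lra | apply circ_notin; auto; lra]).
  assert (S0 : 0 <= small k0 k1 k2 z). { unfold small. generalize (Rabs_pos (ln (Cmod (k0 z)))) (Rabs_pos (ln (Cmod (k1 z)))) (Rabs_pos (ln (Cmod (k2 z)))). lra. }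
  assert (U : ln (Cmod (F z)) <= ln 4 + 3 * small k0 k1 k2 z + lnmax z).
  { pose proof (DF z) as D. rewrite max_exp in D by auto. apply ln_le_mono in D; [|now apply Cmod_pos_neq].
    rewrite !ln_mult, !ln_exp in D by (try apply Rmult_lt_0_compat; try apply exp_pos; lra). lra. }
  assert (LQ : ln (Cmod (Q z)) <= poles_weight r).
  { destruct FR as [EQ _]. apply Cmod_pos_neq in NQ. pose proof (lprod_factor_upper B r0 z ltac:(lra)) as X. rewrite <- EQ, Hz in X.
    apply ln_le_mono in X; auto. rewrite ln_pow in X. exact X. assert (0 < r / r0) by (apply Rdiv_lt_0_compat; lra). lra. }
  assert (W0 : 0 <= poles_weight r).
  { apply Rmult_le_pos. apply pos_INR. apply ln_nonneg. assert (0 < r / r0) by (apply Rdiv_lt_0_compat; lra). lra. }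
  assert (LM : lnmax z <= poles_weight r + Rabs (lr P Q z)). { generalize (Rle_abs (lr P Q z)). unfold lnmax, lr in *. lra. }
  pose proof (Rabs_pos (lr P Q z)). assert (0 <= ln 4) by (apply ln_nonneg; lra).
  unfold k. apply Rabs_le. lra. }
rewrite (mn_minus (fun z => k + 6 * diffsum z + 2 * Rabs (lr P Q z)) (fun z => ln (Cmod (F z))) r C4 CF) in I.
rewrite (mn_plus (fun z => k + 6 * diffsum z) (fun z => 2 * Rabs (lr P Q z)) r C3 C2) in I.
rewrite (mn_plus (fun _ => k) (fun z => 6 * diffsum z) r (ccirc_const k r) C6) in I.
rewrite mn_const, (mn_scal 6 diffsum r CD), (mn_scal 2 (fun z => Rabs (lr P Q z)) r CA) in I.
unfold excess, k in *. lra.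
Qed.

End Scale.

(** A jump over two indices multiplies by four, so 2^i <= t i is preserved along the indices
    visited; the last jump may overshoot [N] by one. *)
Lemma doubling (t : nat -> R) N : 1 <= t 0%nat -> (forall j, (j < N)%nat -> 2 * t j < t (S j) \/ 4 * t j < t (S (S j))) ->
  exists i, (i = N \/ i = S N) /\ 2 ^ N <= t i.
Proof.
intros H0. enough (A : (forall j, (j < N)%nat -> 2 * t j < t (S j) \/ 4 * t j < t (S (S j))) -> exists i, (i = N \/ i = S N) /\ 2 ^ i <= t i).
{ intros H. destruct (A H) as [i [Hi Hb]]. exists i. split; auto. eapply Rle_trans; [|apply Hb]. apply Rle_pow. lra. destruct Hi; lia. }
induction N; intros H. exists 0%nat. simpl. split; auto.
destruct IHN as [i [[->| ->] Hi]]. intros; apply H; lia.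
- destruct (H N ltac:(lia)) as [X|X]. exists (S N). split; auto. simpl; lra. exists (S (S N)). split; auto. simpl; lra.
- exists (S N). auto.
Qed.

(** Any fixed power of [Th] would do: this bound enters the main inequality only through its
    logarithm. *)
Lemma log_derivative_crude F S l X r R eps Th C1 z : zsys F S l -> 1 <= X -> 3 * X < S -> X <= r -> 1 <= R - r -> R <= 2 * X ->
  X <= Th -> 1 <= C1 -> 0 < eps <= 1 -> / eps <= 152 * C1 * Th ->
  (forall a, In a (inside (3 * X) l) -> eps <= Rabs (Cmod a - r) /\ eps <= Rabs (Cmod a - R)) ->
  ncount (3 * X) l <= 6 * C1 * Th -> mn (fun w => Rabs (ln (Cmod (F w)))) R <= C1 * Th -> Cmod z = r ->
  Cmod (C_derive F z / F z) <= 9000 * C1 ^ 2 * Th ^ 3.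
Proof.
intros Z HX HS Hr HR HR2 HT HC He Hie Hl Hn Hm Hz. destruct Z as [_ Z]. destruct (Z (3 * X) ltac:(lra)) as [h Zh].
pose proof (log_derivative F (3 * X) (inside (3 * X) l) h R r eps z Zh ltac:(lra) ltac:(lra) ltac:(lra) He Hl Hz) as B.
rewrite length_inside in B. eapply Rle_trans. apply B. pose proof (ncount_nonneg (3 * X) l) as N0. set (n := ncount (3 * X) l) in *.
assert (Pe : 0 < / eps) by (apply Rinv_0_lt_compat; lra).
assert (L1 : ln (2 * (3 * X)) - ln eps <= 6 * Th + 152 * C1 * Th).
{ generalize (ln_le_sub1 (2 * (3 * X)) ltac:(lra)) (ln_le_sub1 (/ eps) Pe). rewrite ln_Rinv by lra. lra. }
assert (L0 : 0 <= ln (2 * (3 * X)) - ln eps).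
{ assert (0 <= ln (2 * (3 * X))) by (apply ln_nonneg; lra). assert (0 <= ln (/ eps)). apply ln_nonneg. rewrite <- Rinv_1. apply Rinv_le_contravar; lra. rewrite ln_Rinv in H0 by lra. lra. }
assert (T1 : 1 <= Th) by lra.
assert (M0 : 0 <= C1 * Th) by (apply Rmult_le_pos; lra).
assert (E1 : n / eps <= 6 * C1 * Th * (152 * C1 * Th)) by (unfold Rdiv; apply Rmult_le_compat; lra).
assert (E2 : n * (ln (2 * (3 * X)) - ln eps) <= 6 * C1 * Th * (6 * Th + 152 * C1 * Th)) by (apply Rmult_le_compat; lra).
assert (E3 : 0 < 4 * R / ((R - r) * (R - r)) <= 8 * Th).
{ assert (1 <= (R - r) * (R - r)) by nra. split. apply Rdiv_lt_0_compat; lra. 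
  apply Rmult_le_reg_r with ((R - r) * (R - r)). lra. unfold Rdiv. rewrite Rmult_assoc, Rinv_l by lra. nra. }
set (V := C1 * Th + 6 * C1 * Th * (6 * Th + 152 * C1 * Th)).
assert (E4 : 4 * R / ((R - r) * (R - r)) * (mn (fun w => Rabs (ln (Cmod (F w)))) R + n * (ln (2 * (3 * X)) - ln eps)) <= 8 * Th * V).
{ apply Rle_trans with (4 * R / ((R - r) * (R - r)) * V). apply Rmult_le_compat_l. lra. unfold V. lra. apply Rmult_le_compat_r. 2: lra.
  unfold V. assert (0 <= 6 * Th + 152 * C1 * Th) by nra. assert (0 <= 6 * C1 * Th) by nra. nra. }
assert (P1 : C1 <= C1 ^ 2) by nra. assert (P2 : Th <= Th ^ 2) by nra. assert (P3 : Th ^ 2 <= Th ^ 3) by (simpl; nra).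
assert (Q1 : 0 <= Th ^ 2) by nra. assert (Q2 : 0 <= Th ^ 3) by lra.
assert (Q3 : C1 * Th ^ 3 <= C1 ^ 2 * Th ^ 3) by nra. assert (Q4 : C1 * Th ^ 2 <= C1 ^ 2 * Th ^ 3). { apply Rle_trans with (C1 ^ 2 * Th ^ 2). nra. apply Rmult_le_compat_l. nra. lra. }
assert (Q5 : C1 ^ 2 * Th ^ 2 <= C1 ^ 2 * Th ^ 3) by (apply Rmult_le_compat_l; [nra|lra]).
unfold V in *. 
replace (8 * Th * (C1 * Th + 6 * C1 * Th * (6 * Th + 152 * C1 * Th))) with (8 * (C1 * Th ^ 2) + 288 * (C1 * Th ^ 3) + 7296 * (C1 ^ 2 * Th ^ 3)) in E4 by ring.
replace (6 * C1 * Th * (152 * C1 * Th)) with (912 * (C1 ^ 2 * Th ^ 2)) in E1 by ring.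
assert (0 <= C1 ^ 2 * Th ^ 3) by (apply Rmult_le_pos; nra). lra.
Qed.

(** * A window in which the characteristic grows slowly *)

Section Window.
Variables (f K : C -> C) (c : C).
Hypothesis Hf : meromorphic f.
Hypothesis HK : forall z, cdiff K z.
Hypothesis HfK : forall z, ~ is_pole f z -> ~ is_pole f (z + c)%C -> f (z + c)%C = (K z * f z)%C.
Hypothesis Hc : c <> RtoC 0.

Let k1 := fun z => K (z + c)%C.

Variables (r0 cP cE c1 c2 c3 C0 A : R).
Hypothesis HC0 : 1 <= C0.
Hypothesis HA : 1 <= A.
Hypothesis bcP : Rabs cP <= A.
Hypothesis bcE : Rabs cE <= A.
Hypothesis bc1 : Rabs c1 <= A.
Hypothesis bc2 : Rabs c2 <= A.
Hypothesis bc3 : Rabs c3 <= A.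

Variables (X y Th mu : R) (N : nat).
Variables (B : list C) (P Q E : C -> C) (lP lQ lE l1 l2 l3 : list C).
Hypothesis SD : scale_data f K c r0 cP cE c1 c2 c3 C0 (20 * X) B P Q E lP lQ lE l1 l2 l3.
Hypothesis HX : 1 <= X.
Hypothesis HcX : 6 * Cmod c <= X.
Hypothesis Hy : 1 <= y.
Hypothesis Hcy : 3 * Cmod c <= y.
Hypothesis HN : 3 * y * INR (S N) + 1 <= X.
Hypothesis HXT : X <= Th.
Hypothesis HTN : Th < 2 ^ N.
Let good r := good_for c lP lQ lE l1 l2 l3 r.
Let T := charT P Q.
Hypothesis HT1 : forall r, X <= r <= 9 * X -> good r -> 1 <= T r <= Th.
Hypothesis HW : forall r, X <= r <= 9 * X -> poles_weight r0 B r <= Th.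
Hypothesis Hmu : forall r dd x, X <= r -> 0 < dd <= 3 * Cmod c -> Cmod x <> r -> mn (nearness dd x) r <= mu.

Lemma scale_products : 1 <= Th /\ A <= A * Th.
Proof using HA HX HXT. split. lra. rewrite <- (Rmult_1_r A) at 1. apply Rmult_le_compat_l; lra. Qed.

(* 370 = 5 * (2 + 72), from 12 |c| / (R - r) <= 2 and 4 * 2 * R2 / (R2 - R) <= 72. *)
Lemma crude_diffsum r R R2 : X <= r -> X <= R - r -> X <= R2 - R -> R2 <= 9 * X -> good r -> good R -> good R2 ->
  ccirc (diffsum c P Q) r /\ mn (diffsum c P Q) r <= 370 * (2 + A) * Th.
Proof.
intros H1 H2 H3 H4 G G1 G2. pose proof (Cmod_pos_neq c Hc) as Pc. apply Rabs_le_between in bcP.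
destruct (mean_diffsum f K c Hc r0 cP cE c1 c2 c3 C0 (20 * X) B P Q E lP lQ lE l1 l2 l3 SD r R R2 2) as [Y1 Y2]; auto; try lra.
{ intros dd x Hd Hx. apply nearness_base; auto; lra. }
split; auto. eapply Rle_trans. apply Y2. unfold excess. fold T.
pose proof (HT1 R ltac:(lra) G1) as B1. pose proof (HT1 R2 ltac:(lra) G2) as B2.
set (U := (2 + A) * Th). destruct scale_products as [T1 AT]. assert (UE : U = 2 * Th + A * Th) by (unfold U; ring).
assert (X1 : 2 * T R - cP <= U) by lra. assert (X2 : 2 * T R2 - cP <= U) by lra. assert (PU : 0 <= U) by lra.
assert (F1 : 0 <= 12 * Cmod c / (R - r) <= 2).
{ split. apply Rmult_le_pos. lra. left; apply Rinv_0_lt_compat; lra. apply Rmult_le_reg_r with (R - r). lra. unfold Rdiv. rewrite Rmult_assoc, Rinv_l by lra. lra. }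
assert (F2 : 0 <= R2 / (R2 - R) <= 9).
{ split. apply Rmult_le_pos. lra. left; apply Rinv_0_lt_compat; lra. apply Rmult_le_reg_r with (R2 - R). lra. unfold Rdiv. rewrite Rmult_assoc, Rinv_l by lra. lra. }
assert (S1 : 12 * Cmod c / (R - r) * (2 * T R - cP) <= 2 * U).
{ apply Rle_trans with (12 * Cmod c / (R - r) * U). apply Rmult_le_compat_l; lra. apply Rmult_le_compat_r; lra. }
assert (S2 : 4 * 2 * (R2 / (R2 - R)) * (2 * T R2 - cP) <= 72 * U).
{ apply Rle_trans with (4 * 2 * (R2 / (R2 - R)) * U). apply Rmult_le_compat_l; lra. apply Rmult_le_compat_r; lra. }
fold U. unfold U in *. lra.
Qed.

Let C1 := 3000 * (2 + A).

(** The radii [r], [rb], [rc] are at least [X] apart instead of bounding a short window. The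
    resulting bound is too large for the main inequality but good enough for the logarithmic
    derivatives. *)
Lemma crude_p F l cF r rb rc : dominated K c P Q F -> zsys F (20 * X) l -> generic r0 l -> mn (fun z => ln (Cmod (F z))) r0 = cF -> Rabs cF <= A ->
  X <= r -> X <= rb - r -> X <= rc - rb -> rc <= 9 * X -> good r -> good rb -> good rc -> generic r l ->
  mn (fun w => Rabs (ln (Cmod (F w)))) r <= C1 * Th.
Proof.
intros D Z G0 EF bF H1 H2 H3 H4 G Gb Gc Gl. destruct (crude_diffsum r rb rc) as [Y1 Y2]; auto.
assert (H5 : r + 3 * Cmod c < 20 * X) by lra.
pose proof (crude_mean f K c Hf HK HfK r0 cP cE c1 c2 c3 C0 (20 * X) B P Q E lP lQ lE l1 l2 l3 SD ltac:(lra) F l cF r D Z G0 EF ltac:(lra) H5 G Gl Y1) as M.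
eapply Rle_trans. apply M. pose proof (HW r ltac:(lra)). pose proof (HT1 r ltac:(lra) G). unfold excess. fold T.
apply Rabs_le_between in bcP. apply Rabs_le_between in bF. assert (ln 4 <= 3) by (generalize (ln_le_sub1 4); lra).
destruct scale_products as [T1 AT]. unfold C1.
replace (3000 * (2 + A) * Th) with (2 * (3 * (370 * (2 + A) * Th)) + 780 * ((2 + A) * Th)) by ring. 
replace ((2 + A) * Th) with (2 * Th + A * Th) in * by ring. lra.
Qed.

Lemma crude_count F l cF ra rb rc : dominated K c P Q F -> zsys F (20 * X) l -> generic r0 l -> mn (fun z => ln (Cmod (F z))) r0 = cF -> Rabs cF <= A ->
  4 * X <= ra <= 5 * X -> X <= rb - ra -> X <= rc - rb -> rc <= 9 * X -> good ra -> good rb -> good rc -> generic ra l ->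
  ncount (3 * X) l <= 6 * C1 * Th.
Proof.
intros D Z G0 EF bF H1 H2 H3 H4 G Gb Gc Gl. pose proof SD as [_ [_ _ Hr0 _ _ _ _] _ _ _ _ _ _ _ _ _ _ _ _ _].
pose proof (crude_p F l cF ra rb rc D Z G0 EF bF ltac:(lra) H2 H3 H4 G Gb Gc Gl) as M.
pose proof (zsys_count' F (20 * X) l r0 (3 * X) ra Z ltac:(lra) ltac:(lra) G0 Gl) as Cn. rewrite EF in Cn.
assert (CF : ccirc (fun z => ln (Cmod (F z))) ra) by (eapply zsys_ccirc; eauto; lra).
pose proof (mn_abs _ ra CF) as MA. pose proof (Rle_abs (mn (fun z => ln (Cmod (F z))) ra)). apply Rabs_le_between in bF.
pose proof (ncount_nonneg (3 * X) l) as N0.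
assert (F2 : 0 < ra / (ra - 3 * X) <= 5).
{ split. apply Rdiv_lt_0_compat; lra. apply Rmult_le_reg_r with (ra - 3 * X). lra. unfold Rdiv. rewrite Rmult_assoc, Rinv_l by lra. lra. }
destruct scale_products as [T1 AT]. assert (CE : C1 * Th = 6000 * Th + 3000 * (A * Th)) by (unfold C1; ring). assert (Q0 : 0 <= C1 * Th + A) by lra.
assert (ncount (3 * X) l <= 5 * (C1 * Th + A)).
{ eapply Rle_trans. apply Cn. apply Rle_trans with (ra / (ra - 3 * X) * (C1 * Th + A)). apply Rmult_le_compat_l; lra. apply Rmult_le_compat_r; lra. }
lra.
Qed.

(* One radius per window (X + 3 y j, X + 3 y j + 1), j <= N + 1: if T more than doubled at every step it
   would exceed 2 ^ N > Th. *)
Theorem window : exists r, X <= r <= 2 * X /\ good r /\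
  T r <= A + ln C0 + ln (30000 * C1 ^ 2) + 3 * ln Th + 45 * ((24 * Cmod c + 32 * (mu * X)) / y) * (T r + A).
Proof.
pose proof (Cmod_pos_neq c Hc) as Pc.
set (I1 := inside (3 * X) l1). set (I2 := inside (3 * X) l2). set (I3 := inside (3 * X) l3).
(* A quantitative distance is needed only from the zeros of [p1], [p2], [p3] in |z| < 3 X, the
   functions whose logarithmic derivatives occur. *)
set (xs := map Cmod (I1 ++ I2 ++ I3)). set (ys := bad_radii c lP lQ lE l1 l2 l3).
assert (GR : forall a, {r | a < r < a + 1 /\ (forall x, In x xs -> / (8 * (INR (length xs) + 1)) <= Rabs (x - r)) /\ good r}).
{ intros a. apply constructive_indefinite_description. destruct (good_radius xs ys a) as [r [R1 [R2 R3]]]. exists r. repeat (split; auto).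
  intros I. now apply (R3 r I). }
set (rad := fun a => proj1_sig (GR a)).
assert (Hrad : forall a, a < rad a < a + 1 /\ (forall x, In x xs -> / (8 * (INR (length xs) + 1)) <= Rabs (x - rad a)) /\ good (rad a)) by (intros; apply (proj2_sig (GR a))).
set (eps := / (8 * (INR (length xs) + 1))) in *.
(* Three widely separated radii for the crude zero counts, which bound [/ eps], and for the crude
   means on the circles of the windows. *)
destruct (Hrad (4 * X)) as [Ra [_ Ga]]. destruct (Hrad (6 * X)) as [Rb [_ Gb]]. destruct (Hrad (8 * X)) as [Rc [_ Gc]].
set (ra := rad (4 * X)) in *. set (rb := rad (6 * X)) in *. set (rc := rad (8 * X)) in *.
assert (GG : forall r, good r -> generic r l1 /\ generic r l2 /\ generic r l3).
{ intros r G. destruct (good_generic c lP lQ lE l1 l2 l3 r G) as [_ [_ [_ H]]]. exact H. }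
pose proof (Cmod_ge_0 c).
pose proof SD as [_ FS _ _ _ _ Z1 g1 e1 Z2 g2 e2 Z3 g3 e3]. fold k1 in Z1, e1, Z2, e2, Z3, e3.
destruct (dominated_p K c P Q) as [D1 [D2 D3]]. fold k1 in D1, D2, D3.
pose proof (crude_count (p1 P Q K k1) l1 c1 ra rb rc D1 Z1 g1 e1 bc1 ltac:(lra) ltac:(lra) ltac:(lra) ltac:(lra) Ga Gb Gc (proj1 (GG ra Ga))) as n1.
pose proof (crude_count (p2 P Q K k1) l2 c2 ra rb rc D2 Z2 g2 e2 bc2 ltac:(lra) ltac:(lra) ltac:(lra) ltac:(lra) Ga Gb Gc (proj1 (proj2 (GG ra Ga)))) as n2.
pose proof (crude_count (p3 P Q K k1) l3 c3 ra rb rc D3 Z3 g3 e3 bc3 ltac:(lra) ltac:(lra) ltac:(lra) ltac:(lra) Ga Gb Gc (proj2 (proj2 (GG ra Ga)))) as n3.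
assert (HC1 : 1 <= C1) by (unfold C1; lra). destruct scale_products as [T1 AT]. assert (CE : C1 * Th = 6000 * Th + 3000 * (A * Th)) by (unfold C1; ring). assert (CT : 1 <= C1 * Th) by lra.
assert (Hlen : INR (length xs) <= 18 * C1 * Th).
{ unfold xs. rewrite length_map, !length_app, !plus_INR. unfold I1, I2, I3. rewrite !length_inside. lra. }
pose proof (pos_INR (length xs)) as Plen.
assert (He : 0 < eps <= 1). { unfold eps. split. apply Rinv_0_lt_compat; lra. rewrite <- Rinv_1. apply Rinv_le_contravar; lra. }
assert (Hie : / eps <= 152 * C1 * Th). { unfold eps. rewrite Rinv_inv. lra. }
(* Spacing [3 * y] with an error below 1 <= y leaves gaps of at least [2 * y] between consecutive
   radii. *)
set (t := fun j => rad (X + 3 * y * INR j)).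
assert (tb : forall j, (j <= S N)%nat -> X + 3 * y * INR j < t j < X + 3 * y * INR j + 1 /\ t j <= 2 * X).
{ intros j Hj. destruct (Hrad (X + 3 * y * INR j)) as [B1 _]. fold (t j) in B1. apply le_INR in Hj. assert (3 * y * INR j <= 3 * y * INR (S N)) by (apply Rmult_le_compat_l; lra). lra. }
assert (tg : forall j, good (t j)) by (intros; apply Hrad).
assert (tX : forall j, (j <= S N)%nat -> X <= t j). { intros j Hj. pose proof (pos_INR j). destruct (tb j Hj). assert (0 <= 3 * y * INR j) by (apply Rmult_le_pos; lra). lra. }
assert (EX : exists j, (j < N)%nat /\ T (t (S j)) <= 2 * T (t j) /\ T (t (S (S j))) <= 4 * T (t j)).
{ apply NNPP. intros NE. destruct (doubling (fun j => T (t j)) N) as [i [Hi Hb]].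
  - apply HT1; auto. split. apply tX; lia. destruct (tb 0%nat); lia || lra.
  - intros j Hj. apply NNPP. intros NO. apply NE. exists j. split; auto. split; apply Rnot_lt_le; intros Lt; apply NO; auto.
  - assert (Hi' : (i <= S N)%nat) by lia. destruct (tb i Hi') as [_ B2]. pose proof (tX i Hi'). destruct (HT1 (t i) ltac:(lra) (tg i)). lra. }
destruct EX as [j [Hj [E1 E2]]].
set (r := t j) in *. set (R := t (S j)) in *. set (R2 := t (S (S j))) in *.
destruct (tb j ltac:(lia)) as [b1 b1']. destruct (tb (S j) ltac:(lia)) as [b2 b2']. destruct (tb (S (S j)) ltac:(lia)) as [b3 b3'].
pose proof (tX j ltac:(lia)) as x1. fold r in x1, b1, b1'. fold R in b2, b2'. fold R2 in b3, b3'. rewrite S_INR in b2. rewrite S_INR, S_INR in b3.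
assert (g : 2 * y <= R - r /\ 2 * y <= R2 - R) by lra. destruct g as [gp1 gp2].
assert (Gr : good r) by apply tg. assert (GR1 : good R) by apply tg. assert (GR2 : good R2) by apply tg.
exists r. split; [lra|split]; auto.
destruct (mean_diffsum f K c Hc r0 cP cE c1 c2 c3 C0 (20 * X) B P Q E lP lQ lE l1 l2 l3 SD r R R2 mu) as [Y1 Y2]; auto; try lra.
(* Three logarithmic derivatives, each at most [9000 * C1 ^ 2 * Th ^ 3]. *)
set (L := 30000 * C1 ^ 2 * Th ^ 3).
assert (P1 : 1 <= C1 ^ 2) by (apply pow_R1_Rle; lra). assert (P2 : 1 <= Th ^ 3) by (apply pow_R1_Rle; lra).
assert (P3 : 1 <= C1 ^ 2 * Th ^ 3) by (rewrite <- (Rmult_1_l 1); apply Rmult_le_compat; lra).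
assert (HL : 1 <= L) by (unfold L; lra).
assert (near : forall l a s, In a (inside (3 * X) l) -> incl (inside (3 * X) l) (I1 ++ I2 ++ I3) -> eps <= Rabs (Cmod a - rad s)).
{ intros l a s I Inc. apply Hrad. unfold xs. apply in_map. auto. }
assert (i1 : incl (inside (3 * X) l1) (I1 ++ I2 ++ I3)) by (intros a; rewrite !in_app_iff; auto).
assert (i2 : incl (inside (3 * X) l2) (I1 ++ I2 ++ I3)) by (intros a; rewrite !in_app_iff; auto).
assert (i3 : incl (inside (3 * X) l3) (I1 ++ I2 ++ I3)) by (intros a; rewrite !in_app_iff; auto).
assert (LD : forall F l cF w, dominated K c P Q F -> zsys F (20 * X) l -> generic r0 l -> mn (fun z => ln (Cmod (F z))) r0 = cF -> Rabs cF <= A ->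
  generic R l -> incl (inside (3 * X) l) (I1 ++ I2 ++ I3) -> ncount (3 * X) l <= 6 * C1 * Th -> Cmod w = r -> Cmod (C_derive F w / F w) <= 9000 * C1 ^ 2 * Th ^ 3).
{ intros F l cF w D Z g e bF GRl Inc Hn Hw.
  apply (log_derivative_crude F (20 * X) l X r R eps Th C1 w); auto; try lra.
  - intros a I. split; now apply (near l).
  - apply (crude_p F l cF R rb rc); auto; lra. }
pose proof (mean_inequality f K c Hf HK HfK r0 cP cE c1 c2 c3 C0 (20 * X) B P Q E lP lQ lE l1 l2 l3 SD ltac:(lra) HC0 r L ltac:(lra) ltac:(lra) Gr Y1 HL) as MI.
fold T in MI. fold k1 in MI.
assert (MI' : T r + cE <= ln C0 + 9 * mn (diffsum c P Q) r + ln L).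
{ apply MI. intros tt. assert (Hw : Cmod (circ r tt) = r) by (apply Cmod_circ; lra). destruct (GG R GR1) as [gg1 [gg2 gg3]].
  pose proof (LD (p1 P Q K k1) l1 c1 (circ r tt) D1 Z1 g1 e1 bc1 gg1 i1 n1 Hw). pose proof (LD (p2 P Q K k1) l2 c2 (circ r tt) D2 Z2 g2 e2 bc2 gg2 i2 n2 Hw).
  pose proof (LD (p3 P Q K k1) l3 c3 (circ r tt) D3 Z3 g3 e3 bc3 gg3 i3 n3 Hw). unfold lamsum, L. lra. }
assert (EL : ln L = ln (30000 * C1 ^ 2) + 3 * ln Th).
{ unfold L. rewrite ln_mult by lra. f_equal. rewrite ln_pow by lra. simpl. lra. }
rewrite EL in MI'. apply Rabs_le_between in bcE. apply Rabs_le_between in bcP.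
pose proof (HT1 r ltac:(lra) Gr) as Tr.
assert (mu0 : 0 <= mu).
{ destruct (avoid_finite (r :: nil) 0 1) as [x [_ Hx]]. lra. eapply Rle_trans. 2: apply (Hmu r (Cmod c) (RtoC (r + 1))); [lra|lra|rewrite Cmod_RtoC_pos; lra].
  apply mn_nonneg. apply ccirc_nearness; try lra. rewrite Cmod_RtoC_pos; lra. intros tt. apply nearness_nonneg. lra. intros Ex. apply (f_equal Cmod) in Ex. rewrite Cmod_circ, Cmod_RtoC_pos in Ex; lra. }
assert (iy : 0 < / y) by (apply Rinv_0_lt_compat; lra).
(* The choice of [j] enters here and in [F2]: T(R) <= 2 T(r) and T(R2) <= 4 T(r), so that everything
   is measured by T at the single radius [r]. *)
assert (F1 : 12 * Cmod c / (R - r) * excess cP P Q R <= 6 * Cmod c * / y * (4 * (T r + A))).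
{ unfold excess. fold T. apply Rmult_le_compat. apply Rmult_le_pos. lra. left; apply Rinv_0_lt_compat; lra.
  pose proof (HT1 R ltac:(lra) GR1). destruct (good_generic c lP lQ lE l1 l2 l3 R GR1) as [q1 [q2 _]].
  destruct (frac_sys_abs P Q (20 * X) r0 cP lP lQ R FS ltac:(lra) q1 q2) as [_ [q3 q4]]. fold T in q3, q4. lra.
  - replace (6 * Cmod c * / y) with (12 * Cmod c * / (2 * y)) by (field; lra). apply Rmult_le_compat_l. lra. apply Rinv_le_contravar; lra.
  - lra. }
assert (F2 : 4 * mu * (R2 / (R2 - R)) * excess cP P Q R2 <= 4 * mu * (X * / y) * (8 * (T r + A))).
{ unfold excess. fold T. 
  assert (0 <= R2 / (R2 - R)) by (apply Rmult_le_pos; [lra|left; apply Rinv_0_lt_compat; lra]).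
  apply Rmult_le_compat. apply Rmult_le_pos; lra.
  destruct (good_generic c lP lQ lE l1 l2 l3 R2 GR2) as [q1 [q2 _]].
  destruct (frac_sys_abs P Q (20 * X) r0 cP lP lQ R2 FS ltac:(lra) q1 q2) as [_ [q3 q4]]. fold T in q3, q4. lra.
  - apply Rmult_le_compat_l. lra. replace (X * / y) with (2 * X * / (2 * y)) by (field; lra). apply Rmult_le_compat; try lra. left; apply Rinv_0_lt_compat; lra. apply Rinv_le_contravar; lra.
  - lra. }
replace (45 * ((24 * Cmod c + 32 * (mu * X)) / y) * (T r + A)) with
 (9 * (5 * (6 * Cmod c * / y * (4 * (T r + A)) + 4 * mu * (X * / y) * (8 * (T r + A))))) by (field; lra).
lra.
Qed.
End Window.

(** * Linear lower bound for the characteristic *)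

Lemma zero_derivative_constant u a b : (forall z, cder u z (RtoC 0)) -> u a = u b.
Proof.
intros H. assert (S : segcont (fun _ => RtoC 0) a b) by (intros t _; apply ccont_const).
pose proof (seg_prim (fun _ => RtoC 0) u a b S (fun t _ => H _)) as E.
pose proof (seg_bound (fun _ => RtoC 0) a b 0 S ltac:(intros; change (Cmod (RtoC 0) <= 0); rewrite Cmod_0; lra)) as Bd. rewrite E in Bd.
symmetry. apply NNPP. intros N. pose proof (Cmod_minus_pos _ _ N). lra.
Qed.

(** At a fixed point z0 with u'(z0) nonzero, u'/u is at most 16 / R times the mean of the absolute
    value of ln |u| over |z| = R, by the derivative bound for a logarithm of u. So this mean grows
    at least linearly. *)
Lemma zero_free_lower u : (forall z, cdiff u z) -> (forall z, u z <> RtoC 0) -> (exists a b, u a <> u b) ->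
  exists kappa R0, 0 < kappa /\ 1 <= R0 /\ forall R, R0 <= R -> kappa * R <= mn (fun z => Rabs (ln (Cmod (u z)))) R.
Proof.
intros Hu Nu [a [b Nab]].
assert (exists z0, C_derive u z0 <> RtoC 0) as [z0 Hz0].
{ apply NNPP. intros N. apply Nab. apply zero_derivative_constant. intros z. replace (RtoC 0) with (C_derive u z).
  now apply C_derive_cder. apply NNPP. intros M. apply N. eauto. }
assert (Nq : (C_derive u z0 / u z0)%C <> RtoC 0) by (intros E; apply Hz0; replace (C_derive u z0) with (C_derive u z0 / u z0 * u z0)%C by (field; auto); rewrite E; ring).
apply Cmod_pos_neq in Nq. set (q := Cmod (C_derive u z0 / u z0)) in *. pose proof (Cmod_ge_0 z0) as P0.
exists (q / 16), (2 * Cmod z0 + 1). split; [lra|split; [lra|]]. intros R HR.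
destruct (holo_log u (R + 1)) as [h [Hh E]]. lra. intros z _; auto. auto.
pose proof (derivative_bound h (R + 1) R z0 Hh ltac:(lra)) as Bd.
destruct (E z0 ltac:(lra)) as [E0 _]. rewrite E0 in Bd. fold q in Bd.
rewrite (mn_ext (fun w => Rabs (Re (h w))) (fun z => Rabs (ln (Cmod (u z))))) in Bd.
2: { intros t. f_equal. symmetry. apply E. rewrite Cmod_circ; lra. }
set (m := mn (fun z => Rabs (ln (Cmod (u z)))) R) in *.
assert (m0 : 0 <= m).
{ apply mn_nonneg. apply ccirc_abs. apply ccirc_lnCmod. intros t; split; auto. now apply cdiff_ccont. intros; apply Rabs_pos. }
assert (F : 4 * R / ((R - Cmod z0) * (R - Cmod z0)) <= 16 / R).
{ apply Rmult_le_reg_r with (R * ((R - Cmod z0) * (R - Cmod z0))). apply Rmult_lt_0_compat; nra.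
  replace (4 * R / ((R - Cmod z0) * (R - Cmod z0)) * (R * ((R - Cmod z0) * (R - Cmod z0)))) with (4 * (R * R)) by (field; lra).
  replace (16 / R * (R * ((R - Cmod z0) * (R - Cmod z0)))) with (16 * ((R - Cmod z0) * (R - Cmod z0))) by (field; lra). nra. }
assert (G : q <= 16 / R * m). { eapply Rle_trans. apply Bd. apply Rmult_le_compat_r; auto. }
apply Rmult_le_compat_r with (r := R) in G; [|lra]. replace (16 / R * m * R) with (16 * m) in G by (field; lra). lra.
Qed.

Lemma progression_count l a c s : c <> RtoC 0 -> Cmod a <= s ->
  (forall n, Cmod a + INR n * Cmod c < s -> In (a + RtoC (INR n) * c)%C l) -> (s - Cmod a) / Cmod c - 1 <= ncount s l.
Proof.
intros Hc Ha H. pose proof (Cmod_pos_neq c Hc) as Pc.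
destruct (nfloor_ex ((s - Cmod a) / Cmod c)) as [M [M1 M2]]. { apply Rmult_le_pos. lra. left; now apply Rinv_0_lt_compat. }
apply Rle_trans with (INR M). lra. rewrite <- length_inside. apply le_INR.
set (g := fun n => (a + RtoC (INR n) * c)%C).
replace M with (length (map g (seq 0 M))) by (rewrite length_map, length_seq; auto).
apply NoDup_incl_length.
- apply Injective_map_NoDup; [|apply seq_NoDup]. intros n m E. unfold g in E. apply INR_eq.
  assert (X : (RtoC (INR n) * c)%C = (RtoC (INR m) * c)%C). { replace (RtoC (INR n) * c)%C with (a + RtoC (INR n) * c - a)%C by ring. rewrite E. ring. }
  rewrite (Cmult_comm _ c), (Cmult_comm _ c) in X. apply Cmult_reg_l in X; auto. now apply RtoC_inj.
- intros z Hz. apply in_map_iff in Hz. destruct Hz as [n [<- In]]. apply in_seq in In.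
  assert (L0 : Cmod a + INR n * Cmod c < s).
  { assert (Y : INR n + 1 <= INR M) by (rewrite <- S_INR; apply le_INR; lia).
    assert (INR M * Cmod c <= s - Cmod a). { apply Rmult_le_compat_r with (r := Cmod c) in M1; [|lra]. replace ((s - Cmod a) / Cmod c * Cmod c) with (s - Cmod a) in M1 by (field; lra). auto. }
    nra. }
  apply in_inside. split. now apply H. eapply Rle_lt_trans. apply Cmod_triangle. rewrite Cmod_scal_pos by apply pos_INR. auto.
Qed.

Section LowerBound.
Variables (f K : C -> C) (c : C).
Hypothesis Hf : meromorphic f.
Hypothesis HK : forall z, cdiff K z.
Hypothesis HfK : forall z, ~ is_pole f z -> ~ is_pole f (z + c)%C -> f (z + c)%C = (K z * f z)%C.
Hypothesis Hc : c <> RtoC 0.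
Hypothesis NK1 : exists z, K z <> RtoC 1.

Lemma progression_zero F l S a w : zsys F S l -> w <> RtoC 0 -> F a = RtoC 0 -> 
  (forall z, Cmod z < S -> F z = RtoC 0 -> Cmod (z + w) < S -> F (z + w)%C = RtoC 0) ->
  forall s n, Cmod a + INR n * Cmod w < s -> s <= S -> F (a + RtoC (INR n) * w)%C = RtoC 0.
Proof.
intros Z Hw Ea Hs s n. revert s. induction n as [|n IH]; intros s H HS.
- simpl. replace (a + 0 * w)%C with a by ring. auto.
- pose proof (Cmod_ge_0 w). rewrite S_INR in H.
  replace (a + RtoC (INR (Datatypes.S n)) * w)%C with (a + RtoC (INR n) * w + w)%C by (rewrite S_INR, RtoC_plus; ring).
  assert (L1 : Cmod (a + RtoC (INR n) * w) < S). { eapply Rle_lt_trans. apply Cmod_triangle. rewrite Cmod_scal_pos by apply pos_INR. lra. }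
  apply Hs; auto. apply (IH s); lra. eapply Rle_lt_trans. apply Cmod_triangle.
  apply Rle_lt_trans with (Cmod a + INR n * Cmod w + Cmod w); [|lra]. apply Rplus_le_compat_r. eapply Rle_trans. apply Cmod_triangle. rewrite Cmod_scal_pos by apply pos_INR. lra.
Qed.

Lemma charT_lower_zeros F l S r0 cF w a : zsys F S l -> generic r0 l -> 0 < r0 < 1 -> mn (fun z => ln (Cmod (F z))) r0 = cF -> w <> RtoC 0 -> F a = RtoC 0 ->
  (forall z, Cmod z < S -> F z = RtoC 0 -> Cmod (z + w) < S -> F (z + w)%C = RtoC 0) ->
  forall r, 2 * Cmod a + 2 <= r < S -> generic r l -> / (4 * Cmod w) * r - (Rabs cF + Cmod a / Cmod w + 1) <= mn (fun z => ln (Cmod (F z))) r.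
Proof.
intros Z g Hr0 EF Hw Ea Hs r Hr G. pose proof (Cmod_pos_neq w Hw) as Pw. pose proof (Cmod_ge_0 a) as Pa.
pose proof (zsys_count F S l r0 (r / 2) r Z ltac:(lra) ltac:(lra) g G) as Cn. rewrite EF in Cn.
replace (r / (r / 2)) with 2 in Cn by (field; lra).
assert (Q : (r / 2 - Cmod a) / Cmod w - 1 <= ncount (r / 2) l).
{ apply (progression_count l a w (r / 2) Hw ltac:(lra)). intros n Hn. apply (zsys_in F S l _ Z).
  eapply Rle_lt_trans. apply Cmod_triangle. rewrite Cmod_scal_pos by apply pos_INR. lra.
  apply (progression_zero F l S a w Z Hw Ea Hs (r / 2)); lra. }
pose proof (ncount_nonneg (r / 2) l) as N0. pose proof (ln_lt_2) as L2.
assert (L1 : ln 2 <= 1) by (generalize (ln_le_sub1 2); lra).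
replace ((r / 2 - Cmod a) / Cmod w - 1) with (2 * (/ (4 * Cmod w) * r) - Cmod a / Cmod w - 1) in Q by (field; lra).
set (u := / (4 * Cmod w) * r) in *. assert (0 <= Cmod a / Cmod w) by (apply Rmult_le_pos; [lra|left; now apply Rinv_0_lt_compat]).
pose proof (Rabs_pos cF). generalize (Rle_abs (- cF)). rewrite Rabs_Ropp. intros.
assert (/ 2 * ncount (r / 2) l <= ncount (r / 2) l * ln 2) by nra. lra.
Qed.

(** As [K] is entire, f(z + c) = K f carries zeros forward by c and poles backward by c; each
    progression contributes linearly many points to Jensen's formula. Without zeros and poles, f is
    a nonconstant zero-free entire function. *)
Lemma charT_lower r0 cP : 0 < r0 < 1 -> exists kappa R0, 0 < kappa /\ 1 <= R0 /\ forall S X B P Q lP lQ,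
  fraction f r0 X B P Q -> S + Cmod c <= X -> frac_sys P Q S r0 cP lP lQ ->
  forall r, R0 <= r < S -> generic r lP -> generic r lQ -> kappa * r <= charT P Q r.
Proof.
intros Hr0. pose proof (Cmod_pos_neq c Hc) as Pc.
assert (lin : forall k m C r, 0 < k -> 2 * C / k <= r -> k * r - C <= m -> k / 2 * r <= m).
{ intros k m C r Hk Hr Hm. apply Rmult_le_compat_l with (r := k / 2) in Hr; [|lra]. replace (k / 2 * (2 * C / k)) with C in Hr by (field; lra). lra. }
assert (Pk : 0 < / (4 * Cmod c)) by (apply Rinv_0_lt_compat; lra).
destruct (classic (exists a, ~ is_pole f a /\ f a = RtoC 0)) as [[a [Na Ea]]|NZ]; [|destruct (classic (exists a, is_pole f a)) as [[a Pa]|NP]].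
- set (C := Rabs cP + Cmod a / Cmod c + 1). set (k := / (4 * Cmod c)) in *.
  exists (k / 2), (Rmax (2 * Cmod a + 2) (2 * C / k)). pose proof (Cmod_ge_0 a) as Pa0.
  pose proof (Rmax_l (2 * Cmod a + 2) (2 * C / k)). pose proof (Rmax_r (2 * Cmod a + 2) (2 * C / k)).
  split; [lra|split; [lra|]]. intros S X B P Q lP lQ HF HX [ZP ZQ _ gP gQ eP eQ] r Hr GP GQ.
  apply (lin k _ C); try lra. eapply Rle_trans. apply (charT_lower_zeros P lP S r0 cP c a ZP gP Hr0 eP Hc); auto; try lra.
  + destruct (fraction_value f r0 X B P Q a HF ltac:(lra) Na) as [_ ->]. rewrite Ea. ring.
  + intros z Hz Ez Hzc. pose proof (fraction_shift f r0 X B P Q c K z Hf HF HK HfK ltac:(lra) ltac:(lra)) as Sh.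
    rewrite Ez in Sh. apply (Cmult_reg_l (Q z)). intros EQ. apply (fraction_coprime f r0 X B P Q z HF); auto; lra.
    rewrite Cmult_comm, Sh. ring.
  + apply charT_ge; eapply zsys_ccirc; eauto; lra.
- set (C := Rabs 0 + Cmod a / Cmod c + 1). set (k := / (4 * Cmod c)) in *.
  exists (k / 2), (Rmax (2 * Cmod a + 2) (2 * C / k)). pose proof (Cmod_ge_0 a) as Pa0.
  pose proof (Rmax_l (2 * Cmod a + 2) (2 * C / k)). pose proof (Rmax_r (2 * Cmod a + 2) (2 * C / k)).
  split; [lra|split; [lra|]]. intros S X B P Q lP lQ HF HX [ZP ZQ _ gP gQ eP eQ] r Hr GP GQ.
  assert (Ec : Cmod (- c) = Cmod c) by apply Cmod_opp. 
  apply (lin k _ C); try lra. unfold C, k. rewrite <- Ec. eapply Rle_trans. apply (charT_lower_zeros Q lQ S r0 0 (- c)%C a ZQ gQ Hr0 eQ); auto; try lra.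
  + intros E. apply Hc. replace c with (- - c)%C by ring. rewrite E. ring.
  + now apply (fraction_pole f r0 X B P Q a HF ltac:(lra)).
  + intros z Hz Ez Hzc. 
    pose proof (fraction_shift f r0 X B P Q c K (z + - c)%C Hf HF HK HfK ltac:(lra)) as Sh.
    replace (z + - c + c)%C with z in Sh by ring. specialize (Sh ltac:(lra)). rewrite Ez in Sh.
    apply (Cmult_reg_l (P z)). intros EP. apply (fraction_coprime f r0 X B P Q z HF); auto; lra.
    rewrite Sh. ring.
  + apply charT_ge; eapply zsys_ccirc; eauto; lra.
- assert (Np : forall z, ~ is_pole f z) by (intros z I; apply NP; eauto).
  assert (Nz : forall z, f z <> RtoC 0) by (intros z E; apply NZ; eauto).
  assert (Hd : forall z, cdiff f z). { intros z. destruct (not_pole_holo f z Hf (Np z)) as [r [Hr H]]. now apply (holo_cdiff_center f z r). }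
  destruct (zero_free_lower f Hd Nz) as [k [R0 [Hk [HR0 HB]]]].
  { destruct NK1 as [z Hz]. exists (z + c)%C, z. rewrite HfK by auto. intros E. apply Hz. apply (Cmult_reg_l (f z)); auto. rewrite Cmult_comm, E. ring. }
  exists (k / 2 / 2), (Rmax R0 (2 * (Rabs cP / 2) / (k / 2))). pose proof (Rmax_l R0 (2 * (Rabs cP / 2) / (k / 2))). pose proof (Rmax_r R0 (2 * (Rabs cP / 2) / (k / 2))).
  split; [lra|split; [lra|]]. intros S X B P Q lP lQ HF HX FS r Hr GP GQ.
  apply (lin (k / 2) _ (Rabs cP / 2)); try lra.
  destruct (frac_sys_abs _ _ _ _ _ _ _ r FS ltac:(lra) GP GQ) as [A1 _].
  specialize (HB r ltac:(lra)). rewrite (mn_ext (fun z => Rabs (ln (Cmod (f z)))) (fun z => Rabs (lr P Q z))) in HB.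
  + generalize (Rle_abs (- cP)). rewrite Rabs_Ropp. lra.
  + intros t. assert (Hz : Cmod (circ r t) = r) by (apply Cmod_circ; lra). unfold lr.
    destruct (fraction_value f r0 X B P Q (circ r t) HF ltac:(lra) (Np _)) as [NQ ->]. rewrite Cmod_mult, ln_mult by (apply Cmod_pos_neq; auto). f_equal. ring.
Qed.
End LowerBound.

(** * Choice of the scale *)

(** All that is used of the hyper-order. The mean is a Riemann integral and is required only on
    circles free of zeros and poles, where its integrand is continuous. *)
Definition tame (f : C -> C) (s : R) : Prop := exists Rb, 1 <= Rb /\ forall r, Rb <= r ->
  INR (npoles f r) <= exp (Rpower r s) /\
  ((forall z, Cmod z = r -> ~ is_pole f z /\ f z <> RtoC 0) -> mn (fun z => Rmax 0 (ln (Cmod (f z)))) r <= exp (Rpower r s)).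

Lemma pow2_ge n : INR n <= 2 ^ n.
Proof. induction n. simpl; lra. rewrite S_INR. simpl. assert (1 <= 2 ^ n) by (apply pow_R1_Rle; lra). lra. Qed.

(* w = X ^ ((1 - s) / 4), so that windows of length 3 w ^ 2 are long compared with ln X and short compared
   with X ^ (1 - s). *)
Lemma exists_scale s D W : 0 <= s < 1 -> 0 < D -> let tau := (1 - s) / 4 in exists n w, let X := D * 2 ^ n in
  W <= w /\ 1 <= w /\ 1 <= X /\ w ^ 4 <= X /\ Rpower X s = X / w ^ 4 /\ ln X <= w / tau /\ INR n <= 2 * (w / tau + Rabs (ln D)).
Proof.
intros Hs HD tau. assert (Ht : 0 < tau) by (unfold tau; lra).
set (W1 := Rmax W 1). assert (H1 : W <= W1) by apply Rmax_l. assert (H2 : 1 <= W1) by apply Rmax_r.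
destruct (nfloor_ex (exp (ln W1 / tau) / D)) as [m [_ Hm]]. { left. apply Rdiv_lt_0_compat; auto using exp_pos. }
set (n := S m). set (X := D * 2 ^ n).
assert (HX : exp (ln W1 / tau) <= X).
{ pose proof (pow2_ge n). rewrite <- S_INR in Hm. fold n in Hm. apply Rlt_le, (Rmult_le_compat_l D) in Hm; [|lra].
  replace (D * (exp (ln W1 / tau) / D)) with (exp (ln W1 / tau)) in Hm by (field; lra). unfold X. eapply Rle_trans. apply Hm. apply Rmult_le_compat_l; lra. }
pose proof (exp_pos (ln W1 / tau)) as Pe. assert (PX : 0 < X) by lra.
assert (LX : ln W1 / tau <= ln X). { apply ln_le_mono in HX; auto. now rewrite ln_exp in HX. }
assert (LW : 0 <= ln W1) by now apply ln_nonneg.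
assert (LX' : ln W1 <= tau * ln X). { apply (Rmult_le_compat_l tau) in LX; [|lra]. replace (tau * (ln W1 / tau)) with (ln W1) in LX by (field; lra). auto. }
assert (L0 : 0 <= ln X). { apply Rle_trans with (ln W1 / tau); auto. apply Rmult_le_pos; auto. left; now apply Rinv_0_lt_compat. }
exists n, (exp (tau * ln X)). fold X. set (w := exp (tau * ln X)).
assert (Ww : W1 <= w). { unfold w. rewrite <- (exp_ln W1) by lra. now apply exp_le. }
assert (w4 : w ^ 4 = exp ((1 - s) * ln X)). { unfold w. simpl. rewrite Rmult_1_r, <- !exp_plus. f_equal. unfold tau. field. }
assert (lw : tau * ln X <= w). { generalize (ln_le_sub1 w ltac:(lra)). unfold w at 1. rewrite ln_exp. lra. }
assert (lw' : ln X <= w / tau). { apply (Rmult_le_reg_l tau); auto. replace (tau * (w / tau)) with w by (field; lra). auto. }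
split; [|split; [|split; [|split; [|split; [|split]]]]]; try lra.
- rewrite <- (exp_ln X) by auto. rewrite <- exp_0. now apply exp_le.
- rewrite w4. rewrite <- (exp_ln X) at 2 by auto. apply exp_le. nra.
- rewrite w4. unfold Rpower. rewrite <- (exp_ln X) at 2 by auto. unfold Rdiv. rewrite <- exp_Ropp, <- exp_plus. f_equal. ring.
- assert (E : ln X = ln D + INR n * ln 2). { unfold X. rewrite ln_mult, ln_pow; try lra. apply pow_lt; lra. }
  pose proof ln_lt_2. pose proof (pos_INR n). generalize (Rle_abs (- ln D)). rewrite Rabs_Ropp. intros. nra.
Qed.

Lemma Rpower_scal_le k X s : 1 <= k -> 0 < X -> 0 <= s < 1 -> Rpower (k * X) s <= k * Rpower X s.
Proof.
intros Hk HX Hs. rewrite <- Rpower_mult_distr by lra. apply Rmult_le_compat_r. left; apply exp_pos.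
rewrite <- (Rpower_1 k) at 2 by lra. apply Rle_Rpower; lra.
Qed.

Lemma Rpower_mono X Y s : 0 < X <= Y -> 0 <= s -> Rpower X s <= Rpower Y s.
Proof. intros. now apply Rle_Rpower_l. Qed.

(** [charT] is the mean of ln |Q| plus the mean of the positive part of ln |f|; the former is
    bounded through the number of poles. *)
Lemma charT_upper f S X r0 cP B P Q lP lQ r : fraction f r0 X B P Q -> S <= X -> frac_sys P Q S r0 cP lP lQ -> 1 <= r < S ->
  generic r lP -> generic r lQ ->
  (forall z, Cmod z = r -> ~ is_pole f z /\ f z <> RtoC 0) /\
  charT P Q r <= poles_weight r0 B r + mn (fun z => Rmax 0 (ln (Cmod (f z)))) r.
Proof.
intros H HX [ZP ZQ Hr0 _ _ _ _] Hr GP GQ.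
assert (NP : forall z, Cmod z = r -> P z <> RtoC 0). { intros z Hz. apply (zsys_nonzero P S lP z ZP). lra. intros I. now apply (GP z I). }
assert (NQ : forall z, Cmod z = r -> Q z <> RtoC 0). { intros z Hz. apply (zsys_nonzero Q S lQ z ZQ). lra. intros I. now apply (GQ z I). }
assert (NF : forall z, Cmod z = r -> ~ is_pole f z /\ f z <> RtoC 0 /\ ln (Cmod (f z)) = lr P Q z).
{ intros z Hz. destruct (fraction_nonpole f r0 X B P Q z H ltac:(lra) (NQ z Hz)) as [M E]. split; auto. pose proof (NP z Hz). pose proof (NQ z Hz).
  rewrite E. split. intros E0. apply H0. replace (P z) with (P z / Q z * Q z)%C by (field; auto). rewrite E0; ring.
  unfold lr. rewrite Cmod_div by auto. apply ln_div; now apply Cmod_pos_neq. }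
split. { intros z Hz. destruct (NF z Hz) as [A1 [A2 _]]. auto. }
assert (CP : ccirc (fun z => ln (Cmod (P z))) r) by (eapply zsys_ccirc; eauto; lra).
assert (CQ : ccirc (fun z => ln (Cmod (Q z))) r) by (eapply zsys_ccirc; eauto; lra).
assert (CL : ccirc (lr P Q) r) by now apply ccirc_minus. assert (CA := ccirc_abs _ r CL). cbv beta in CA.
assert (CS := ccirc_plus _ _ r CA CL). cbv beta in CS.
rewrite (mn_ext (fun z => Rmax 0 (ln (Cmod (f z)))) (fun z => / 2 * (Rabs (lr P Q z) + lr P Q z))).
2: { intros t. destruct (NF (circ r t)) as [_ [_ ->]]. apply Cmod_circ; lra. unfold Rmax, Rabs. destruct Rle_dec, Rcase_abs; lra. }
rewrite (mn_scal (/ 2) (fun z => Rabs (lr P Q z) + lr P Q z) r CS), (mn_plus (fun z => Rabs (lr P Q z)) (lr P Q) r CA CL).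
assert (EL : mn (lr P Q) r = mn (fun z => ln (Cmod (P z))) r - mn (fun z => ln (Cmod (Q z))) r) by now apply mn_minus.
rewrite EL. unfold charT.
assert (MQ : mn (fun z => ln (Cmod (Q z))) r <= poles_weight r0 B r).
{ rewrite <- (mn_const (poles_weight r0 B r) r). apply mn_le; auto. apply ccirc_const. intros t.
  destruct H as [EQ _]. pose proof (lprod_factor_upper B r0 (circ r t) ltac:(lra)) as Y. rewrite <- EQ, Cmod_circ in Y by lra.
  apply ln_le_mono in Y; [|apply Cmod_pos_neq, NQ, Cmod_circ; lra]. rewrite ln_pow in Y. exact Y. assert (0 < r / r0) by (apply Rdiv_lt_0_compat; lra). lra. }
lra.
Qed.

Section Main.
Variables (f K : C -> C) (c d : C) (s : R).
Hypothesis Hf : meromorphic f.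
Hypothesis HK : forall z, cdiff K z.
Hypothesis HfK : forall z, ~ is_pole f z -> ~ is_pole f (z + c)%C -> f (z + c)%C = (K z * f z)%C.
Hypothesis HO : forall z, ~ is_pole f z -> f z = RtoC 1 -> K z = d.
Hypothesis Hc : c <> RtoC 0.
Hypothesis N0 : exists q, ~ is_pole f q /\ f q <> RtoC 0.
Hypothesis N1 : exists q, ~ is_pole f q /\ f q <> RtoC 1.
Hypothesis NK1 : exists z, K z <> RtoC 1.
Hypothesis NKd : exists z, K z <> d.
Hypothesis NK2 : exists z, (K z * K (z + c))%C <> RtoC 1.
Hypothesis Hs : 0 <= s < 1.
Hypothesis Ht : tame f s.

Theorem main_contradiction : False.
Proof.
pose proof (Cmod_pos_neq c Hc) as Pc. 
destruct (scale_data_exists f K c d Hf HK HfK HO N0 N1 NK1 NKd NK2) as [r0 [cP [cE [c1 [c2 [c3 [C0 [Hr0 [HC0 SDE]]]]]]]]].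
destruct (charT_lower f K c Hf HK HfK Hc NK1 r0 cP Hr0) as [kappa [R0 [Hk [HR0 LB]]]].
destruct Ht as [Rb [HRb HT]].
set (A := 1 + Rabs cP + Rabs cE + Rabs c1 + Rabs c2 + Rabs c3).
pose proof (Rabs_pos cP) as ap. pose proof (Rabs_pos cE) as ae. pose proof (Rabs_pos c1) as a1. pose proof (Rabs_pos c2) as a2. pose proof (Rabs_pos c3) as a3.
(* The largest translation. With X = D 2^n the nearness bound allows n doublings, and mu X = D (n +
   2) is then at most of order w. *)
set (D := 3 * Cmod c). assert (HD : 0 < D) by (unfold D; lra). set (tau := (1 - s) / 4). assert (Htau : 0 < tau) by (unfold tau; lra).
set (c' := ln (20 / r0)). assert (Hc' : 0 <= c'). { apply ln_nonneg. apply Rmult_le_reg_r with r0. lra. replace (20 / r0 * r0) with 20 by (field; lra). lra. }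
(* Chosen so that ln Th <= G V. The poles are counted in the disc of radius 400 X + 10 + 3 |c|,
   which is at most 411 X. *)
set (G := 411 + / tau + c'). assert (Pt : 0 < / tau) by now apply Rinv_0_lt_compat. assert (PG : 411 <= G) by (unfold G; lra).
set (Hd := 45 * (24 * Cmod c + 32 * (3 * Cmod c * (2 * (/ tau + Rabs (ln D)) + 2)))).
set (C2 := A + ln C0 + ln (30000 * (3000 * (2 + A)) ^ 2)).
assert (HC2 : 0 <= C2). { unfold C2. assert (0 <= ln C0) by (apply ln_nonneg; lra). 
  assert (1 <= (3000 * (2 + A)) ^ 2) by (apply pow_R1_Rle; unfold A; lra). assert (0 <= ln (30000 * (3000 * (2 + A)) ^ 2)) by (apply ln_nonneg; lra). unfold A in *; lra. }
assert (HH : 0 <= Hd). { unfold Hd. pose proof (Rabs_pos (ln D)). apply Rmult_le_pos. lra. apply Rplus_le_le_0_compat. lra. apply Rmult_le_pos. lra. apply Rmult_le_pos; lra. }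
(* The sum of all lower bounds for [w] that the estimates below require. *)
set (W := Rb + R0 + 6 * Cmod c + / kappa + (6 * G + 7) + 2 * Hd + 12 * G / kappa + (4 * C2 + 2 * A + 2) / kappa).
assert (Pik : 0 < / kappa) by now apply Rinv_0_lt_compat.
assert (Q1 : 0 <= 12 * G / kappa) by (apply Rmult_le_pos; lra). assert (Q2 : 0 <= (4 * C2 + 2 * A + 2) / kappa) by (apply Rmult_le_pos; unfold A; lra).
destruct (exists_scale s D W Hs HD) as [n [w [HW [Hw1 [HX1 [HX4 [EXs [LX Ln]]]]]]]]. set (X := D * 2 ^ n) in *. fold tau in LX, Ln.
assert (w2 : w <= w ^ 2) by (rewrite <- (pow_1 w) at 1; apply Rle_pow; lia || lra).
assert (w3 : w ^ 2 <= w ^ 3) by (apply Rle_pow; lia || lra). assert (w4 : w ^ 3 <= w ^ 4) by (apply Rle_pow; lia || lra).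
assert (HXw : w <= X) by lra.
(* ln Th is at most of order V, so the windows, about 2 ln Th of them and each of length 3 w^2, take
   up a part of order X / w of the interval from X to 2 X. *)
set (V := X / w ^ 3). assert (V1 : w <= V). { unfold V. apply Rmult_le_reg_r with (w ^ 3). lra. replace (X / w ^ 3 * w ^ 3) with X by (field; lra). replace (w * w ^ 3) with (w ^ 4) by ring. lra. }
assert (EV : X = V * w ^ 3) by (unfold V; field; lra).
assert (Es : Rpower X s <= V). { rewrite EXs. apply Rmult_le_compat_l. lra. apply Rinv_le_contravar; lra. }
set (Th := exp (411 * Rpower X s) * (20 / r0 * X)).
assert (LTh : ln Th <= G * V).
{ unfold Th. assert (0 < 20 / r0) by (apply Rdiv_lt_0_compat; lra). rewrite ln_mult, ln_mult, ln_exp by first [apply exp_pos | lra | apply Rmult_lt_0_compat; lra]. fold c'.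
  assert (w / tau <= / tau * V) by (unfold Rdiv; rewrite Rmult_comm; apply Rmult_le_compat_l; lra). assert (c' * 1 <= c' * V) by (apply Rmult_le_compat_l; lra). unfold G. lra. }
assert (E1 : 1 <= exp (411 * Rpower X s)). { rewrite <- exp_0. apply exp_le. assert (0 < Rpower X s) by apply exp_pos. lra. }
assert (i0 : 20 <= 20 / r0). { apply Rmult_le_reg_r with r0. lra. replace (20 / r0 * r0) with 20 by (field; lra). lra. }
assert (XTh : 20 * X <= Th). { unfold Th. assert (20 * X <= 20 / r0 * X) by (apply Rmult_le_compat_r; lra). apply Rle_trans with (1 * (20 * X)). lra. apply Rmult_le_compat; lra. }
assert (LTh0 : 0 <= ln Th) by (apply ln_nonneg; lra).
destruct (nfloor_ex (2 * ln Th)) as [N' [B1 B2]]. lra. set (N := S N').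
assert (HTN : Th < 2 ^ N).
{ apply ln_lt_inv; try lra. apply pow_lt; lra. rewrite ln_pow by lra. unfold N. rewrite S_INR. pose proof ln_lt_2.
  assert ((INR N' + 1) * / 2 <= (INR N' + 1) * ln 2) by (apply Rmult_le_compat_l; lra). lra. }
destruct (SDE (20 * X)) as [B [P [Q [E [lP [lQ [lE [l1 [l2 [l3 SD]]]]]]]]]]. lra.
pose proof SD as [FR FS _ _ _ _ _ _ _ _ _ _ _ _ _].
assert (Wk : w >= W) by lra. unfold W in Wk.
assert (Xc : 6 * Cmod c <= X) by lra.
assert (gen : forall r, good_for c lP lQ lE l1 l2 l3 r -> generic r lP /\ generic r lQ).
{ intros r g. destruct (good_generic c lP lQ lE l1 l2 l3 r g) as [g1 [g2 _]]. auto. }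
assert (HPW : forall r, X <= r <= 9 * X -> poles_weight r0 B r <= exp (411 * Rpower X s) * (9 * X / r0)).
{ intros r Hr. unfold poles_weight. apply Rmult_le_compat. apply pos_INR. apply ln_nonneg. assert (0 < r / r0) by (apply Rdiv_lt_0_compat; lra). lra.
  - destruct FR as [_ [_ [_ ->]]]. destruct (HT (20 * (20 * X) + 10 + 3 * Cmod c) ltac:(lra)) as [-> _].
    apply exp_le. eapply Rle_trans. apply (Rpower_mono _ (411 * X)); lra. apply Rpower_scal_le; lra.
  - eapply Rle_trans. apply ln_1p_le. left; apply Rdiv_lt_0_compat; lra. apply Rmult_le_compat_r. left; apply Rinv_0_lt_compat; lra. lra. }
assert (P9 : 0 <= 9 * X / r0) by (left; apply Rdiv_lt_0_compat; lra).
assert (P9' : 20 / r0 * X = 9 * X / r0 + 11 * X / r0) by (field; lra).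
assert (P11 : 1 <= 11 * X / r0). { apply Rmult_le_reg_r with r0. lra. replace (11 * X / r0 * r0) with (11 * X) by (field; lra). lra. }
destruct (window f K c Hf HK HfK Hc r0 cP cE c1 c2 c3 C0 A HC0) with (X := X) (y := w ^ 2) (Th := Th) (mu := D * (INR n + 2) / X) (N := N) 
  (B := B) (P := P) (Q := Q) (E := E) (lP := lP) (lQ := lQ) (lE := lE) (l1 := l1) (l2 := l2) (l3 := l3) as [r [Hr [Gr HFin]]]; auto; try (unfold A; lra); try lra.
- unfold N. rewrite !S_INR. 
  assert (Y1 : w ^ 2 * (2 * ln Th + 2) <= w ^ 2 * (2 * (G * V) + 2)) by (apply Rmult_le_compat_l; lra).
  assert (Y2 : w ^ 2 * (INR N' + 1 + 1) <= w ^ 2 * (2 * ln Th + 2)) by (apply Rmult_le_compat_l; lra).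
  assert (Y3 : w ^ 2 <= w ^ 2 * V) by (rewrite <- (Rmult_1_r (w ^ 2)) at 1; apply Rmult_le_compat_l; lra). assert (Y4 : (6 * G + 7) * (w ^ 2 * V) <= w * (w ^ 2 * V)) by (apply Rmult_le_compat_r; [apply Rmult_le_pos; lra|lra]).
  rewrite EV at 1. replace (V * w ^ 3) with (w * (w ^ 2 * V)) by ring. assert (1 <= w ^ 2) by lra.
  replace (w ^ 2 * (2 * (G * V) + 2)) with (2 * (G * (w ^ 2 * V)) + 2 * w ^ 2) in Y1 by ring. lra.
- intros r Hr g. destruct (gen r g) as [g1 g2]. split.
  + pose proof (LB (20 * X) _ B P Q lP lQ FR ltac:(lra) FS r ltac:(lra) g1 g2) as L. eapply Rle_trans; [|apply L].
    apply Rle_trans with (kappa * / kappa). rewrite Rinv_r; lra. apply Rmult_le_compat_l; lra.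
  + destruct (charT_upper f (20 * X) _ r0 cP B P Q lP lQ r FR ltac:(lra) FS ltac:(lra) g1 g2) as [NZ U].
    destruct (HT r ltac:(lra)) as [_ M]. specialize (M NZ). pose proof (HPW r Hr) as U2.
    assert (M2 : exp (Rpower r s) <= exp (411 * Rpower X s)).
    { apply exp_le. eapply Rle_trans. apply (Rpower_mono _ (411 * X)); lra. apply Rpower_scal_le; lra. }
    unfold Th. rewrite P9'. set (e := exp (411 * Rpower X s)) in *.
    assert (e * 1 <= e * (11 * X / r0)) by (apply Rmult_le_compat_l; lra). rewrite Rmult_plus_distr_l. lra.
- intros r Hr. eapply Rle_trans. now apply HPW. unfold Th. rewrite P9'. apply Rmult_le_compat_l; lra.
- intros r dd x Hr Hdd Hx. fold D in Hdd. 
  assert (P2n : 0 < 2 ^ n) by (apply pow_lt; lra).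
  eapply Rle_trans. apply (nearness_bound n dd x r); auto; try lra.
  apply Rle_trans with X; auto. unfold X. rewrite Rmult_comm. apply Rmult_le_compat_r; lra.
  pose proof (pos_INR n) as Pn.
  assert (Z1 : INR n * dd / r <= INR n * D / X). { apply Rmult_le_compat. apply Rmult_le_pos; lra. left; apply Rinv_0_lt_compat; lra. apply Rmult_le_compat_l; lra. apply Rinv_le_contravar; lra. }
  assert (Z2 : 2 / 2 ^ n = D * 2 / X) by (unfold X; field; lra).
  rewrite Z2. replace (D * (INR n + 2) / X) with (INR n * D / X + D * 2 / X) by (field; lra). lra.
- set (T := charT P Q r) in *. destruct (gen r Gr) as [g1 g2].
  pose proof (LB (20 * X) _ B P Q lP lQ FR ltac:(lra) FS r ltac:(lra) g1 g2) as L. fold T in L.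
  (* The coefficient of T + A is of order w / w^2; the threshold for [w] makes it at most 1/2, so
     that this term is absorbed on the left. *)
  assert (Dl : 45 * ((24 * Cmod c + 32 * (D * (INR n + 2) / X * X)) / w ^ 2) <= / 2).
  { replace (D * (INR n + 2) / X * X) with (D * (INR n + 2)) by (field; lra).
    assert (Y : 45 * (24 * Cmod c + 32 * (D * (INR n + 2))) <= Hd * w).
    { unfold Hd, D. pose proof (Rabs_pos (ln D)) as PD. fold D. set (a := Rabs (ln D)) in *.
      assert (INR n + 2 <= (2 * (/ tau + a) + 2) * w). { unfold Rdiv in Ln. assert (a * 1 <= a * w) by (apply Rmult_le_compat_l; lra). lra. }
      assert (D * (INR n + 2) <= D * ((2 * (/ tau + a) + 2) * w)) by (apply Rmult_le_compat_l; lra).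
      assert (Cmod c * 1 <= Cmod c * w) by (apply Rmult_le_compat_l; lra). 
      replace (45 * (24 * Cmod c + 32 * (D * (2 * (/ tau + a) + 2))) * w) with (45 * (24 * (Cmod c * w) + 32 * (D * ((2 * (/ tau + a) + 2) * w)))) by ring. lra. }
    apply Rmult_le_reg_r with (w ^ 2). lra. 
    replace (45 * ((24 * Cmod c + 32 * (D * (INR n + 2))) / w ^ 2) * w ^ 2) with (45 * (24 * Cmod c + 32 * (D * (INR n + 2)))) by (field; lra).
    assert (2 * Hd * w <= w * w) by (apply Rmult_le_compat_r; lra). replace (w ^ 2) with (w * w) by ring. lra. }
  assert (TA : 0 <= T + A). { assert (0 <= kappa * r) by (apply Rmult_le_pos; lra). unfold A; lra. }
  apply (Rmult_le_compat_r (T + A)) in Dl; auto.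
  change (T <= C2 + 3 * ln Th + 45 * ((24 * Cmod c + 32 * (D * (INR n + 2) / X * X)) / w ^ 2) * (T + A)) in HFin || (unfold C2 in HFin).
  (* What remains is kappa X against constants and 6 G V = 6 G X / w^3, which is impossible for
     large [w]. *)
  assert (F1 : kappa * X <= T) by (eapply Rle_trans; [|apply L]; apply Rmult_le_compat_l; lra).
  assert (F2 : kappa * X <= 2 * C2 + 6 * (G * V) + A) by (unfold C2 in *; lra).
  assert (F3 : 6 * (G * V) <= kappa * X / 2).
  { rewrite EV. assert (H6 : 12 * G / kappa <= w ^ 3) by lra. apply (Rmult_le_compat_l (kappa * V)) in H6; [|apply Rmult_le_pos; lra].
    replace (kappa * V * (12 * G / kappa)) with (12 * (G * V)) in H6 by (field; lra). lra. }
  assert (F4 : (4 * C2 + 2 * A + 2) / kappa <= X) by lra. apply (Rmult_le_compat_l kappa) in F4; [|lra].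
  replace (kappa * ((4 * C2 + 2 * A + 2) / kappa)) with (4 * C2 + 2 * A + 2) in F4 by (field; lra). lra.
Qed.
End Main.

(** * The case K(z) K(z + c) = 1 *)

Lemma zrep_zero_free u R : 0 < R -> (forall z, cdiff u z) -> (forall z, u z <> RtoC 0) -> exists h, zrep u R nil h.
Proof.
intros HR Hu Nu. destruct (holo_log u R HR) as [h [Hh E]]; auto. intros z _; auto.
exists h. split; [|split; [|split]]; auto. intros z _; auto. simpl; tauto.
intros z Hz. destruct (E z Hz) as [E1 E2]. split. simpl; tauto. intros _. split; [|split]; auto.
- rewrite E2. simpl. ring.
- rewrite E1. simpl. field. auto.
Qed.

Definition logmean (u : C -> C) (r : R) := mn (fun z => Rabs (ln (Cmod (u z)))) r.

Section Involution.
Variables (u : C -> C) (c : C).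
Hypothesis Hu : forall z, cdiff u z.
Hypothesis Hc : c <> RtoC 0.
Hypothesis Huc : forall z, (u z * u (z + c))%C = RtoC 1.

Lemma involution_nonzero z : u z <> RtoC 0.
Proof. intros E. pose proof (Huc z) as X. rewrite E, Cmult_0_l in X. apply RtoC_inj in X. lra. Qed.

(* [2 ln |u|] is the difference of [ln |u|] and its translate by [c], which is small on average. *)
Lemma involution_step r : Cmod c <= r -> 4 * logmean u r <= logmean u (r + 8 * Cmod c).
Proof.
(* With R - r = 8 |c| the factor 4 |c| / (R - r) is 1/2, and both zero lists are empty, so no
   counting term appears. *)
intros Hr. pose proof (Cmod_pos_neq c Hc) as Pc. set (R := r + 8 * Cmod c).
destruct (zrep_zero_free u (R + 1) ltac:(unfold R; lra) Hu involution_nonzero) as [h Zu].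
destruct (zrep_zero_free (fun _ => RtoC 1) (R + 1) ltac:(unfold R; lra)) as [h1 Z1]. intros; apply cdiff_const. intros; apply RtoC_neq; lra.
destruct (log_difference u (fun _ => RtoC 1) nil h nil h1 c (R + 1) R r 2 Zu Z1) as [X1 [X2 X3]]; try (unfold R; lra); try (intros a I; solve [destruct I]).
{ intros x Hx. apply nearness_base; auto; lra. }
simpl in X3. rewrite (mn_ext (fun z => Rabs (ln (Cmod (u z)) - ln (Cmod 1))) (fun z => Rabs (ln (Cmod (u z))))) in X3
 by (intros; rewrite Cmod_1, ln_1, Rminus_0_r; auto).
rewrite (mn_ext _ (fun z => 2 * Rabs (ln (Cmod (u z))))) in X3.
- assert (CU : ccirc (fun z => Rabs (ln (Cmod (u z)))) r).
  { apply ccirc_abs. apply ccirc_lnCmod. intros t; split; [now apply cdiff_ccont|apply involution_nonzero]. }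
  rewrite (mn_scal 2 (fun z => Rabs (ln (Cmod (u z)))) r CU) in X3. unfold logmean.
  replace (4 * Cmod c / (R - r)) with (/ 2) in X3 by (unfold R; field; lra). lra.
- intros t. set (z := circ r t). pose proof (Huc z) as E. apply (f_equal Cmod) in E. rewrite Cmod_mult, Cmod_1 in E.
  apply (f_equal ln) in E. rewrite ln_1, ln_mult in E by (apply Cmod_pos_neq, involution_nonzero).
  rewrite Cmod_1, ln_1. replace (ln (Cmod (u (z + c)%C)) - 0 - (ln (Cmod (u z)) - 0)) with (- (2 * ln (Cmod (u z)))) by lra.
  rewrite Rabs_Ropp, Rabs_mult, (Rabs_pos_eq 2); lra.
Qed.

Lemma involution_iterate n r : Cmod c <= r -> 4 ^ n * logmean u r <= logmean u (r + 8 * Cmod c * INR n).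
Proof.
intros Hr. pose proof (Cmod_ge_0 c) as Pc. induction n.
- simpl. rewrite Rmult_0_r, Rplus_0_r. lra.
- rewrite S_INR. replace (r + 8 * Cmod c * (INR n + 1)) with (r + 8 * Cmod c * INR n + 8 * Cmod c) by ring.
  eapply Rle_trans; [|apply involution_step]. simpl. lra. pose proof (pos_INR n). assert (0 <= 8 * Cmod c * INR n) by (apply Rmult_le_pos; lra). lra.
Qed.

(** For nonconstant u the logarithmic mean would be multiplied by 4^(2^n) over a length X / 2, with
    2^n proportional to X. Starting from the linear lower bound, this exceeds the growth exp (C1
    X^s) allowed for s < 1. *)
Theorem involution_constant s C1 Rb : 0 <= s < 1 -> 1 <= C1 ->
  (forall X, Rb <= X -> exists r, X <= r <= 2 * X /\ logmean u r <= C1 * X * exp (C1 * Rpower X s)) ->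
  forall a b, u a = u b.
Proof.
intros Hs HC1 HG a b. apply NNPP. intros N. pose proof (Cmod_pos_neq c Hc) as Pc.
destruct (zero_free_lower u Hu involution_nonzero) as [k [R0 [Hk [HR0 HL]]]]. eauto.
(* Then X = D 2^n makes 2^n steps of length 8 |c| cover exactly X / 2. *)
set (D := 16 * Cmod c). set (l := ln (2 * C1 / k)).
destruct (exists_scale s D (Rabs Rb + 2 * R0 + 2 * Cmod c + 2 * (C1 * D) + 2 * D * (Rabs l + 1)) Hs ltac:(unfold D; lra)) as [n [w H]].
set (X := D * 2 ^ n) in H. destruct H as [HW [Hw1 [HX1 [HX4 [EXs _]]]]].
assert (w4 : w <= w ^ 4) by (rewrite <- (pow_1 w) at 1; apply Rle_pow; lia || lra).
pose proof (Rabs_pos l) as Pl. pose proof (Rabs_pos Rb). pose proof (Rle_abs Rb). pose proof (Rle_abs l).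
assert (PD : 0 < D) by (unfold D; lra). assert (P1 : 0 <= 2 * (C1 * D)) by (apply Rmult_le_pos; [lra|apply Rmult_le_pos; lra]). 
assert (P2 : 0 <= 2 * D * (Rabs l + 1)) by (apply Rmult_le_pos; lra).
destruct (HG X ltac:(lra)) as [r [Hr HV]]. set (p := 2 ^ n) in *. assert (P0 : 1 <= p) by (apply pow_R1_Rle; lra).
assert (Ep : INR (2 ^ n) = p) by (rewrite pow_INR; reflexivity).
assert (EX : 8 * Cmod c * p = X / 2) by (unfold X, D; field).
pose proof (involution_iterate (2 ^ n) (r - X / 2) ltac:(lra)) as I. rewrite Ep, EX in I. replace (r - X / 2 + X / 2) with r in I by ring.
pose proof (HL (r - X / 2) ltac:(lra)) as L. fold (logmean u (r - X / 2)) in L.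
assert (L2 : k * (X / 2) <= logmean u (r - X / 2)). { eapply Rle_trans; [|apply L]. apply Rmult_le_compat_l; lra. }
assert (Q4 : 0 < 4 ^ (2 ^ n)) by (apply pow_lt; lra).
assert (I2 : 4 ^ (2 ^ n) * (k * (X / 2)) <= C1 * X * exp (C1 * Rpower X s)). { eapply Rle_trans. apply Rmult_le_compat_l. lra. apply L2. lra. }
assert (I3 : 4 ^ (2 ^ n) <= 2 * C1 / k * exp (C1 * Rpower X s)).
{ apply Rmult_le_reg_r with (k * (X / 2)). apply Rmult_lt_0_compat; lra. eapply Rle_trans. apply I2. right. field. lra. }
apply ln_le_mono in I3; auto. rewrite ln_pow, Ep in I3 by lra.
rewrite ln_mult, ln_exp in I3 by (try apply exp_pos; apply Rdiv_lt_0_compat; lra). fold l in I3.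
assert (L4 : 1 <= ln 4). { replace 4 with (2 * 2) by ring. rewrite ln_mult by lra. pose proof ln_lt_2. lra. }
assert (I4 : p * 1 <= p * ln 4) by (apply Rmult_le_compat_l; lra).
assert (I5 : C1 * Rpower X s <= p / 2).
{ rewrite EXs. apply Rmult_le_reg_r with (w ^ 4). lra. replace (C1 * (X / w ^ 4) * w ^ 4) with (C1 * D * p) by (unfold X; field; lra).
  assert (2 * (C1 * D) * p <= w ^ 4 * p) by (apply Rmult_le_compat_r; lra). lra. }
assert (I6 : D * (2 * (Rabs l + 1)) <= D * p) by (fold X; lra). apply Rmult_le_reg_l in I6; lra.
Qed.
End Involution.

(** * Reduction of the involutive case to K = -1 and two omitted values *)

Lemma RtoC_m1 : RtoC (-1) = (- RtoC 1)%C.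
Proof. apply injective_projections; simpl; ring. Qed.

Lemma frac_sys_exists f : meromorphic f -> (exists q, ~ is_pole f q /\ f q <> RtoC 0) ->
  exists r0, 0 < r0 < 1 /\ (forall z, Cmod z = r0 -> ~ is_pole f z /\ f z <> RtoC 0) /\
  forall S X, 1 < S -> 4 * S < X -> exists B P Q lP lQ, fraction f r0 X B P Q /\ frac_sys P Q S r0 (mn (fun z => ln (Cmod (f z))) r0) lP lQ /\
    ccirc (fun z => ln (Cmod (Q z))) r0 /\ mn (fun z => ln (Cmod (Q z))) r0 = 0.
Proof.
intros Hf [q [Nq Eq]]. set (R := 4 * Cmod q + 5). pose proof (Cmod_ge_0 q) as Pq.
destruct (fraction_exists f 1 R Hf) as [B0 [P0 [Q0 H0]]].
destruct (fraction_value f 1 R B0 P0 Q0 q H0 ltac:(unfold R; lra) Nq) as [NQ0 EP0].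
destruct (common_circle (P0 :: Q0 :: nil) R ltac:(unfold R; lra)) as [r0 [Hr0 Hz]].
{ intros F [<-|[<-|[]]]; split.
  - apply H0. - exists q. split. unfold R; lra. rewrite EP0. now apply Cmult_neq_0.
  - eapply fraction_holo_Q; eauto. - exists q. split; auto. unfold R; lra. }
assert (NF : forall z, Cmod z = r0 -> ~ is_pole f z /\ f z <> RtoC 0).
{ intros z E. pose proof (Hz P0 z ltac:(simpl; auto) E) as A1. pose proof (Hz Q0 z ltac:(simpl; auto) E) as A2.
  destruct (fraction_nonpole f 1 R B0 P0 Q0 z H0 ltac:(unfold R; lra) A2) as [M Ef]. split; auto.
  intros E0. apply A1. replace (P0 z) with (P0 z / Q0 z * Q0 z)%C by (field; auto). rewrite <- Ef, E0. ring. }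
exists r0. split; [|split]; auto. intros S X HS HX.
destruct (fraction_exists f r0 X Hf) as [B [P [Q H]]].
assert (HPX : holo_on_disc P 0 X) by apply H. assert (HQX : holo_on_disc Q 0 X) by (eapply fraction_holo_Q; eauto).
assert (V : forall z, Cmod z = r0 -> Q z <> RtoC 0 /\ P z = (Q z * f z)%C).
{ intros z E. apply (fraction_value f r0 X B P Q z H); [lra|now apply NF]. }
assert (NQ : forall z, Cmod z = r0 -> Q z <> RtoC 0) by (intros; now apply V).
assert (NP : forall z, Cmod z = r0 -> P z <> RtoC 0). { intros z E. destruct (V z E) as [A ->]. apply Cmult_neq_0; auto. now apply NF. }
set (z1 := circ r0 0). assert (Hz1 : Cmod z1 = r0) by (apply Cmod_circ; lra).
destruct (zsys_exists P z1 S X ltac:(lra) HX HPX ltac:(lra) (NP z1 Hz1)) as [lP ZP].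
destruct (zsys_exists Q z1 S X ltac:(lra) HX HQX ltac:(lra) (NQ z1 Hz1)) as [lQ ZQ].
assert (gP : generic r0 lP) by (eapply zsys_generic; eauto). assert (gQ : generic r0 lQ) by (eapply zsys_generic; eauto).
assert (GB : generic r0 B). { intros b Hb Eb. apply (NQ b Eb). destruct H as [-> _]. rewrite lprod_in by auto. ring. }
destruct (fraction_mn_Q f r0 X B P Q r0 H ltac:(lra) GB) as [cQ CQ].
rewrite (lsum_ext _ (fun _ => 0)), lsum_const, Rmult_0_r in cQ by (intros; ring).
assert (CP : ccirc (fun z => ln (Cmod (P z))) r0) by (eapply zsys_ccirc; eauto; lra).
exists B, P, Q, lP, lQ. split; [|split; [|split]]; auto. split; auto.
apply (mn_quotient P Q (fun z => ln (Cmod (f z)))); auto. intros t. destruct (V (circ r0 t)) as [A ->]. apply Cmod_circ; lra.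
rewrite Cmod_mult, ln_mult by (apply Cmod_pos_neq; auto; apply NF, Cmod_circ; lra). ring.
Qed.

(** The poles are counted on the disc of radius 50 X, because zero lists in |z| < 10 X need more
    than four times that radius. *)
Lemma charT_tame f s r0 : tame f s -> 0 <= s < 1 -> 0 < r0 < 1 -> exists Rb, 1 <= Rb /\ forall X B P Q cP lP lQ, Rb <= X ->
  fraction f r0 (50 * X) B P Q -> frac_sys P Q (10 * X) r0 cP lP lQ -> forall r, X <= r <= 9 * X -> generic r lP -> generic r lQ ->
  0 <= poles_weight r0 B r /\ poles_weight r0 B r + charT P Q r <= 20 / r0 * X * exp (50 * Rpower X s).
Proof.
intros [Rb [HRb HT]] Hs Hr0. exists Rb. split; auto. intros X B P Q cP lP lQ HX H FS r Hr GP GQ.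
destruct (charT_upper f (10 * X) (50 * X) r0 cP B P Q lP lQ r H ltac:(lra) FS ltac:(lra) GP GQ) as [NZ U].
destruct (HT r ltac:(lra)) as [_ M]. specialize (M NZ).
assert (L0 : 0 <= ln (1 + r / r0)). { apply ln_nonneg. assert (0 < r / r0) by (apply Rdiv_lt_0_compat; lra). lra. }
assert (PW : poles_weight r0 B r <= exp (50 * Rpower X s) * (9 * X / r0)).
{ unfold poles_weight. apply Rmult_le_compat; auto. apply pos_INR.
  - destruct H as [_ [_ [_ ->]]]. destruct (HT (50 * X) ltac:(lra)) as [-> _]. apply exp_le. apply Rpower_scal_le; lra.
  - eapply Rle_trans. apply ln_1p_le. left; apply Rdiv_lt_0_compat; lra. apply Rmult_le_compat_r. left; apply Rinv_0_lt_compat; lra. lra. }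
assert (M2 : exp (Rpower r s) <= exp (50 * Rpower X s)).
{ apply exp_le. eapply Rle_trans. apply (Rpower_mono _ (50 * X)); lra. apply Rpower_scal_le; lra. }
set (e := exp (50 * Rpower X s)) in *. assert (Pe : 0 < e) by apply exp_pos.
assert (P1 : 1 <= 2 * X / r0). { apply Rmult_le_reg_r with r0. lra. replace (2 * X / r0 * r0) with (2 * X) by (field; lra). lra. }
assert (e * 1 <= e * (2 * X / r0)) by (apply Rmult_le_compat_l; lra).
split. apply Rmult_le_pos; auto. apply pos_INR.
replace (20 / r0 * X * e) with (2 * (e * (9 * X / r0)) + e * (2 * X / r0)) by (field; lra). lra.
Qed.

(** [P - sg Q] has no zeros, not even at the poles of f, so its logarithmic mean is the same on
    every circle. The mean of the absolute value then follows from a pointwise upper bound U >= 0 by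
    |x| <= 2 U - x. *)
Lemma omitted_value_mean f S X r0 cP B P Q lP lQ sg r : fraction f r0 X B P Q -> S <= X -> frac_sys P Q S r0 cP lP lQ -> 1 <= r < S ->
  generic r lP -> generic r lQ -> Cmod sg = 1 -> (forall z, ~ is_pole f z -> f z <> sg) -> (forall z, Cmod z = r0 -> ~ is_pole f z) ->
  (forall z, Cmod z < X -> (P z - sg * Q z)%C <> RtoC 0) /\
  ccirc (fun z => Rabs (ln (Cmod (P z - sg * Q z)))) r /\
  mn (fun z => Rabs (ln (Cmod (P z - sg * Q z)))) r <=
    2 * (ln 2 + poles_weight r0 B r + (2 * charT P Q r - cP)) - mn (fun z => ln (Cmod (f z - sg))) r0.
Proof.
intros H HX FS Hr GP GQ Hsg Om NF. pose proof FS as [ZP ZQ Hr0 gP gQ eP eQ].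
assert (HP : holo_on_disc P 0 X) by apply H. assert (HQ : holo_on_disc Q 0 X) by (eapply fraction_holo_Q; eauto).
set (F := fun z => (P z - sg * Q z)%C).
assert (HF : holo_on_disc F 0 X) by (apply holo_minus; auto; apply holo_mult; auto; apply holo_const).
assert (NZ : forall z, Cmod z < X -> F z <> RtoC 0).
{ intros z Hz E. assert (E1 : P z = (sg * Q z)%C) by (replace (P z) with (F z + sg * Q z)%C by (unfold F; ring); rewrite E; ring).
  destruct (classic (is_pole f z)) as [I|N].
  - destruct (fraction_pole f r0 X B P Q z H Hz I) as [EQ NP]. apply NP. rewrite E1, EQ. ring.
  - destruct (fraction_value f r0 X B P Q z H Hz N) as [NQ EP]. apply (Om z N). apply (Cmult_reg_l (Q z)); auto. rewrite <- EP, E1. ring. }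
assert (CCF : forall x, 0 <= x < X -> ccirc (fun z => ln (Cmod (F z))) x).
{ intros x Hx. apply ccirc_lnCmod. intros t. assert (Ht : Cmod (circ x t) < X) by (rewrite Cmod_circ; lra). split; auto. apply cdiff_ccont, HF. now rewrite Cmod_minus_0. }
assert (MF : mn (fun z => ln (Cmod (F z))) r = mn (fun z => ln (Cmod (f z - sg))) r0).
{ rewrite (mn_ln_nonvanishing F X r), <- (mn_ln_nonvanishing F X r0) by (auto; lra).
  apply (mn_quotient F Q (fun z => ln (Cmod (f z - sg)))); auto. apply CCF; lra. eapply zsys_ccirc; eauto; lra.
  intros t. assert (Hz : Cmod (circ r0 t) = r0) by (apply Cmod_circ; lra).
  destruct (fraction_value f r0 X B P Q (circ r0 t) H ltac:(lra) (NF _ Hz)) as [NQ EP].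
  assert (EF : F (circ r0 t) = (Q (circ r0 t) * (f (circ r0 t) - sg))%C) by (unfold F; rewrite EP; ring).
  rewrite EF, Cmod_mult, ln_mult. ring. now apply Cmod_pos_neq. apply Cmod_pos_neq. apply Cminus_neq. auto. }
split; [|split]; auto. { apply ccirc_abs, CCF. lra. }
assert (CP : ccirc (fun z => ln (Cmod (P z))) r) by (eapply zsys_ccirc; eauto; lra).
assert (CQ : ccirc (fun z => ln (Cmod (Q z))) r) by (eapply zsys_ccirc; eauto; lra).
assert (CA : ccirc (fun z => Rabs (lr P Q z)) r) by (apply ccirc_abs; now apply ccirc_minus).
destruct (frac_sys_abs P Q S r0 cP lP lQ r FS ltac:(lra) GP GQ) as [AA _].
assert (W0 : 0 <= poles_weight r0 B r).
{ apply Rmult_le_pos. apply pos_INR. apply ln_nonneg. assert (0 < r / r0) by (apply Rdiv_lt_0_compat; lra). lra. }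
set (k := 2 * (ln 2 + poles_weight r0 B r)).
assert (CF := CCF r ltac:(lra)). assert (C2 := ccirc_scal 2 _ r CA). cbv beta in C2.
assert (C4 := ccirc_plus _ _ r (ccirc_const k r) C2). cbv beta in C4. assert (C5 := ccirc_minus _ _ r C4 CF). cbv beta in C5.
assert (I : mn (fun z => Rabs (ln (Cmod (F z)))) r <= mn (fun z => k + 2 * Rabs (lr P Q z) - ln (Cmod (F z))) r).
{ apply mn_le; auto. now apply ccirc_abs. intros t. set (z := circ r t). assert (Hz : Cmod z = r) by (apply Cmod_circ; lra).
  assert (NP : P z <> RtoC 0) by (apply (zsys_nonzero P S lP z ZP); [lra|apply circ_notin; auto; lra]).
  assert (NQ : Q z <> RtoC 0) by (apply (zsys_nonzero Q S lQ z ZQ); [lra|apply circ_notin; auto; lra]).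
  assert (U : ln (Cmod (F z)) <= ln 2 + lnmax P Q z).
  { rewrite <- (ln_exp (lnmax P Q z)), <- max_exp by auto. rewrite <- ln_mult by (try (eapply Rlt_le_trans; [|apply Rmax_l]); try lra; now apply Cmod_pos_neq).
    apply ln_le_mono. apply Cmod_pos_neq, NZ; lra. unfold F. eapply Rle_trans. apply Cmod_minus_le. rewrite Cmod_mult, Hsg.
    pose proof (Rmax_l (Cmod (P z)) (Cmod (Q z))). pose proof (Rmax_r (Cmod (P z)) (Cmod (Q z))). lra. }
  assert (LQ : ln (Cmod (Q z)) <= poles_weight r0 B r).
  { destruct H as [EQ _]. apply Cmod_pos_neq in NQ. pose proof (lprod_factor_upper B r0 z ltac:(lra)) as Y. rewrite <- EQ, Hz in Y.
    apply ln_le_mono in Y; auto. rewrite ln_pow in Y. exact Y. assert (0 < r / r0) by (apply Rdiv_lt_0_compat; lra). lra. }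
  assert (LM : lnmax P Q z <= poles_weight r0 B r + Rabs (lr P Q z)). { generalize (Rle_abs (lr P Q z)). unfold lnmax, lr in *. lra. }
  pose proof (Rabs_pos (lr P Q z)). assert (0 <= ln 2) by (apply ln_nonneg; lra). unfold k. apply Rabs_le. lra. }
rewrite (mn_minus (fun z => k + 2 * Rabs (lr P Q z)) (fun z => ln (Cmod (F z))) r C4 CF) in I.
rewrite (mn_plus (fun _ => k) (fun z => 2 * Rabs (lr P Q z)) r (ccirc_const k r) C2) in I.
rewrite mn_const, (mn_scal 2 (fun z => Rabs (lr P Q z)) r CA), MF in I. unfold k in I. unfold F in I. lra.
Qed.

Section Degenerate.
Variables (f K : C -> C) (c d : C) (s : R).
Hypothesis Hf : meromorphic f.
Hypothesis HK : forall z, cdiff K z.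
Hypothesis HfK : forall z, ~ is_pole f z -> ~ is_pole f (z + c)%C -> f (z + c)%C = (K z * f z)%C.
Hypothesis HO : forall z, ~ is_pole f z -> f z = RtoC 1 -> K z = d.
Hypothesis Hc : c <> RtoC 0.
Hypothesis N0 : exists q, ~ is_pole f q /\ f q <> RtoC 0.
Hypothesis NK1 : exists z, K z <> RtoC 1.
Hypothesis NKd : exists z, K z <> d.
Hypothesis HK2 : forall z, (K z * K (z + c))%C = RtoC 1.
Hypothesis Hs : 0 <= s < 1.
Hypothesis Ht : tame f s.

Lemma three_radii X lP lQ : 1 <= X -> exists r R R2, X < r < X + 1 /\ 3 * X < R < 3 * X + 1 /\ 5 * X < R2 < 5 * X + 1 /\
  shift_generic r c lP /\ shift_generic r c lQ /\ generic R lP /\ generic R lQ /\ generic R2 lP /\ generic R2 lQ.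
Proof.
intros HX. set (ys := map Cmod (lP ++ lQ) ++ map (fun a => Cmod (a - c)) (lP ++ lQ)).
assert (A : forall x, exists r, x < r < x + 1 /\ forall a, In a (lP ++ lQ) -> Cmod a <> r /\ Cmod (a - c) <> r).
{ intros x. destruct (avoid_finite ys x (x + 1)) as [r [Hr Hy]]. lra. exists r. split; auto. intros a I. split; apply Hy; unfold ys; apply in_app_iff.
  left; now apply in_map. right. now apply (in_map (fun a => Cmod (a - c))). }
destruct (A X) as [r [H1 G1]]. destruct (A (3 * X)) as [R [H2 G2]]. destruct (A (5 * X)) as [R2 [H3 G3]].
exists r, R, R2. do 3 (split; [auto|]).
split; [|split; [|split; [|split; [|split]]]]; intros a I; try (apply G1); try (apply G2); try (apply G3); apply in_app_iff; auto.
Qed.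

(** ln |K| is a logarithmic difference of f, so the growth assumption on f bounds its mean, which is
    what the theorem on u(z) u(z + c) = 1 requires. *)
Lemma quotient_constant a b : K a = K b.
Proof.
destruct (frac_sys_exists f Hf N0) as [r0 [Hr0 [NF FSE]]].
destruct (charT_tame f s r0 Ht Hs Hr0) as [Rb [HRb HB]]. set (cP := mn (fun z => ln (Cmod (f z))) r0) in *.
pose proof (Cmod_pos_neq c Hc) as Pc. pose proof (Rabs_pos cP) as PcP. assert (i0 : 0 < 20 / r0) by (apply Rdiv_lt_0_compat; lra).
set (C1 := 50 * (2 * (20 / r0) + Rabs cP) + 50).
apply (involution_constant K c HK Hc HK2 s C1 (Rb + 3 * Cmod c) Hs); [unfold C1; lra|].
intros X HX. destruct (FSE (10 * X) (50 * X)) as [B [P [Q [lP [lQ [H [FS _]]]]]]]; try lra.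
destruct (three_radii X lP lQ) as [r [R [R2 [H1 [H2 [H3 [SP [SQ [G1 [G2 [G3 G4]]]]]]]]]]]. lra.
exists r. split. lra.
assert (gP : generic r lP) by (intros x I; now apply SP). assert (gQ : generic r lQ) by (intros x I; now apply SQ).
destruct (small_quotient P Q (10 * X) r0 cP lP lQ c r R R2 2 FS) as [_ Sm]; auto; try lra.
{ intros x Hx. apply nearness_base; auto; lra. }
pose proof FS as [ZP ZQ _ _ _ _ _].
unfold logmean. rewrite (mn_ext _ (fun z => Rabs (lr P Q (z + c)%C - lr P Q z))).
2: { intros t. f_equal. assert (Hz : Cmod (circ r t) = r) by (apply Cmod_circ; lra).
  assert (SP1 : shift_generic r (RtoC 1 * c) lP) by (rewrite Cmult_1_l; auto). assert (SQ1 : shift_generic r (RtoC 1 * c) lQ) by (rewrite Cmult_1_l; auto).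
  pose proof (circ_shift_notin c r t 1 lP ltac:(lra) SP1) as n1. pose proof (circ_shift_notin c r t 1 lQ ltac:(lra) SQ1) as n2. rewrite Cmult_1_l in n1, n2.
  apply (ln_shift_quotient f K c (10 * X) (50 * X) r0 B P Q lP lQ); auto; try lra. eapply Rle_lt_trans. apply Cmod_triangle. lra.
  apply circ_notin; auto; lra. apply circ_notin; auto; lra. }
eapply Rle_trans. apply Sm.
destruct (HB X B P Q cP lP lQ ltac:(lra) H FS R ltac:(lra) G1 G2) as [w1 B1]. destruct (HB X B P Q cP lP lQ ltac:(lra) H FS R2 ltac:(lra) G3 G4) as [w2 B2].
set (e := exp (50 * Rpower X s)) in *. assert (Rp : 0 < Rpower X s) by apply exp_pos. assert (Pe : 1 <= e). { unfold e. rewrite <- exp_0. apply exp_le. lra. }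
set (U := (2 * (20 / r0) + Rabs cP) * X * e).
assert (Xe : 1 <= X * e) by (rewrite <- (Rmult_1_l 1); apply Rmult_le_compat; lra).
assert (cX : Rabs cP * 1 <= Rabs cP * (X * e)) by (apply Rmult_le_compat_l; lra).
pose proof (Rle_abs (- cP)) as q. rewrite Rabs_Ropp in q.
assert (U1 : 2 * charT P Q R - cP <= U) by (unfold U; lra). assert (U2 : 2 * charT P Q R2 - cP <= U) by (unfold U; lra).
assert (U0 : 0 <= U). { unfold U. apply Rmult_le_pos; [apply Rmult_le_pos|]; lra. }
assert (F1 : 0 <= 4 * Cmod c / (R - r) <= 2).
{ split. apply Rmult_le_pos. lra. left; apply Rinv_0_lt_compat; lra. apply Rmult_le_reg_r with (R - r). lra. unfold Rdiv. rewrite Rmult_assoc, Rinv_l by lra. lra. }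
assert (F2 : 0 <= R2 / (R2 - R) <= 6).
{ split. apply Rmult_le_pos. lra. left; apply Rinv_0_lt_compat; lra. apply Rmult_le_reg_r with (R2 - R). lra. unfold Rdiv. rewrite Rmult_assoc, Rinv_l by lra. lra. }
assert (S1 : 4 * Cmod c / (R - r) * (2 * charT P Q R - cP) <= 2 * U).
{ apply Rle_trans with (4 * Cmod c / (R - r) * U). apply Rmult_le_compat_l; lra. apply Rmult_le_compat_r; lra. }
assert (S2 : 4 * 2 * (R2 / (R2 - R)) * (2 * charT P Q R2 - cP) <= 48 * U).
{ apply Rle_trans with (4 * 2 * (R2 / (R2 - R)) * U). apply Rmult_le_compat_l; lra. apply Rmult_le_compat_r; lra. }
apply Rle_trans with (50 * U). lra. unfold U.
apply Rle_trans with (C1 * X * e). replace (50 * ((2 * (20 / r0) + Rabs cP) * X * e)) with (50 * (2 * (20 / r0) + Rabs cP) * (X * e)) by ring.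
replace (C1 * X * e) with (C1 * (X * e)) by ring. apply Rmult_le_compat_r. lra. unfold C1; lra.
apply Rmult_le_compat_l. apply Rmult_le_pos; unfold C1; lra. apply exp_le. apply Rmult_le_compat_r. lra. unfold C1; lra.
Qed.

Lemma quotient_minus_one z : K z = RtoC (-1).
Proof.
destruct NK1 as [z1 Hz1]. rewrite (quotient_constant z z1). pose proof (HK2 z1) as E. rewrite (quotient_constant (z1 + c) z1) in E.
assert (X : ((K z1 - 1) * (K z1 + 1))%C = RtoC 0). { replace ((K z1 - 1) * (K z1 + 1))%C with (K z1 * K z1 - 1)%C by ring. rewrite E. ring. }
apply NNPP. intros N. revert X. apply Cmult_neq_0. now apply Cminus_neq. intros E1. apply N.
replace (K z1) with (K z1 + 1 - 1)%C by ring. rewrite E1, RtoC_m1. ring.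
Qed.

Lemma antiperiodic z : ~ is_pole f z -> ~ is_pole f (z + c)%C -> f (z + c)%C = (- f z)%C.
Proof. intros A B. rewrite HfK, quotient_minus_one, RtoC_m1 by auto. ring. Qed.

Lemma pole_antiperiodic' z : ~ is_pole f z -> ~ is_pole f (z + c)%C.
Proof.
intros N. set (X := Cmod z + Cmod c + 1). pose proof (Cmod_ge_0 z). pose proof (Cmod_ge_0 c). pose proof (Cmod_triangle z c).
destruct (fraction_exists f 1 X Hf) as [B [P [Q H2]]].
pose proof (fraction_shift f 1 X B P Q c K z Hf H2 HK HfK ltac:(unfold X; lra) ltac:(unfold X; lra)) as E.
destruct (fraction_value f 1 X B P Q z H2 ltac:(unfold X; lra) N) as [NQ _].
intros I. destruct (fraction_pole f 1 X B P Q (z + c)%C H2 ltac:(unfold X; lra) I) as [EQ NP].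
rewrite EQ in E. replace (K z * P z * 0)%C with (RtoC 0) in E by ring. revert E. now apply Cmult_neq_0.
Qed.

(** K is the constant -1, so a 1-point of f would give d = -1 and K = d everywhere; a point where f
    is -1 is carried to a 1-point by the translation c. *)
Lemma omits_one z : ~ is_pole f z -> f z <> RtoC 1 /\ f z <> RtoC (-1).
Proof.
intros N. assert (A : forall w, ~ is_pole f w -> f w <> RtoC 1).
{ intros w Nw E. destruct NKd as [v Hv]. apply Hv. rewrite <- (HO w Nw E). now rewrite !quotient_minus_one. }
split. auto. intros E. apply (A (z + c)%C). now apply pole_antiperiodic'. rewrite antiperiodic, E, RtoC_m1 by (auto; now apply pole_antiperiodic'). ring.
Qed.

(** At a pole of f the quotient has the limit 1; elsewhere its denominator does not vanish because f
    omits -1. *)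
Lemma cayley_entire : exists u, (forall z, cdiff u z) /\ forall z, ~ is_pole f z -> u z = ((f z - 1) / (f z + 1))%C.
Proof.
assert (NP1 : forall z, ~ is_pole f z -> (f z + 1)%C <> RtoC 0).
{ intros z N E. apply (proj2 (omits_one z N)). replace (f z) with (f z + 1 - 1)%C by ring. rewrite E, RtoC_m1. ring. }
assert (U : forall z, exists r g, 0 < r /\ holo_on_disc g z r /\ forall w, 0 < Cmod (w - z) < r -> ((f w - 1) / (f w + 1))%C = g w).
{ intros z. destruct (Hf z) as [[r [Hr Hh]]|[m Hm]].
  + exists r, (fun z => (f z - 1) / (f z + 1))%C. split; [|split]; auto. intros w Hw.
    assert (Nw : ~ is_pole f w). { apply holo_not_pole. exists (r - Cmod (w - z)). split. lra. eapply holo_sub; eauto. lra. }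
    apply (cdiff_div (fun z => f z - 1)%C (fun z => f z + 1)%C); auto. apply cdiff_minus. now apply Hh. apply cdiff_const.
    apply cdiff_plus. now apply Hh. apply cdiff_const.
  + destruct Hm as [Hm [r [g [Hr [Hg [Ng Eg]]]]]].
    set (D := fun w => (g w + (w - z) ^ m)%C).
    assert (CD : forall w, cdiff g w -> cdiff D w) by (intros w Hw; apply (cdiff_plus g (fun w => (w - z) ^ m)%C); auto; apply cdiff_pow).
    assert (ND : D z <> RtoC 0). { unfold D. destruct m; [lia|]. rewrite Cminus_diag, Cpow_0_S, Cplus_0_r. auto. }
    destruct (ccont_nonzero_near D z) as [e [He Ke]]; auto. { apply cdiff_ccont, CD, Hg. rewrite Cmod_minus_self; auto. }
    pose proof (Rmin_l r e). pose proof (Rmin_r r e).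
    exists (Rmin r e), (fun w => (g w - (w - z) ^ m) / D w)%C. split; [|split]. now apply Rmin_pos.
    * intros w Hw. apply (cdiff_div (fun w => g w - (w - z) ^ m)%C D). apply Ke; lra. apply cdiff_minus. apply Hg; lra. apply cdiff_pow. apply CD, Hg; lra.
    * intros w Hw. rewrite Eg by lra. pose proof (Cpow_neq0 _ m (punct_neq _ _ (proj1 Hw))) as Np. pose proof (Ke w ltac:(lra)) as Nd. unfold D in *.
      field. split; auto. }
destruct (glue (fun z => (f z - 1) / (f z + 1))%C (fun _ => True)) as [u Hu]; [intros z _; exists 1; split; [lra|auto]|auto|].
exists u. split.
  + intros z. destruct (U z) as [r [g [Hr [Hg Eg]]]]. now apply (Hu z r g I Hr Hg Eg).
  + intros z N. destruct (not_pole_holo f z Hf N) as [r [Hr Hh]]. 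
    apply (Hu z r (fun z => (f z - 1) / (f z + 1))%C I Hr); auto. intros w Hw.
    assert (Nw : ~ is_pole f w). { apply holo_not_pole. exists (r - Cmod (w - z)). split. lra. eapply holo_sub; eauto. lra. }
    apply (cdiff_div (fun z => f z - 1)%C (fun z => f z + 1)%C); auto. apply cdiff_minus. now apply Hh. apply cdiff_const.
    apply cdiff_plus. now apply Hh. apply cdiff_const.
Qed.

Theorem degenerate_contradiction : False.
Proof.
destruct cayley_entire as [u [Hu Eu]].
assert (NP1 : forall z, ~ is_pole f z -> (f z + 1)%C <> RtoC 0 /\ (f z - 1)%C <> RtoC 0).
{ intros z N. destruct (omits_one z N) as [A1 A2]. split; [|now apply Cminus_neq]. intros E. apply A2. replace (f z) with (f z + 1 - 1)%C by ring. rewrite E, RtoC_m1. ring. }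
assert (Euc : forall z, ~ is_pole f z -> u (z + c)%C = ((- f z - 1) / (- f z + 1))%C).
{ intros z N. pose proof (pole_antiperiodic' z N) as N'. now rewrite Eu, antiperiodic. }
assert (Huc : forall z, (u z * u (z + c))%C = RtoC 1).
{ intros z. destruct (poles_discrete f z Hf) as [r [Hr H]].
  apply (ccont_unique (fun z => u z * u (z + c))%C (fun _ => RtoC 1) z r Hr).
  - apply cdiff_ccont. apply (cdiff_mult u (fun z => u (z + c)%C)); auto. apply (cdiff_comp u (fun z => z + c)%C); auto. apply cdiff_plus. apply cdiff_id. apply cdiff_const.
  - apply ccont_const.
  - intros w Hw. pose proof (H w Hw) as N. rewrite Eu, Euc by auto. destruct (NP1 w N) as [A1 A2]. field. split; auto.
    intros E. apply A2. replace (f w - 1)%C with (- (- f w + 1))%C by ring. rewrite E. ring. }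
destruct (frac_sys_exists f Hf N0) as [r0 [Hr0 [NF FSE]]].
destruct (charT_tame f s r0 Ht Hs Hr0) as [Rb [HRb HB]]. set (cP := mn (fun z => ln (Cmod (f z))) r0) in *.
pose proof (Cmod_pos_neq c Hc) as Pc. pose proof (Rabs_pos cP) as PcP. assert (i0 : 0 < 20 / r0) by (apply Rdiv_lt_0_compat; lra).
set (m1 := mn (fun z => ln (Cmod (f z - 1))) r0). set (m2 := mn (fun z => ln (Cmod (f z - RtoC (-1)))) r0).
pose proof (Rabs_pos m1). pose proof (Rabs_pos m2).
set (C1 := 50 + 8 * (20 / r0) + 4 * Rabs cP + Rabs m1 + Rabs m2).
assert (HC1 : 50 <= C1) by (unfold C1; lra).
assert (cst : forall a b, u a = u b).
{ apply (involution_constant u c Hu Hc Huc s C1 Rb Hs); [lra|].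
  intros X HX. destruct (FSE (10 * X) (50 * X)) as [B [P [Q [lP [lQ [H1 [FS _]]]]]]]; try lra.
  destruct (three_radii X lP lQ) as [r [_ [_ [Hr [_ [_ [SP [SQ _]]]]]]]]. lra. exists r. split. lra.
  assert (gP : generic r lP) by (intros x I; now apply SP). assert (gQ : generic r lQ) by (intros x I; now apply SQ).
  assert (NFp : forall z, Cmod z = r0 -> ~ is_pole f z) by (intros; now apply NF).
  destruct (omitted_value_mean f (10 * X) (50 * X) r0 cP B P Q lP lQ 1 r H1) as [Z1 [cc1 B1]]; auto; try lra. apply Cmod_1. intros; now apply omits_one.
  destruct (omitted_value_mean f (10 * X) (50 * X) r0 cP B P Q lP lQ (RtoC (-1)) r H1) as [Z2 [cc2 B2]]; auto; try lra.
  { rewrite RtoC_m1, Cmod_opp. apply Cmod_1. } { intros; now apply omits_one. }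
  fold m1 in B1. fold m2 in B2.
  destruct (HB X B P Q cP lP lQ HX H1 FS r ltac:(lra) gP gQ) as [w0 TB].
  assert (LM : logmean u r <= mn (fun z => Rabs (ln (Cmod (P z - 1 * Q z))) + Rabs (ln (Cmod (P z - RtoC (-1) * Q z)))) r).
  { unfold logmean. assert (Nu := involution_nonzero u c Huc). apply mn_le.
    - apply ccirc_abs, ccirc_lnCmod. intros t; split; auto. now apply cdiff_ccont.
    - exact (ccirc_plus _ _ r cc1 cc2).
    - intros t. set (z := circ r t). assert (Hz : Cmod z = r) by (apply Cmod_circ; lra).
      pose proof FS as [ZP ZQ _ _ _ _ _].
      assert (NQ : Q z <> RtoC 0) by (apply (zsys_nonzero Q (10 * X) lQ z ZQ); [lra|apply circ_notin; auto; lra]).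
      destruct (fraction_nonpole f r0 (50 * X) B P Q z H1 ltac:(lra) NQ) as [N Ef].
      pose proof (Z1 z ltac:(lra)) as q1. pose proof (Z2 z ltac:(lra)) as q2. destruct (NP1 z N) as [q3 q4].
      assert (E : u z = ((P z - 1 * Q z) / (P z - RtoC (-1) * Q z))%C).
      { rewrite Eu by auto. destruct (fraction_value f r0 (50 * X) B P Q z H1 ltac:(lra) N) as [_ EP]. rewrite EP in q2 |- *. rewrite RtoC_m1 in q2 |- *. field. split; auto.
        intros E2. apply q2. rewrite <- E2. ring. }
      rewrite E, Cmod_div, ln_div by (auto; now apply Cmod_pos_neq). unfold Rminus. eapply Rle_trans. apply Rabs_triang. rewrite Rabs_Ropp. lra. }
  rewrite (mn_plus (fun z => Rabs (ln (Cmod (P z - 1 * Q z)))) (fun z => Rabs (ln (Cmod (P z - RtoC (-1) * Q z)))) r cc1 cc2) in LM.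
  set (e := exp (50 * Rpower X s)) in *. assert (Rp : 0 < Rpower X s) by apply exp_pos. assert (Pe : 1 <= e). { unfold e. rewrite <- exp_0. apply exp_le. lra. }
  assert (Xe : 1 <= X * e) by (rewrite <- (Rmult_1_l 1); apply Rmult_le_compat; lra).
  assert (L2 : ln 2 <= 1) by (generalize (ln_le_sub1 2); lra).
  apply Rle_trans with (C1 * (X * e)).
  - pose proof (Rle_abs (- cP)) as q. rewrite Rabs_Ropp in q. pose proof (Rle_abs (- m1)) as q1. rewrite Rabs_Ropp in q1. pose proof (Rle_abs (- m2)) as q2. rewrite Rabs_Ropp in q2.
    set (k := 50 + 4 * Rabs cP + Rabs m1 + Rabs m2). assert (K1 : k * 1 <= k * (X * e)) by (apply Rmult_le_compat_l; unfold k; lra).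
    replace (C1 * (X * e)) with (8 * (20 / r0 * X * e) + k * (X * e)) by (unfold C1, k; ring). unfold k in *. lra.
  - rewrite <- Rmult_assoc. apply Rmult_le_compat_l. apply Rmult_le_pos; lra. apply exp_le. apply Rmult_le_compat_r; lra. }
destruct N0 as [q [Nq Zq]]. pose proof (cst (q + c)%C q) as E. rewrite Euc, Eu in E by auto. destruct (NP1 q Nq) as [A1 A2].
assert (A3 : (- f q + 1)%C <> RtoC 0). { intros E3. apply A2. replace (f q - 1)%C with (- (- f q + 1))%C by ring. rewrite E3. ring. }
(* Constancy of [u] gives (f - 1) / (f + 1) = (f + 1) / (f - 1) at q, hence 4 f = 0, although f(q)
   is not 0. *)
assert (X : (RtoC 4 * f q)%C = RtoC 0).
{ replace (RtoC 4 * f q)%C with ((f q - 1) / (f q + 1) * ((f q + 1) * (- f q + 1)) - (- f q - 1) / (- f q + 1) * ((f q + 1) * (- f q + 1)))%C.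
  rewrite E. ring. field. auto. }
revert X. apply Cmult_neq_0; auto. apply RtoC_neq; lra.
Qed.
End Degenerate.

Theorem shift_dichotomy f a b c s : meromorphic f -> ~ rational_fun f -> 0 <= s < 1 -> tame f s -> c <> RtoC 0 -> a <> RtoC 0 ->
  let L := fun z : C => (a * f (z + c) - b * f z)%C in
  E_sub f (RtoC 0) L (RtoC 0) -> E_sub_infty L f -> Ebar_sub f (RtoC 1) L (RtoC 1) ->
  (forall z : C, ~ is_pole f z -> ~ is_pole f (z + c)%C -> L z = f z) \/
  (forall z : C, ~ is_pole f z -> ~ is_pole f (z + c)%C -> f (z + c)%C = f z).
Proof.
intros Hf Hr Hs Ht Hc Ha L E0 Einf E1.
destruct (meromorphic_nonconstant f 0 Hf Hr) as [p [Np Zp]]. destruct (meromorphic_nonconstant f 1 Hf Hr) as [p1 [Np1 Zp1]].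
destruct (quotient_entire f a b c p Hf Np Zp Ha E0 Einf) as [K [HK HfK]].
set (d := ((1 + b) / a)%C).
assert (HO : forall z, ~ is_pole f z -> f z = RtoC 1 -> K z = d) by (intros z Nz Ez; apply (one_point f a b c K z p1); auto).
destruct (classic (forall z, K z = d)) as [Kd|NKd].
{ left. intros z N N'. unfold L. rewrite HfK, Kd by auto. unfold d. field. auto. }
destruct (classic (forall z, K z = RtoC 1)) as [K1|NK1].
{ right. intros z N N'. rewrite HfK, K1 by auto. ring. }
exfalso. apply not_all_ex_not in NKd, NK1.
destruct (classic (forall z, (K z * K (z + c))%C = RtoC 1)) as [KK|NKK].
- eapply (degenerate_contradiction f K c d s); eauto.
- apply not_all_ex_not in NKK. eapply (main_contradiction f K c d s); eauto.
Qed.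

(** * Lower bounds for the Lebesgue integrals of the characteristic *)

Module LIntTheory.
From mathcomp Require Import all_boot all_order all_algebra.
From mathcomp Require Import all_classical all_reals all_analysis.
From mathcomp Require Import Rstruct Rstruct_topology.
Import Order.TTheory GRing.Theory Num.Theory numFieldNormedType.Exports.
Local Open Scope classical_set_scope.
Local Open Scope ring_scope.

(** The integral of a nonnegative function is a supremum over the simple functions below it, so the
    comparison holds without measurability, and the pole count can be integrated as it stands. *)
Lemma ge0_integral_mono (f g : R -> R) (D E : set R) :
  D `<=` E -> (forall x, E x -> 0 <= f x) -> (forall x, D x -> 0 <= g x <= f x) ->
  (\int[@lebesgue_measure R]_(x in D) (g x)%:E <= \int[@lebesgue_measure R]_(x in E) (f x)%:E)%E.
Proof.
move=> DE f0 gf.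
rewrite ge0_integralE; last by move=> x Dx; rewrite lee_fin; case/andP: (gf x Dx).
rewrite ge0_integralE; last by move=> x Ex; rewrite lee_fin; exact: f0.
apply: le_ereal_sup => _ [h /= hg <-]; exists h => //= x.
apply: (le_trans (hg x)); rewrite /patch.
case: ifPn => [/set_mem Dx|_].
  by rewrite ifT ?lee_fin; [case/andP: (gf x Dx)|apply/mem_set/DE].
by case: ifPn => [/set_mem Ex|_]; rewrite ?lee_fin ?f0.
Qed.

Lemma itv_measure (a b : R) : a <= b -> lebesgue_measure `[a, b] = (b - a)%:E.
Proof.
move=> ab; rewrite lebesgue_measure_itv /= lte_fin.
case: ltP => [_|ba]; first by rewrite -EFinB.
by have -> : b = a; [apply/eqP; rewrite eq_le ab ba|rewrite subrr].
Qed.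

Lemma integral_itv_cst (k a b : R) : a <= b -> (\int[@lebesgue_measure R]_(x in `[a, b]) k%:E = (k * (b - a))%:E)%E.
Proof.
move=> ab; have := @integral_cst _ _ R (@lebesgue_measure R) `[a, b] (measurable_itv _) k%:E.
by rewrite /= itv_measure // -EFinM.
Qed.

Lemma derivable_pt_lim_derive (F : R -> R) x l : derivable_pt_lim F x l -> derivable (F : R^o -> R^o) x 1 /\ derive1 (F : R -> R^o) x = l.
Proof.
move=> H.
have C : (fun h : R => h^-1 *: (((F : R^o -> R^o) \o shift (x : R^o)) (h *: (1 : R^o)) - F x) : R^o) @ (0 : R)^' --> (l : R^o).
  apply/cvgrPdist_lt => e e0; have /RltP e0' := e0; have [[d /= /RltP d0] Hd] := H e e0'.
  near=> h.
  have h0 : h != 0 by near: h; exact: nbhs_dnbhs_neq.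
  have hd : `|h| < d.
    near: h; exact: (@dnbhs0_lt R R^o).
  have hd' : (Rabs h < d)%coqR by apply/RltP.
  have hE : (h : R^o) *: (1 : R^o) = h by rewrite /GRing.scale /= mulr1.
  move: (Hd h (elimN eqP h0) hd') => /RltP; rewrite distrC /= hE [h + x]addrC /GRing.scale /= mulrC.
  by [].
split; first by apply/cvg_ex; exists l.
by rewrite derive1E; apply: cvg_lim.
Unshelve. all: by end_near. Qed.

Lemma lint_ftc (F Phi : R -> R) (a b : R) : (a < b)%coqR -> (forall t, continuity_pt F t) ->
  (forall t, derivable_pt_lim Phi t (F t)) -> LInt.rlint F a b = (Phi b - Phi a)%coqR.
Proof.
move=> /RltP ab cF dPhi.
have cP t : {for t, continuous (Phi : R^o -> R^o)}.
  by apply/continuity_pt_cvg; apply: derivable_continuous_pt; exists (F t); exact: dPhi.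
rewrite /LInt.rlint /LInt.lint.
have -> // : (\int[@lebesgue_measure R]_(x in `[a, b]) (F x)%:E = (Phi b)%:E - (Phi a)%:E)%E.
apply: continuous_FTC2 => //.
- by apply: continuous_subspaceT => t; apply/continuity_pt_cvg; exact: cF.
- split.
  + by move=> t _; exact: (derivable_pt_lim_derive _ _ _ (dPhi t)).1.
  + by apply: cvg_at_right_filter; exact: cP.
  + by apply: cvg_at_left_filter; exact: cP.
- by move=> t _; exact: (derivable_pt_lim_derive _ _ _ (dPhi t)).2.
Qed.

Lemma rlint_nonneg (f : R -> R) (a b : R) : (forall x, (a <= x <= b)%coqR -> (0 <= f x)%coqR) -> (0 <= LInt.rlint f a b)%coqR.
Proof.
move=> f0; apply/RleP; apply: fine_ge0; apply: integral_ge0 => x /=.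
rewrite in_itv /= => /andP[/RleP ax /RleP xb]; rewrite lee_fin; apply/RleP; exact: f0.
Qed.

(** [fine] sends an infinite integral to 0. The upper bound [M] excludes this, so that the lower
    bound survives the passage to a real value. *)
Lemma rlint_lower (f : R -> R) (k a b c d M : R) : (a <= c)%coqR -> (c <= d)%coqR -> (d <= b)%coqR ->
  (forall x, (a <= x <= b)%coqR -> (0 <= f x <= M)%coqR) -> (0 <= k)%coqR -> (forall x, (c <= x <= d)%coqR -> (k <= f x)%coqR) ->
  (k * (d - c) <= LInt.rlint f a b)%coqR.
Proof.
move=> /RleP ac /RleP cd /RleP db fM /RleP k0 kf.
have ab : a <= b by apply: le_trans ac (le_trans cd db).
have f0 x : `[a, b]%classic x -> 0 <= f x <= M.
  by rewrite /= in_itv /= => /andP[/RleP ax /RleP xb]; have [/RleP -> /RleP ->] := fM x (conj ax xb).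
have L1 : ((k * (d - c))%:E <= LInt.lint f a b)%E.
  rewrite -integral_itv_cst //; apply: ge0_integral_mono.
  - by move=> x /=; rewrite !in_itv /= => /andP[cx xd]; rewrite (le_trans ac cx) (le_trans xd db).
  - by move=> x /f0 /andP[].
  - by move=> x /=; rewrite in_itv /= k0 => /andP[/RleP cx /RleP xd]; apply/RleP; apply: kf.
have L2 : (LInt.lint f a b <= (M * (b - a))%:E)%E.
  rewrite -integral_itv_cst //; apply: ge0_integral_mono => // x /f0 /andP[fx fM'] //; exact: le_trans fx fM'.
apply/RleP; rewrite -lee_fin /LInt.rlint fineK // fin_numE; apply/andP; split.
  by apply/eqP => E; move: L1; rewrite E.
by apply/eqP => E; move: L2; rewrite E.
Qed.
End LIntTheory.

(** * From the hyper-order to a growth bound *)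

Lemma limsup_lt_eventually g : Rbar_lt (limsup_pinfty g) (Finite 1) -> exists s R0, s < 1 /\ forall r, R0 < r -> g r <= s.
Proof.
intros H. unfold limsup_pinfty in H. set (E := fun y => exists R0 : R, y = Rbar_lub (fun x => exists r, R0 < r /\ x = Finite (g r))) in H.
destruct (proj2_sig (Rbar_ex_glb E)) as [_ G]. fold (Rbar_glb E) in G.
assert (exists m : R, m < 1 /\ Rbar_lt (Rbar_glb E) (Finite m)) as [m [Hm Gm]].
{ destruct (Rbar_glb E) as [x| |]; simpl in H. exists ((x + 1) / 2). simpl. lra. contradiction. exists 0. simpl. split; [lra|auto]. }
assert (exists y, E y /\ Rbar_lt y (Finite m)) as [y [Ey Ly]].
{ apply NNPP. intros N. apply (Rbar_lt_not_le _ _ Gm). apply G. intros y Hy. apply Rbar_not_lt_le. intros L. apply N. eauto. }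
destruct Ey as [R0 ->]. exists m, R0. split; auto. intros r Hr.
assert (L : Rbar_le (Finite (g r)) (Rbar_lub (fun x => exists r, R0 < r /\ x = Finite (g r)))).
{ apply (proj2_sig (Rbar_ex_lub (fun x => exists r, R0 < r /\ x = Finite (g r)))). eauto. }
assert (X := Rbar_le_lt_trans _ _ _ L Ly). simpl in X. lra.
Qed.

Lemma char_T_bound f : Rbar_lt (hyper_order f) (Finite 1) -> exists s R0, 0 <= s < 1 /\ 1 <= R0 /\ forall r, R0 <= r -> char_T f r <= exp (Rpower r s).
Proof.
intros H. destruct (limsup_lt_eventually _ H) as [s0 [R0 [Hs HB]]].
set (s := Rmax s0 0). exists s, (Rmax (R0 + 1) 3). pose proof (Rmax_l s0 0). pose proof (Rmax_r s0 0). fold s in H0, H1.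
pose proof (Rmax_l (R0 + 1) 3). pose proof (Rmax_r (R0 + 1) 3).
split. { split; auto. unfold s. apply Rmax_lub_lt; lra. } split. lra. intros r Hr.
specialize (HB r ltac:(lra)). assert (L0 : 0 < ln r) by (rewrite <- ln_1; apply ln_increasing; lra).
set (T := char_T f r) in *. assert (P : 0 < exp (Rpower r s)) by apply exp_pos. assert (Pr : 0 < Rpower r s) by apply exp_pos.
(* For [T <= 1] the iterated logarithm takes a default value and gives no information, but the bound
   is then trivial. *)
destruct (Rle_lt_dec T 1) as [|T1]. { apply Rle_trans with 1; auto. rewrite <- exp_0. apply exp_le. lra. }
assert (LT : 0 < ln T) by (rewrite <- ln_1; apply ln_increasing; lra).
rewrite <- (exp_ln T) by lra. apply exp_le. rewrite <- (exp_ln (ln T)) by auto. unfold Rpower. apply exp_le.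
apply Rmult_le_compat_r with (r := ln r) in HB; [|lra]. replace (ln (ln T) / ln r * ln r) with (ln (ln T)) in HB by (field; lra).
eapply Rle_trans. apply HB. apply Rmult_le_compat_r; lra.
Qed.

Lemma logplus_nonneg x : 0 <= logplus x.
Proof. apply Rmax_l. Qed.

Lemma prox_nonneg f r : 0 <= prox f r.
Proof.
unfold prox. apply Rmult_le_pos. left; apply Rinv_0_lt_compat, twoPI_pos. apply LIntTheory.rlint_nonneg. intros; apply logplus_nonneg.
Qed.

Lemma npoles_mono f t t' : meromorphic f -> t <= t' -> INR (npoles f t) <= INR (npoles f t').
Proof. intros Hf H. apply le_INR. eapply pole_count_mono; eauto; now apply npoles_count. Qed.

Lemma npoles_near_0 f : meromorphic f -> exists e, 0 < e /\ forall t, 0 <= t < e -> npoles f t = npoles f 0.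
Proof.
intros Hf. destruct (poles_discrete f 0 Hf) as [e [He H]]. exists e. split; auto. intros t Ht.
pose proof (npoles_count f 0 Hf) as [l [L1 [L2 [L3 L4]]]].
assert (C : pole_count f t (npoles f 0)).
{ exists l. split; [|split; [|split]]; auto.
  - intros z Hz I. apply L2; auto. destruct (Req_dec (Cmod z) 0) as [->|N]. lra. exfalso. apply (H z); auto. rewrite Cmod_minus_0. generalize (Cmod_ge_0 z). lra.
  - intros z m I. destruct (L3 z m I). split; auto. lra. }
pose proof (npoles_count f t Hf) as C'. apply Nat.le_antisymm; eapply pole_count_mono; eauto; lra.
Qed.

(** Near 0 the pole count equals its value at 0, so the numerator vanishes there, which also settles
    the division at t = 0; elsewhere t is bounded below. *)
Lemma count_integrand f r : meromorphic f -> 0 < r -> exists M, forall t, 0 <= t <= r -> 0 <= (INR (npoles f t) - INR (npoles f 0)) / t <= M.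
Proof.
intros Hf Hr. destruct (npoles_near_0 f Hf) as [e [He H]]. pose proof (pos_INR (npoles f r)) as P. pose proof (pos_INR (npoles f 0)) as P0.
assert (M0 : 0 <= INR (npoles f r) / e) by (apply Rmult_le_pos; [lra|left; now apply Rinv_0_lt_compat]).
exists (INR (npoles f r) / e). intros t Ht. destruct (Rlt_le_dec t e) as [L|L].
- rewrite H by lra. unfold Rdiv. rewrite Rminus_diag, Rmult_0_l. lra.
- pose proof (npoles_mono f 0 t Hf ltac:(lra)). pose proof (npoles_mono f t r Hf ltac:(lra)). split.
  apply Rmult_le_pos. lra. left; apply Rinv_0_lt_compat; lra.
  apply Rmult_le_compat. lra. left; apply Rinv_0_lt_compat; lra. lra. apply Rinv_le_contravar; lra.
Qed.

(** Between r / 2 and r the integrand is at least (n(r/2) - n(0)) / r, where n counts poles; the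
    poles at 0 are recovered from ln r >= 1/2. *)
Lemma count_fun_lower f r : meromorphic f -> 2 <= r -> INR (npoles f (r / 2)) / 2 <= count_fun f r.
Proof.
intros Hf Hr. destruct (count_integrand f r Hf ltac:(lra)) as [M HM]. unfold count_fun.
set (D := INR (npoles f (r / 2)) - INR (npoles f 0)). pose proof (npoles_mono f 0 (r / 2) Hf ltac:(lra)) as HD.
assert (L : D / r * (r - r / 2) <= LInt.rlint (fun t => (INR (npoles f t) - INR (npoles f 0)) / t) 0 r).
{ apply LIntTheory.rlint_lower with (M := M); auto; try lra. apply Rmult_le_pos. unfold D; lra. left; apply Rinv_0_lt_compat; lra.
  intros t Ht. pose proof (npoles_mono f (r / 2) t Hf ltac:(lra)). unfold D. apply Rmult_le_compat. lra. left; apply Rinv_0_lt_compat; lra. lra. apply Rinv_le_contravar; lra. }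
replace (D / r * (r - r / 2)) with (D / 2) in L by (field; lra).
assert (L2 : / 2 <= ln r). { apply Rle_trans with (ln 2). pose proof ln_lt_2; lra. apply ln_le_mono; lra. }
pose proof (pos_INR (npoles f 0)). assert (INR (npoles f 0) * / 2 <= INR (npoles f 0) * ln r) by (apply Rmult_le_compat_l; lra). unfold D in L. lra.
Qed.

(** Without zeros and poles on the circle the integrand is continuous, so its Riemann integral is a
    primitive, and the Lebesgue integral agrees with it. *)
Lemma mn_prox f r : meromorphic f -> 0 < r -> (forall z, Cmod z = r -> ~ is_pole f z /\ f z <> RtoC 0) ->
  mn (fun z => Rmax 0 (ln (Cmod (f z)))) r = prox f r.
Proof.
intros Hf Hr H. set (F := fun t => logplus (Cmod (f (circ r t)))).
assert (CF : forall t, continuous F t).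
{ assert (CL : ccirc (fun z => ln (Cmod (f z))) r).
  { apply ccirc_lnCmod. intros t. destruct (H (circ r t)) as [N Z]. apply Cmod_circ; lra. split; auto.
    destruct (not_pole_holo f _ Hf N) as [e [He Hh]]. now apply (holo_ccont_center f _ e). }
  assert (CA := ccirc_abs _ r CL). assert (CS := ccirc_plus _ _ r CA CL). assert (C2 := ccirc_scal (/ 2) _ r CS). cbv beta in C2.
  intros t. refine (ccirc_ext (fun z => / 2 * (Rabs (ln (Cmod (f z))) + ln (Cmod (f z)))) (fun z => logplus (Cmod (f z))) r _ C2 t).
  intros u. unfold logplus, Rmax, Rabs. destruct Rle_dec, Rcase_abs; lra. }
unfold mn, prox. change (fun t => Rmax 0 (ln (Cmod (f (circ r t))))) with F. fold F.
rewrite (LIntTheory.lint_ftc F (fun t => RInt F 0 t) 0 (2 * PI)).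
- rewrite RInt_point. unfold zero; simpl. field. generalize twoPI_pos; lra.
- apply twoPI_pos.
- intros t. apply continuity_pt_filterlim, CF.
- intros t. apply is_derive_Reals. apply is_derive_RInt with (a := 0); auto. apply filter_forall. intros x. apply (RInt_correct (V := R_CompleteNormedModule)).
  apply (ex_RInt_continuous (V := R_CompleteNormedModule)). auto.
Qed.

(** Passing from s to the larger exponent (s + 1) / 2 absorbs constant factors, in particular those
    from bounding the pole count at r by the characteristic at 2 r. *)
Theorem hyper_order_tame f : meromorphic f -> Rbar_lt (hyper_order f) (Finite 1) -> exists s, 0 <= s < 1 /\ tame f s.
Proof.
intros Hf H. destruct (char_T_bound f H) as [s [R0 [Hs [HR0 HT]]]].
set (s' := (s + 1) / 2). exists s'. split. unfold s'; lra.
set (q := s' - s). assert (Hq : 0 < q) by (unfold q, s'; lra).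
set (R1 := exp (ln 4 / q)). exists (R0 + R1 + 1). pose proof (exp_pos (ln 4 / q)) as P1. fold R1 in P1. split. lra.
intros r Hr.
assert (C0 : forall x, R0 <= x -> 2 <= x -> prox f x <= exp (Rpower x s) /\ INR (npoles f (x / 2)) / 2 <= exp (Rpower x s)).
{ intros x H1 H2. specialize (HT x H1). unfold char_T in HT. pose proof (prox_nonneg f x). pose proof (count_fun_lower f x Hf H2).
  pose proof (pos_INR (npoles f (x / 2))). lra. }
assert (E4 : 4 * Rpower r s <= Rpower r s').
{ replace s' with (q + s) by (unfold q; ring). rewrite Rpower_plus. apply Rmult_le_compat_r. left; apply exp_pos.
  unfold Rpower. rewrite <- (exp_ln 4) at 1 by lra. apply exp_le.
  assert (L : ln 4 / q <= ln r). { rewrite <- (ln_exp (ln 4 / q)). fold R1. apply ln_le_mono; lra. }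
  apply Rmult_le_compat_l with (r := q) in L; [|lra]. replace (q * (ln 4 / q)) with (ln 4) in L by (field; lra). auto. }
assert (E1 : 1 <= Rpower r s). { rewrite <- (Rpower_O r) by lra. apply Rle_Rpower; lra. }
split.
- destruct (C0 (2 * r)) as [_ B]; try lra. replace (2 * r / 2) with r in B by field.
  assert (E2 : Rpower (2 * r) s <= 2 * Rpower r s) by (apply Rpower_scal_le; lra).
  assert (L2 : ln 2 <= 1) by (generalize (ln_le_sub1 2); lra).
  apply Rle_trans with (2 * exp (2 * Rpower r s)). apply exp_le in E2. lra.
  rewrite <- (exp_ln 2) at 1 by lra. rewrite <- exp_plus. apply exp_le. lra.
- intros NZ. rewrite (mn_prox f r) by (auto; lra). 
  destruct (Rle_lt_dec 2 r) as [H2|H2].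
  + destruct (C0 r) as [B _]; try lra. eapply Rle_trans. apply B. apply exp_le. lra.
  + specialize (HT r ltac:(lra)). exfalso. assert (1 < R1); [|lra]. unfold R1. rewrite <- exp_0. apply exp_increasing. apply Rdiv_lt_0_compat; auto. rewrite <- ln_1. apply ln_increasing; lra.
Qed.

Theorem theorem1 (f : C -> C) (a b c : C) :
  transcendental_meromorphic f ->
  Rbar_lt (hyper_order f) (Finite 1) ->
  c <> RtoC 0 -> a <> RtoC 0 -> b <> RtoC 0 ->
  let L := fun z : C => (a * f (z + c) - b * f z)%C in
  E_sub f (RtoC 0) L (RtoC 0) ->
  E_sub_infty L f ->
  Ebar_sub f (RtoC 1) L (RtoC 1) ->
  (forall z : C, ~ is_pole f z -> ~ is_pole f (z + c)%C -> L z = f z) \/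
  (forall z : C, ~ is_pole f z -> ~ is_pole f (z + c)%C -> f (z + c)%C = f z).
Proof.
intros [Hf Hr] Ho Hc Ha _ L E0 Einf E1.
destruct (hyper_order_tame f Hf Ho) as [s [Hs Ht]].
exact (shift_dichotomy f a b c s Hf Hr Hs Ht Hc Ha E0 Einf E1).
Qed.
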